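(* Let $N\in\mathbb{N}_{\ge 2}$, $1\le\alpha,\beta\le N$ with $\alpha\ne\beta$, and let $c_0\in\mathbb{R}$ be a fixed constant. Write $\partial=\partial(n):=\lceil c_0n^{1/4}\rceil-c_0n^{1/4}$ and, for $\bm\ell=(\ell_1,\dots,\ell_N)$ with $\ell_j\in\{0,1,\dots,N-1\}$, $\partial^*=\partial^*(n,\bm\ell):=\partial+[\ell_\alpha-\ell_\beta-\lceil c_0n^{1/4}\rceil]_N$. Then as $n\to\infty$, \begin{multline*} d_{\alpha,\beta;N;c_0n^{1/4}}(n) = e^{\pi\sqrt{n/3}}\, n^{-3/4} \sum_{\substack{\bm\ell\in\{0,\dots,N-1\}^N\\ NH(\bm\ell) \equiv n \pmod{N}}} \left(\frac{1}{8\sqrt[4]{3}\,N^{N-1}} \operatorname{erfc}\left(\frac{c_0\sqrt{\pi N}}{2\sqrt[4]{3}}\right)\right.\\ \left.{}+ \frac{e^{-c_0^2\pi N/(4\sqrt{3})}\,(N^2-2\partial^*N+(\beta-\alpha))}{16\sqrt{3}\, N^{N-1/2}\, n^{1/4}} + O\left(n^{-1/2}\right)\right). \end{multline*}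
   Context: A partition into distinct parts of $n$ is a strictly decreasing sequence of positive integers $\lambda=(\lambda_1,\dots,\lambda_l)$ summing to $n$; $\mathcal D(n)$ denotes the set of these. For $N\ge2$, $1\le\alpha,\beta\le N$, $\alpha\neq\beta$, define $\operatorname{pd}_{\alpha,\beta;N}(\lambda):=\#\{i:\lambda_i\equiv\alpha \pmod N\}-\#\{i:\lambda_i\equiv\beta\pmod N\}$. For $c\in\mathbb{R}$, $d_{\alpha,\beta;N;c}(n):=\#\{\lambda\in\mathcal D(n):\operatorname{pd}_{\alpha,\beta;N}(\lambda)\ge c\}$. For $\ell\in\mathbb{Z}$, $[\ell]_N$ denotes the smallest non-negative integer congruent to $\ell$ modulo $N$. For $\bm m\in\mathbb{R}^N$, $H(\bm m):=\tfrac12\bm m^T\bm m+\bm b^T\bm m$ where $\bm b=(\tfrac1N-\tfrac12,\tfrac2N-\tfrac12,\dots,\tfrac NN-\tfrac12)^T$ (so $b_j=j/N-1/2$); for integer vectors $NH(\bm m)$ is an integer. $\operatorname{erfc}$ is the complementary error function. *)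

(* Defs.v *)
From HB Require Import structures.
From mathcomp Require Import all_boot all_order all_algebra.
From mathcomp Require Import finmap.
From mathcomp Require Import all_classical all_reals all_analysis.

Set Implicit Arguments.
Unset Strict Implicit.
Unset Printing Implicit Defensive.

Import Order.TTheory GRing.Theory Num.Theory.
Import numFieldNormedType.Exports.

Local Open Scope classical_set_scope.
Local Open Scope ring_scope.

Definition distinct_partitions (n : nat) : set (seq nat) :=
  [set lambda | [/\ sorted gtn lambda, all (ltn 0%N) lambda & sumn lambda = n]].

Definition pd (alpha beta N : nat) (lambda : seq nat) : int :=
  (count (fun p => p == alpha %[mod N])%N lambda)%:Z
  - (count (fun p => p == beta %[mod N])%N lambda)%:Z.

(* [fset_set] is the empty set on infinite sets; the set below is finite by
   [finite_distinct_partitions]. *)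
Definition d (R : realType) (alpha beta N : nat) (c : R) (n : nat) : nat :=
  #|` fset_set [set lambda | distinct_partitions n lambda
                             /\ c <= (pd alpha beta N lambda)%:~R] |.

Lemma finite_distinct_partitions (n : nat) :
  finite_set (distinct_partitions n).
Proof.
pose f (s : {set 'I_n.+1}) := sort geq [seq val i | i <- enum s].
apply: (@sub_finite_set _ _ (f @` setT)); last first.
  by apply: finite_image; exact: finite_finset.
move=> l [sl _ sumnl] /=.
have le_n x : x \in l -> (x < n.+1)%N.
  move=> xl; rewrite ltnS -sumnl.
  by rewrite (perm_sumn (perm_to_rem xl)) /= leq_addr.
exists [set i : 'I_n.+1 | val i \in l]%SET => //.
have gtr : transitive gtn by move=> y x z /= h1 h2; exact: ltn_trans h2 h1.
have ul : uniq l by apply: (sorted_uniq gtr) => // x; rewrite /= ltnn.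
have gr : transitive geq by move=> y x z /= h1 h2; exact: leq_trans h2 h1.
have ga : antisymmetric geq by move=> x y; rewrite /= andbC => /anti_leq.
have gt : total geq by move=> x y; exact: leq_total.
apply: (sorted_eq gr ga).
- exact: sort_sorted.
- by apply: sub_sorted sl => x y /=; exact: ltnW.
rewrite /f perm_sort; apply: uniq_perm => //.
  by rewrite (map_inj_uniq val_inj) enum_uniq.
move=> x; apply/mapP/idP => [[i]|xl].
  by rewrite mem_enum inE => il ->.
by exists (Ordinal (le_n x xl)); rewrite // mem_enum inE.
Qed.

(* Vectors of {0, ..., N-1}^N are tuples [ell : N.-tuple 'I_N].  Tuples and
   column vectors are indexed from 0, whereas coordinates are numbered from 1:
   [ell_ ell j] is coordinate number j, for 1 <= j <= N. *)
Definition ell_ (N : nat) (ell : N.-tuple 'I_N) (j : nat) : nat :=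
  nth 0%N [seq val i | i <- ell] j.-1.

Definition vec (R : realType) (N : nat) (ell : N.-tuple 'I_N) : 'cV[R]_N :=
  \col_(j < N) (tnth ell j)%:R.

Definition b (R : realType) (N : nat) : 'cV[R]_N :=
  \col_(j < N) (j.+1%:R / N%:R - 1 / 2).

Definition H (R : realType) (N : nat) (m : 'cV[R]_N) : R :=
  1 / 2 * (m^T *m m) 0 0 + ((b R N)^T *m m) 0 0.

(* x = y (mod N) for real numbers x and y (here always integer-valued) *)
Definition eq_mod (R : realType) (N : nat) (x y : R) : bool :=
  (x - y) / N%:R \is a Num.int.

(* [l]_N: [modz] by N > 0 is the least non-negative residue, also for l < 0 *)
Definition residue (l : int) (N : nat) : int := (l %% N%:Z)%Z.

Definition partial (R : realType) (c0 : R) (n : nat) : R :=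
  (Num.ceil (c0 * n%:R `^ (1 / 4)))%:~R - c0 * n%:R `^ (1 / 4).

Definition partial_star (R : realType) (alpha beta N : nat) (c0 : R) (n : nat)
    (ell : N.-tuple 'I_N) : R :=
  partial c0 n
  + (residue ((ell_ ell alpha)%:Z - (ell_ ell beta)%:Z
              - Num.ceil (c0 * n%:R `^ (1 / 4))) N)%:~R.

Definition erfc (R : realType) (x : R) : R :=
  2 / Num.sqrt pi
  * \int[lebesgue_measure]_(t in `[x, +oo[) expR (- (t ^+ 2)).

(* Main.v *)
(* Give each partition into distinct parts the weight exp (- t^2 |lambda| + t pd (lambda)), where
   n t^4 = pi^2 / 12 is the value at 0 of L x = \int_x^oo ln (1 + e^-u) du. Then the parts are
   independent Bernoulli variables, and the number of partitions of n with pd = r is a Fourier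
   integral of a product of two-point characteristic functions over a torus. The torus is cut
   into N^2 boxes around the points (2 pi u / N, 2 pi v / N). Near the centres at which the
   character (u, v) of the residue classes is trivial the integrand is Gaussian up to cubic
   phases; these and all other corrections of relative order t are odd in the first angle, so they
   cancel after symmetrisation and the relative error is O(t^2). Everything else is exponentially
   small. This gives a local limit theorem for pd, uniform in r, whose normalisation comes from
   Euler-Maclaurin estimates for sums of ln (1 + e^-x) and of its derivatives.

   Summing over the r >= c in a fixed class mod N with the trapezoidal rule gives the
   complementary error function plus a correction of relative order t that depends on the class of
   r. The weights of the classes are sums over the trivial characters, and by orthogonality they
   count the vectors ell with N H(ell) = n (mod N) and ell_alpha - ell_beta = r (mod N). *)

Require Import Defs.
From HB Require Import structures.
From mathcomp Require Import all_boot all_order all_algebra finmap.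
From mathcomp Require Import all_classical all_reals all_analysis.
From mathcomp Require Import complex.
From mathcomp Require Import ring lra zify.

Set Implicit Arguments.
Unset Strict Implicit.
Unset Printing Implicit Defensive.

Import Order.TTheory GRing.Theory Num.Theory.
Import numFieldNormedType.Exports.
Import ComplexField.Normc.

Local Open Scope classical_set_scope.
Local Open Scope ring_scope.

(** * Calculus *)

(** The tilt by [t] in the direction of [pd] is no saddle point condition: all thresholds of order
    n^(1/4), which is also the order of the standard deviation of [pd], are served by one [t]. Its
    purpose is the factor exp (- t r) that appears when the weight of a partition with difference r
    is divided out. The local limit theorem has the error t^6 times this factor, so the errors over
    all r >= c sum to t^5, against a main term of order t^3; an error without decay would be
    multiplied by the number of admissible r. The tilt moves the mean of [pd] by 1 / (N t), and
    completing the square removes this shift again. The cancellation of terms odd in the first angle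
    does not reach the even terms of order t. Those carry the sign [eps] and cancel between the
    classes of alpha and beta, except for the constant [kappa0] = (beta - alpha) / (2 N) in the mean
    of [pd]. This constant, the boundary term of the trapezoidal rule and the position of the first
    r in its class make up the second term of the formula. *)

Section Calculus.
Variable R : realType.
Implicit Types (f g : R -> R) (x y a b : R).

Definition is_primitive f g := forall x, is_derive x (1 : R) f (g x).

Lemma is_derive_continuous f x (d : R) :
  is_derive x (1 : R) f d -> {for x, continuous f}.
Proof.
by move=> [df _]; apply: differentiable_continuous; apply/derivable1_diffP.
Qed.

Lemma primitive_continuous f g : is_primitive f g -> continuous f.
Proof. by move=> H x; apply: is_derive_continuous (H x). Qed.

Lemma MVT_on f g a b : a <= b ->
  (forall x, a <= x <= b -> is_derive x (1 : R) f (g x)) ->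
  exists2 c, a <= c <= b & f b - f a = g c * (b - a).
Proof.
move=> ab df.
have dfo x : x \in `]a, b[%R -> is_derive x (1 : R) f (g x).
  by rewrite in_itv => /andP[ax xb]; apply: df; rewrite !ltW.
have cf : {within `[a, b], continuous f}.
  apply: derivable_within_continuous => x; rewrite in_itv => xab.
  exact: (@ex_derive _ _ _ _ _ _ _ (df x xab)).
have [c cab e] := MVT_segment ab dfo cf.
by exists c => //; move: cab; rewrite in_itv.
Qed.

Lemma ge0_derive_le f g a b : a <= b ->
  (forall x, a <= x <= b -> is_derive x (1 : R) f (g x)) ->
  (forall x, a <= x <= b -> 0 <= g x) -> f a <= f b.
Proof.
move=> ab df g0; have [c cab e] := MVT_on ab df.
by rewrite -subr_ge0 e mulr_ge0 ?g0 // subr_ge0.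
Qed.

Lemma norm_derive_le f g M a b :
  (forall x, Num.min a b <= x <= Num.max a b -> is_derive x (1 : R) f (g x)) ->
  (forall x, Num.min a b <= x <= Num.max a b -> `|g x| <= M) ->
  `|f b - f a| <= M * `|b - a|.
Proof.
have H c d : c <= d ->
  (forall x, c <= x <= d -> is_derive x (1 : R) f (g x)) ->
  (forall x, c <= x <= d -> `|g x| <= M) ->  `|f d - f c| <= M * `|d - c|.
  move=> cd df gM; have [y ycd ->] := MVT_on cd df.
  by rewrite normrM ler_wpM2r // gM.
have [ab|/ltW ba] := leP a b; first exact: H.
by rewrite -normrN opprB -(normrN (b - a)) opprB; exact: H.
Qed.

(* The factor [1 / k.+1] of the integrated bound is dropped. *)
Lemma derive_bound_pow f g M B k : 0 <= M ->
  (forall x, `|x| <= B -> is_derive x (1 : R) f (g x)) ->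
  (forall x, `|x| <= B -> `|g x| <= M * `|x| ^+ k) ->
  forall x, `|x| <= B -> `|f x - f 0| <= M * `|x| ^+ k.+1.
Proof.
move=> M0 df gM x xB.
have inB y : Num.min 0 x <= y <= Num.max 0 x -> `|y| <= `|x|.
  by case: (leP 0 x) => h; rewrite ?(ger0_norm h) ?(ltr0_norm h);
    case/andP => h1 h2; rewrite ler_norml; apply/andP; split; lra.
have := @norm_derive_le f g (M * `|x| ^+ k) 0 x _ _.
rewrite subr0 exprSr mulrA; apply=> y yx.
  by apply: df; apply: le_trans xB; exact: inB.
apply: le_trans (gM _ _) _; first by apply: le_trans xB; exact: inB.
by rewrite ler_wpM2l // lerXn2r ?nnegrE // inB.
Qed.

Lemma derive_boundT_pow f g M k : 0 <= M -> is_primitive f g ->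
  (forall x, `|g x| <= M * `|x| ^+ k) ->
  forall x, `|f x - f 0| <= M * `|x| ^+ k.+1.
Proof. by move=> M0 df gM x; apply: (@derive_bound_pow f g M `|x|). Qed.

Lemma dv_eq f x (d d' : R) : is_derive x (1 : R) f d -> d = d' -> is_derive x (1 : R) f d'.
Proof. by move=> ? <-. Qed.

Lemma dvC (c : R) x : is_derive x (1 : R) (fun=> c) 0.
Proof. exact: is_derive_cst. Qed.

Lemma dv_id x : is_derive x (1 : R) (fun y => y) 1.
Proof. exact: is_derive_id. Qed.

Lemma dvD f g x (a b : R) : is_derive x (1 : R) f a -> is_derive x (1 : R) g b ->
  is_derive x (1 : R) (fun y => f y + g y) (a + b).
Proof. by move=> ? ?; apply: is_deriveD. Qed.

Lemma dvN f x (a : R) : is_derive x (1 : R) f a -> is_derive x (1 : R) (fun y => - f y) (- a).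
Proof. by move=> ?; apply: is_deriveN. Qed.

Lemma dvM f g x (a b : R) : is_derive x (1 : R) f a -> is_derive x (1 : R) g b ->
  is_derive x (1 : R) (fun y => f y * g y) (a * g x + f x * b).
Proof.
move=> df dg; apply: (dv_eq (is_deriveM df dg)).
by rewrite /GRing.scale /= addrC [g x * a]mulrC.
Qed.

Lemma dv_comp f g x (a b : R) : is_derive (g x) (1 : R) f a -> is_derive x (1 : R) g b ->
  is_derive x (1 : R) (fun y => f (g y)) (a * b).
Proof. by move=> ? ?; apply: (dv_eq (is_derive1_comp _ _)). Qed.

Lemma dvV f x (a : R) : f x != 0 -> is_derive x (1 : R) f a ->
  is_derive x (1 : R) (fun y => (f y)^-1) (- a / f x ^+ 2).
Proof.
move=> f0 df; apply: (dv_eq (is_deriveV f0 df)).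
by rewrite /GRing.scale /= mulNr mulrC mulNr.
Qed.

Lemma dvX f x n (a : R) : is_derive x (1 : R) f a ->
  is_derive x (1 : R) (fun y => f y ^+ n) (n%:R * f x ^+ n.-1 * a).
Proof.
move=> df; rewrite (_ : (fun y => f y ^+ n) = f ^+ n); last by rewrite exprfctE.
exact: (dv_eq (is_deriveX n df)).
Qed.

Lemma dv_exp f x (a : R) : is_derive x (1 : R) f a ->
  is_derive x (1 : R) (fun y => expR (f y)) (expR (f x) * a).
Proof. exact: dv_comp. Qed.

Lemma dv_cos f x (a : R) : is_derive x (1 : R) f a ->
  is_derive x (1 : R) (fun y => cos (f y)) (- sin (f x) * a).
Proof. exact: dv_comp. Qed.

Lemma dv_sin f x (a : R) : is_derive x (1 : R) f a ->
  is_derive x (1 : R) (fun y => sin (f y)) (cos (f x) * a).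
Proof. exact: dv_comp. Qed.

Lemma dv_ln f x (a : R) : 0 < f x -> is_derive x (1 : R) f a ->
  is_derive x (1 : R) (fun y => ln (f y)) ((f x)^-1 * a).
Proof. by move=> f0; apply: dv_comp; exact: is_derive1_ln. Qed.

Lemma dv_atan f x (a : R) : is_derive x (1 : R) f a ->
  is_derive x (1 : R) (fun y => atan (f y)) ((1 + f x ^+ 2)^-1 * a).
Proof. exact: dv_comp. Qed.

End Calculus.

Ltac dv_rec := first
  [ eassumption | eapply dvC | eapply dv_id | eapply dvD; [dv_rec|dv_rec] | eapply dvN; dv_rec
  | eapply dvM; [dv_rec|dv_rec] | eapply dvX; dv_rec | eapply dv_exp; dv_rec
  | eapply dv_cos; dv_rec | eapply dv_sin; dv_rec | eapply dv_atan; dv_rec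
  | eapply dv_ln; [|dv_rec] | eapply dvV; [|dv_rec] | idtac ].

(* Reduces [is_derive x 1 f d] to the equation between [d] and the derivative
   computed by the usual rules (and to side conditions for [ln] and inverses). *)
Ltac dv := eapply dv_eq; [dv_rec|cbn [Nat.pred]].

(** * Elementary bounds for trigonometric and exponential functions *)

Section Elementary.
Variable R : realType.
Implicit Types (x y a b p psi : R).

Lemma norm_cos_le1 x : `|cos x| <= 1 :> R.
Proof. by rewrite ler_norml cos_geN1 cos_le1. Qed.

Lemma norm_sin_le1 x : `|sin x| <= 1 :> R.
Proof. by rewrite ler_norml sin_geN1 sin_le1. Qed.

Lemma is_derive_ext (f g : R -> R) x d d' :
  (forall y, f y = g y) -> d = d' -> is_derive x (1 : R) f d -> is_derive x (1 : R) g d'.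
Proof. by move=> /funext -> ->. Qed.

(** Here and in the next lemmas each bound integrates the preceding one; as [derive_bound_pow] drops
    the factorials, every constant is 1, and the bounds hold on the whole line. *)
Lemma norm_sin_le x : `|sin x| <= `|x|.
Proof.
have := @derive_boundT_pow R sin cos 1 0 ler01 (fun x => is_derive_sin x) _ x.
by rewrite sin0 subr0 mul1r expr1; apply=> y; rewrite expr0 mulr1 norm_cos_le1.
Qed.

Lemma norm_cosB1_le x : `|cos x - 1| <= x ^+ 2.
Proof.
have := @derive_boundT_pow R cos (fun x => - sin x) 1 1 ler01 (fun x => is_derive_cos x) _ x.
rewrite cos0 mul1r real_normK ?num_real //; apply=> y.
by rewrite normrN mul1r expr1 norm_sin_le.
Qed.

Lemma norm_sinB_le x : `|sin x - x| <= `|x| ^+ 3.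
Proof.
have D : is_primitive (fun x : R => sin x - x) (fun x => cos x - 1).
  by move=> y; apply: is_derive_eq.
have := @derive_boundT_pow R _ _ 1 2 ler01 D _ x.
rewrite sin0 !subr0 mul1r; apply=> y.
by rewrite mul1r real_normK ?num_real // norm_cosB1_le.
Qed.

Lemma norm_cos_taylor2 x : `|cos x - 1 + x ^+ 2 / 2| <= x ^+ 4.
Proof.
have D : is_primitive (fun x : R => cos x - 1 + x ^+ 2 / 2) (fun x => - (sin x - x)).
  by move=> y; dv; field.
have := @derive_boundT_pow R _ _ 1 3 ler01 D _ x.
rewrite cos0 expr0n /= mul0r subrr addr0 subr0 mul1r.
rewrite (_ : `|x| ^+ 4 = x ^+ 4); last first.
  by rewrite -[4%N]/(2 * 2)%N !exprM real_normK ?num_real.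
apply=> y; by rewrite mul1r normrN norm_sinB_le.
Qed.

Lemma norm_sin_taylor3 x : `|sin x - x + x ^+ 3 / 6| <= `|x| ^+ 5.
Proof.
have D : is_primitive (fun x : R => sin x - x + x ^+ 3 / 6) (fun x => cos x - 1 + x ^+ 2 / 2).
  by move=> y; dv; field.
have := @derive_boundT_pow R _ _ 1 4 ler01 D _ x.
rewrite sin0 expr0n /= mul0r subrr addr0 subr0 mul1r; apply=> y.
rewrite mul1r (_ : `|y| ^+ 4 = y ^+ 4) ?norm_cos_taylor2 //.
by rewrite -[4%N]/(2 * 2)%N !exprM real_normK ?num_real.
Qed.

(** The cubic bound is weak for large x. The quadratic one holds everywhere and fits the term
    [Y ^+ 2] in [bern_gauss_cf], where [Y] need not be small. *)
Lemma norm_sinB_le2 x : `|sin x - x| <= 2 * x ^+ 2.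
Proof.
have [x1|x1] := leP `|x| 1.
  apply: le_trans (norm_sinB_le x) _; rewrite -(real_normK (num_real x)).
  have := normr_ge0 x; nra.
apply: le_trans (ler_normB _ _) _; have := norm_sin_le x.
rewrite -(real_normK (num_real x)); nra.
Qed.

Lemma cosB1_le_sqr x : `|x| <= 1 / 2 -> x ^+ 2 / 4 <= 1 - cos x.
Proof.
move=> xh; have := norm_cos_taylor2 x; rewrite ler_norml => /andP[_].
have : `|x| ^+ 2 <= (1 / 2) ^+ 2 by rewrite lerXn2r ?nnegrE //; lra.
rewrite real_normK ?num_real // -[x ^+ 4]/(x ^+ (2 * 2)) exprM.
have := sqr_ge0 x; set u := x ^+ 2; nra.
Qed.

Lemma pi_lt4 : pi < 4 :> R.
Proof.
have := pihalf_lt2 R; lra.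
Qed.

(** A weak form of Jordan's inequality: Taylor expansion up to 1/2, and from there on monotonicity,
    with sin (1/2) >= 3/8 against x < 2. *)
Lemma ger0_sin_lower x : 0 <= x <= pi / 2 -> 3 / 16 * x <= sin x.
Proof.
move=> /andP[x0 x1].
have H y : 0 <= y <= 1 / 2 -> 3 / 4 * y <= sin y.
  move=> /andP[y0 y1]; have := norm_sinB_le y; rewrite ler_norml => /andP[+ _].
  rewrite ger0_norm //; have : y ^+ 3 <= y / 4 by nra.
  lra.
have [xh|xh] := leP x (1 / 2); first by have := H x; rewrite x0 xh => /(_ isT); lra.
have h1 := H (1 / 2) ltac:(lra).
have : sin (1 / 2) <= sin x :> R.
  rewrite leNgt; apply/negP; rewrite ltr_sin ?in_itv /=; first by lra.
    by apply/andP; split; lra.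
  by have := pi_ge2 R; move=> ?; apply/andP; split; lra.
have := pi_lt4; lra.
Qed.

Lemma norm_sin_lower x : `|x| <= pi / 2 -> 3 / 16 * `|x| <= `|sin x|.
Proof.
move=> xp; have [x0|x0] := leP 0 x.
  move: xp; rewrite ger0_norm // => xp.
  by apply: le_trans (ler_norm _); apply: ger0_sin_lower; rewrite x0.
move: xp; rewrite ltr0_norm // -(normrN (sin x)) -sinN => xp.
by apply: le_trans (ler_norm _); apply: ger0_sin_lower; rewrite xp oppr_ge0 ltW.
Qed.

Lemma expRN_le1 x : 0 <= x -> expR (- x) <= 1.
Proof. by move=> x0; rewrite -expR0 ler_expR oppr_le0. Qed.

Lemma norm_expRNB1_le x : 0 <= x -> `|expR (- x) - 1| <= x.
Proof.
move=> x0; have := expR_ge1Dx (- x); have := expRN_le1 x0.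
by move=> h1 h2; rewrite ler0_norm; lra.
Qed.

Lemma norm_expRNB1D_le x : 0 <= x -> `|expR (- x) - 1 + x| <= x ^+ 2.
Proof.
move=> x0.
have h1 := expR_ge1Dx (- x); have h2 := expR_ge1Dx x.
suff h3 : expR (- x) <= 1 - x + x ^+ 2 by rewrite ger0_norm; lra.
have D y : is_derive y (1 : R) (fun y => 1 - y + y ^+ 2 - expR (- y)) (-1 + 2 * y + expR (- y)).
  by dv; ring.
have := ge0_derive_le x0 (fun y _ => D y); rewrite /= oppr0 expR0 expr0n /=.
have D0 y : 0 <= y <= x -> 0 <= -1 + 2 * y + expR (- y).
  by move=> /andP[y0 _]; have := expR_ge1Dx (- y); lra.
by move=> /(_ D0); lra.
Qed.

End Elementary.

(** * Characteristic functions of Bernoulli variables *)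

Section Complex.
Variable R : realType.
Implicit Types (x y a b p psi : R) (z w : R[i]).

Definition cis x : R[i] := (cos x +i* sin x)%C.

Lemma cisD x y : cis (x + y) = cis x * cis y.
Proof.
apply/eqP; rewrite eq_complex /= cosD sinD.
by apply/andP; split; apply/eqP; ring.
Qed.

Lemma cis0 : cis 0 = 1. Proof. by rewrite /cis cos0 sin0. Qed.

Lemma cis_sum (I : Type) (r : seq I) (P : pred I) (F : I -> R) :
  cis (\sum_(i <- r | P i) F i) = \prod_(i <- r | P i) cis (F i).
Proof. exact: (big_morph cis cisD cis0). Qed.

Lemma normc_ge0 z : 0 <= normc z.
Proof. by case: z => a b; exact: sqrtr_ge0. Qed.

Lemma normc_cis x : normc (cis x) = 1.
Proof. by rewrite /normc /cis /= cos2Dsin2 sqrtr1. Qed.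

Lemma normc_real x : normc (x%:C)%C = `|x|.
Proof. by rewrite /normc /= expr0n /= addr0 sqrtr_sqr. Qed.

Lemma norm_Re_le z : `|complex.Re z| <= normc z.
Proof.
case: z => a b /=; rewrite -sqrtr_sqr ler_sqrt ?lerDl ?sqr_ge0 //.
by rewrite addr_ge0 ?sqr_ge0.
Qed.

Lemma normc_le z : normc z <= `|complex.Re z| + `|complex.Im z|.
Proof.
case: z => a b /=; rewrite -[leRHS]ger0_norm ?addr_ge0 // -sqrtr_sqr.
rewrite ler_sqrt ?sqr_ge0 // -(real_normK (num_real a)) -(real_normK (num_real b)).
by rewrite sqrrD -addrA lerD2l lerDr mulrn_wge0 // mulr_ge0.
Qed.

Lemma normc_prod (I : Type) (r : seq I) (P : pred I) (F : I -> R[i]) :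
  normc (\prod_(i <- r | P i) F i) = \prod_(i <- r | P i) normc (F i).
Proof. exact: (big_morph _ (@normcM _) (normc1 _)). Qed.

(* Telescoping: in [\prod z - \prod w] one factor at a time is replaced. *)
Lemma normc_prodB_le (I : finType) (z w : I -> R[i]) (c : I -> R) (M : R) :
  (forall i, normc (z i) <= c i) -> (forall i, normc (w i) <= c i) ->
  (forall i, 0 < c i <= 1) -> (forall i, M <= c i) -> 0 < M ->
  normc (\prod_i z i - \prod_i w i) <=
    M^-1 * (\prod_i c i) * \sum_i normc (z i - w i).
Proof.
move=> zc wc c01 Mc M0.
have key (s : seq I) : normc (\prod_(i <- s) z i - \prod_(i <- s) w i) <=
    M^-1 * (\prod_(i <- s) c i) * \sum_(i <- s) normc (z i - w i).
  elim: s => [|i s IH]; first by rewrite !big_nil subrr normc0 mulr0.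
  rewrite !big_cons.
  set Z := \prod_(_ <- _) z _ in IH *; set W := \prod_(_ <- _) w _ in IH *.
  set P := \prod_(_ <- _) c _ in IH *; set S := \sum_(_ <- _) _ in IH *.
  have -> : z i * Z - w i * W = (z i - w i) * W + z i * (Z - W) by ring.
  have P0 : 0 <= P by apply: prodr_ge0 => j _; have /andP[/ltW] := c01 j.
  have WP : normc W <= P.
    rewrite /W normc_prod; apply: ler_prod => j _.
    by rewrite normc_ge0 wc.
  apply: le_trans (le_normcD _ _) _; rewrite !normcM.
  rewrite mulrDr lerD //.
    rewrite mulrC ler_wpM2r ?normc_ge0 //.
    (* The factor [c i] missing from the tail product is restored at the price [M^-1], because
       [M <= c i]. *)
    by apply: le_trans WP _; rewrite mulrA ler_peMl // ler_pdivlMl // mulr1 Mc.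
  apply: le_trans (ler_pM _ _ (zc i) IH) _; rewrite ?normc_ge0 //.
  by rewrite le_eqVlt; apply/orP; left; apply/eqP; ring.
exact: key.
Qed.

(** The characteristic function of a Bernoulli variable minus its mean. Centring leaves no linear
    phase in the factors; the means are collected in [charf_bern]. *)
Definition bern_cf p psi : R[i] :=
  ((1 - p)%:C * cis (- (p * psi)) + p%:C * cis ((1 - p) * psi))%C.

Lemma bern_cfE p psi :
  bern_cf p psi = cis (- (p * psi)) * ((1 - p)%:C + p%:C * cis psi)%C.
Proof.
rewrite /bern_cf (_ : (1 - p) * psi = - (p * psi) + psi); last by ring.
by rewrite cisD; ring.
Qed.

Lemma normc_bern_sqr p psi :
  normc ((1 - p)%:C + p%:C * cis psi)%C ^+ 2 = 1 - 2 * (p * (1 - p)) * (1 - cos psi).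
Proof.
rewrite /normc /cis /=; rewrite sqr_sqrtr ?addr_ge0 ?sqr_ge0 //.
have := cos2Dsin2 psi; set c := cos psi; set s := sin psi => cs.
rewrite [LHS](_ : _ = (1 - p) ^+ 2 + 2 * (1 - p) * p * c + p ^+ 2 * (c ^+ 2 + s ^+ 2)); last by ring.
by rewrite cs; ring.
Qed.

Lemma normc_bern p psi :
  normc ((1 - p)%:C + p%:C * cis psi)%C <= expR (- (p * (1 - p) * (1 - cos psi))).
Proof.
rewrite -(@ler_pXn2r _ 2) ?nnegrE ?normc_ge0 ?expR_ge0 // normc_bern_sqr.
rewrite -expRM_natl; apply: le_trans (expR_ge1Dx _); lra.
Qed.

Lemma normc_bern_cf p psi :
  normc (bern_cf p psi) <= expR (- (p * (1 - p) * (1 - cos psi))).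
Proof. by rewrite bern_cfE normcM normc_cis mul1r normc_bern. Qed.

(* [bern_cf] with its logarithm replaced by the cumulant expansion up to order 3. *)
Definition gauss_cf p psi : R[i] :=
  (expR (- (p * (1 - p) * psi ^+ 2 / 2)))%:C%C *
    cis (- (p * (1 - p) * (1 - 2 * p) * psi ^+ 3 / 6)).

Lemma normc_gauss_cf p psi :
  normc (gauss_cf p psi) = expR (- (p * (1 - p) * psi ^+ 2 / 2)).
Proof. by rewrite normcM normc_cis mulr1 normc_real ger0_norm ?expR_ge0. Qed.

(** The cumulant expansion without a smallness assumption on psi: real and imaginary parts are
    compared, and every remainder keeps a factor p. Since p will be at most exp (- energy), the sum
    over all parts can be controlled. *)
Lemma bern_gauss_cf p psi : 0 <= p <= 1 ->
  normc (bern_cf p psi - gauss_cf p psi) <= 6 * p * (psi ^+ 4 + psi ^+ 6).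
Proof.
move=> /andP[p0 p1].
apply: le_trans (normc_le _) _.
set X := p * (1 - p) * psi ^+ 2 / 2.
set Y := p * (1 - p) * (1 - 2 * p) * psi ^+ 3 / 6.
(* The quadratic Taylor terms of the two cosines add up to [X], the cubic ones of the two sines to
   [Y]; only remainders survive. *)
have -> : complex.Re (bern_cf p psi - gauss_cf p psi) =
    ((1 - p) * (cos (p * psi) - 1 + (p * psi) ^+ 2 / 2) +
     p * (cos ((1 - p) * psi) - 1 + ((1 - p) * psi) ^+ 2 / 2)) -
    ((expR (- X) - 1 + X) + expR (- X) * (cos Y - 1)).
  by rewrite /bern_cf /gauss_cf /= !cosN -/X -/Y /X; field.
have -> : complex.Im (bern_cf p psi - gauss_cf p psi) =
    (p * (sin ((1 - p) * psi) - (1 - p) * psi + ((1 - p) * psi) ^+ 3 / 6) -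
     (1 - p) * (sin (p * psi) - (p * psi) + (p * psi) ^+ 3 / 6)) +
    ((sin Y - Y) + (expR (- X) - 1) * sin Y).
  by rewrite /bern_cf /gauss_cf /= !sinN -/X -/Y /Y; field.
have v0 : 0 <= p * (1 - p) <= p by rewrite -subr_ge0; apply/andP; split; nra.
have X0 : 0 <= X by rewrite /X divr_ge0 // mulr_ge0 ?sqr_ge0 //; lra.
have X2 : X ^+ 2 <= p * psi ^+ 4 / 4.
  have -> : X ^+ 2 = (p * (1 - p)) ^+ 2 * psi ^+ 4 / 4 by rewrite /X; field.
  rewrite ler_wpM2r // ler_wpM2r ?exprn_even_ge0 //; nra.
have Y2 : Y ^+ 2 <= p * psi ^+ 6 / 4.
  have -> : Y ^+ 2 = (p * (1 - p) * (1 - 2 * p)) ^+ 2 * psi ^+ 6 / 36 by rewrite /Y; field.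
  have h6 : 0 <= psi ^+ 6 by rewrite exprn_even_ge0.
  have h : (p * (1 - p) * (1 - 2 * p)) ^+ 2 <= p.
    have h1 : (1 - 2 * p) ^+ 2 <= 1 by nra.
    have h2 : (p * (1 - p)) ^+ 2 <= p by nra.
    rewrite exprMn; have := sqr_ge0 (p * (1 - p)); nra.
  have := ler_wpM2r h6 h; nra.
have B1 : `|cos (p * psi) - 1 + (p * psi) ^+ 2 / 2| <= p * psi ^+ 4.
  apply: le_trans (norm_cos_taylor2 _) _; rewrite exprMn ler_wpM2r ?exprn_even_ge0 //.
  by rewrite exprS ler_piMr // exprn_ile1.
have B2 : `|cos ((1 - p) * psi) - 1 + ((1 - p) * psi) ^+ 2 / 2| <= psi ^+ 4.
  apply: le_trans (norm_cos_taylor2 _) _; rewrite exprMn ler_piMl ?exprn_even_ge0 //.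
  by rewrite exprn_ile1 //; lra.
have psi5 : `|psi| ^+ 5 <= (psi ^+ 4 + psi ^+ 6) / 2.
  have -> : psi ^+ 4 = `|psi| ^+ 4.
    by rewrite -[4%N]/(2 * 2)%N !exprM real_normK ?num_real.
  have -> : psi ^+ 6 = `|psi| ^+ 6.
    by rewrite -[6%N]/(2 * 3)%N !exprM real_normK ?num_real.
  have := sqr_ge0 (`|psi| ^+ 2 - `|psi| ^+ 3).
  rewrite [X in 0 <= X](_ : _ = `|psi| ^+ 4 - 2 * `|psi| ^+ 5 + `|psi| ^+ 6); last by ring.
  lra.
have B3 : `|sin ((1 - p) * psi) - (1 - p) * psi + ((1 - p) * psi) ^+ 3 / 6| <= `|psi| ^+ 5.
  apply: le_trans (norm_sin_taylor3 _) _; rewrite normrM exprMn ler_piMl ?exprn_ge0 //.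
  by rewrite exprn_ile1 // ger0_norm; lra.
have B4 : `|sin (p * psi) - p * psi + (p * psi) ^+ 3 / 6| <= p * `|psi| ^+ 5.
  apply: le_trans (norm_sin_taylor3 _) _; rewrite normrM exprMn ler_wpM2r ?exprn_ge0 //.
  by rewrite (ger0_norm p0) exprS ler_piMr // exprn_ile1.
have eX1 := expRN_le1 X0; have eX0 := expR_ge0 (- X).
have cY := norm_cosB1_le Y.
have B5 : `|expR (- X) * (cos Y - 1)| <= Y ^+ 2.
  by rewrite normrM (ger0_norm eX0); apply: le_trans cY; rewrite ler_piMl.
have B6 : `|(expR (- X) - 1) * sin Y| <= (X ^+ 2 + Y ^+ 2) / 2.
  rewrite normrM; apply: le_trans (ler_pM _ _ (norm_expRNB1_le X0) (norm_sin_le Y)) _ => //.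
  rewrite -(real_normK (num_real Y)); have := sqr_ge0 (X - `|Y|); lra.
have B7 := norm_expRNB1D_le X0.
have B8 := norm_sinB_le2 Y.
have mulp a c : 0 <= a -> forall x, `|x| <= c -> `|a * x| <= a * c.
  by move=> a0 x xc; rewrite normrM (ger0_norm a0) ler_wpM2l.
have p10 : 0 <= 1 - p by rewrite subr_ge0.
have p11 : 1 - p <= 1 by rewrite lerBlDr lerDl.
have E1 := mulp _ _ p10 _ B1; have E2 := mulp _ _ p0 _ B2.
have E3 := mulp _ _ p0 _ B3; have E4 := mulp _ _ p10 _ B4.
have F1 : `|(1 - p) * (cos (p * psi) - 1 + (p * psi) ^+ 2 / 2) +
     p * (cos ((1 - p) * psi) - 1 + ((1 - p) * psi) ^+ 2 / 2) -
     (expR (- X) - 1 + X + expR (- X) * (cos Y - 1))| <=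
   (1 - p) * (p * psi ^+ 4) + p * psi ^+ 4 + (X ^+ 2 + Y ^+ 2).
  by apply: le_trans (ler_normB _ _) _; apply: lerD; apply: le_trans (ler_normD _ _) _; apply: lerD.
have F2 : `|p * (sin ((1 - p) * psi) - (1 - p) * psi + ((1 - p) * psi) ^+ 3 / 6) -
     (1 - p) * (sin (p * psi) - p * psi + (p * psi) ^+ 3 / 6) +
    (sin Y - Y + (expR (- X) - 1) * sin Y)| <=
   p * `|psi| ^+ 5 + (1 - p) * (p * `|psi| ^+ 5) + (2 * Y ^+ 2 + (X ^+ 2 + Y ^+ 2) / 2).
  apply: le_trans (ler_normD _ _) _; apply: lerD; last first.
    by apply: le_trans (ler_normD _ _) _; apply: lerD.
  by apply: le_trans (ler_normB _ _) _; apply: lerD.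
apply: le_trans (lerD F1 F2) _.
have q4 : 0 <= psi ^+ 4 by rewrite exprn_even_ge0.
have q6 : 0 <= psi ^+ 6 by rewrite exprn_even_ge0.
have q5 : 0 <= `|psi| ^+ 5 by rewrite exprn_ge0.
have G1 : (1 - p) * (p * psi ^+ 4) <= p * psi ^+ 4 by rewrite ler_piMl //; rewrite mulr_ge0.
have G2 : (1 - p) * (p * `|psi| ^+ 5) <= p * `|psi| ^+ 5 by rewrite ler_piMl //; rewrite mulr_ge0.
have G3 := ler_wpM2l p0 psi5.
have G4 : 0 <= p * psi ^+ 4 by rewrite mulr_ge0.
have G5 : 0 <= p * psi ^+ 6 by rewrite mulr_ge0.
set U := (1 - p) * (p * _) in G1 *; set V := (1 - p) * (p * _) in G2 *.
clear B1 B2 B3 B4 B5 B6 B7 B8 E1 E2 E3 E4 F1 F2 mulp v0 X0 eX0 eX1 cY p10 p11 psi5 q4 q6 q5 p0 p1.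
rewrite -mulrA mulrDr; lra.
Qed.

End Complex.

(** * Primitives and quadrature rules *)

Section Calculus2.
Variable R : realType.
Implicit Types (f g F Phi : R -> R) (x y a b h M : R).

Lemma continuous_primitive g a : continuous g ->
  exists F, forall x, a < x -> is_derive x (1 : R) F (g x).
Proof.
move=> cg; exists (fun x => \int[lebesgue_measure]_(t in `[a, x]) g t) => x ax.
have int : lebesgue_measure.-integrable `[a, x + 1] (EFin \o g).
  apply: continuous_compact_integrable; first exact: segment_compact.
  exact: continuous_subspaceT.
have [d e] := @continuous_FTC1_closed R g a x (x + 1) ltac:(lra) int ax (cg x).
by rewrite -e derive1E; exact: derivableP.
Qed.

Lemma taylor1_bound f g (f2 : R -> R) M x y :
  (forall z, Num.min x y <= z <= Num.max x y -> is_derive z (1 : R) f (g z)) ->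
  (forall z, Num.min x y <= z <= Num.max x y -> is_derive z (1 : R) g (f2 z)) ->
  (forall z, Num.min x y <= z <= Num.max x y -> `|f2 z| <= M) ->
  `|f y - f x - (y - x) * g x| <= M * (y - x) ^+ 2.
Proof.
move=> df dg f2M.
have D z : Num.min x y <= z <= Num.max x y ->
    is_derive z (1 : R) (fun z => f z - (z - x) * g x) (g z - g x).
  move=> /df ?; dv; ring.
have := @norm_derive_le R _ _ (M * `|y - x|) x y D _.
rewrite (_ : f y - _ - _ = f y - f x - (y - x) * g x); last by ring.
rewrite -mulrA -expr2 real_normK ?num_real //; apply=> z zxy.
have sub u : Num.min x z <= u <= Num.max x z -> Num.min x y <= u <= Num.max x y.
  move: zxy; case: (leP x y) => h1; case: (leP x z) => h2 /andP[h3 h4] /andP[h5 h6];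
     by apply/andP; split; lra.
have M0 : 0 <= M by apply: le_trans (f2M z zxy).
apply: le_trans (@norm_derive_le R g f2 M x z _ _) _.
- by move=> u /sub; exact: dg.
- by move=> u /sub; exact: f2M.
rewrite ler_wpM2l //; move: zxy; case: (leP x y) => h1 /andP[h2 h3].
  rewrite !ger0_norm; lra.
by rewrite !ler0_norm; lra.
Qed.

(* Increments that are quadratically small up to [e * (y - x)] accumulate to at
   most [e * (b - a)]: subdivide [a, b] into m equal pieces and let m grow. *)
Lemma quadratic_increments f M e a b : a <= b ->
  (forall x y, a <= x -> x <= y -> y <= b ->
     `|f y - f x| <= M * (y - x) ^+ 2 + e * (y - x)) ->
  `|f b - f a| <= e * (b - a).
Proof.
move=> ab H.
have key (m : nat) : `|f b - f a| <= M * (b - a) ^+ 2 / m.+1%:R + e * (b - a).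
  pose u (i : nat) := a + (b - a) * (i%:R / m.+1%:R).
  have m0 : 0 < m.+1%:R :> R by rewrite ltr0n.
  have mn0 : 1 + m%:R != 0 :> R by rewrite addrC natr1 gt_eqF.
  have u0 : u 0%N = a by rewrite /u mul0r mulr0 addr0.
  have um : u m.+1 = b by rewrite /u divff ?gt_eqF // mulr1; ring.
  have step i : u i.+1 - u i = (b - a) / m.+1%:R.
    by rewrite /u -[i.+1]addn1 natrD; field; exact: mn0.
  have ba0 : 0 <= b - a by lra.
  have st0 : 0 <= (b - a) / m.+1%:R by rewrite divr_ge0 // ltW.
  have lo i : a <= u i by rewrite /u lerDl mulr_ge0 // divr_ge0.
  have hi i : (i <= m.+1)%N -> u i <= b.
    move=> im; rewrite /u -lerBrDl ler_piMr // ler_pdivrMr // mul1r ler_nat //.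
  have part i : (i <= m.+1)%N -> `|f (u i) - f a| <=
      i%:R * (M * ((b - a) / m.+1%:R) ^+ 2 + e * ((b - a) / m.+1%:R)).
    elim: i => [_|i IH im]; first by rewrite u0 subrr normr0 mul0r.
    rewrite (_ : f (u i.+1) - f a = (f (u i.+1) - f (u i)) + (f (u i) - f a)); last by ring.
    apply: le_trans (ler_normD _ _) _.
    rewrite -natr1 mulrDl mul1r addrC lerD ?IH // ?(ltnW im) //.
    apply: le_trans (H _ _ (lo i) _ (hi _ im)) _; rewrite ?step //.
    by rewrite -subr_ge0 step.
  have := part m.+1 (leqnn _); rewrite um; move/le_trans; apply.
  rewrite le_eqVlt; apply/orP; left; apply/eqP; field.
  exact: mn0.
rewrite leNgt; apply/negP => lt.
set d := `|f b - f a| - e * (b - a).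
have d0 : 0 < d by rewrite /d subr_gt0.
have [m hm] : exists m : nat, M * (b - a) ^+ 2 / d < m%:R.
  by exists (Num.truncn `|M * (b - a) ^+ 2 / d|).+1; apply: le_lt_trans (ler_norm _) (truncnS_gt _).
have := key m; rewrite -lerBlDr -/d leNgt => /negP; apply.
have m0 : 0 < m.+1%:R :> R by rewrite ltr0n.
rewrite ltr_pdivrMr // [ltRHS]mulrC -ltr_pdivrMr //; apply: lt_le_trans hm _.
by rewrite ler_nat.
Qed.

(** In the quadrature lemmas [Phi] plays the role of the integral of [g] from its argument to
    infinity, whence the sign of its derivative. *)
Lemma rectangle_cell Phi g g1 M x h : 0 <= h ->
  (forall z, x <= z <= x + h -> is_derive z (1 : R) Phi (- g z)) ->
  (forall z, x <= z <= x + h -> is_derive z (1 : R) g (g1 z)) ->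
  (forall z, x <= z <= x + h -> `|g1 z| <= M) ->
  `|h * g x - (Phi x - Phi (x + h))| <= M * h ^+ 2.
Proof.
move=> h0 dP dg gM.
have mm : (Num.min x (x + h) = x) * (Num.max x (x + h) = x + h).
  by rewrite min_l ?max_r // lerDl.
have dN z : x <= z <= x + h -> is_derive z (1 : R) (fun z => - g z) (- g1 z).
  by move=> /dg dgz; exact: is_deriveN.
have := @taylor1_bound Phi (fun z => - g z) (fun z => - g1 z) M x (x + h).
rewrite mm !mm.2 (_ : x + h - x = h); last by ring.
move=> T; have {}T := T dP dN; have := T _; rewrite (_ : Phi (x + h) - _ - _ = h * g x - (Phi x - Phi (x + h))); last by ring.
by apply=> z zx; rewrite normrN gM.
Qed.

(** As a function of the right end z, the error has as derivative half of a first-order Taylor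
    remainder of [g] at z, so it grows by at most M h^2 per unit length. *)
Lemma trapezoid_cell Phi g g1 g2 M x h : 0 <= h ->
  (forall z, x <= z <= x + h -> is_derive z (1 : R) Phi (- g z)) ->
  (forall z, x <= z <= x + h -> is_derive z (1 : R) g (g1 z)) ->
  (forall z, x <= z <= x + h -> is_derive z (1 : R) g1 (g2 z)) ->
  (forall z, x <= z <= x + h -> `|g2 z| <= M) ->
  `|h / 2 * (g x + g (x + h)) - (Phi x - Phi (x + h))| <= M * h ^+ 3.
Proof.
move=> h0 dP dg dg1 gM.
have D z : Num.min x (x + h) <= z <= Num.max x (x + h) ->
   is_derive z (1 : R) (fun z => Phi z + (z - x) / 2 * (g x + g z))
     ((g x - g z + (z - x) * g1 z) / 2).
  rewrite min_l ?max_r ?lerDl // => zx; have ? := dP _ zx; have ? := dg _ zx.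
  by dv; field.
have := @norm_derive_le R _ _ (M * h ^+ 2) x (x + h) D _.
rewrite (_ : x + h - x = h); last by ring.
rewrite (_ : _ - _ = h / 2 * (g x + g (x + h)) - (Phi x - Phi (x + h))); last by ring.
rewrite (ger0_norm h0) (_ : M * h ^+ 2 * h = M * h ^+ 3); last by ring.
apply=> z.
rewrite min_l ?max_r ?lerDl // => zx.
have zx0 : x <= z by case/andP: zx.
have M0 : 0 <= M by apply: le_trans (gM _ zx).
have n2 : `|2^-1| = 2^-1 :> R by rewrite ger0_norm.
rewrite normrM n2.
have := @taylor1_bound g g1 g2 M z x.
rewrite min_r ?max_l // => T.
have sub u : x <= u <= z -> x <= u <= x + h.
  by move=> /andP[-> uz] /=; apply: le_trans uz _; case/andP: zx.
have {}T := T (fun u ux => dg u (sub u ux)) (fun u ux => dg1 u (sub u ux)) (fun u ux => gM u (sub u ux)).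
have -> : g x - g z + (z - x) * g1 z = g x - g z - (x - z) * g1 z by ring.
have : M * (x - z) ^+ 2 <= M * h ^+ 2.
  rewrite ler_wpM2l // -(sqrrN (x - z)) lerXn2r ?nnegrE //; case/andP: zx => *; lra.
have : 0 <= M * h ^+ 2 by rewrite mulr_ge0 ?sqr_ge0.
lra.
Qed.

Lemma geometric_expR_le x h (n : nat) : 0 < h <= 1 ->
  \sum_(i < n) expR (- (x + h * i%:R) / 2) <= expR (- x / 2) * (4 / h).
Proof.
move=> /andP[h0 h1].
have e1 : expR (- h / 2) < 1 by rewrite -[ltRHS]expR0 ltr_expR; lra.
have -> : \sum_(i < n) expR (- (x + h * i%:R) / 2) =
    expR (- x / 2) * \sum_(i < n) expR (- h / 2) ^+ i.
  rewrite mulr_sumr; apply: eq_bigr => i _.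
  by rewrite -expRM_natl -expRD; congr expR; ring.
rewrite ler_wpM2l ?expR_ge0 //.
have e2 : h / 4 <= 1 - expR (- h / 2).
  have := expR_ge1Dx (h / 2); have := expRN (h / 2); rewrite -mulNr => -> e3.
  have : (expR (h / 2))^-1 <= (1 + h / 2)^-1 by rewrite lef_pV2 ?posrE ?expR_gt0 //; lra.
  have : (1 + h / 2)^-1 <= 1 - h / 4.
    rewrite -[leRHS]mul1r -ler_pdivrMr; last lra.
    rewrite -invfM -[leRHS]invr1 lef_pV2 ?posrE; nra.
  lra.
have e3 : (1 - expR (- h / 2)) * \sum_(i < n) expR (- h / 2) ^+ i <= 1.
  by rewrite -[1 - _]opprB mulNr -subrX1 opprB lerBlDr lerDl exprn_ge0 ?expR_ge0.
have s0 : 0 <= \sum_(i < n) expR (- h / 2) ^+ i.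
  by apply: sumr_ge0 => i _; rewrite exprn_ge0 ?expR_ge0.
rewrite ler_pdivlMr //.
have := ler_wpM2r s0 e2; lra.
Qed.

(* The derivative bounds decay like [exp (- x / 2)], so the errors of the
   cells of width [h] add up to a geometric series. *)
Lemma rectangle_sum Phi g g1 C B : 0 <= C ->
  (forall x, - B <= x -> is_derive x (1 : R) Phi (- g x)) ->
  (forall x, - B <= x -> is_derive x (1 : R) g (g1 x)) ->
  (forall x, - B <= x -> `|g1 x| <= C * expR (- x / 2)) ->
  forall x h (n : nat), - B <= x -> 0 < h <= 1 ->
  `|h * \sum_(i < n) g (x + h * i%:R) - (Phi x - Phi (x + h * n%:R))| <=
     4 * C * expR (- x / 2) * h.
Proof.
move=> C0 dP dg g1C x h n xB h01; have /andP[h0 h1] := h01.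
have -> : h * \sum_(i < n) g (x + h * i%:R) - (Phi x - Phi (x + h * n%:R)) =
  \sum_(i < n) (h * g (x + h * i%:R) - (Phi (x + h * i%:R) - Phi (x + h * i%:R + h))).
  rewrite big_split /= mulr_sumr; congr (_ + _).
  elim: n => [|n IH]; first by rewrite big_ord0 mulr0 addr0 subrr oppr0.
  by rewrite big_ord_recr /= -IH -natr1 mulrDr mulr1 addrA; ring.
apply: le_trans (ler_norm_sum _ _ _) _.
apply: (@le_trans _ _ (\sum_(i < n) (C * h ^+ 2) * expR (- (x + h * i%:R) / 2))).
  apply: ler_sum => i _.
  have xi : - B <= x + h * i%:R by apply: le_trans xB _; rewrite lerDl mulr_ge0 // ltW.
  rewrite (_ : C * h ^+ 2 * _ = C * expR (- (x + h * i%:R) / 2) * h ^+ 2); last by ring.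
  apply: (@rectangle_cell Phi g g1 (C * expR (- (x + h * i%:R) / 2)) (x + h * i%:R) h); first exact: ltW.
  - by move=> z /andP[h2 _]; apply: dP; apply: le_trans h2.
  - by move=> z /andP[h2 _]; apply: dg; apply: le_trans h2.
  - move=> z /andP[h2 _]; apply: le_trans (g1C z _) _; first exact: le_trans h2.
    by rewrite ler_wpM2l // ler_expR; lra.
rewrite -mulr_sumr; apply: le_trans (ler_wpM2l _ (geometric_expR_le x n h01)) _.
  by rewrite mulr_ge0 ?sqr_ge0.
by rewrite le_eqVlt; apply/orP; left; apply/eqP; field; rewrite gt_eqF.
Qed.

(** Euler-Maclaurin to first order: the sum runs over left ends only, and the trapezoidal rule
    differs from it by half of the boundary values. *)
Lemma trapezoid_sum Phi g g1 g2 C B : 0 <= C ->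
  (forall x, - B <= x -> is_derive x (1 : R) Phi (- g x)) ->
  (forall x, - B <= x -> is_derive x (1 : R) g (g1 x)) ->
  (forall x, - B <= x -> is_derive x (1 : R) g1 (g2 x)) ->
  (forall x, - B <= x -> `|g2 x| <= C * expR (- x / 2)) ->
  forall x h (n : nat), - B <= x -> 0 < h <= 1 ->
  `|h * \sum_(i < n) g (x + h * i%:R) - (Phi x - Phi (x + h * n%:R))
     - h / 2 * (g x - g (x + h * n%:R))| <=
     4 * C * expR (- x / 2) * h ^+ 2.
Proof.
move=> C0 dP dg dg1 g2C x h n xB h01; have /andP[h0 h1] := h01.
have -> : h * \sum_(i < n) g (x + h * i%:R) - (Phi x - Phi (x + h * n%:R))
     - h / 2 * (g x - g (x + h * n%:R)) =
  \sum_(i < n) (h / 2 * (g (x + h * i%:R) + g (x + h * i%:R + h)) -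
     (Phi (x + h * i%:R) - Phi (x + h * i%:R + h))).
  elim: n => [|n IH]; first by rewrite !big_ord0 !mulr0 addr0 !subrr mulr0 !subr0.
  have e : x + h * n.+1%:R = x + h * n%:R + h by rewrite -natr1; ring.
  by rewrite [RHS]big_ord_recr /= -IH big_ord_recr /= e; field.
apply: le_trans (ler_norm_sum _ _ _) _.
apply: (@le_trans _ _ (\sum_(i < n) (C * h ^+ 3) * expR (- (x + h * i%:R) / 2))).
  apply: ler_sum => i _.
  have xi : - B <= x + h * i%:R by apply: le_trans xB _; rewrite lerDl mulr_ge0 // ltW.
  rewrite (_ : C * h ^+ 3 * _ = C * expR (- (x + h * i%:R) / 2) * h ^+ 3); last by ring.
  apply: (@trapezoid_cell Phi g g1 g2 (C * expR (- (x + h * i%:R) / 2)) (x + h * i%:R) h); first exact: ltW.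
  - by move=> z /andP[h2 _]; apply: dP; apply: le_trans h2.
  - by move=> z /andP[h2 _]; apply: dg; apply: le_trans h2.
  - by move=> z /andP[h2 _]; apply: dg1; apply: le_trans h2.
  - move=> z /andP[h2 _]; apply: le_trans (g2C z _) _; first exact: le_trans h2.
    by rewrite ler_wpM2l // ler_expR; lra.
rewrite -mulr_sumr; apply: le_trans (ler_wpM2l _ (geometric_expR_le x n h01)) _.
  by rewrite mulr_ge0 ?exprn_ge0 // ltW.
by rewrite le_eqVlt; apply/orP; left; apply/eqP; field; rewrite gt_eqF.
Qed.

End Calculus2.

(** * The dilogarithm and the Fermi function *)

Section Fermi.
Variable R : realType.
Implicit Types (x y h phi : R).

(** For a part of energy x, [softlog x] is its contribution to the logarithm of the partition
    function and [fermi x] the probability with which it occurs. *)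
Definition softlog x : R := ln (1 + expR (- x)).
Definition fermi x : R := (1 + expR x)^-1.

Lemma is_derive_softlog x : is_derive x (1 : R) softlog (- fermi x).
Proof.
have e0 := expR_gt0 x; rewrite /softlog /fermi.
dv; first by have := expR_gt0 (- x); lra.
by rewrite expRN; field; rewrite !gt_eqF //; lra.
Qed.

Lemma is_derive_fermi x : is_derive x (1 : R) fermi (- (fermi x * (1 - fermi x))).
Proof.
have e0 := expR_gt0 x; rewrite /fermi.
have n0 : 1 + expR x != 0 by rewrite gt_eqF //; lra.
by dv => //; field.
Qed.

Lemma softlog_bound x : 0 <= softlog x <= expR (- x).
Proof.
have e0 := expR_gt0 (- x).
by rewrite ln_ge0 ?le_ln1Dx //=; [lra| lra].
Qed.

Lemma norm_atan_le x : `|atan x| <= `|x|.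
Proof.
have := @derive_boundT_pow R atan (fun x => (1 + x ^+ 2)^-1) 1 0 ler01 (fun x => is_derive1_atan x) _ x.
rewrite atan0 subr0 mul1r expr1; apply=> y; rewrite expr0 mulr1.
have y2 := sqr_ge0 y; rewrite ger0_norm ?invr_ge0; last lra.
by rewrite invf_le1; lra.
Qed.

Lemma primitive_unique (F G f : R -> R) a b : a <= b ->
  (forall x, a <= x <= b -> is_derive x (1 : R) F (f x)) ->
  (forall x, a <= x <= b -> is_derive x (1 : R) G (f x)) ->
  F b - F a = G b - G a.
Proof.
move=> ab dF dG.
have D x : a <= x <= b -> is_derive x (1 : R) (fun x => F x - G x) 0.
  by move=> xab; have ? := dF _ xab; have ? := dG _ xab; apply: is_derive_eq; rewrite subrr.
by have [c _] := MVT_on ab D; rewrite mul0r => /eqP; rewrite subr_eq0 => /eqP; lra.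
Qed.

Let gtN1 x : 0 <= x -> -1 < x. Proof. by lra. Qed.
Let pihalf_range : 0 <= (0 : R) <= pi / 2. Proof. by rewrite lexx divr_ge0 ?pi_ge0. Qed.
Let pihalf_range' : 0 <= (pi / 2 : R) <= pi / 2. Proof. by rewrite lexx divr_ge0 ?pi_ge0. Qed.
Let cos_range phi : 0 <= phi <= pi / 2 -> - (pi / 2) <= phi <= pi / 2.
Proof. by have := pi_gt0 R; move=> ? /andP[? ?]; apply/andP; split; lra. Qed.
Let half_range phi : 0 <= phi <= pi / 2 -> - (pi / 2) < phi / 2 < pi / 2.
Proof. by have := pi_gt0 R; move=> ? /andP[? ?]; apply/andP; split; lra. Qed.

(* [J phi = \int_0^X ln (1 + 2 e^-x cos phi + e^-2x) dx] satisfies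
   [J' phi = - phi + O(e^-X)], because the integrand is twice the real part of
   the analytic function [ln (1 + e^(-x + i phi))]. *)
Lemma softlog_doubling (F : R -> R) :
  (forall x, -1 < x -> is_derive x (1 : R) F (softlog x)) ->
  forall X, 0 <= X ->
  `|(F (2 * X) - F 0) / 2 - 2 * (F X - F 0) + pi ^+ 2 / 8| <= 4 * expR (- X).
Proof.
move=> dF X X0.
pose D x phi : R := 1 + 2 * expR (- x) * cos phi + expR (- x) ^+ 2.
pose g x phi := ln (D x phi).
pose g1 x phi := - (2 * expR (- x) * sin phi) / D x phi.
pose g2 x phi := - (2 * expR (- x) * cos phi) / D x phi
   - (2 * expR (- x) * sin phi) ^+ 2 / D x phi ^+ 2.
(* [v] is twice the argument of 1 + e^(-x + i phi). By the Cauchy-Riemann equations its x-derivative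
   is the phi-derivative of [g]. *)
pose v x phi : R := 2 * atan (expR (- x) * sin phi / (1 + expR (- x) * cos phi)).
have c0 phi : 0 <= phi <= pi / 2 -> 0 <= cos phi.
  by move=> h; apply: cos_ge0_pihalf; exact: cos_range.
have Dgt x phi : 0 <= phi <= pi / 2 -> 1 <= D x phi.
  move=> /c0 c; have e := expR_gt0 (- x); rewrite /D.
  have := mulr_ge0 (ltW e) c; have := sqr_ge0 (expR (- x)); lra.
have dDphi x phi : is_derive phi (1 : R) (D x) (- (2 * expR (- x) * sin phi)).
  by rewrite /D; dv; ring.
have dDx x phi : is_derive x (1 : R) (D^~ phi) (- (2 * expR (- x) * cos phi) - 2 * expR (- x) ^+ 2).
  by rewrite /D; dv; ring.
have dg1 x phi : 0 <= phi <= pi / 2 -> is_derive phi (1 : R) (g x) (g1 x phi).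
  move=> h; have := Dgt x _ h => D1; have Dp := dDphi x phi.
  rewrite /g; dv; first lra.
  by rewrite /g1; field; rewrite gt_eqF //; lra.
have dg2 x phi : 0 <= phi <= pi / 2 -> is_derive phi (1 : R) (g1 x) (g2 x phi).
  move=> h; have := Dgt x _ h => D1; have Dp := dDphi x phi.
  have n0 : D x phi != 0 by rewrite gt_eqF //; lra.
  by rewrite /g1 /g2; dv => //; field.
have cg phi : 0 <= phi <= pi / 2 -> continuous (g^~ phi).
  move=> h; apply: (@primitive_continuous _ _
    (fun x => (D x phi)^-1 * (- (2 * expR (- x) * cos phi) - 2 * expR (- x) ^+ 2))) => x.
  by have D1 := Dgt x _ h; have Dp := dDx x phi; apply: dv_ln => //; lra.
have dvx x phi : 0 <= phi <= pi / 2 -> is_derive x (1 : R) (v^~ phi) (g1 x phi).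
  move=> h; have D1 := Dgt x _ h; have c := c0 _ h; have e := expR_gt0 (- x).
  have q0 : 0 < 1 + expR (- x) * cos phi by have := mulr_ge0 (ltW e) c; lra.
  have n0 : 1 + expR (- x) * cos phi != 0 by rewrite gt_eqF.
  rewrite /v; dv => //.
  rewrite /g1.
  have DE : D x phi = (1 + expR (- x) * cos phi) ^+ 2 + (expR (- x) * sin phi) ^+ 2.
    have s2 : sin phi ^+ 2 = 1 - cos phi ^+ 2 by have := cos2Dsin2 phi; lra.
    by rewrite /D [(_ * sin phi) ^+ 2]exprMn s2; ring.
  have De : (1 + expR (- x) * cos phi) ^+ 2 + (expR (- x) * sin phi) ^+ 2 != 0.
    by rewrite -DE gt_eqF //; lra.
  by rewrite DE /=; field; rewrite n0 De.
(* A primitive in x is chosen separately for each phi; [G] contains only its increments, so the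
   arbitrary constants drop out. *)
pose P phi := if pselect (0 <= phi <= pi / 2) is left h then
  sval (cid (continuous_primitive (-1) (cg phi h))) else fun=> 0.
have dP phi : 0 <= phi <= pi / 2 -> forall x, -1 < x -> is_derive x (1 : R) (P phi) (g x phi).
  by move=> h; rewrite /P; case: pselect => // h'; exact: (svalP (cid (continuous_primitive _ _))).
pose G phi := P phi X - P phi 0.
have g2b x phi : 0 <= phi <= pi / 2 -> 0 <= x -> `|g2 x phi| <= 6.
  move=> h x0; have D1 := Dgt x _ h.
  have y1 := expRN_le1 x0; have y0 := expR_ge0 (- x).
  have a0 y : `|y| <= 1 -> `|2 * expR (- x) * y| <= 2.
    by move=> yle; rewrite normrM ger0_norm ?mulr_ge0 // -mulrA ler_piMr // mulr_ile1.
  have a1 := a0 _ (norm_cos_le1 phi); have a2 := a0 _ (norm_sin_le1 phi).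
  have a3 : (2 * expR (- x) * sin phi) ^+ 2 <= 4.
    by rewrite -(real_normK (num_real _)); have := normr_ge0 (2 * expR (- x) * sin phi); nra.
  apply: le_trans (ler_normB _ _) _.
  have b1 : `|- (2 * expR (- x) * cos phi) / D x phi| <= 2.
    rewrite normrM normrN normfV (ger0_norm (le_trans ler01 D1)).
    by rewrite ler_pdivrMr ?(lt_le_trans ltr01 D1) //; apply: le_trans a1 _; rewrite ler_peMr.
  have b2 : `|(2 * expR (- x) * sin phi) ^+ 2 / D x phi ^+ 2| <= 4.
    rewrite ger0_norm; last by rewrite divr_ge0 ?sqr_ge0.
    rewrite ler_pdivrMr ?exprn_gt0 ?(lt_le_trans ltr01 D1) //; apply: le_trans a3 _.
    by rewrite ler_peMr // exprn_ege1.
  by rewrite (_ : 6 = 2 + 4); [exact: lerD|ring].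
have v0 phi : 0 <= phi <= pi / 2 -> v 0 phi = phi.
  move=> h; have c := c0 _ h; rewrite /v oppr0 expR0 !mul1r.
  have e : phi = phi / 2 + phi / 2 by field.
  have ch : 0 < cos (phi / 2).
    by apply: cos_gt0_pihalf; exact: half_range.
  have -> : sin phi / (1 + cos phi) = tan (phi / 2).
    rewrite {1 2}e sinD cosD /tan.
    have s2 : sin (phi / 2) * sin (phi / 2) = 1 - cos (phi / 2) * cos (phi / 2).
      by have := cos2Dsin2 (phi / 2); rewrite !expr2; lra.
    rewrite s2 (_ : 1 + _ = 2 * cos (phi / 2) ^+ 2); last by ring.
    by field; rewrite gt_eqF.
  rewrite tanK; first by field.
  by rewrite in_itv /=; exact: half_range.
have vX phi : 0 <= phi <= pi / 2 -> `|v X phi| <= 2 * expR (- X).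
  move=> h; have c := c0 _ h; have e := expR_gt0 (- X).
  rewrite /v normrM ger0_norm // ler_wpM2l //.
  apply: le_trans (norm_atan_le _) _.
  have q0 : 1 <= 1 + expR (- X) * cos phi by have := mulr_ge0 (ltW e) c; lra.
  rewrite normrM normfV (ger0_norm (_ : 0 <= 1 + _)); last lra.
  rewrite ler_pdivrMr; last lra.
  rewrite normrM (ger0_norm (ltW e)); have := norm_sin_le1 phi; have := normr_ge0 (sin phi).
  by move=> s0 s1; have := ler_wpM2l (ltW e) s1; have := ler_wpM2l (ltW e) q0; lra.
(* The derivative of [G] is v X - v 0 = v X - phi, so G phi + phi^2 / 2 has slope at most 2 e^-X. *)
have key : `|(G (pi / 2) + (pi / 2) ^+ 2 / 2) - (G 0 + 0 ^+ 2 / 2)| <= 2 * expR (- X) * (pi / 2 - 0).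
  apply: (@quadratic_increments R (fun phi => G phi + phi ^+ 2 / 2) (6 * X + 1)).
    by have := pi_gt0 R; lra.
  move=> a b a0 ab bp.
  have ha : 0 <= a <= pi / 2 by rewrite a0 (le_trans ab bp).
  have hb : 0 <= b <= pi / 2 by rewrite bp (le_trans a0 ab).
  pose w x := P b x - P a x - (b - a) * v x a.
  have T : `|w X - w 0| <= 6 * (b - a) ^+ 2 * `|X - 0|.
    apply: (@norm_derive_le R w (fun x => g x b - g x a - (b - a) * g1 x a)) => x;
      rewrite min_l ?max_r // => /andP[x0 xX].
      have ? := dP b hb x (gtN1 x0); have ? := dP a ha x (gtN1 x0); have ? := dvx x a ha.
      by dv; ring.
    apply: (@taylor1_bound R (g x) (g1 x) (g2 x) 6 a b) => z; rewrite (min_l ab) (max_r ab) => /andP[z1 z2].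
    - by apply: dg1; rewrite (le_trans a0 z1) (le_trans z2 bp).
    - by apply: dg2; rewrite (le_trans a0 z1) (le_trans z2 bp).
    - by apply: g2b => //; rewrite (le_trans a0 z1) (le_trans z2 bp).
  rewrite subr0 (ger0_norm X0) in T.
  have -> : G b + b ^+ 2 / 2 - (G a + a ^+ 2 / 2) =
     (w X - w 0) + (b - a) * v X a + (b - a) ^+ 2 / 2.
    by rewrite /G /w (v0 a ha); field.
  have ba : 0 <= b - a by rewrite subr_ge0.
  apply: le_trans (ler_normD _ _) _; rewrite (ger0_norm (_ : 0 <= (b - a) ^+ 2 / 2)); last first.
    by rewrite divr_ge0 ?sqr_ge0.
  have T2 : `|(b - a) * v X a| <= (b - a) * (2 * expR (- X)).
    by rewrite normrM (ger0_norm ba) ler_wpM2l // vX.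
  have T3 := ler_normD (w X - w 0) ((b - a) * v X a).
  clear X0 a0 ab bp ha hb; have := sqr_ge0 (b - a); lra.
have h0 := pihalf_range.
have hp := pihalf_range'.
have dPX phi : 0 <= phi <= pi / 2 -> forall x, 0 <= x <= X -> is_derive x (1 : R) (P phi) (g x phi).
  by move=> h x /andP[x0 _]; apply: dP => //; exact: gtN1.
(* At phi = 0 the integrand is 2 softlog x, at phi = pi / 2 it is softlog (2 x); both ends are
   values of [F]. *)
have G0 : G 0 = 2 * (F X - F 0).
  have dF2 x : 0 <= x <= X -> is_derive x (1 : R) (fun x => 2 * F x) (g x 0).
    move=> /andP[x0 _]; have Dx := dF x (gtN1 x0).
    dv; rewrite /g /D cos0 /softlog.
    have -> : 1 + 2 * expR (- x) * 1 + expR (- x) ^+ 2 = (1 + expR (- x)) ^+ 2 by ring.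
    rewrite lnXn; last by rewrite addr_gt0 ?expR_gt0.
    by ring.
  by have := primitive_unique X0 (dPX 0 h0) dF2; rewrite /G; lra.
have G1 : G (pi / 2) = (F (2 * X) - F 0) / 2.
  have dF2 x : 0 <= x <= X -> is_derive x (1 : R) (fun x => F (2 * x) / 2) (g x (pi / 2)).
    move=> /andP[x0 _].
    have DF : is_derive (2 * x) (1 : R) F (softlog (2 * x)) by apply: dF; apply: gtN1; rewrite mulr_ge0.
    have Q : is_derive x (1 : R) (fun x => F (2 * x)) (softlog (2 * x) * 2).
      by apply: dv_comp => //; dv; ring.
    dv; rewrite /g /D cos_pihalf mulr0 addr0 /softlog -expRM_natl.
    have -> : 1 + 2 * expR (- x) * 0 + expR (2%:R * - x) = 1 + expR (- (2 * x)).
      by rewrite (_ : 2%:R * - x = - (2 * x)); ring.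
    by field.
  by have := primitive_unique X0 (dPX _ hp) dF2; rewrite /G mulr0; lra.
move: key; rewrite G0 G1 expr0n /= mul0r addr0 subr0.
have -> : (F (2 * X) - F 0) / 2 + (pi / 2) ^+ 2 / 2 - 2 * (F X - F 0) =
  (F (2 * X) - F 0) / 2 - 2 * (F X - F 0) + pi ^+ 2 / 8 by field.
move/le_trans; apply; have := pi_lt4 R; have := expR_gt0 (- X); nra.
Qed.

(* [L x = \int_x^oo softlog], i.e. [- Li_2 (- e^-x)]. *)
Lemma dilog_exists : exists L : R -> R,
  [/\ forall x, -3 < x -> is_derive x (1 : R) L (- softlog x),
     forall x, -3 < x -> 0 <= L x <= expR (- x) & L 0 = pi ^+ 2 / 12].
Proof.
have cs : continuous softlog by exact: primitive_continuous is_derive_softlog.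
have [F dF] := continuous_primitive (-3) cs.
have incr x y : -3 < x -> x <= y -> F x <= F y <= F x + expR (- x).
  move=> x3 xy; apply/andP; split.
    apply: (@ge0_derive_le R F softlog) => // z /andP[xz _]; first by apply: dF; lra.
    by have /andP[] := softlog_bound z.
  have : - F x - expR (- x) <= - F y - expR (- y).
    apply: (@ge0_derive_le R (fun x => - F x - expR (- x)) (fun z => expR (- z) - softlog z)) => // z /andP[xz _].
      by have D := dF z ltac:(lra); dv; ring.
    by have /andP[] := softlog_bound z; lra.
  by have := expR_ge0 (- y); lra.
(* The integral to infinity is obtained as the supremum of a bounded nondecreasing primitive. *)
pose S := [set F x | x in [set x | 0 <= x]].
have supS : has_sup S.
  split; first by exists (F 0), 0 => //=.
  exists (F 0 + expR (- 0)) => _ [x /= x0 <-].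
  by have /andP[_] := incr 0 x ltac:(lra) x0.
pose l := sup S.
have lF x : 0 <= x -> F x <= l <= F x + expR (- x).
  move=> x0; apply/andP; split; first by apply: (ub_le_sup supS.2); exists x.
  apply: (ge_sup supS.1) => _ [y /= y0 <-].
  have [xy|yx] := leP x y; first by have /andP[] := incr x y ltac:(lra) xy.
  have /andP[h _] := incr y x ltac:(lra) (ltW yx); have := expR_ge0 (- x); lra.
have lF3 x : -3 < x -> F x <= l <= F x + expR (- x).
  move=> x3; have [/lF //|x0] := leP 0 x.
  have := lF 0 (lexx _) => /andP[h1 _].
  have := incr x 0 x3 (ltW x0) => /andP[h3 _].
  apply/andP; split; first lra.
  have : - F x - expR (- x) <= - F 0 - expR (- 0).
    apply: (@ge0_derive_le R (fun x => - F x - expR (- x)) (fun z => expR (- z) - softlog z)) => // [|z /andP[xz _]|z /andP[xz _]].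
    - exact: ltW.
    - by have D := dF z ltac:(lra); dv; ring.
    by have /andP[] := softlog_bound z; lra.
  by have /andP[_] := lF 0 (lexx _); lra.
(* In the limit [softlog_doubling] reads I / 2 - 2 I = - pi^2 / 8 for I = l - F 0, that is I = pi^2
   / 12. A deviation [K] would satisfy K <= 6 e^-X for all X >= 0, which fails at X = 6 / K. *)
have val : l - F 0 = pi ^+ 2 / 12.
  apply/eqP; rewrite -subr_eq0 -normr_eq0; apply/negPn/negP => n0.
  set K := `|_| in n0.
  have K0 : 0 < K by rewrite lt_neqAle normr_ge0 andbT eq_sym.
  have key X : 0 <= X -> K <= 6 * expR (- X).
    move=> X0.
    have D1 : forall x, -1 < x -> is_derive x (1 : R) F (softlog x).
      by move=> x x1; apply: dF; lra.
    have := softlog_doubling D1 X0.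
    have := lF X X0; have := lF (2 * X) ltac:(lra).
    have : expR (- (2 * X)) <= expR (- X) by rewrite ler_expR; lra.
    rewrite /K !ler_norml => h1 /andP[h2 h3] /andP[h4 h5] /andP[h6 h7].
    by apply/andP; split; lra.
  have X0 : 0 <= 6 / K by rewrite divr_ge0 // ltW.
  have := key _ X0; rewrite leNgt => /negP; apply.
  rewrite expRN ltr_pdivrMr ?expR_gt0 // mulrC -ltr_pdivrMr //.
  apply: lt_le_trans (expR_ge1Dx _); lra.
exists (fun x => l - F x); split.
- by move=> x /dF D; dv; ring.
- by move=> x /lF3; lra.
- exact: val.
Qed.

End Fermi.

Arguments softlog {R} x.
Arguments fermi {R} x.

(** * Euler-Maclaurin estimates for the Fermi function and its moments *)

Section FermiSums.
Variable R : realType.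
Implicit Types (x y h d s t : R).

(** Half of the exponential pays for the power; for m = 0 the constant is 0^0 = 1. Bounds by exp (-
    x / 2) are the form that [rectangle_sum] expects. *)
Lemma pow_expR_le (m : nat) x : 0 <= x -> x ^+ m * expR (- x) <= (2 * m%:R) ^+ m * expR (- x / 2).
Proof.
move=> x0; have -> : expR (- x) = expR (- x / 2) * expR (- x / 2).
  by rewrite -expRD; congr expR; field.
rewrite mulrA ler_wpM2r ?expR_ge0 //.
case: m => [|m]; first by rewrite !expr0 !mul1r mulNr expRN_le1 //; lra.
have m0 : 0 < 2 * m.+1%:R :> R by rewrite mulr_gt0 // ltr0n.
have h1 : x / (2 * m.+1%:R) <= expR (x / (2 * m.+1%:R)).
  by apply: le_trans (expR_ge1Dx _); rewrite lerDr.
have h2 : x ^+ m.+1 <= (2 * m.+1%:R) ^+ m.+1 * expR (x / 2).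
  have -> : x / 2 = m.+1%:R * (x / (2 * m.+1%:R)).
    by field; rewrite addrC natr1 pnatr_eq0.
  rewrite expRM_natl -exprMn lerXn2r ?nnegrE //.
  by rewrite mulrC -ler_pdivrMr.
apply: le_trans (ler_wpM2r (expR_ge0 _) h2) _.
by rewrite -mulrA -expRD mulNr subrr expR0 mulr1.
Qed.

Lemma expR_half_le2 : expR (1 / 2) <= 2 :> R.
Proof.
have h := expR_ge1Dx (- (1 / 2) : R).
have e0 := expR_gt0 (1 / 2 : R); rewrite expRN in h.
by rewrite -[leRHS]invrK -[leLHS]invrK lef_pV2 ?posrE ?invr_gt0 //; lra.
Qed.

Lemma expR1_le4 : expR 1 <= 4 :> R.
Proof.
rewrite (_ : expR 1 = expR (1 / 2) ^+ 2 :> R); last by rewrite -expRM_natl; congr expR; field.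
by have := expR_half_le2; have := expR_gt0 (1 / 2 : R); nra.
Qed.

Lemma expRN_half x : -1 <= x -> expR (- x) <= 2 * expR (- x / 2).
Proof.
move=> x1; have -> : expR (- x) = expR (- x / 2) * expR (- x / 2).
  by rewrite -expRD; congr expR; field.
rewrite ler_wpM2r ?expR_ge0 //.
have : expR (- x / 2) <= expR (1 / 2) by rewrite ler_expR; lra.
by have := expR_half_le2; lra.
Qed.

Lemma norm_expRN_le x : -1 <= x -> `|x| * expR (- x) <= 2 * expR (- x / 2).
Proof.
move=> x1; have [x0|x0] := leP 0 x.
  by have := pow_expR_le 1 x0; rewrite !expr1 ger0_norm // mulr1.
rewrite ltr0_norm //; apply: le_trans (expRN_half x1); have := expR_ge0 (- x); nra.
Qed.

Lemma sqr_expRN_le x : -1 <= x -> x ^+ 2 * expR (- x) <= 16 * expR (- x / 2).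
Proof.
move=> x1; have [x0|x0] := leP 0 x.
  by have := pow_expR_le 2 x0; rewrite (_ : (2 * 2%:R) ^+ 2 = 16 :> R) //; ring.
have x2 : x ^+ 2 <= 1 by nra.
have := expRN_half x1; have := expR_ge0 (- x / 2); have := expR_ge0 (- x); nra.
Qed.

(** [fvar] and [fskew] are the variance and the third central moment of a Bernoulli variable with
    parameter [fermi x]. *)
Definition fvar x : R := fermi x * (1 - fermi x).
Definition fskew x : R := fermi x * (1 - fermi x) * (1 - 2 * fermi x).

Lemma fermi_bound x : 0 < fermi x <= expR (- x).
Proof.
have e := expR_gt0 x; by rewrite /fermi invr_gt0 expRN lef_pV2 ?posrE //; lra.
Qed.

Lemma fermi_lt1 x : fermi x < 1.
Proof. by have e := expR_gt0 x; rewrite /fermi invf_lt1; lra. Qed.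

Lemma fvar_bound x : 0 <= fvar x <= expR (- x).
Proof.
have /andP[p0 p1] := fermi_bound x; have p2 := fermi_lt1 x.
by rewrite /fvar; apply/andP; split; nra.
Qed.

Lemma fskew_bound x : `|fskew x| <= expR (- x).
Proof.
have /andP[p0 p1] := fermi_bound x; have p2 := fermi_lt1 x.
have v := fvar_bound x; rewrite /fskew -/(fvar x) normrM.
have : `|1 - 2 * fermi x| <= 1 by rewrite ler_norml; apply/andP; split; lra.
case/andP: v => v0 v1; rewrite (ger0_norm v0); have := normr_ge0 (1 - 2 * fermi x); nra.
Qed.

Lemma is_derive_fvar x : is_derive x (1 : R) fvar (- fskew x).
Proof. by have D := is_derive_fermi x; rewrite /fvar /fskew; dv; ring. Qed.

(** The weight exp (- x) is kept so that differences between neighbouring parts of two residue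
    classes remain summable, as in [eps_sum_le]. *)
Lemma fermi_lip x y : `|x - y| <= 1 ->
  `|fermi x - fermi y| <= 4 * `|x - y| * expR (- x) /\
  `|fvar x - fvar y| <= 4 * `|x - y| * expR (- x) /\
  `|fskew x - fskew y| <= 12 * `|x - y| * expR (- x).
Proof.
move=> xy.
have e3 z : Num.min y x <= z <= Num.max y x -> expR (- z) <= 4 * expR (- x).
  move=> zz; have h : - z <= 1 + - x.
    by move: xy zz; rewrite ler_norml; case: (leP y x) => h /andP[h1 h2] /andP[h3 h4]; lra.
  apply: (@le_trans _ _ (expR (1 + - x))); first by rewrite ler_expR.
  rewrite expRD ler_wpM2r ?expR_ge0 //.
  exact: expR1_le4.
have lip (g g1 : R -> R) (M : R) : (forall z, is_derive z (1 : R) g (g1 z)) -> 0 <= M ->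
    (forall z, `|g1 z| <= M * expR (- z)) -> `|g x - g y| <= (4 * M) * `|x - y| * expR (- x).
  move=> dg M0 g1M; rewrite mulrAC; apply: (@norm_derive_le R g g1) => // z zz.
  by apply: le_trans (g1M z) _; have := ler_wpM2l M0 (e3 z zz); lra.
split; last split.
- have := lip fermi (fun x => - fvar x) 1 (@is_derive_fermi R) ler01; rewrite mulr1; apply.
  by move=> z; have /andP[h1 h2] := fvar_bound z; rewrite normrN ger0_norm // mul1r.
- have := lip fvar (fun x => - fskew x) 1 is_derive_fvar ler01; rewrite mulr1; apply.
  by move=> z; rewrite normrN mul1r fskew_bound.
- have D z : is_derive z (1 : R) fskew (- (fskew z * (1 - 2 * fermi z) - 2 * fvar z ^+ 2)).
    have D1 := is_derive_fvar z; have D2 := is_derive_fermi z.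
    rewrite (_ : fskew = fun z => fvar z * (1 - 2 * fermi z)); last by apply/funext => u; rewrite /fskew /fvar.
    by dv; rewrite /fvar /fskew; ring.
  have -> : 12 = 4 * 3 :> R by ring.
  apply: (lip fskew _ 3 D); first by [].
  move=> z; rewrite normrN; apply: le_trans (ler_normB _ _) _.
  have /andP[p0 p1] := fermi_bound z; have p2 := fermi_lt1 z; have /andP[h1 h2] := fvar_bound z.
  have a1 : `|1 - 2 * fermi z| <= 1 by rewrite ler_norml; apply/andP; split; lra.
  have a2 : `|fskew z * (1 - 2 * fermi z)| <= expR (- z).
    rewrite normrM; have := fskew_bound z; have := normr_ge0 (fskew z); have := normr_ge0 (1 - 2 * fermi z); nra.
  have a3 : `|2 * fvar z ^+ 2| <= 2 * expR (- z).
    have f1 : fvar z <= 1 by rewrite /fvar; nra.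
    rewrite ger0_norm; last by have := sqr_ge0 (fvar z); lra.
    have : fvar z ^+ 2 <= fvar z by rewrite expr2 ler_piMr.
    lra.
  lra.
Qed.

Section EulerMaclaurin.
Variable L : R -> R.
Hypothesis dL : forall x, -3 < x -> is_derive x (1 : R) L (- softlog x).
Hypothesis bL : forall x, -3 < x -> 0 <= L x <= expR (- x).

Variables (h d : R) (n : nat).
Hypothesis h01 : 0 < h <= 1.
Hypothesis d1 : -1 <= d.
(** The grid stops at d + h n; this makes the values there as small as the error of the trapezoidal
    rule. *)
Hypothesis tail : expR (- (h * n%:R) / 2) <= h ^+ 2.

Let h0 : 0 < h. Proof. by case/andP: h01. Qed.
Let h1 : h <= 1. Proof. by case/andP: h01. Qed.
Let hn0 : 0 <= h * n%:R. Proof. by rewrite mulr_ge0 // ltW. Qed.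

Let ed : expR (- d / 2) <= 2.
Proof.
have D1 := d1; have e1 : expR (- d / 2) <= expR (1 / 2) by rewrite ler_expR; lra.
exact: le_trans e1 expR_half_le2.
Qed.

Let ltN3 x : -1 <= x -> -3 < x. Proof. by move=> ?; lra. Qed.

Let tail_le (g : R -> R) (C : R) : 0 <= C -> (forall x, -1 <= x -> `|g x| <= C * expR (- x / 2)) ->
  `|g (d + h * n%:R)| <= 2 * C * h ^+ 2.
Proof.
move=> C0 gC; have D1 := d1; have H := hn0; apply: le_trans (gC _ _) _; first lra.
move: H D1 => _ _.
rewrite (_ : - (d + h * n%:R) / 2 = - d / 2 + - (h * n%:R) / 2); last by field.
rewrite expRD; have := ler_pM (expR_ge0 _) (expR_ge0 _) ed tail.
by move=> H; have := ler_wpM2l C0 H; lra.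
Qed.

Let rect (Phi g g1 : R -> R) (C : R) : 0 <= C ->
  (forall x, -1 <= x -> is_derive x (1 : R) Phi (- g x)) ->
  (forall x, -1 <= x -> is_derive x (1 : R) g (g1 x)) ->
  (forall x, -1 <= x -> `|g1 x| <= C * expR (- x / 2)) ->
  (forall x, -1 <= x -> `|Phi x| <= C * expR (- x / 2)) ->
  `|h * \sum_(i < n) g (d + h * i%:R) - Phi d| <= 10 * C * h.
Proof.
have H0 := h0; have H1 := h1; have D1 := d1.
move=> C0 dP dg g1C PC.
have := rectangle_sum C0 dP dg g1C n d1 h01; have := tail_le C0 PC.
have : C * expR (- d / 2) * h <= C * 2 * h by apply: ler_wpM2r; [exact: ltW|exact: ler_wpM2l].
have : C * h ^+ 2 <= C * h by rewrite ler_wpM2l // expr2 ler_piMr // ltW.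
rewrite !ler_norml => k1 k2 /andP[k3 k4] /andP[k5 k6]; apply/andP; split; lra.
Qed.

Let trap (Phi g g1 g2 : R -> R) (C : R) : 0 <= C ->
  (forall x, -1 <= x -> is_derive x (1 : R) Phi (- g x)) ->
  (forall x, -1 <= x -> is_derive x (1 : R) g (g1 x)) ->
  (forall x, -1 <= x -> is_derive x (1 : R) g1 (g2 x)) ->
  (forall x, -1 <= x -> `|g2 x| <= C * expR (- x / 2)) ->
  (forall x, -1 <= x -> `|Phi x| <= C * expR (- x / 2)) ->
  (forall x, -1 <= x -> `|g x| <= C * expR (- x / 2)) ->
  `|h * \sum_(i < n) g (d + h * i%:R) - Phi d - h / 2 * g d| <= 12 * C * h ^+ 2.
Proof.
have H0 := h0; have H1 := h1; have D1 := d1.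
move=> C0 dP dg dg1 g2C PC gC.
have := trapezoid_sum C0 dP dg dg1 g2C n d1 h01; have := tail_le C0 PC; have := tail_le C0 gC.
have h20 := sqr_ge0 h.
have : C * expR (- d / 2) * h ^+ 2 <= C * 2 * h ^+ 2 by apply: ler_wpM2r => //; exact: ler_wpM2l.
set G := g (d + _); move=> k1 k2.
have : `|h / 2 * G| <= C * h ^+ 2.
  rewrite normrM ger0_norm; last by rewrite divr_ge0 // ltW.
  have := normr_ge0 G; nra.
move: k2; rewrite !ler_norml => /andP[k3 k4] /andP[k5 k6] /andP[k7 k8] /andP[k9 k10].
apply/andP; split; lra.
Qed.

Lemma softlog_sum : `|h * \sum_(i < n) softlog (d + h * i%:R) - L d - h / 2 * softlog d| <= 24 * h ^+ 2.
Proof.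
have -> : 24 = 12 * 2 :> R by ring.
apply: (@trap L softlog (fun x => - fermi x) fvar 2); first by [].
- by move=> x x1; apply: dL; lra.
- by move=> x _; exact: is_derive_softlog.
- by move=> x _; have D := is_derive_fermi x; dv; rewrite /fvar; ring.
- move=> x x1; have /andP[v0 v1] := fvar_bound x; rewrite ger0_norm //.
  exact: le_trans v1 (expRN_half x1).
- move=> x x1; have /andP[v0 v1] := bL (ltN3 x1); rewrite ger0_norm //.
  exact: le_trans v1 (expRN_half x1).
- move=> x x1; have /andP[v0 v1] := softlog_bound x; rewrite ger0_norm //.
  exact: le_trans v1 (expRN_half x1).
Qed.

Lemma fermi_sum : `|h * \sum_(i < n) fermi (d + h * i%:R) - softlog d - h / 2 * fermi d| <= 24 * h ^+ 2.
Proof.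
have -> : 24 = 12 * 2 :> R by ring.
apply: (@trap softlog fermi (fun x => - fvar x) fskew 2); first by [].
- by move=> x _; exact: is_derive_softlog.
- by move=> x _; exact: is_derive_fermi.
- by move=> x _; have D := is_derive_fvar x; dv; ring.
- by move=> x x1; exact: le_trans (fskew_bound x) (expRN_half x1).
- move=> x x1; have /andP[v0 v1] := softlog_bound x; rewrite ger0_norm //.
  exact: le_trans v1 (expRN_half x1).
- move=> x x1; have /andP[v0 v1] := fermi_bound x; rewrite ger0_norm; last exact: ltW.
  exact: le_trans v1 (expRN_half x1).
Qed.

Lemma fvar_sum : `|h * \sum_(i < n) fvar (d + h * i%:R) - fermi d| <= 20 * h.
Proof.
have -> : 20 = 10 * 2 :> R by ring.
apply: (@rect fermi fvar (fun x => - fskew x) 2); first by [].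
- by move=> x _; exact: is_derive_fermi.
- by move=> x _; exact: is_derive_fvar.
- by move=> x x1; rewrite normrN; exact: le_trans (fskew_bound x) (expRN_half x1).
- move=> x x1; have /andP[v0 v1] := fermi_bound x; rewrite ger0_norm; last exact: ltW.
  exact: le_trans v1 (expRN_half x1).
Qed.

Let mulx_le x y : -1 <= x -> `|y| <= expR (- x) -> `|x * y| <= 2 * expR (- x / 2).
Proof.
move=> x1 yx; rewrite normrM; apply: le_trans (norm_expRN_le x1); rewrite ler_wpM2l //.
Qed.

Let mulx2_le x y : -1 <= x -> `|y| <= expR (- x) -> `|x ^+ 2 * y| <= 16 * expR (- x / 2).
Proof.
move=> x1 yx; rewrite normrM (ger0_norm (sqr_ge0 x)).
by apply: le_trans (sqr_expRN_le x1); rewrite ler_wpM2l // sqr_ge0.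
Qed.

Let np x : `|fermi x| <= expR (- x).
Proof. by have /andP[v0 v1] := fermi_bound x; rewrite ger0_norm // ltW. Qed.
Let nv x : `|fvar x| <= expR (- x).
Proof. by have /andP[v0 v1] := fvar_bound x; rewrite ger0_norm. Qed.
Let nf x : `|softlog x| <= expR (- x).
Proof. by have /andP[v0 v1] := softlog_bound x; rewrite ger0_norm. Qed.
Let nL x : -1 <= x -> `|L x| <= 2 * expR (- x / 2).
Proof.
move=> x1; have /andP[v0 v1] := bL (ltN3 x1); rewrite ger0_norm //.
exact: le_trans v1 (expRN_half x1).
Qed.

(** Integration by parts: the derivative of x softlog x + L x is - x fermi x. The next two lemmas
    use primitives found in the same way. *)
Lemma xfermi_sum : `|h * \sum_(i < n) ((d + h * i%:R) * fermi (d + h * i%:R))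
   - (d * softlog d + L d)| <= 40 * h.
Proof.
have -> : 40 = 10 * 4 :> R by ring.
apply: (@rect (fun x => x * softlog x + L x) (fun x => x * fermi x)
  (fun x => fermi x - x * fvar x) 4); first by [].
- move=> x x1; have D := is_derive_softlog x; have D' := dL (ltN3 x1); dv; ring.
- by move=> x _; have D := is_derive_fermi x; dv; rewrite /fvar; ring.
- move=> x x1; apply: le_trans (ler_normB _ _) _.
  have := mulx_le x1 (nv x); have := le_trans (np x) (expRN_half x1); lra.
- move=> x x1; apply: le_trans (ler_normD _ _) _.
  have := mulx_le x1 (nf x); have := nL x1; lra.
Qed.

Lemma xfvar_sum : `|h * \sum_(i < n) ((d + h * i%:R) * fvar (d + h * i%:R))
   - (d * fermi d + softlog d)| <= 40 * h.
Proof.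
have -> : 40 = 10 * 4 :> R by ring.
apply: (@rect (fun x => x * fermi x + softlog x) (fun x => x * fvar x)
  (fun x => fvar x - x * fskew x) 4); first by [].
- by move=> x x1; have D := is_derive_softlog x; have D' := is_derive_fermi x; dv; rewrite /fvar; ring.
- by move=> x _; have D := is_derive_fvar x; dv; ring.
- move=> x x1; apply: le_trans (ler_normB _ _) _.
  have := mulx_le x1 (fskew_bound x); have := le_trans (nv x) (expRN_half x1); lra.
- move=> x x1; apply: le_trans (ler_normD _ _) _.
  have := mulx_le x1 (np x); have := le_trans (nf x) (expRN_half x1); lra.
Qed.

Lemma x2fvar_sum : `|h * \sum_(i < n) ((d + h * i%:R) ^+ 2 * fvar (d + h * i%:R))
   - (d ^+ 2 * fermi d + 2 * (d * softlog d + L d))| <= 240 * h.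
Proof.
have -> : 240 = 10 * 24 :> R by ring.
apply: (@rect (fun x => x ^+ 2 * fermi x + 2 * (x * softlog x + L x)) (fun x => x ^+ 2 * fvar x)
  (fun x => 2 * (x * fvar x) - x ^+ 2 * fskew x) 24); first by [].
- move=> x x1; have D := is_derive_softlog x; have D' := dL (ltN3 x1).
  by have D2 := is_derive_fermi x; dv; rewrite /fvar; ring.
- by move=> x _; have D := is_derive_fvar x; dv; ring.
- move=> x x1; apply: le_trans (ler_normB _ _) _.
  have := mulx_le x1 (nv x); have := mulx2_le x1 (fskew_bound x).
  rewrite (normrM 2) ger0_norm //; have := expR_ge0 (- x / 2); lra.
- move=> x x1; apply: le_trans (ler_normD _ _) _.
  have := mulx_le x1 (nf x); have := mulx2_le x1 (np x); have := nL x1.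
  rewrite (normrM 2) (ger0_norm (_ : 0 <= 2 :> R)) //.
  have := ler_normD (x * softlog x) (L x); lra.
Qed.

End EulerMaclaurin.
End FermiSums.

Arguments fvar {R} x.
Arguments fskew {R} x.

(** * Taylor expansions at the origin *)

Section FermiTaylor.
Variable R : realType.
Implicit Types (x d : R).

Lemma fermi0 : fermi 0 = 1 / 2 :> R.
Proof. by rewrite /fermi expR0 div1r; congr (_^-1); ring. Qed.

Lemma softlog0 : softlog 0 = ln 2 :> R.
Proof. by rewrite /softlog oppr0 expR0; congr ln; ring. Qed.

Lemma fvar0 : fvar 0 = 1 / 4 :> R.
Proof. by rewrite /fvar fermi0; field. Qed.

Let fvar_le1 x : 0 <= fvar x <= 1.
Proof. by have := fermi_lt1 x; have /andP[h _] := fermi_bound x; rewrite /fvar; move=> ?; apply/andP; split; nra. Qed.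

Let fskew_le1 x : `|fskew x| <= 1.
Proof.
have /andP[h0 h1] := fvar_le1 x; rewrite /fskew -/(fvar x) normrM (ger0_norm h0).
have := fermi_lt1 x; have /andP[h _] := fermi_bound x => h2.
have : `|1 - 2 * fermi x| <= 1 by rewrite ler_norml; apply/andP; split; lra.
have := normr_ge0 (1 - 2 * fermi x); nra.
Qed.

Lemma fermi_taylor0 d : `|fermi d - 1 / 2| <= `|d|.
Proof.
have H := @derive_boundT_pow R fermi (fun x => - fvar x) 1 0 ler01 (@is_derive_fermi R) _ d.
rewrite -[leRHS]mul1r -[X in _ <= 1 * X]expr1.
rewrite [X in `|X|](_ : _ = fermi d - fermi 0); last by rewrite fermi0; field.
apply: H => x.
rewrite expr0 mulr1 normrN.
by have /andP[h0 h1] := fvar_le1 x; rewrite ger0_norm.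
Qed.

Lemma fvar_taylor0 d : `|fvar d - 1 / 4| <= `|d|.
Proof.
have H := @derive_boundT_pow R fvar (fun x => - fskew x) 1 0 ler01 (@is_derive_fvar R) _ d.
rewrite -[leRHS]mul1r -[X in _ <= 1 * X]expr1.
rewrite [X in `|X|](_ : _ = fvar d - fvar 0); last by rewrite fvar0; field.
apply: H => x.
by rewrite expr0 mulr1 normrN; exact: fskew_le1.
Qed.

Lemma fermi_taylor1 d : `|fermi d - 1 / 2 + d / 4| <= `|d| ^+ 2.
Proof.
have D : is_primitive (fun x => fermi x - 1 / 2 + x / 4) (fun x => - (fvar x - 1 / 4)).
  by move=> x; have D := is_derive_fermi x; dv; rewrite /fvar; field.
have H := derive_boundT_pow ler01 D (k := 1) _ d.
rewrite -[leRHS]mul1r.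
rewrite [X in `|X|](_ : _ = (fermi d - 1 / 2 + d / 4) - (fermi 0 - 1 / 2 + 0 / 4)); last by rewrite fermi0; field.
apply: H => x.
by rewrite [leRHS]mul1r expr1 normrN fvar_taylor0.
Qed.

Lemma softlog_taylor1 d : `|softlog d - ln 2 + d / 2| <= `|d| ^+ 2.
Proof.
have D : is_primitive (fun x => softlog x - ln 2 + x / 2) (fun x => - (fermi x - 1 / 2)).
  by move=> x; have D := is_derive_softlog x; dv; field.
have H := derive_boundT_pow ler01 D (k := 1) _ d.
rewrite -[leRHS]mul1r.
rewrite [X in `|X|](_ : _ = (softlog d - ln 2 + d / 2) - (softlog 0 - ln 2 + 0 / 2)); last by rewrite softlog0; field.
apply: H => x.
by rewrite [leRHS]mul1r expr1 normrN fermi_taylor0.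
Qed.

Lemma softlog_taylor2 d : `|softlog d - ln 2 + d / 2 - d ^+ 2 / 8| <= `|d| ^+ 3.
Proof.
have D : is_primitive (fun x => softlog x - ln 2 + x / 2 - x ^+ 2 / 8) (fun x => - (fermi x - 1 / 2 + x / 4)).
  by move=> x; have D := is_derive_softlog x; dv; field.
have H := derive_boundT_pow ler01 D (k := 2) _ d.
rewrite -[leRHS]mul1r.
rewrite [X in `|X|](_ : _ = (softlog d - ln 2 + d / 2 - d ^+ 2 / 8) - (softlog 0 - ln 2 + 0 / 2 - 0 ^+ 2 / 8)); last by rewrite softlog0; field.
apply: H => x.
by rewrite [leRHS]mul1r normrN fermi_taylor1.
Qed.

Variable L : R -> R.
Hypothesis dL : forall x, -3 < x -> is_derive x (1 : R) L (- softlog x).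

Let dL1 x : `|x| <= 1 -> is_derive x (1 : R) L (- softlog x).
Proof. by rewrite ler_norml => /andP[h1 h2]; apply: dL; lra. Qed.

Lemma dilog_taylor1 d : `|d| <= 1 -> `|L d - L 0 + d * ln 2| <= 2 * `|d| ^+ 2.
Proof.
have D x : `|x| <= 1 -> is_derive x (1 : R) (fun x => L x + x * ln 2) (- (softlog x - ln 2 + x / 2) + x / 2).
  by move=> x1; have D := dL1 x1; dv; field.
move=> d1; have := derive_bound_pow (_ : 0 <= 2) D (k := 1) _ d1.
rewrite (_ : L d + _ - _ = L d - L 0 + d * ln 2); last by ring.
apply => // x x1; rewrite expr1; apply: le_trans (ler_normD _ _) _; rewrite normrN.
have := softlog_taylor1 x; rewrite normrM (_ : `|2^-1| = 2^-1); last by rewrite ger0_norm.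
by have := normr_ge0 x; nra.
Qed.

(** Third order, because the argument will be an offset of order t and [softlog_model_sum] controls
    h times the sum up to an error t^4. *)
Lemma dilog_taylor3 d : `|d| <= 1 ->
  `|L d - L 0 + d * ln 2 - d ^+ 2 / 4 + d ^+ 3 / 24| <= `|d| ^+ 4.
Proof.
have D x : `|x| <= 1 -> is_derive x (1 : R) (fun x => L x + x * ln 2 - x ^+ 2 / 4 + x ^+ 3 / 24)
   (- (softlog x - ln 2 + x / 2 - x ^+ 2 / 8)).
  by move=> x1; have D := dL1 x1; dv; field.
move=> d1; have := derive_bound_pow ler01 D (k := 3) _ d1.
rewrite (_ : L d + _ - _ + _ - _ = L d - L 0 + d * ln 2 - d ^+ 2 / 4 + d ^+ 3 / 24); last by field.
move=> H; rewrite -[leRHS]mul1r; apply: H => x x1.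
by rewrite [leRHS]mul1r normrN softlog_taylor2.
Qed.

End FermiTaylor.

(** * Sums over the parts *)

Lemma sum_succ (R : realType) (m : nat) :
  \sum_(j < m) j.+1%:R = m%:R * (m%:R + 1) / 2 :> R.
Proof.
elim: m => [|m IH]; first by rewrite big_ord0 !mul0r.
by rewrite big_ord_recr /= IH -natr1; field.
Qed.

(** This lemma and the next two let linear arithmetic absorb the polynomials in N that occur in
    error bounds into one power of N + 2. *)
Lemma square_bounds (R : realType) (x : R) : 1 <= x ->
  [/\ x <= (x + 2) ^+ 2, x <= (x + 2) ^+ 2 / 4, 1 <= (x + 2) ^+ 2 / 4 & (x + 1) ^+ 2 <= (x + 2) ^+ 2].
Proof. by move=> x1; have := sqr_ge0 (x - 2); split; nra. Qed.

Lemma quartic_bounds (R : realType) (x : R) : 1 <= x ->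
  [/\ x <= (x + 2) ^+ 4, x ^+ 2 <= (x + 2) ^+ 4, x ^+ 3 <= (x + 2) ^+ 4,
      (x + 1) ^+ 4 <= (x + 2) ^+ 4 & x * (x + 1) ^+ 2 <= (x + 2) ^+ 4].
Proof.
move=> x1; have x0 : 0 <= x by lra.
have e m : (m <= 4)%N -> (x + 2) ^+ m <= (x + 2) ^+ 4 by move=> m4; rewrite ler_weXn2l //; lra.
split.
- by apply: le_trans (e 1%N isT); rewrite expr1; lra.
- by apply: le_trans (e 2%N isT); rewrite lerXn2r ?nnegrE; lra.
- by apply: le_trans (e 3%N isT); rewrite lerXn2r ?nnegrE; lra.
- by rewrite lerXn2r ?nnegrE; lra.
- apply: le_trans (e 3%N isT); rewrite exprS; apply: ler_pM; rewrite ?sqr_ge0 ?lerXn2r ?nnegrE //; lra.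
Qed.

Lemma cubic_bounds (R : realType) (x : R) : 1 <= x ->
  [/\ (x + 1) ^+ 3 <= (x + 2) ^+ 3, x ^+ 2 <= (x + 2) ^+ 3 & x * (x + 1) <= (x + 2) ^+ 3].
Proof.
move=> x1; have x0 : 0 <= x by lra.
have e : (x + 2) ^+ 2 <= (x + 2) ^+ 3 by rewrite ler_weXn2l //; lra.
split.
- by rewrite lerXn2r ?nnegrE; lra.
- by apply: le_trans e; rewrite lerXn2r ?nnegrE; lra.
- by apply: le_trans e; nra.
Qed.

Section Model.
Variables (R : realType) (N : nat) (a b : 'I_N).
Hypothesis ab : a != b.
Implicit Types (n i : nat) (j : 'I_N) (t : R).

(* A pair (i, j) stands for the part [N i + j + 1], so that the second component gives the
   residue class; the parts congruent to [a.+1] and [b.+1] carry the signs 1 and -1. *)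
Definition part n (x : 'I_n * 'I_N) : nat := (x.1 * N + x.2).+1.
Definition sgn_ j : int := (j == a)%:Z - (j == b)%:Z.
Definition eps j : R := (sgn_ j)%:~R.
Definition energy n t (x : 'I_n * 'I_N) : R := t ^+ 2 * (part x)%:R - t * eps x.2.
(** The bounded term in the mean of [pd]. It stems from the different smallest parts of the two
    classes and is the source of beta - alpha in the formula. *)
Definition kappa0 : R := (b%:R - a%:R) / (2 * N%:R).

Lemma eps_a : eps a = 1.
Proof. by rewrite /eps /sgn_ eqxx (negPf ab). Qed.

Lemma eps_b : eps b = -1.
Proof. by rewrite /eps /sgn_ eqxx eq_sym (negPf ab). Qed.

Lemma eps_other j : j != a -> j != b -> eps j = 0.
Proof. by rewrite /eps /sgn_ => /negPf -> /negPf ->. Qed.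

Lemma eps_cases j : [\/ eps j = 1, eps j = -1 | eps j = 0].
Proof.
have [->|ja] := eqVneq j a; first by constructor 1; exact: eps_a.
have [->|jb] := eqVneq j b; first by constructor 2; exact: eps_b.
by constructor 3; exact: eps_other.
Qed.

Lemma norm_eps_le1 j : `|eps j| <= 1.
Proof. by case: (eps_cases j) => ->; rewrite ?normrN ?normr1 ?normr0. Qed.

Lemma sum_eps (F : 'I_N -> R) : \sum_j eps j * F j = F a - F b.
Proof.
rewrite (bigD1 a) //= (bigD1 b) /=; last by rewrite eq_sym.
rewrite eps_a eps_b big1 ?addr0 ?mul1r ?mulN1r // => j /andP[ja jb].
by rewrite eps_other // mul0r.
Qed.

Lemma sum_eps2 (F : 'I_N -> R) : \sum_j eps j ^+ 2 * F j = F a + F b.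
Proof.
under eq_bigr do rewrite expr2 -mulrA.
by rewrite sum_eps eps_a eps_b mul1r mulN1r opprK.
Qed.

Lemma sum_model n (F : 'I_n * 'I_N -> R) : \sum_x F x = \sum_j \sum_i F (i, j).
Proof. by rewrite exchange_big pair_bigA; apply: eq_bigr => -[]. Qed.

Let N0 : 0 < N%:R :> R. Proof. by rewrite ltr0n; case: N a => // -[]. Qed.

(** The energies of one residue class form an arithmetic progression of step N t^2, of which this is
    the first term. It is of order t because of the tilt. *)
Definition offset t j : R := t ^+ 2 * j.+1%:R - t * eps j.

Lemma energyE n t (i : 'I_n) j : energy t (i, j) = offset t j + (N%:R * t ^+ 2) * i%:R.
Proof. by rewrite /energy /offset /part /= -addnS natrD natrM; ring. Qed.

Section Fixed.
Variables (t : R) (n : nat).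
Hypothesis t0 : 0 < t.
Hypothesis tN : (N%:R + 2) * t <= 1.

Let N1 : 1 <= N%:R :> R. Proof. by rewrite ler1n; case: N a => // -[]. Qed.
Let t1 : t <= 1. Proof. have := t0; have := tN; have := N1; nra. Qed.
Let h := N%:R * t ^+ 2.
Let h01 : 0 < h <= 1.
Proof.
have := t0; have := tN; have := N0; have := t1 => h1 h2 h3 h4; rewrite /h; apply/andP; split.
  by rewrite mulr_gt0 ?exprn_gt0.
by nra.
Qed.

Lemma offset_le j : `|offset t j| <= (N%:R + 1) * t.
Proof.
have := t0; have := t1; have := N0 => H1 H2 H3.
rewrite /offset; apply: le_trans (ler_normB _ _) _.
have e : `|t * eps j| <= t by rewrite normrM gtr0_norm // ler_piMr ?norm_eps_le1 // ltW.
have j1 : j.+1%:R <= N%:R :> R by rewrite ler_nat.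
have j0 : 0 <= j.+1%:R :> R by [].
rewrite ger0_norm; last by rewrite mulr_ge0 ?sqr_ge0.
have : t ^+ 2 * j.+1%:R <= t * N%:R.
  by rewrite expr2 -mulrA ler_wpM2l ?(ltW H3) //; nra.
lra.
Qed.

Lemma offset_le1 j : `|offset t j| <= 1.
Proof. by apply: le_trans (offset_le j) _; have := tN; have := t0; lra. Qed.

Lemma offset_geN1 j : -1 <= offset t j.
Proof. by have := offset_le1 j; rewrite ler_norml => /andP[]. Qed.

Lemma expRN_energy_le (x : 'I_n * 'I_N) : expR (- energy t x) <= 4 * expR (- (t ^+ 2 * (part x)%:R)).
Proof.
rewrite /energy opprB addrC expRD mulrC ler_wpM2r ?expR_ge0 //.
apply: le_trans (expR1_le4 R); rewrite ler_expR.
have := ler_norm (t * eps x.2); have : `|t * eps x.2| <= t.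
  by rewrite normrM (gtr0_norm t0) ler_piMr ?norm_eps_le1 // ltW.
have := t1; lra.
Qed.

(** The weights are concentrated on parts of order t^-2, and there are about t^-2 of them. *)
Lemma moment_expR_le (m : nat) :
  \sum_(x : 'I_n * 'I_N) (part x)%:R ^+ m * expR (- energy t x) <=
    16 * (2 * m%:R) ^+ m / (t ^+ 2) ^+ m.+1.
Proof.
have s0 : 0 < t ^+ 2 by rewrite exprn_gt0.
pose C := 4 * ((2 * m%:R) ^+ m / (t ^+ 2) ^+ m : R).
have C0 : 0 <= C by rewrite /C mulr_ge0 // divr_ge0 // exprn_ge0 ?mulr_ge0 // ltW.
apply: (@le_trans _ _ (\sum_(x : 'I_n * 'I_N) C * expR (- (0 + h * x.1%:R) / 2))).
  apply: ler_sum => x _.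
  apply: (@le_trans _ _ ((part x)%:R ^+ m * (4 * expR (- (t ^+ 2 * (part x)%:R))))).
    by rewrite ler_wpM2l ?exprn_ge0 // expRN_energy_le.
  have K0 : 0 <= t ^+ 2 * (part x)%:R by rewrite mulr_ge0 // ltW.
  have := pow_expR_le m K0; rewrite exprMn mulrAC => H.
  have H2 : (part x)%:R ^+ m * expR (- (t ^+ 2 * (part x)%:R)) <=
     (2 * m%:R) ^+ m / (t ^+ 2) ^+ m * expR (- (t ^+ 2 * (part x)%:R) / 2).
    rewrite [leRHS]mulrAC ler_pdivlMr ?exprn_gt0 //.
    by apply: le_trans H; rewrite le_eqVlt; apply/orP; left; apply/eqP; ring.
  rewrite mulrCA /C -mulrA ler_wpM2l //; apply: le_trans H2 _.
  rewrite ler_wpM2l //; first by rewrite divr_ge0 // exprn_ge0 ?mulr_ge0 // ltW.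
  rewrite ler_expR add0r ler_wpM2r // lerN2 /h /part -natr1 natrD natrM.
  by have := ler0n R x.2; nra.
rewrite sum_model /= sumr_const card_ord -mulr_sumr.
have G := geometric_expR_le 0 n h01; rewrite oppr0 mul0r expR0 mul1r in G.
apply: (@le_trans _ _ ((C * (4 / h)) *+ N)).
  by rewrite ler_wMn2r // ler_wpM2l.
rewrite -mulr_natr /C /h le_eqVlt; apply/orP; left; apply/eqP.
rewrite [_ ^+ m.+1]exprS; field.
by rewrite !gt_eqF ?exprn_gt0.
Qed.

Lemma part_pos (x : 'I_n * 'I_N) : 1 <= (part x)%:R :> R.
Proof. by rewrite ler1n. Qed.

(** The sign sets the classes of [a] and [b] against each other. In the same row their parts differ
    by at most N and their energies by O(t), which gains a factor t over [moment_expR_le]. *)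
Lemma eps_sum_le (w : R -> R) (m : nat) : (m <= 2)%N ->
  (forall x, `|w x| <= expR (- x)) ->
  (forall x y, `|x - y| <= 1 -> `|w x - w y| <= 12 * `|x - y| * expR (- x)) ->
  `|\sum_(x : 'I_n * 'I_N) eps x.2 * ((part x)%:R ^+ m * w (energy t x))| <=
     (3000 * (N%:R + 2) ^+ 2) / t ^+ (2 * m).+1.
Proof.
move=> m2 wb wl; have T0 := t0; have T1 := t1; have NN := N1.
rewrite sum_model /=.
under eq_bigr do rewrite -mulr_sumr.
rewrite sum_eps -sumrB.
pose D := 2 * (N%:R + 2) ^+ 2 : R.
have step (i : 'I_n) : `|(part (i, a))%:R ^+ m * w (energy t (i, a)) - (part (i, b))%:R ^+ m * w (energy t (i, b))|
   <= (m != 0%N)%:R * D * ((part (i, a))%:R ^+ m.-1 * expR (- energy t (i, a))) +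
      12 * ((N%:R + 2) * t) * ((part (i, b))%:R ^+ m * expR (- energy t (i, b))).
  set ka := (part (i, a))%:R : R; set kb := (part (i, b))%:R : R.
  have ka1 : 1 <= ka := part_pos (i, a).
  have kb1 : 1 <= kb := part_pos (i, b).
  have kab : `|ka - kb| <= N%:R.
    rewrite /ka /kb /part /= -!addnS !natrD opprD addrACA subrr add0r.
    have ha : a.+1%:R <= N%:R :> R by rewrite ler_nat.
    have hb : b.+1%:R <= N%:R :> R by rewrite ler_nat.
    have := ler0n R a.+1; have := ler0n R b.+1; rewrite ler_norml => *; apply/andP; split; lra.
  have exy : `|energy t (i, a) - energy t (i, b)| <= (N%:R + 2) * t.
    rewrite /energy /= -/ka -/kb eps_a eps_b.
    have -> : t ^+ 2 * ka - t * 1 - (t ^+ 2 * kb - t * -1) = t ^+ 2 * (ka - kb) - 2 * t by ring.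
    apply: le_trans (ler_normB _ _) _.
    rewrite normrM (ger0_norm (sqr_ge0 t)) (ger0_norm (_ : 0 <= 2 * t)); last by lra.
    have : t ^+ 2 * `|ka - kb| <= t * N%:R.
      by rewrite expr2 -mulrA ler_wpM2l ?(ltW T0) //; have := normr_ge0 (ka - kb); nra.
    lra.
  have exy' : `|energy t (i, b) - energy t (i, a)| <= (N%:R + 2) * t by rewrite distrC.
  have wab := wl _ _ (le_trans exy' tN).
  have -> : ka ^+ m * w (energy t (i, a)) - kb ^+ m * w (energy t (i, b)) =
     (ka ^+ m - kb ^+ m) * w (energy t (i, a)) - kb ^+ m * (w (energy t (i, b)) - w (energy t (i, a))) by ring.
  apply: le_trans (ler_normB _ _) _; rewrite !normrM; apply: lerD.
    have H : `|ka ^+ m - kb ^+ m| <= (m != 0%N)%:R * D * ka ^+ m.-1.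
      case: m m2 => [|[|[|//]]] _ /=; first by rewrite !expr0 subrr normr0 !mul0r.
        rewrite expr0 !expr1 mulr1 mul1r; apply: le_trans kab _; rewrite /D; nra.
      rewrite expr1 mul1r (_ : ka ^+ 2 - kb ^+ 2 = (ka - kb) * (ka + kb)); last by ring.
      rewrite normrM (ger0_norm (_ : 0 <= ka + kb)); last by lra.
      have kb2 : kb <= ka + N%:R by move: kab; rewrite ler_norml => /andP[]; lra.
      apply: (@le_trans _ _ (N%:R * (ka + kb))); first by rewrite ler_wpM2r //; lra.
      apply: (@le_trans _ _ (N%:R * ((2 + N%:R) * ka))).
        rewrite ler_wpM2l //; nra.
      rewrite mulrA; apply: ler_wpM2r; first by lra.
      by rewrite /D; nra.
    by rewrite mulrA; apply: ler_pM.
  have kbm : 0 <= kb ^+ m by rewrite exprn_ge0 //; lra.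
  rewrite ger0_norm // mulrCA; apply: ler_wpM2l => //.
  apply: le_trans wab _; apply: ler_wpM2r; first exact: expR_ge0.
  by apply: ler_wpM2l.
have sub (F : 'I_n * 'I_N -> R) j : (forall x, 0 <= F x) -> \sum_i F (i, j) <= \sum_x F x.
  move=> F0; rewrite sum_model (bigD1 j) //= lerDl; apply: sumr_ge0 => k _; exact: sumr_ge0.
apply: le_trans (ler_norm_sum _ _ _) _.
apply: le_trans; first by apply: ler_sum => i _; exact: step.
rewrite big_split /= -!mulr_sumr.
have M1 := le_trans (sub (fun x => (part x)%:R ^+ m.-1 * expR (- energy t x)) a _) (moment_expR_le m.-1).
have M2 := le_trans (sub (fun x => (part x)%:R ^+ m * expR (- energy t x)) b _) (moment_expR_le m).
have pos k (x : 'I_n * 'I_N) : 0 <= (part x)%:R ^+ k * expR (- energy t x).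
  by rewrite mulr_ge0 ?exprn_ge0 ?expR_ge0.
have {}M1 := M1 (pos _); have {}M2 := M2 (pos _).
have D0 : 0 <= (m != 0%N)%:R * D by rewrite mulr_ge0 // /D; nra.
have E0 : 0 <= 12 * ((N%:R + 2) * t) by rewrite !mulr_ge0 // ltW //; lra.
apply: le_trans (lerD (ler_wpM2l D0 M1) (ler_wpM2l E0 M2)) _.
have tp k : 0 < t ^+ k by rewrite exprn_gt0.
rewrite ler_pdivlMr // /D.
have u1 : 3 <= N%:R + 2 :> R by lra.
set u := N%:R + 2 in u1 *.
have u2 : u <= u ^+ 2 by nra.
case: m m2 {step M1 M2 sub pos D0 E0} => [|[|[|//]]] _ /=.
- rewrite (_ : _ * t ^+ _ = 192 * u); last by rewrite -[(2 * 0).+1]/1%N; field; rewrite gt_eqF.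
  nra.
- rewrite -[(2 * 1).+1]/3%N (_ : _ * t ^+ 3 = 32 * u ^+ 2 * t + 384 * u); last by field; rewrite gt_eqF.
  nra.
- rewrite -[(2 * 2).+1]/5%N (_ : _ * t ^+ 5 = 64 * u ^+ 2 * t + 3072 * u); last by field; rewrite gt_eqF.
  nra.
Qed.

Variable L : R -> R.
Hypothesis dL : forall x : R, -3 < x -> is_derive x (1 : R) L (- softlog x).
Hypothesis bL : forall x : R, -3 < x -> 0 <= L x <= expR (- x).
Hypothesis tail : expR (- (N%:R * t ^+ 2 * n%:R) / 2) <= (N%:R * t ^+ 2) ^+ 2.

(** The expansion of a class sum is sorted by powers of [eps j]: summed over the classes, the first
    power leaves G a - G b and the second leaves twice its coefficient. *)
Let approx_sum (X c G : 'I_N -> R) (c2 B : R) :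
  (forall j, `|X j - (c j + eps j * G j + eps j ^+ 2 * c2)| <= B) ->
  `|\sum_j X j - (\sum_j c j + (G a - G b) + 2 * c2)| <= N%:R * B.
Proof.
move=> H; have -> : \sum_j X j - (\sum_j c j + (G a - G b) + 2 * c2) =
   \sum_j (X j - (c j + eps j * G j + eps j ^+ 2 * c2)).
  by rewrite sumrB !big_split /= sum_eps (sum_eps2 (fun=> c2)); ring.
apply: le_trans (ler_norm_sum _ _ _) _; apply: le_trans (ler_sum _ (fun j _ => H j)) _.
by rewrite sumr_const card_ord mulr_natl.
Qed.

Lemma ln2_bound : 0 <= (ln 2 : R) <= 1.
Proof.
apply/andP; split; first by rewrite ln_ge0 //; lra.
by have := @le_ln1Dx R 1; rewrite (_ : 1 + 1 = 2) //; apply; lra.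
Qed.

Let eps3 j : eps j ^+ 3 = eps j.
Proof. by case: (eps_cases j) => ->; ring. Qed.

Let J0 j : 0 <= (j.+1%:R : R) <= N%:R.
Proof. by rewrite ler0n ler_nat ltn_ord. Qed.

Let off2 j : `|offset t j| ^+ 2 <= (N%:R + 1) ^+ 2 * t ^+ 2.
Proof. by rewrite -exprMn lerXn2r ?nnegrE ?offset_le // mulr_ge0 //; have := t0; lra. Qed.

Let off3 j : `|offset t j| ^+ 3 <= (N%:R + 1) ^+ 3 * t ^+ 3.
Proof. by rewrite -exprMn lerXn2r ?nnegrE ?offset_le // mulr_ge0 //; have := t0; lra. Qed.

Let off4 j : `|offset t j| ^+ 4 <= (N%:R + 1) ^+ 4 * t ^+ 4.
Proof. by rewrite -exprMn lerXn2r ?nnegrE ?offset_le // mulr_ge0 //; have := t0; lra. Qed.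

(** L 0 / t^2 comes from the integral. The boundary term h / 2 and the average of the residues
    combine to - ln 2 / 2. The square of the sign gives 1 / (2 N), and the product of sign and
    residue gives kappa0 t. *)
Lemma softlog_model_sum :
  `|\sum_x softlog (energy t (x : 'I_n * 'I_N)) -
    (L 0 / t ^+ 2 - ln 2 / 2 + (2 * N%:R)^-1 + kappa0 * t)| <= 100 * (N%:R + 2) ^+ 4 * t ^+ 2.
Proof.
have T0 := t0; have T1 := t1; have NN := N1; have tp k : 0 < t ^+ k by rewrite exprn_gt0.
pose X j := h * \sum_(i < n) softlog (offset t j + h * i%:R).
pose c (j : 'I_N) := L 0 + ln 2 * (h / 2) - ln 2 * t ^+ 2 * j.+1%:R.
pose G (j : 'I_N) := t * ln 2 + N%:R * t ^+ 3 / 4 + t ^+ 3 / 24 - t ^+ 3 * j.+1%:R / 2.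
have u0 : 0 <= (N%:R + 2 : R) by lra.
have B j : `|X j - (c j + eps j * G j + eps j ^+ 2 * (t ^+ 2 / 4))| <= 100 * (N%:R + 2) ^+ 4 * t ^+ 4.
  set d := offset t j.
  have S := softlog_sum dL bL h01 (offset_geN1 j) tail; rewrite -/d -/h -/(X j) in S.
  have T := dilog_taylor3 dL (offset_le1 j); rewrite -/d in T.
  have F := softlog_taylor1 d.
  (* [rho] gathers the terms of order t^4 and higher in the exact expansion that belong to none of
     the three remainders. *)
  pose rho := j.+1%:R ^+ 2 / 4 - (t ^+ 2 * j.+1%:R ^+ 3 - 3 * t * j.+1%:R ^+ 2 * eps j + 3 * j.+1%:R * eps j ^+ 2) / 24 - N%:R * j.+1%:R / 4 : R.
  have -> : X j - (c j + eps j * G j + eps j ^+ 2 * (t ^+ 2 / 4)) =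
     (X j - L d - h / 2 * softlog d) + (L d - L 0 + d * ln 2 - d ^+ 2 / 4 + d ^+ 3 / 24)
     + h / 2 * (softlog d - ln 2 + d / 2) + t ^+ 4 * rho.
    rewrite /c /G /rho /d /offset /h; have := eps3 j; set e := eps j => e3.
    have -> : (t ^+ 2 * j.+1%:R - t * e) ^+ 3 = t ^+ 6 * j.+1%:R ^+ 3 - 3 * t ^+ 5 * j.+1%:R ^+ 2 * e
       + 3 * t ^+ 4 * j.+1%:R * e ^+ 2 - t ^+ 3 * e ^+ 3 by ring.
    by rewrite e3; field.
  have rb : `|rho| <= 2 * (N%:R + 2) ^+ 4.
    have /andP[j0 j1] := J0 j; set J := j.+1%:R in j0 j1 rho *.
    have e1 := norm_eps_le1 j; rewrite ler_norml in e1; case/andP: e1 => e1 e2.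
    have J2 : 0 <= J ^+ 2 <= N%:R ^+ 2 by rewrite sqr_ge0 lerXn2r ?nnegrE.
    have J3 : 0 <= J ^+ 3 <= N%:R ^+ 3 by rewrite exprn_ge0 // lerXn2r ?nnegrE.
    have t2 : 0 <= t ^+ 2 <= 1 by rewrite sqr_ge0 exprn_ile1 // ltW.
    have p1 : 0 <= t ^+ 2 * J ^+ 3 <= N%:R ^+ 3.
      move: J3 t2 => /andP[J30 J31] /andP[t20 t21]; rewrite mulr_ge0 //=.
      by apply: le_trans J31; rewrite ler_piMl.
    have p2 : `|t * J ^+ 2 * eps j| <= N%:R ^+ 2.
      have tJ0 : 0 <= t * J ^+ 2 by rewrite mulr_ge0 ?sqr_ge0 // ltW.
      have tJ1 : t * J ^+ 2 <= N%:R ^+ 2.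
        by case/andP: J2 => J20 J21; apply: le_trans J21; rewrite ler_piMl.
      rewrite normrM (ger0_norm tJ0); apply: le_trans tJ1.
      by rewrite ler_piMr // norm_eps_le1.
    have p3 : 0 <= J * eps j ^+ 2 <= N%:R.
      have n1 := norm_eps_le1 j; have n2 : eps j ^+ 2 <= 1 by rewrite -real_normK ?num_real // exprn_ile1.
      by rewrite mulr_ge0 ?sqr_ge0 //=; apply: le_trans j1; rewrite ler_piMr.
    have p4 : 0 <= N%:R * J <= N%:R ^+ 2 by rewrite mulr_ge0 //= expr2 ler_wpM2l.
    have [q1 q2 q3 _ _] := quartic_bounds NN.
    move: p2; rewrite !ler_norml /rho -/J => /andP[p21 p22].
    move: p1 p3 p4 J2 => /andP[? ?] /andP[? ?] /andP[? ?] /andP[? ?].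
    clear S T F X c G e1 e2 J3 t2 tp j0 j1 NN T0 T1 u0.
    by apply/andP; split; lra.
  have h20 : 0 <= h / 2 by case/andP: h01 => *; lra.
  have F2 : `|h / 2 * (softlog d - ln 2 + d / 2)| <= h / 2 * ((N%:R + 1) ^+ 2 * t ^+ 2).
    by rewrite normrM (ger0_norm h20) ler_wpM2l //; apply: le_trans F (off2 j).
  have T2 := le_trans T (off4 j).
  have R2 : `|t ^+ 4 * rho| <= t ^+ 4 * (2 * (N%:R + 2) ^+ 4).
    by rewrite normrM (ger0_norm (ltW (tp 4%N))) ler_wpM2l // ltW.
  do 3!(apply: le_trans (ler_normD _ _) _; rewrite -?lerBrDr).
  apply: le_trans S _; rewrite !lerBrDr.
  apply: (@le_trans _ _ (24 * h ^+ 2 + (N%:R + 1) ^+ 4 * t ^+ 4 + h / 2 * ((N%:R + 1) ^+ 2 * t ^+ 2) + t ^+ 4 * (2 * (N%:R + 2) ^+ 4))); first lra.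
  have -> : 24 * h ^+ 2 + (N%:R + 1) ^+ 4 * t ^+ 4 + h / 2 * ((N%:R + 1) ^+ 2 * t ^+ 2) + t ^+ 4 * (2 * (N%:R + 2) ^+ 4) =
    (24 * N%:R ^+ 2 + (N%:R + 1) ^+ 4 + N%:R * (N%:R + 1) ^+ 2 / 2 + 2 * (N%:R + 2) ^+ 4) * t ^+ 4 by rewrite /h; field.
  rewrite ler_wpM2r ?(ltW (tp 4%N)) //.
  have [_ q2 _ q1 q3] := quartic_bounds NN.
  have q0 : 0 <= (N%:R + 2) ^+ 4 :> R by rewrite exprn_ge0.
  clear T F F2 T2 R2 rb rho h20 tp T0 T1 NN.
  lra.
have := approx_sum B.
rewrite (_ : \sum_j c j = N%:R * L 0 + N%:R ^+ 2 * t ^+ 2 * ln 2 / 2 - ln 2 * t ^+ 2 * (N%:R * (N%:R + 1) / 2)); last first.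
  by rewrite /c sumrB sumr_const card_ord -mulr_sumr sum_succ -mulr_natl /h; field.
have -> : \sum_j X j = h * \sum_x softlog (energy t (x : 'I_n * 'I_N)).
  rewrite sum_model mulr_sumr; apply: eq_bigr => j _; rewrite /X; congr (_ * _).
  by apply: eq_bigr => i _; rewrite energyE.
set S := \sum_x _ => H.
have hp : 0 < h by case/andP: h01.
rewrite -(ler_pM2l hp) -[X in X * `|_|](gtr0_norm hp) -normrM.
rewrite (_ : h * (100 * _ * _) = N%:R * (100 * (N%:R + 2) ^+ 4 * t ^+ 4)); last by rewrite /h; ring.
apply: le_trans H; rewrite le_eqVlt; apply/orP; left; apply/eqP; congr `|_|.
rewrite /h /kappa0 /G -!natr1; field.
by rewrite !gt_eqF.
Qed.

(** This determines t: with n t^4 = L 0 the expected size is n up to O(t^-2), well within the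
    standard deviation of order t^-3. *)
Lemma fermi_energy_sum :
  `|\sum_x (part x)%:R * fermi (energy t (x : 'I_n * 'I_N)) - L 0 / t ^+ 4| <=
    200 * (N%:R + 2) ^+ 2 / t ^+ 2.
Proof.
have T0 := t0; have T1 := t1; have NN := N1; have tp k : 0 < t ^+ k by rewrite exprn_gt0.
have /andP[hp h1] := h01.
pose x j i := offset t j + h * i%:R.
(* t^2 times a part equals its energy plus t times its sign, so moments of the parts reduce to
   moments of the energies. *)
pose X j := h * \sum_(i < n) (x j i * fermi (x j i)) + t * eps j * (h * \sum_(i < n) fermi (x j i)).
pose G (j : 'I_N) := t * ln 2.
have B j : `|X j - (L 0 + eps j * G j + eps j ^+ 2 * 0)| <= 200 * (N%:R + 2) ^+ 2 * t ^+ 2.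
  set d := offset t j; have d1 := offset_le1 j; rewrite -/d in d1.
  have S := xfermi_sum dL bL h01 (offset_geN1 j) tail; rewrite -/d -/h in S.
  have U := fermi_sum h01 (offset_geN1 j) tail; rewrite -/d -/h in U.
  have T := dilog_taylor1 dL (offset_le1 j); rewrite -/d in T.
  have F := softlog_taylor1 d; have O := off2 j; rewrite -/d in O.
  have /andP[p0 p1] := fermi_bound d; have p2 := fermi_lt1 d.
  have e1 := norm_eps_le1 j.
  have F2 : `|d + t * eps j| * `|softlog d - ln 2| <= 2 * `|d| * (N%:R * t ^+ 2).
    rewrite mulrC; apply: ler_pM => //.
      rewrite (_ : softlog d - ln 2 = (softlog d - ln 2 + d / 2) - d / 2); last by ring.
      apply: le_trans (ler_normB _ _) _; rewrite normrM (_ : `|2^-1| = 2^-1); last by rewrite ger0_norm.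
      have d0 := normr_ge0 d; have : `|d| ^+ 2 <= `|d| by rewrite expr2 ler_piMr.
      by clear T O p0 p1 p2 e1; lra.
    rewrite /d /offset subrK ger0_norm; last by rewrite mulr_ge0 ?sqr_ge0.
    by rewrite mulrC ler_wpM2r ?sqr_ge0 // ler_nat.
  have dd : d + t * eps j = t ^+ 2 * j.+1%:R by rewrite /d /offset subrK.
  have J1 : t ^+ 2 * j.+1%:R * ln 2 <= N%:R * t ^+ 2.
    have /andP[l0 l1] := ln2_bound; have /andP[j0 j1] := J0 j.
    rewrite -mulrA mulrC ler_wpM2r ?(ltW (tp 2%N)) //.
    by apply: le_trans j1; rewrite ler_piMr.
  have J2 : 0 <= t ^+ 2 * j.+1%:R * ln 2.
    by have /andP[l0 l1] := ln2_bound; rewrite mulr_ge0 // mulr_ge0 ?sqr_ge0.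
  have -> : X j - (L 0 + eps j * G j + eps j ^+ 2 * 0) =
     (h * \sum_(i < n) (x j i * fermi (x j i)) - (d * softlog d + L d))
     + t * eps j * (h * \sum_(i < n) fermi (x j i) - softlog d - h / 2 * fermi d)
     + t * eps j * (h / 2 * fermi d)
     + (L d - L 0 + d * ln 2) + (d + t * eps j) * (softlog d - ln 2).
    by rewrite /X /G; field.
  have te : `|t * eps j| <= 1 by rewrite normrM (gtr0_norm T0) mulr_ile1 // ltW.
  have mm (y z : R) : `|y| <= z -> `|t * eps j * y| <= z.
    by move=> yz; rewrite normrM; apply: le_trans yz; rewrite ler_piMl.
  have U2 := mm _ _ U.
  have U3 : `|t * eps j * (h / 2 * fermi d)| <= h.
    have hf0 : 0 <= h * fermi d by rewrite mulr_ge0 // ltW.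
    have hf1 : h * fermi d <= h by rewrite ler_piMr // ltW.
    by apply: mm; clear S U U2 T F O F2 J1 J2 te dd e1 d1 p0 p1 p2; rewrite ger0_norm; lra.
  have F3 : `|(d + t * eps j) * (softlog d - ln 2)| <= 2 * (N%:R * t ^+ 2).
    rewrite normrM; apply: le_trans F2 _; rewrite ler_wpM2r ?mulr_ge0 ?(ltW (tp 2%N)) ?(ltW T0) //.
    by rewrite ler_piMr.
  do 4!(apply: le_trans (ler_normD _ _) _; rewrite -?lerBrDr).
  apply: le_trans S _; rewrite !lerBrDr.
  have hh : h ^+ 2 <= h by rewrite expr2 ler_piMr // ltW.
  have [Nu _ _ Nu2] := square_bounds NN.
  have M1 := ler_wpM2r (ltW (tp 2%N)) Nu; have M2 := ler_wpM2r (ltW (tp 2%N)) Nu2.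
  have hE : h = N%:R * t ^+ 2 by [].
  clear U d1 F F2 dd J1 J2 te mm Nu Nu2 p0 p1 p2 e1 T0 T1 NN h1.
  lra.
have := approx_sum B.
rewrite sumr_const card_ord subrr addr0 mulr0 addr0.
have -> : \sum_j X j = h * t ^+ 2 * \sum_x (part x)%:R * fermi (energy t (x : 'I_n * 'I_N)).
  rewrite sum_model mulr_sumr; apply: eq_bigr => j _; rewrite /X !mulr_sumr -big_split /=.
  apply: eq_bigr => i _; rewrite /x -energyE /energy /=; ring.
set S := \sum_x _ => H.
have hp2 : 0 < h * t ^+ 2 by rewrite mulr_gt0.
rewrite -(ler_pM2l hp2) -[X in X * `|_|](gtr0_norm hp2) -normrM.
rewrite (_ : h * t ^+ 2 * (_ / _) = N%:R * (200 * (N%:R + 2) ^+ 2 * t ^+ 2)); last first.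
  by rewrite /h; field; rewrite gt_eqF.
apply: le_trans H; rewrite le_eqVlt; apply/orP; left; apply/eqP; congr `|_|.
by rewrite /h -mulr_natl; field; rewrite gt_eqF.
Qed.

(** The tilt moves the mean of [pd] to 1 / (N t). The expansion has to go one term further, since
    [kappa0] is visible in the final formula. *)
Lemma eps_fermi_sum :
  `|\sum_x eps x.2 * fermi (energy t (x : 'I_n * 'I_N)) - ((N%:R * t)^-1 + kappa0)| <=
    200 * (N%:R + 2) ^+ 3 * t.
Proof.
have T0 := t0; have T1 := t1; have NN := N1; have tp k : 0 < t ^+ k by rewrite exprn_gt0.
have /andP[hp h1] := h01.
pose X j := eps j * (h * \sum_(i < n) fermi (offset t j + h * i%:R)).
pose G (j : 'I_N) := ln 2 - t ^+ 2 * j.+1%:R / 2 + N%:R * t ^+ 2 / 4 + t ^+ 2 / 8.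
have B j : `|X j - (0 + eps j * G j + eps j ^+ 2 * (t / 2))| <= 200 * (N%:R + 2) ^+ 3 * t ^+ 3.
  set d := offset t j; have d1 := offset_le1 j; rewrite -/d in d1.
  have U := fermi_sum h01 (offset_geN1 j) tail; rewrite -/d -/h in U.
  have F := softlog_taylor2 d; have O := off3 j; rewrite -/d in O.
  have P := fermi_taylor0 d; have Q := offset_le j; rewrite -/d in Q.
  have /andP[j0 j1] := J0 j.
  pose rho := (t * j.+1%:R ^+ 2 - 2 * j.+1%:R * eps j) / 8 : R.
  have -> : X j - (0 + eps j * G j + eps j ^+ 2 * (t / 2)) =
    eps j * ((h * \sum_(i < n) fermi (d + h * i%:R) - softlog d - h / 2 * fermi d)
     + (softlog d - ln 2 + d / 2 - d ^+ 2 / 8) + h / 2 * (fermi d - 1 / 2) + t ^+ 3 * rho).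
    have dE : d = t ^+ 2 * j.+1%:R - t * eps j by [].
    rewrite /X /G /rho -/d; set S := \sum_(i < n) _; set f := softlog d; set p := fermi d.
    by rewrite dE /h; case: (eps_cases j) => ->; field.
  rewrite normrM; apply: le_trans (_ : 1 * _ <= _); first by apply: ler_pM => //; exact: norm_eps_le1.
  rewrite mul1r.
  have U3 : `|h / 2 * (fermi d - 1 / 2)| <= h / 2 * ((N%:R + 1) * t).
    have h20 : 0 <= h / 2 by rewrite divr_ge0 // ltW.
    by rewrite normrM (ger0_norm h20) ler_wpM2l //; exact: le_trans P Q.
  have R2 : `|t ^+ 3 * rho| <= t ^+ 3 * N%:R ^+ 2.
    rewrite normrM (ger0_norm (ltW (tp 3%N))) ler_wpM2l ?(ltW (tp 3%N)) //.
    have := norm_eps_le1 j; rewrite !ler_norml => /andP[e1 e2]; rewrite /rho; apply/andP; split; nra.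
  do 3!(apply: le_trans (ler_normD _ _) _; rewrite -?lerBrDr).
  apply: le_trans U _; rewrite !lerBrDr.
  have h3 : h ^+ 2 <= N%:R ^+ 2 * t ^+ 3.
    rewrite /h exprMn ler_wpM2l ?sqr_ge0 // (_ : t ^+ 2 ^+ 2 = t ^+ 3 * t); last by ring.
    by rewrite ler_piMr // ltW.
  have hE : h / 2 * ((N%:R + 1) * t) = N%:R * (N%:R + 1) / 2 * t ^+ 3 by rewrite /h; field.
  have [q1 q2 q3] := cubic_bounds NN.
  have t3 := ltW (tp 3%N).
  have M1 := ler_wpM2r t3 q1; have M2 := ler_wpM2r t3 q2; have M3 := ler_wpM2r t3 q3.
  have q0 : 0 <= (N%:R + 2) ^+ 3 * t ^+ 3 :> R by rewrite mulr_ge0 // exprn_ge0.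
  rewrite hE in U3; clear P Q hE q1 q2 q3 d1 j0 j1 T0 T1 NN tp hp h1 t3; lra.
have := approx_sum B.
rewrite sumr_const mul0rn add0r.
have -> : \sum_j X j = h * \sum_x eps x.2 * fermi (energy t (x : 'I_n * 'I_N)).
  rewrite sum_model mulr_sumr; apply: eq_bigr => j _; rewrite /X mulrCA; congr (_ * _).
  by rewrite mulr_sumr; apply: eq_bigr => i _; rewrite energyE.
set S := \sum_x _ => H.
rewrite -(ler_pM2l hp) -[X in X * `|_|](gtr0_norm hp) -normrM.
rewrite (_ : h * (200 * _ * _) = N%:R * (200 * (N%:R + 2) ^+ 3 * t ^+ 3)); last by rewrite /h; ring.
apply: le_trans H; rewrite le_eqVlt; apply/orP; left; apply/eqP; congr `|_|.
by rewrite /h /kappa0 /G -!natr1; field; rewrite !gt_eqF.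
Qed.

Lemma fvar_energy2_sum :
  `|\sum_x (part x)%:R ^+ 2 * fvar (energy t (x : 'I_n * 'I_N)) - 2 * L 0 / t ^+ 6| <=
    500 * (N%:R + 2) ^+ 2 / t ^+ 4.
Proof.
have T0 := t0; have T1 := t1; have NN := N1; have tp k : 0 < t ^+ k by rewrite exprn_gt0.
have /andP[hp h1] := h01.
pose x j i := offset t j + h * i%:R.
pose X j := h * \sum_(i < n) (x j i ^+ 2 * fvar (x j i)) + 2 * (t * eps j) * (h * \sum_(i < n) (x j i * fvar (x j i)))
  + (t * eps j) ^+ 2 * (h * \sum_(i < n) fvar (x j i)).
pose G (j : 'I_N) := 2 * t * ln 2.
have B j : `|X j - (2 * L 0 + eps j * G j + eps j ^+ 2 * 0)| <= 500 * (N%:R + 2) ^+ 2 * t ^+ 2.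
  set d := offset t j; have d1 := offset_le1 j; rewrite -/d in d1.
  have S2 := x2fvar_sum dL bL h01 (offset_geN1 j) tail; rewrite -/d -/h in S2.
  have S1 := xfvar_sum h01 (offset_geN1 j) tail; rewrite -/d -/h in S1.
  have S0 := fvar_sum h01 (offset_geN1 j) tail; rewrite -/d -/h in S0.
  have T := dilog_taylor1 dL (offset_le1 j); rewrite -/d in T.
  have F := softlog_taylor1 d; have O := off2 j; rewrite -/d in O.
  have Q := offset_le j; rewrite -/d in Q.
  have /andP[p0 p1] := fermi_bound d; have p2 := fermi_lt1 d.
  have e1 := norm_eps_le1 j.
  have dn := normr_ge0 d.
  have f2 : `|softlog d - ln 2| <= 2 * `|d|.
    rewrite (_ : softlog d - ln 2 = (softlog d - ln 2 + d / 2) - d / 2); last by ring.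
    apply: le_trans (ler_normB _ _) _; rewrite normrM (_ : `|2^-1| = 2^-1); last by rewrite ger0_norm.
    have : `|d| ^+ 2 <= `|d| by rewrite expr2 ler_piMr.
    by clear S2 S1 S0 T O Q p0 p1 p2 e1; lra.
  have A1 : `|d ^+ 2 * fermi d + 2 * ((d * (softlog d - ln 2)) + (L d - L 0 + d * ln 2))| <= 9 * `|d| ^+ 2.
    apply: le_trans (ler_normD _ _) _; rewrite (normrM 2) (ger0_norm (_ : 0 <= 2 :> R)) //.
    have g1 : `|d ^+ 2 * fermi d| <= `|d| ^+ 2.
      by rewrite normrM normrX (gtr0_norm p0) ler_piMr ?exprn_ge0 // ltW.
    have g2 : `|d * (softlog d - ln 2)| <= 2 * `|d| ^+ 2 by rewrite normrM expr2 mulrCA ler_wpM2l.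
    rewrite [leRHS](_ : _ = `|d| ^+ 2 + 2 * (2 * `|d| ^+ 2 + 2 * `|d| ^+ 2)); last by ring.
    by apply: lerD => //; rewrite ler_wpM2l //; apply: le_trans (ler_normD _ _) (lerD g2 T).
  have A2 : `|d * fermi d + (softlog d - ln 2)| <= 3 * `|d|.
    apply: le_trans (ler_normD _ _) _; rewrite normrM (gtr0_norm p0).
    have : `|d| * fermi d <= `|d| by rewrite ler_piMr // ltW.
    lra.
  have te : `|t * eps j| <= t by rewrite normrM (gtr0_norm T0) ler_piMr // ltW.
  have -> : X j - (2 * L 0 + eps j * G j + eps j ^+ 2 * 0) =
    (h * \sum_(i < n) (x j i ^+ 2 * fvar (x j i)) - (d ^+ 2 * fermi d + 2 * (d * softlog d + L d)))
    + (d ^+ 2 * fermi d + 2 * ((d * (softlog d - ln 2)) + (L d - L 0 + d * ln 2)))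
    + 2 * (t * eps j) * (h * \sum_(i < n) (x j i * fvar (x j i)) - (d * fermi d + softlog d))
    + 2 * (t * eps j) * (d * fermi d + (softlog d - ln 2))
    + (t * eps j) ^+ 2 * (h * \sum_(i < n) fvar (x j i) - fermi d) + (t * eps j) ^+ 2 * fermi d.
    by rewrite /X /G; ring.
  have ten := normr_ge0 (t * eps j).
  have mm (y z : R) : `|y| <= z -> `|2 * (t * eps j) * y| <= 2 * t * z.
    move=> yz; rewrite -mulrA normrM (ger0_norm (_ : 0 <= 2 :> R)) // -[leRHS]mulrA ler_wpM2l //.
    by rewrite normrM; apply: ler_pM.
  have mm2 (y z : R) : `|y| <= z -> `|(t * eps j) ^+ 2 * y| <= t ^+ 2 * z.
    by move=> yz; rewrite normrM normrX; apply: ler_pM => //; rewrite ?exprn_ge0 // lerXn2r ?nnegrE // ltW.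
  have B1 := mm _ _ S1; have B2 := mm _ _ A2; have B3 := mm2 _ _ S0.
  have B4 : `|(t * eps j) ^+ 2 * fermi d| <= t ^+ 2 * 1 by apply: mm2; rewrite gtr0_norm // ltW.
  do 5!(apply: le_trans (ler_normD _ _) _; rewrite -?lerBrDr).
  apply: le_trans S2 _; rewrite !lerBrDr.
  have c1 : t * h <= h by rewrite ler_piMl // ltW.
  have c2 : t * `|d| <= t * ((N%:R + 1) * t) by rewrite ler_pM2l.
  have t2 := ltW (tp 2%N); have c3 : t ^+ 2 * h <= h by rewrite ler_piMl ?exprn_ile1 // ltW.
  have [_ Nu Nu3 Nu2] := square_bounds NN.
  have M1 := ler_wpM2r t2 Nu; have M2 := ler_wpM2r t2 Nu2; have M3 := ler_wpM2r t2 Nu3.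
  have hE : h = N%:R * t ^+ 2 by [].
  clear S1 S0 T F Q d1 p0 p1 p2 e1 dn f2 A2 te ten mm mm2 t2 Nu Nu2 Nu3 T0 T1 NN tp hp h1.
  lra.
have := approx_sum B.
rewrite sumr_const card_ord subrr addr0 mulr0 addr0.
have -> : \sum_j X j = h * t ^+ 4 * \sum_x (part x)%:R ^+ 2 * fvar (energy t (x : 'I_n * 'I_N)).
  rewrite sum_model mulr_sumr; apply: eq_bigr => j _; rewrite /X !mulr_sumr -!big_split /=.
  apply: eq_bigr => i _; rewrite /x -energyE /energy /=; ring.
set S := \sum_x _ => H.
have hp2 : 0 < h * t ^+ 4 by rewrite mulr_gt0.
rewrite -(ler_pM2l hp2) -[X in X * `|_|](gtr0_norm hp2) -normrM.
rewrite (_ : h * t ^+ 4 * (_ / _) = N%:R * (500 * (N%:R + 2) ^+ 2 * t ^+ 2)); last first.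
  by rewrite /h; field; rewrite gt_eqF.
apply: le_trans H; rewrite le_eqVlt; apply/orP; left; apply/eqP; congr `|_|.
by rewrite /h -mulr_natl; field; rewrite gt_eqF.
Qed.

Lemma fvar_eps2_sum :
  `|\sum_x eps x.2 ^+ 2 * fvar (energy t (x : 'I_n * 'I_N)) - (N%:R * t ^+ 2)^-1| <=
    100 * (N%:R + 2) ^+ 2.
Proof.
have T0 := t0; have T1 := t1; have NN := N1; have tp k : 0 < t ^+ k by rewrite exprn_gt0.
have /andP[hp h1] := h01.
pose X j := eps j ^+ 2 * (h * \sum_(i < n) fvar (offset t j + h * i%:R)).
pose G (j : 'I_N) := t / 4.
have B j : `|X j - (0 + eps j * G j + eps j ^+ 2 * (1 / 2))| <= 100 * (N%:R + 2) ^+ 2 * t ^+ 2.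
  set d := offset t j.
  have S0 := fvar_sum h01 (offset_geN1 j) tail; rewrite -/d -/h in S0.
  have P := fermi_taylor1 d; have O := off2 j; rewrite -/d in O.
  have /andP[j0 j1] := J0 j.
  have -> : X j - (0 + eps j * G j + eps j ^+ 2 * (1 / 2)) =
    eps j ^+ 2 * ((h * \sum_(i < n) fvar (d + h * i%:R) - fermi d) + (fermi d - 1 / 2 + d / 4)
     - t ^+ 2 * (j.+1%:R / 4)).
    rewrite /X /G -/d; have e3 := eps3 j.
    have -> : eps j * (t / 4) = eps j ^+ 3 * (t / 4) by rewrite e3.
    by rewrite /d /offset; field.
  rewrite normrM; apply: le_trans (_ : 1 * _ <= _).
    by apply: ler_pM => //; rewrite normrX exprn_ile1 // norm_eps_le1.
  rewrite mul1r.
  have J4 : `|t ^+ 2 * (j.+1%:R / 4)| <= t ^+ 2 * N%:R.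
    by rewrite ger0_norm ?ler_wpM2l ?(ltW (tp 2%N)) ?mulr_ge0 ?(ltW (tp 2%N)) //; lra.
  apply: le_trans (ler_normB _ _) _; rewrite -lerBrDr; apply: le_trans (ler_normD _ _) _; rewrite lerBrDr.
  have t2 := ltW (tp 2%N).
  have [Nu _ _ Nu2] := square_bounds NN.
  have M1 := ler_wpM2r t2 Nu; have M2 := ler_wpM2r t2 Nu2.
  have hE : h = N%:R * t ^+ 2 by [].
  lra.
have := approx_sum B.
rewrite sumr_const mul0rn add0r subrr add0r.
have -> : \sum_j X j = h * \sum_x eps x.2 ^+ 2 * fvar (energy t (x : 'I_n * 'I_N)).
  rewrite sum_model mulr_sumr; apply: eq_bigr => j _; rewrite /X mulrCA; congr (_ * _).
  by rewrite mulr_sumr; apply: eq_bigr => i _; rewrite energyE.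
set S := \sum_x _ => H.
rewrite -(ler_pM2l hp) -[X in X * `|_|](gtr0_norm hp) -normrM.
rewrite (_ : h * (100 * _) = N%:R * (100 * (N%:R + 2) ^+ 2 * t ^+ 2)); last by rewrite /h; ring.
apply: le_trans H; rewrite le_eqVlt; apply/orP; left; apply/eqP; congr `|_|.
by rewrite /h; field; rewrite !gt_eqF.
Qed.

End Fixed.
End Model.

(** * The major arc *)

Section Compare.
Variable R : realType.
Implicit Types (x y z X Y M K t : R).

Lemma add1_expR_le K M : 1 <= K -> 0 <= M -> 1 + M <= K * expR (M / K).
Proof.
move=> K1 M0; have K0 : 0 < K by lra.
have := ler_wpM2l (ltW K0) (expR_ge1Dx (M / K)); rewrite mulrDr mulr1 mulrCA divff ?gt_eqF // mulr1.
by lra.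
Qed.

Lemma poly_expR_absorb (c : R) (k : nat) : 0 < c -> exists2 D, 0 < D &
  forall M, 0 <= M -> (1 + M) ^+ k * expR (- (c * M)) <= D * expR (- (c / 2 * M)).
Proof.
(* (1 + M)^k is at most K^k exp (k M / K), and this [K] makes k / K <= c / 2. *)
move=> c0; pose K := 2 * k%:R / c + 1.
have K1 : 1 <= K by rewrite /K lerDr divr_ge0 ?mulr_ge0 // ltW.
have K0 : 0 < K by lra.
exists (K ^+ k); first by rewrite exprn_gt0.
move=> M M0; have h := add1_expR_le K1 M0.
apply: (@le_trans _ _ ((K * expR (M / K)) ^+ k * expR (- (c * M)))).
  by rewrite ler_wpM2r ?expR_ge0 // lerXn2r ?nnegrE //; [lra|rewrite mulr_ge0 ?expR_ge0 // ltW].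
rewrite exprMn -[leLHS]mulrA; apply: ler_wpM2l; first by rewrite exprn_ge0 ?(ltW K0).
rewrite -expRM_natl -expRD ler_expR.
have : k%:R * (M / K) <= c / 2 * M.
  rewrite mulrA mulrAC ler_wpM2r // ler_pdivrMr // /K.
  have -> : c / 2 * (2 * k%:R / c + 1) = k%:R + c / 2 by field; rewrite gt_eqF.
  lra.
lra.
Qed.

Lemma norm_cos_dist x y : `|cos x - cos y| <= `|x - y|.
Proof.
rewrite -[leRHS]mul1r; apply: (@norm_derive_le R cos (fun z => - sin z)) => z _.
by rewrite normrN norm_sin_le1.
Qed.

Lemma norm_expRN_dist x y c : c <= x -> c <= y -> `|expR (- x) - expR (- y)| <= `|x - y| * expR (- c).
Proof.
move=> cx cy; rewrite mulrC; apply: (@norm_derive_le R (fun z => expR (- z)) (fun z => - expR (- z))).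
  by move=> z _; dv; ring.
move=> z zz; rewrite normrN ger0_norm ?expR_ge0 // ler_expR lerN2.
by move: zz; case: (leP y x) => _ /andP[h1 h2]; lra.
Qed.

Lemma cosh_bound x : 0 <= (expR x + expR (- x)) / 2 - 1 <= x ^+ 2 * expR `|x|.
Proof.
wlog x0 : x / 0 <= x.
  move=> H; have [/H //|x0] := leP 0 x.
  have := H (- x); rewrite opprK normrN sqrrN [expR (- x) + _]addrC; apply; lra.
rewrite (ger0_norm x0); have e0 := expR_gt0 x; have e1 := expR_ge1Dx (- x).
have e2 : expR x * expR (- x) = 1 by rewrite -expRD subrr expR0.
have -> : (expR x + expR (- x)) / 2 - 1 = (expR x - 1) ^+ 2 * expR (- x) / 2.
  rewrite (_ : (expR x - 1) ^+ 2 * expR (- x) = expR x * (expR x * expR (- x)) - 2 * (expR x * expR (- x)) + expR (- x)); last by ring.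
  by rewrite e2; field.
have f0 := expR_gt0 (- x).
apply/andP; split; first by rewrite divr_ge0 // mulr_ge0 ?(ltW f0) // sqr_ge0.
have d1 : expR x - 1 <= x * expR x by nra.
have d0 : 0 <= expR x - 1 by have := expR_ge1Dx x; lra.
have : (expR x - 1) ^+ 2 <= (x * expR x) ^+ 2 by rewrite !expr2; apply: ler_pM.
move=> h; have := ler_wpM2r (ltW f0) h.
rewrite (_ : (x * expR x) ^+ 2 * expR (- x) = x ^+ 2 * expR x * (expR x * expR (- x))); last by ring.
rewrite e2 mulr1; have : 0 <= x ^+ 2 * expR x by rewrite mulr_ge0 ?sqr_ge0 // ltW.
lra.
Qed.

Lemma sinh_bound x : `|(expR x - expR (- x)) / 2| <= `|x| * expR `|x|.
Proof.
wlog x0 : x / 0 <= x.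
  move=> H; have [/H //|x0] := leP 0 x.
  by have := H (- x); rewrite opprK normrN -opprB mulNr normrN; apply; lra.
have e0 := expR_gt0 x; have e1 := expR_ge1Dx (- x); have f0 := expR_gt0 (- x).
have e2 : expR x * expR (- x) = 1 by rewrite -expRD subrr expR0.
have m : expR (- x) <= expR x by rewrite ler_expR; lra.
rewrite (ger0_norm x0) ger0_norm; last by rewrite divr_ge0 //; lra.
have e3 : 1 <= expR x by have := expR_ge1Dx x; lra.
have : expR x - expR (- x) <= 2 * x * expR x.
  have -> : expR x - expR (- x) = (1 - expR (- x) * expR (- x)) * expR x.
    rewrite mulrBl mul1r -mulrA [_ * expR x]mulrC e2 mulr1 //.
  rewrite ler_wpM2r ?(ltW e0) //.
  have := ler_pM (ltW f0) (ltW f0) (lexx _) (lexx (expR (- x))); nra.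
lra.
Qed.

Lemma gauss_combine (q q0 u we wo z W m : R) : 0 <= W ->
  2 * m <= q -> 2 * m <= q0 -> 0 <= m -> `|u| <= m ->
  u ^+ 2 <= W -> wo ^+ 2 <= 6 * W -> `|we - z| <= W -> `|q - q0| <= W ->
  `|(expR (- (q + u)) * cos (we + wo) + expR (- (q - u)) * cos (we - wo)) / 2
     - expR (- q0) * cos z| <= 20 * W * expR (- m).
Proof.
move=> W0 qm q0m m0 um u2 wo2 wez qq.
pose ch := (expR u + expR (- u)) / 2; pose sh := (expR u - expR (- u)) / 2.
have /andP[ch0 ch1] := cosh_bound u; rewrite -/ch in ch0 ch1.
have sh1 := sinh_bound u; rewrite -/sh in sh1.
have qe : expR (- (q + u)) = expR (- q) * (ch - sh).
  by rewrite opprD expRD /ch /sh; field.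
have qe2 : expR (- (q - u)) = expR (- q) * (ch + sh).
  by rewrite opprB addrC expRD /ch /sh; field.
rewrite qe qe2 (cosD we wo) (cosB we wo) {qe qe2}.
have E0 : 0 < expR (- q) by rewrite expR_gt0.
have EM : expR (- q) * expR `|u| <= expR (- m) by rewrite -expRD ler_expR; lra.
have EM1 : expR (- q) <= expR (- m) by rewrite ler_expR; lra.
have b3 : `|expR (- q) - expR (- q0)| <= W * expR (- m).
  have mq : m <= q by apply: le_trans qm; rewrite ler_peMl // ler1n.
  have mq0 : m <= q0 by apply: le_trans q0m; rewrite ler_peMl // ler1n.
  by apply: le_trans (norm_expRN_dist mq mq0) _; rewrite ler_wpM2r ?expR_ge0.
set E := expR (- q) in E0 EM EM1 b3 *; set Q := expR (- q0) in b3 *; set F := expR (- m) in EM EM1 b3 *.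
have eu1 : 1 <= expR `|u| by rewrite -expR0 ler_expR.
set G := expR `|u| in EM eu1 ch1 sh1.
have -> : (E * (ch - sh) * (cos we * cos wo - sin we * sin wo) +
   E * (ch + sh) * (cos we * cos wo + sin we * sin wo)) / 2 - Q * cos z =
   E * (cos we * ((ch - 1) * cos wo + (cos wo - 1)) + sh * (sin we * sin wo))
   + E * (cos we - cos z) + (E - Q) * cos z by field.
have d1 : `|cos we * ((ch - 1) * cos wo + (cos wo - 1))| <= (ch - 1) + wo ^+ 2.
  rewrite normrM; apply: (@le_trans _ _ (1 * `|(ch - 1) * cos wo + (cos wo - 1)|)).
    by rewrite ler_wpM2r // norm_cos_le1.
  rewrite mul1r; apply: le_trans (ler_normD _ _) _; apply: lerD; last exact: norm_cosB1_le.
  by rewrite normrM (ger0_norm ch0) ler_piMr // norm_cos_le1.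
have d2 : `|sh * (sin we * sin wo)| <= (u ^+ 2 + wo ^+ 2) / 2 * G.
  rewrite normrM; apply: (@le_trans _ _ (`|u| * G * `|wo|)).
    apply: ler_pM => //; rewrite normrM; apply: (@le_trans _ _ (1 * `|wo|)); last by rewrite mul1r.
    by apply: ler_pM; rewrite ?norm_sin_le1 ?norm_sin_le.
  rewrite mulrAC ler_wpM2r ?expR_ge0 //.
  rewrite -(real_normK (num_real u)) -(real_normK (num_real wo)).
  by have := sqr_ge0 (`|u| - `|wo|); rewrite sqrrB -mulr_natr; lra.
have b1 : `|cos we * ((ch - 1) * cos wo + (cos wo - 1)) + sh * (sin we * sin wo)| <= 15 * W * G.
  have d3 : wo ^+ 2 <= wo ^+ 2 * G by rewrite ler_peMr ?sqr_ge0.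
  have G0 : 0 <= G by rewrite expR_ge0.
  have d4 := ler_wpM2r G0 u2; have d5 := ler_wpM2r G0 wo2.
  clear W0 qm q0m m0 um u2 wo2 wez qq E0 EM EM1 b3 eu1 G0.
  apply: le_trans (ler_normD _ _) _; lra.
have c1' : `|E * (cos we * ((ch - 1) * cos wo + (cos wo - 1)) + sh * (sin we * sin wo))| <= 15 * W * F.
  rewrite normrM (gtr0_norm E0); apply: le_trans (ler_wpM2l (ltW E0) b1) _.
  rewrite (_ : E * (15 * W * G) = 15 * W * (E * G)); last by ring.
  by apply: ler_wpM2l => //; rewrite mulr_ge0.
have c2' : `|E * (cos we - cos z)| <= W * F.
  rewrite normrM (gtr0_norm E0) mulrC; apply: ler_pM => //; first exact: ltW.
  exact: le_trans (norm_cos_dist _ _) wez.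
have c3' : `|(E - Q) * cos z| <= W * F.
  by rewrite normrM; apply: le_trans b3; rewrite ler_piMr // norm_cos_le1.
have WF : 0 <= W * F by rewrite mulr_ge0 ?expR_ge0.
move: c1' c2' c3'; set a1 := E * _; set a2 := E * _; set a3 := _ * cos z => c1' c2' c3'.
rewrite [leRHS](_ : _ = 15 * W * F + W * F + W * F + 3 * (W * F)); last by ring.
apply: ler_wpDr; first by rewrite mulr_ge0.
apply: le_trans (ler_normD _ _) (lerD _ c3').
exact: le_trans (ler_normD _ _) (lerD c1' c2').
Qed.

Section Bounds.
Variables (C t : R).
Hypothesis C0 : 0 <= C.
Variables X Y : R.
Let M := X ^+ 2 + Y ^+ 2.
Let X2 : 0 <= X ^+ 2. Proof. exact: sqr_ge0. Qed.
Let Y2 : 0 <= Y ^+ 2. Proof. exact: sqr_ge0. Qed.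
Let M0 : 0 <= M. Proof. exact: addr_ge0. Qed.
Let t20 : 0 <= t ^+ 2. Proof. exact: sqr_ge0. Qed.
Let C1 : C <= (C + 1) ^+ 2. Proof. have := C0; nra. Qed.
Let C2 : C ^+ 2 <= (C + 1) ^+ 2. Proof. have := C0; nra. Qed.
Let cube : (1 + M) ^+ 3 = 1 + 3 * M + 3 * M ^+ 2 + M ^+ 3. Proof. ring. Qed.
Let M2 : 0 <= M ^+ 2. Proof. exact: sqr_ge0. Qed.
Let M3 : 0 <= M ^+ 3. Proof. exact: exprn_ge0. Qed.
Let norm_prod_le : `|X * Y| <= M / 2.
Proof.
rewrite ler_norml /M; have := sqr_ge0 (X - Y); have := sqr_ge0 (X + Y).
by rewrite sqrrD sqrrB -mulr_natr => *; apply/andP; split; lra.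
Qed.

Lemma quad_form_bound (a b al be : R) : `|a - al| <= C * t ^+ 2 -> `|b - be| <= C * t ^+ 2 ->
  `|(a * X ^+ 2 + b * Y ^+ 2) / 2 - (al * X ^+ 2 + be * Y ^+ 2) / 2| <= C * t ^+ 2 * M.
Proof.
move=> ha hb.
have -> : (a * X ^+ 2 + b * Y ^+ 2) / 2 - (al * X ^+ 2 + be * Y ^+ 2) / 2 =
  ((a - al) * X ^+ 2 + (b - be) * Y ^+ 2) / 2 by field.
rewrite normrM (_ : `|2^-1| = 2^-1); last by rewrite ger0_norm.
have := ler_normD ((a - al) * X ^+ 2) ((b - be) * Y ^+ 2).
rewrite [ `|(a - al) * _|]normrM [ `|(b - be) * _|]normrM (ger0_norm X2) (ger0_norm Y2).
have h1 := ler_wpM2r X2 ha; have h2 := ler_wpM2r Y2 hb; rewrite /M mulrDr.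
have h3 : 0 <= C * t ^+ 2 * X ^+ 2 by apply: mulr_ge0 => //; exact: mulr_ge0.
have h4 : 0 <= C * t ^+ 2 * Y ^+ 2 by apply: mulr_ge0 => //; exact: mulr_ge0.
lra.
Qed.

(** A common majorant for all second-order errors; the exponent 3 covers the square of a cubic
    phase. *)
Let W := (C + 1) ^+ 2 * t ^+ 2 * (1 + M) ^+ 3.

Lemma quad_form_bound_W : C * t ^+ 2 * M <= W.
Proof.
apply: ler_pM => //; [exact: mulr_ge0|exact: ler_wpM2r|].
by rewrite cube; have := M0; have := M2; have := M3; lra.
Qed.

Lemma cross_bound c1 : `|c1| <= C * t -> `|c1 * (X * Y)| <= C * t * (M / 2) /\ (c1 * (X * Y)) ^+ 2 <= W.
Proof.
move=> h; have H : `|c1 * (X * Y)| <= C * t * (M / 2) by rewrite normrM; apply: ler_pM.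
split=> //; apply: (@le_trans _ _ ((C * t * (M / 2)) ^+ 2)).
  rewrite -(real_normK (num_real (c1 * _))) !expr2; apply: ler_pM => //.
have -> : (C * t * (M / 2)) ^+ 2 = C ^+ 2 * t ^+ 2 * (M ^+ 2 / 4) by field.
apply: ler_pM.
- by apply: mulr_ge0; exact: sqr_ge0.
- by apply: divr_ge0 => //; exact: sqr_ge0.
- exact: ler_wpM2r.
- by rewrite cube; have := M0; have := M2; have := M3; lra.
Qed.

Lemma odd_phase_bound d k30 k12 : `|d| <= C * t -> `|k30| <= C * t -> `|k12| <= C * t ->
  (d * X - (k30 * X ^+ 3 + 3 * k12 * (X * Y ^+ 2)) / 6) ^+ 2 <= 6 * W.
Proof.
move=> hd h30 h12.
have X6 : X ^+ 2 ^+ 3 <= M ^+ 3 by rewrite lerXn2r ?nnegrE // /M lerDl.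
have XY4 : X ^+ 2 * (Y ^+ 2) ^+ 2 <= M ^+ 3.
  rewrite [M ^+ 3]exprS; apply: ler_pM => //; first exact: sqr_ge0.
    by rewrite /M lerDl.
  by rewrite lerXn2r ?nnegrE // /M lerDr.
have sq k : `|k| <= C * t -> k ^+ 2 <= C ^+ 2 * t ^+ 2.
  by move=> hk; rewrite -exprMn -(real_normK (num_real k)) !expr2; apply: ler_pM.
have s1 := sq _ hd; have s2 := sq _ h30; have s3 := sq _ h12.
apply: (@le_trans _ _ (3 * ((d * X) ^+ 2 + (k30 * X ^+ 3) ^+ 2 + (k12 * (X * Y ^+ 2)) ^+ 2))).
  set A1 := d * X; set A2 := k30 * _.
  have -> : 3 * k12 * (X * Y ^+ 2) = 3 * (k12 * (X * Y ^+ 2)) by ring.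
  set A3 := k12 * _; rewrite -subr_ge0.
  rewrite (_ : _ - _ = A1 ^+ 2 + (A1 + (A2 + 3 * A3) / 6) ^+ 2 + A2 ^+ 2 * (26 / 9) + A3 ^+ 2 * 2
    + (A2 - 3 * A3) ^+ 2 / 18); last by field.
  have := sqr_ge0 A1; have := sqr_ge0 A2; have := sqr_ge0 A3.
  have := sqr_ge0 (A1 + (A2 + 3 * A3) / 6); have := sqr_ge0 (A2 - 3 * A3); lra.
rewrite (_ : 6 * W = 3 * ((C + 1) ^+ 2 * t ^+ 2 * (2 * (1 + M) ^+ 3))); last by rewrite /W; ring.
rewrite ler_wpM2l //.
have -> : (d * X) ^+ 2 + (k30 * X ^+ 3) ^+ 2 + (k12 * (X * Y ^+ 2)) ^+ 2 =
   d ^+ 2 * X ^+ 2 + k30 ^+ 2 * X ^+ 2 ^+ 3 + k12 ^+ 2 * (X ^+ 2 * (Y ^+ 2) ^+ 2) by ring.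
have XM : X ^+ 2 <= M by rewrite /M lerDl.
have m1 := ler_pM (sqr_ge0 d) X2 s1 XM.
have m2 := ler_pM (sqr_ge0 k30) (exprn_ge0 3 X2) s2 X6.
have m3 := ler_pM (sqr_ge0 k12) (mulr_ge0 X2 (sqr_ge0 (Y ^+ 2))) s3 XY4.
apply: (@le_trans _ _ (C ^+ 2 * t ^+ 2 * (M + M ^+ 3 + M ^+ 3))); first lra.
apply: ler_pM.
- by apply: mulr_ge0; exact: sqr_ge0.
- by have := M0; have := M3; lra.
- exact: ler_wpM2r.
- by rewrite cube; have := M0; have := M2; lra.
Qed.

Lemma even_phase_bound e k21 k03 :
  `|e| <= C * t ^+ 2 -> `|k21| <= C * t ^+ 2 -> `|k03| <= C * t ^+ 2 ->
  `|e * Y - (3 * k21 * (X ^+ 2 * Y) + k03 * Y ^+ 3) / 6| <= W.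
Proof.
move=> he h21 h03.
have Y0 := normr_ge0 Y.
have Y1 : `|Y| <= 1 + M.
  have : Y ^+ 2 <= M by rewrite /M lerDr.
  by rewrite -(real_normK (num_real Y)); have := sqr_ge0 (`|Y| - 1); rewrite sqrrB1 -mulr_natr; lra.
have a1 : `|e * Y| <= C * t ^+ 2 * `|Y| by rewrite normrM ler_wpM2r.
have a2 : `|k21 * (X ^+ 2 * Y)| <= C * t ^+ 2 * (X ^+ 2 * `|Y|).
  by rewrite normrM [ `|X ^+ 2 * Y|]normrM (ger0_norm X2); apply: ler_wpM2r => //; exact: mulr_ge0.
have a3 : `|k03 * Y ^+ 3| <= C * t ^+ 2 * (Y ^+ 2 * `|Y|).
  rewrite normrM normrX exprSr (real_normK (num_real Y)).
  by apply: ler_wpM2r => //; exact: mulr_ge0.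
have Ct : 0 <= C * t ^+ 2 by exact: mulr_ge0.
apply: (@le_trans _ _ (C * t ^+ 2 * (`|Y| + M * `|Y|))).
  have b1 : 0 <= C * t ^+ 2 * (X ^+ 2 * `|Y|) by apply: mulr_ge0 => //; exact: mulr_ge0.
  have b2 : 0 <= C * t ^+ 2 * (Y ^+ 2 * `|Y|) by apply: mulr_ge0 => //; exact: mulr_ge0.
  have -> : C * t ^+ 2 * (`|Y| + M * `|Y|) = C * t ^+ 2 * `|Y| + C * t ^+ 2 * (X ^+ 2 * `|Y|) + C * t ^+ 2 * (Y ^+ 2 * `|Y|).
    by rewrite /M; ring.
  have -> : 3 * k21 * (X ^+ 2 * Y) = 3 * (k21 * (X ^+ 2 * Y)) by ring.
  move: a1 a2 a3; rewrite !ler_norml => /andP[? ?] /andP[? ?] /andP[? ?].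
  by apply/andP; split; lra.
apply: ler_pM => //.
- by apply: addr_ge0 => //; exact: mulr_ge0.
- exact: ler_wpM2r.
have h : (1 + M) * `|Y| <= (1 + M) * (1 + M) by apply: ler_wpM2l => //; have := M0; lra.
have e1 : (1 + M) * `|Y| = `|Y| + M * `|Y| by ring.
have e2 : (1 + M) * (1 + M) = 1 + 2 * M + M ^+ 2 by ring.
by rewrite cube; have := M3; have := M2; have := M0; lra.
Qed.

End Bounds.

(* Averaging over the sign of [X] removes the terms of first order in t, all of
   which are odd in [X]. *)
Lemma symmetrised_gauss (al be C : R) : 0 < al -> 0 < be -> 0 <= C ->
  exists D c t0 : R, [/\ 0 < D, 0 < c & 0 < t0] /\
  forall t, 0 < t <= t0 ->
  forall a b c1 d e k30 k21 k12 k03,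
   `|a - al| <= C * t ^+ 2 -> `|b - be| <= C * t ^+ 2 -> `|c1| <= C * t ->
   `|d| <= C * t -> `|e| <= C * t ^+ 2 -> `|k30| <= C * t -> `|k21| <= C * t ^+ 2 ->
   `|k12| <= C * t -> `|k03| <= C * t ^+ 2 ->
  forall X Y z,
  `|(expR (- ((a * X ^+ 2 + 2 * c1 * (X * Y) + b * Y ^+ 2) / 2)) *
       cos (z + e * Y + d * X - (k30 * X ^+ 3 + 3 * k21 * (X ^+ 2 * Y) + 3 * k12 * (X * Y ^+ 2) + k03 * Y ^+ 3) / 6)
    + expR (- ((a * X ^+ 2 - 2 * c1 * (X * Y) + b * Y ^+ 2) / 2)) *
       cos (z + e * Y - d * X - (- (k30 * X ^+ 3) + 3 * k21 * (X ^+ 2 * Y) - 3 * k12 * (X * Y ^+ 2) + k03 * Y ^+ 3) / 6)) / 2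
    - expR (- ((al * X ^+ 2 + be * Y ^+ 2) / 2)) * cos z|
   <= D * t ^+ 2 * expR (- (c * (X ^+ 2 + Y ^+ 2))).
Proof.
(* With this [c2] the limiting form is at least 2 c2 M and the perturbed one at least c2 M. The
   cross term is at most half of that, which leaves the decay exp (- c2 M / 2), and absorbing (1 +
   M)^3 halves the exponent once more. *)
move=> al0 be0 C0; pose c2 := Num.min al be / 4.
have c20 : 0 < c2 by rewrite /c2 divr_gt0 // lt_min al0 be0.
have cal : 4 * c2 <= al by rewrite /c2 mulrC divfK // ge_min lexx.
have cbe : 4 * c2 <= be by rewrite /c2 mulrC divfK // ge_min lexx orbT.
have c22 : 0 < c2 / 2 by rewrite divr_gt0.
have [D D0 HD] := poly_expR_absorb 3 c22.
have C1 : 0 < C + 1 by lra.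
exists ((20 * (C + 1) ^+ 2) * D), (c2 / 2 / 2), (Num.min 1 (c2 / (C + 1))).
split.
  split; last by rewrite lt_min ltr01 divr_gt0.
    by rewrite mulr_gt0 // mulr_gt0 // exprn_gt0.
  by rewrite divr_gt0.
move=> t /andP[t0]; rewrite le_min => /andP[t1]; rewrite ler_pdivlMr // => tC.
move=> a b c1 d e k30 k21 k12 k03 ha hb hc1 hd he h30 h21 h12 h03 X Y z.
have tt : t ^+ 2 <= t by rewrite expr2 ler_piMl // ltW.
have Ct : C * t <= c2 by lra.
have Ct2 : C * t ^+ 2 <= c2 by apply: le_trans Ct; rewrite ler_wpM2l.
have X2 := sqr_ge0 X; have Y2 := sqr_ge0 Y.
have qq := quad_form_bound C0 X Y ha hb.
have qW := quad_form_bound_W t C0 X Y.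
have [uM u2] := cross_bound C0 X Y hc1.
have wo2 := odd_phase_bound C0 X Y hd h30 h12.
have we1 := even_phase_bound C0 X Y he h21 h03.
set M := X ^+ 2 + Y ^+ 2 in qq qW uM u2 wo2 we1 *.
have M0 : 0 <= M by apply: addr_ge0.
set W := _ * (1 + M) ^+ 3 in qW u2 wo2 we1.
set q := (a * X ^+ 2 + b * Y ^+ 2) / 2 in qq *; set q0 := (al * X ^+ 2 + be * Y ^+ 2) / 2 in qq *.
set u := c1 * (X * Y) in uM u2 *.
set w := e * Y - _ in we1; set wo := d * X - _ in wo2.
have -> : (a * X ^+ 2 + 2 * c1 * (X * Y) + b * Y ^+ 2) / 2 = q + u by rewrite /q /u; field.
have -> : (a * X ^+ 2 - 2 * c1 * (X * Y) + b * Y ^+ 2) / 2 = q - u by rewrite /q /u; field.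
have -> : z + e * Y + d * X - (k30 * X ^+ 3 + 3 * k21 * (X ^+ 2 * Y) + 3 * k12 * (X * Y ^+ 2) + k03 * Y ^+ 3) / 6 = (z + w) + wo.
  by rewrite /w /wo; field.
have -> : z + e * Y - d * X - (- (k30 * X ^+ 3) + 3 * k21 * (X ^+ 2 * Y) - 3 * k12 * (X * Y ^+ 2) + k03 * Y ^+ 3) / 6 = (z + w) - wo.
  by rewrite /w /wo; field.
have q0M : 2 * (c2 * M) <= q0.
  have h1 := ler_wpM2r X2 cal; have h2 := ler_wpM2r Y2 cbe.
  clear qq qW uM u2 wo2 we1 ha hb hc1 hd he h30 h21 h12 h03 tt Ct Ct2 tC t0 t1 C0 C1 al0 be0 c20 c22 D0 HD M0.
  by rewrite /q0 /M mulrDr; lra.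
have qcM : C * t ^+ 2 * M <= c2 * M by rewrite ler_wpM2r.
have qM : c2 * M <= q.
  move: qq; rewrite ler_norml => /andP[qq _].
  clear ha hb hc1 hd he h30 h21 h12 h03 uM u2 wo2 we1 X2 Y2 cal cbe al0 be0 t0 t1 tC tt Ct Ct2 qW; lra.
have uM2 : `|u| <= c2 / 2 * M.
  by apply: le_trans uM _; rewrite (_ : c2 / 2 * M = c2 * (M / 2)); [apply: ler_wpM2r Ct; exact: divr_ge0|field].
have W0 : 0 <= W by apply: le_trans qW; rewrite !mulr_ge0 // ltW.
have m0 : 0 <= c2 / 2 * M by rewrite mulr_ge0 // ltW.
have e2 : 2 * (c2 / 2 * M) = c2 * M by field.
have H1 : 2 * (c2 / 2 * M) <= q by rewrite e2.
have H2 : 2 * (c2 / 2 * M) <= q0.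
  by rewrite e2; apply: le_trans q0M; rewrite ler_peMl ?ler1n // mulr_ge0 // ltW.
have H3 : `|z + w - z| <= W by rewrite addrAC subrr add0r.
have H := gauss_combine W0 H1 H2 m0 uM2 u2 wo2 H3 (le_trans qq qW).
apply: le_trans H _.
rewrite (_ : 20 * (C + 1) ^+ 2 * D * t ^+ 2 * _ = 20 * (C + 1) ^+ 2 * t ^+ 2 * (D * expR (- (c2 / 2 / 2 * M)))); last by ring.
rewrite (_ : 20 * W * _ = 20 * (C + 1) ^+ 2 * t ^+ 2 * ((1 + M) ^+ 3 * expR (- (c2 / 2 * M)))); last by rewrite /W; ring.
apply: ler_wpM2l; last exact: HD.
by apply: mulr_ge0; [apply: mulr_ge0 => //|]; exact: sqr_ge0.
Qed.

End Compare.

Lemma ler_div1156 (R : realFieldType) (x y : R) : x <= y -> x / 1156 <= y / 1156.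
Proof. lra. Qed.

Lemma moment_numerics (R : realFieldType) (s4 s6 s0 A B A' B' : R) :
  s4 <= 16 * 4096 * A -> s6 <= 16 * (1728 * 1728) * A' -> s0 <= 128 * B + 512 * B' ->
  A' <= A * (1 / 64) -> B' <= B * (1 / 64) -> 0 <= A -> 0 <= B ->
  8 * s4 + 32 * s6 + s0 <= 10000 * 10000 * A + 10000 * 10000 * B.
Proof. lra. Qed.

(** * Comparison with the Gaussian through a window of typical parts *)

Section Major.
Variables (R : realType) (N : nat) (a b : 'I_N).
Hypothesis ab : a != b.
Implicit Types (n : nat) (t th ph : R).

Definition phase n th ph (x : 'I_n * 'I_N) : R := th * (part x)%:R + ph * eps R a b x.2.

(** From e^2 <= 16 both [fermi x] and 1 - [fermi x] are at least 1/17, and 289 = 17^2. *)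
Lemma fvar_lower (x : R) : `|x| <= 2 -> 1 / 289 <= fvar x.
Proof.
rewrite ler_norml => /andP[x0 x1].
have e2 : expR 2 <= 16 :> R.
  rewrite (_ : expR 2 = expR 1 ^+ 2 :> R); last by rewrite -expRM_natl; congr expR; ring.
  by have := expR1_le4 R; have := expR_gt0 (1 : R); nra.
have low y : y <= 2 -> 1 / 17 <= fermi y :> R.
  move=> y2; have : expR y <= 16 by apply: le_trans e2; rewrite ler_expR.
  by move=> h; have h0 := expR_gt0 y; rewrite /fermi div1r lef_pV2 ?qualifE /=; lra.
have l1 := low _ x1; have l2 := low (- x) ltac:(lra).
have e : 1 - fermi x = fermi (- x).
  rewrite /fermi expRN; field; have := expR_gt0 x => h; rewrite !gt_eqF //; lra.
by rewrite /fvar e; nra.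
Qed.

Let N1 : 1 <= N%:R :> R. Proof. by rewrite ler1n; case: N a => // -[]. Qed.

Lemma sum_window n m (c : R) : (2 * m <= n)%N ->
  \sum_(i < n) (if (m <= i < 2 * m)%N then c else 0) = m%:R * c.
Proof.
move=> mn; rewrite -big_mkcond /=.
rewrite -(big_mkord (fun i => (m <= i < 2 * m)%N) (fun=> c)).
have m2 : (m <= 2 * m)%N by rewrite mul2n -addnn leq_addr.
rewrite (@big_cat_nat _ _ _ (2 * m)) //= (@big_cat_nat _ _ _ m _ (2 * m)) //=.
rewrite big_nat_cond big_pred0 ?add0r; last by move=> i /=; case: (leqP m i) => h; rewrite ?andbF //= leqNgt h.
rewrite [X in _ + X]big_nat_cond [X in _ + X]big_pred0 ?addr0; last first.
  by move=> i /=; case: (leqP (2 * m) i) => h //=; rewrite ?andbF // ltnNge h !andbF.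
rewrite big_nat_cond (eq_bigl (fun i => (m <= i < 2 * m)%N && true)); last first.
  by move=> i; rewrite andbT andbb.
by rewrite -big_nat_cond big_const_nat iter_addr_0 mul2n -addnn addnK mulr_natl.
Qed.

Section Fixed.
Variables (t : R) (n m : nat).
Hypothesis t0 : 0 < t.
Hypothesis tN : (N%:R + 2) * t <= 1.
Hypothesis m0 : (0 < m)%N.
Hypothesis mn : (2 * m <= n)%N.
Hypothesis mt : 2 * m%:R * N%:R * t ^+ 2 <= 1.
Hypothesis mt2 : 1 <= 4 * m%:R * N%:R * t ^+ 2.

Notation p x := (fermi (energy a b t (x : 'I_n * 'I_N))).
Notation k x := ((part (x : 'I_n * 'I_N))%:R : R).

(** The rows from m to 2 m hold parts of order t^-2. The classes of [a] and [b] have opposite signs,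
    so in the sum of their squared phases the mixed term in th and ph nearly cancels and a definite
    form remains. *)
Lemma phase_window_sum th ph :
  m%:R * (3 / 2 * N%:R ^+ 2 * m%:R ^+ 2 * th ^+ 2 + ph ^+ 2) <=
  \sum_(x : 'I_n * 'I_N) (if (m <= x.1 < 2 * m)%N then phase th ph x ^+ 2 else 0).
Proof.
set c := (_ + ph ^+ 2).
rewrite -(sum_window c mn) sum_model (bigD1 a) //= (bigD1 b) /=; last by rewrite eq_sym.
rewrite addrA -big_split /=.
apply: (@le_trans _ _ (\sum_(i < n) ((if (m <= i < 2 * m)%N then phase th ph (i, a) ^+ 2 else 0) +
   (if (m <= i < 2 * m)%N then phase th ph (i, b) ^+ 2 else 0)))); last first.
  rewrite lerDl; apply: sumr_ge0 => j _; apply: sumr_ge0 => i _.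
  by case: ifP => // _; exact: sqr_ge0.
apply: ler_sum => i _; case: ifP => [/andP[mi _]|_]; last by rewrite addr0.
rewrite /phase /= eps_a // eps_b //.
set ka := (part (i, a))%:R; set kb := (part (i, b))%:R.
have kE (j : 'I_N) : (part (i, j))%:R = i%:R * N%:R + j.+1%:R :> R.
  by rewrite /part /= -addnS natrD natrM.
have ja : 0 <= (a.+1%:R : R) <= N%:R by rewrite ler0n ler_nat ltn_ord.
have jb : 0 <= (b.+1%:R : R) <= N%:R by rewrite ler0n ler_nat ltn_ord.
have mi' : m%:R <= i%:R :> R by rewrite ler_nat.
have m1 : 1 <= m%:R :> R by rewrite ler1n.
have kab : 2 * (m%:R * N%:R) <= ka + kb :> R.
  have : m%:R * N%:R <= i%:R * N%:R :> R by rewrite ler_wpM2r.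
  by rewrite /ka /kb !kE; case/andP: ja => *; case/andP: jb => *; lra.
have kd : (ka - kb) ^+ 2 <= N%:R ^+ 2 :> R.
  have -> : ka - kb = a.+1%:R - b.+1%:R by rewrite /ka /kb !kE opprD addrACA subrr add0r.
  case/andP: ja => *; case/andP: jb => *.
  by rewrite -(real_normK (num_real (_ - _))) lerXn2r ?nnegrE // ler_norml; apply/andP; split; lra.
have q1 : (2 * (m%:R * N%:R)) ^+ 2 <= (ka + kb) ^+ 2 :> R.
  have mN0 : 0 <= m%:R * N%:R :> R by apply: mulr_ge0.
  by rewrite lerXn2r ?nnegrE //; lra.
have q2 : 1 <= m%:R ^+ 2 :> R by rewrite exprn_ege1.
have -> : (th * ka + ph * 1) ^+ 2 + (th * kb + ph * -1) ^+ 2 =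
   th ^+ 2 * (ka + kb) ^+ 2 / 2 + (th * (ka - kb) + ph) ^+ 2 + ph ^+ 2 - th ^+ 2 * (ka - kb) ^+ 2 / 2 by field.
have h2 := sqr_ge0 th.
have r1 := ler_wpM2l h2 q1; have r2 := ler_wpM2l h2 kd.
have r3 : th ^+ 2 * N%:R ^+ 2 <= th ^+ 2 * N%:R ^+ 2 * m%:R ^+ 2 :> R.
  by apply: ler_peMr => //; apply: mulr_ge0; exact: sqr_ge0.
have r4 := sqr_ge0 (th * (ka - kb) + ph).
rewrite /c; move: r1; have -> : th ^+ 2 * (2 * (m%:R * N%:R)) ^+ 2 = 4 * (th ^+ 2 * N%:R ^+ 2 * m%:R ^+ 2) by ring.
have -> : 3 / 2 * N%:R ^+ 2 * m%:R ^+ 2 * th ^+ 2 = 3 / 2 * (th ^+ 2 * N%:R ^+ 2 * m%:R ^+ 2) by ring.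
lra.
Qed.

Variables th ph : R.
Hypothesis thb : `|th| <= t ^+ 2 / 8.
Hypothesis phb : `|ph| <= 1 / 8.

(** Decay is extracted only from the window. There the variance is at least 1/289 and 1 - cos psi is
    at least psi^2 / 4, and 1156 = 4 * 289. *)
Let cx (x : 'I_n * 'I_N) : R := if (m <= x.1 < 2 * m)%N then expR (- (phase th ph x ^+ 2 / 1156)) else 1.

Lemma window_phase_le (x : 'I_n * 'I_N) : (m <= x.1 < 2 * m)%N ->
  `|phase th ph x| <= 1 / 2 /\ `|energy a b t x| <= 2.
Proof.
move=> /andP[_ x2].
have T0 := t0.
have K1 : t ^+ 2 * (part x)%:R <= 1 :> R.
  apply: le_trans mt; rewrite mulrC ler_wpM2r ?sqr_ge0 // -!natrM ler_nat /part.
  have : (x.1.+1 * N <= 2 * m * N)%N by rewrite leq_mul2r x2 orbT.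
  by apply: leq_trans; rewrite mulSn -addnS addnC leq_add2r.
have K0 : 0 <= t ^+ 2 * (part x)%:R :> R by rewrite mulr_ge0 ?sqr_ge0.
have e1 := norm_eps_le1 R ab x.2.
split.
  apply: le_trans (ler_normD _ _) _; rewrite !normrM normr_nat.
  have : `|th| * (part x)%:R <= t ^+ 2 / 8 * (part x)%:R by rewrite ler_wpM2r.
  have : `|ph| * `|eps R a b x.2| <= 1 / 8 * 1 by apply: ler_pM.
  lra.
apply: le_trans (ler_normB _ _) _; rewrite (ger0_norm K0).
have : `|t * eps R a b x.2| <= 1 * 1.
  rewrite normrM; apply: ler_pM => //; rewrite gtr0_norm //.
  by have := tN; have := N1; nra.
lra.
Qed.

Lemma char_prod_diff :
  normc (\prod_x bern_cf (p x) (phase th ph x) - \prod_x gauss_cf (p x) (phase th ph x)) <=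
  24 * expR (- (m%:R * (3 / 2 * N%:R ^+ 2 * m%:R ^+ 2 * th ^+ 2 + ph ^+ 2) / 1156)) *
   \sum_x expR (- energy a b t (x : 'I_n * 'I_N)) * (phase th ph x ^+ 4 + phase th ph x ^+ 6).
Proof.
have pb x : 0 <= p x <= 1.
  by have /andP[h1 h2] := fermi_bound (energy a b t x); rewrite (ltW h1) ltW ?fermi_lt1.
have vc (x : 'I_n * 'I_N) : (m <= x.1 < 2 * m)%N -> 1 / 289 <= p x * (1 - p x).
  by move=> /window_phase_le [_ e]; exact: fvar_lower.
have v0 x : 0 <= p x * (1 - p x) by have /andP[] := fvar_bound (energy a b t x).
have zc x : normc (bern_cf (p x) (phase th ph x)) <= cx x.
  apply: le_trans (normc_bern_cf _ _) _; rewrite /cx; case: ifP => h; last first.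
    by rewrite expRN_le1 // mulr_ge0 // subr_ge0 cos_le1.
  rewrite ler_expR lerN2; have [ph2 _] := window_phase_le h.
  have c1 := cosB1_le_sqr ph2; have c2 := vc _ h; have c3 := sqr_ge0 (phase th ph x).
  apply: (@le_trans _ _ (1 / 289 * (phase th ph x ^+ 2 / 4))); first lra.
  by apply: ler_pM c2 c1; [exact: divr_ge0 ler01 (ler0n _ _)|exact: divr_ge0 (sqr_ge0 _) (ler0n _ _)].
have wc x : normc (gauss_cf (p x) (phase th ph x)) <= cx x.
  rewrite normc_gauss_cf /cx; case: ifP => h; last first.
    by rewrite expRN_le1 // divr_ge0 // mulr_ge0 ?sqr_ge0.
  rewrite ler_expR lerN2; have c2 := vc _ h; have c3 := sqr_ge0 (phase th ph x).
  have := ler_wpM2r c3 c2; lra.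
have c01 x : 0 < cx x <= 1.
  rewrite /cx; case: ifP => _; last by rewrite ltr01 lexx.
  rewrite expR_gt0 /=; apply: expRN_le1; apply: divr_ge0; [exact: sqr_ge0|exact: ler0n].
(* Phases in the window are at most 1/2, so no factor falls below e^-1. The factor missing in the
   telescoped product therefore costs at most e <= 4; with the 6 of [bern_gauss_cf] this gives
   24. *)
have Mc x : expR (-1) <= cx x.
  rewrite /cx; case: ifP => h; last by rewrite expRN_le1.
  have [ph2 _] := window_phase_le h; rewrite ler_expR lerN2.
  by rewrite -(real_normK (num_real (phase th ph x))); have := normr_ge0 (phase th ph x); nra.
apply: le_trans (normc_prodB_le zc wc c01 Mc (expR_gt0 _)) _.
have -> : \prod_x cx x = expR (- ((\sum_(x : 'I_n * 'I_N) (if (m <= x.1 < 2 * m)%N then phase th ph x ^+ 2 else 0)) / 1156)).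
  rewrite mulr_suml -sumrN expR_sum; apply: eq_bigr => x _; rewrite /cx.
  by case: ifP => _ //; rewrite mul0r oppr0 expR0.
have W := phase_window_sum th ph.
set S1 := \sum_x (if _ then _ else _) in W *.
set S0 := m%:R * _ in W *.
have S2 : \sum_(x : 'I_n * 'I_N) normc (bern_cf (p x) (phase th ph x) - gauss_cf (p x) (phase th ph x)) <=
   6 * \sum_(x : 'I_n * 'I_N) expR (- energy a b t x) * (phase th ph x ^+ 4 + phase th ph x ^+ 6).
  rewrite mulr_sumr; apply: ler_sum => x _; apply: le_trans (bern_gauss_cf _ (pb x)) _.
  rewrite -mulrA ler_wpM2l // ler_wpM2r //; last by have /andP[] := fermi_bound (energy a b t x).
  by rewrite addr_ge0 ?exprn_even_ge0.
rewrite -[(expR (-1))^-1]expRN opprK.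
set S3 := \sum_x _ * _ in S2 *.
have S30 : 0 <= S3.
  apply: sumr_ge0 => x _; rewrite mulr_ge0 ?expR_ge0 //.
  by rewrite addr_ge0 ?exprn_even_ge0.
have e4 := expR1_le4 R.
apply: (@le_trans _ _ (4 * expR (- (S0 / 1156)) * (6 * S3))); last first.
  by rewrite le_eqVlt; apply/orP; left; apply/eqP; ring.
have S21 : 0 <= \sum_(x : 'I_n * 'I_N) normc (bern_cf (p x) (phase th ph x) - gauss_cf (p x) (phase th ph x)).
  by apply: sumr_ge0 => x _; exact: normc_ge0.
have e41 : expR 1 * expR (- (S1 / 1156)) <= 4 * expR (- (S0 / 1156)).
  apply: ler_pM; [exact: expR_ge0|exact: expR_ge0|exact: e4|].
  by rewrite ler_expR lerN2; exact: ler_div1156.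
by apply: ler_pM; [apply: mulr_ge0; exact: expR_ge0|exact: S21|exact: e41|exact: S2].
Qed.

(** In the scaled angles th / t^3 and ph / t the fourth-order error is t^2 times a quartic. As t
    times a scaled angle is at most 1/8, the sixth powers are dominated by the fourth. *)
Lemma quartic_moment_sum :
   \sum_x expR (- energy a b t (x : 'I_n * 'I_N)) * (phase th ph x ^+ 4 + phase th ph x ^+ 6) <=
   (10000 * 10000) * t ^+ 2 * ((th / t ^+ 3) ^+ 4 + (ph / t) ^+ 4).
Proof.
have T0 := t0; have tp j : 0 < t ^+ j by rewrite exprn_gt0.
have pw x : phase th ph x ^+ 4 + phase th ph x ^+ 6 <=
   8 * th ^+ 4 * k x ^+ 4 + 32 * th ^+ 6 * k x ^+ 6 + (8 * ph ^+ 4 + 32 * ph ^+ 6).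
  have e1 := norm_eps_le1 R ab x.2.
  set u := th * k x; set w := ph * eps R a b x.2.
  have w2 : w ^+ 2 <= ph ^+ 2.
    rewrite /w exprMn ler_piMr ?sqr_ge0 // -(real_normK (num_real (eps R a b x.2))).
    by rewrite exprn_ile1.
  have wj j : w ^+ 2 ^+ j <= ph ^+ 2 ^+ j by rewrite lerXn2r ?nnegrE ?sqr_ge0.
  have w4 := wj 2%N; have w6 := wj 3%N; rewrite -!exprM in w4 w6.
  have b4 : (u + w) ^+ 4 <= 8 * u ^+ 4 + 8 * w ^+ 4.
    rewrite -subr_ge0 (_ : _ - _ = (u - w) ^+ 2 * (7 * u ^+ 2 + 10 * (u * w) + 7 * w ^+ 2)); last by ring.
    rewrite mulr_ge0 ?sqr_ge0 //; have := sqr_ge0 (u + w); have := sqr_ge0 u; have := sqr_ge0 w; rewrite sqrrD -mulr_natr; lra.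
  have b6 : (u + w) ^+ 6 <= 32 * u ^+ 6 + 32 * w ^+ 6.
    have c2 : (u + w) ^+ 2 <= 2 * (u ^+ 2 + w ^+ 2) by have := sqr_ge0 (u - w); nra.
    have c6 : (u + w) ^+ 2 ^+ 3 <= (2 * (u ^+ 2 + w ^+ 2)) ^+ 3.
      by rewrite lerXn2r ?nnegrE ?sqr_ge0 // mulr_ge0 // addr_ge0 ?sqr_ge0.
    rewrite -exprM in c6; apply: le_trans c6 _.
    have := sqr_ge0 u; have := sqr_ge0 w.
    have -> : 32 * u ^+ 6 + 32 * w ^+ 6 = 32 * u ^+ 2 ^+ 3 + 32 * w ^+ 2 ^+ 3 by rewrite -!exprM.
    set A := u ^+ 2; set B := w ^+ 2 => B0 A0.
    rewrite -subr_ge0 (_ : _ - _ = 24 * ((A - B) ^+ 2 * (A + B))); last by ring.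
    by rewrite mulr_ge0 // mulr_ge0 ?sqr_ge0 // addr_ge0.
  rewrite /phase -/u -/w.
  have -> : 8 * th ^+ 4 * k x ^+ 4 = 8 * u ^+ 4 by rewrite /u; ring.
  have -> : 32 * th ^+ 6 * k x ^+ 6 = 32 * u ^+ 6 by rewrite /u; ring.
  lra.
pose S j := \sum_x (k x) ^+ j * expR (- energy a b t x).
apply: (@le_trans _ _ (8 * th ^+ 4 * S 4%N + 32 * th ^+ 6 * S 6%N + (8 * ph ^+ 4 + 32 * ph ^+ 6) * S 0%N)).
  rewrite /S !mulr_sumr -!big_split /=; apply: ler_sum => x _.
  have := ler_wpM2l (expR_ge0 (- energy a b t x)) (pw x).
  by move/le_trans; apply; rewrite le_eqVlt; apply/orP; left; apply/eqP; ring.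
have M4 : S 4%N <= _ := moment_expR_le ab n t0 tN 4.
have M6 : S 6%N <= _ := moment_expR_le ab n t0 tN 6.
have M0 : S 0%N <= _ := moment_expR_le ab n t0 tN 0.
pose X := th / t ^+ 3; pose Y := ph / t.
have tX : th = X * t ^+ 3 by rewrite /X divfK // gt_eqF.
have tY : ph = Y * t by rewrite /Y divfK // gt_eqF.
have Xt : (X * t) ^+ 2 <= 1 / 64.
  have : `|X * t| <= 1 / 8.
    have := thb; rewrite tX (_ : X * t ^+ 3 = X * t * t ^+ 2); last by ring.
    by rewrite normrM (gtr0_norm (tp 2%N)) => h; rewrite -(ler_pM2r (tp 2%N)); lra.
  by rewrite -(real_normK (num_real (X * t))); have := normr_ge0 (X * t); nra.
have Yt : (Y * t) ^+ 2 <= 1 / 64.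
  by have := phb; rewrite tY -(real_normK (num_real (Y * t))); have := normr_ge0 (Y * t); nra.
have h4 : 0 <= th ^+ 4 by rewrite exprn_even_ge0.
have h6 : 0 <= th ^+ 6 by rewrite exprn_even_ge0.
have g4 : 0 <= ph ^+ 4 by rewrite exprn_even_ge0.
have g6 : 0 <= ph ^+ 6 by rewrite exprn_even_ge0.
have N4 := ler_wpM2l h4 M4; have N6 := ler_wpM2l h6 M6.
have N0 := ler_wpM2l (_ : 0 <= 8 * ph ^+ 4 + 32 * ph ^+ 6) M0.
have {}N0 := N0 ltac:(lra).
have X4 : 0 <= X ^+ 4 by rewrite exprn_even_ge0.
have Y4 : 0 <= Y ^+ 4 by rewrite exprn_even_ge0.
have E4 : th ^+ 4 * (16 * (2 * 4) ^+ 4 / t ^+ 2 ^+ 5) = 16 * 4096 * (X ^+ 4 * t ^+ 2).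
  by rewrite tX; field; rewrite gt_eqF.
have E6 : th ^+ 6 * (16 * (2 * 6) ^+ 6 / t ^+ 2 ^+ 7) = 16 * (1728 * 1728) * (X ^+ 4 * t ^+ 2 * (X * t) ^+ 2).
  by rewrite tX; field; rewrite gt_eqF.
have E0 : (8 * ph ^+ 4 + 32 * ph ^+ 6) * (16 * (2 * 0) ^+ 0 / t ^+ 2 ^+ 1) =
    128 * (Y ^+ 4 * t ^+ 2) + 512 * (Y ^+ 4 * t ^+ 2 * (Y * t) ^+ 2).
  by rewrite tY; field; rewrite gt_eqF.
rewrite E4 in N4; rewrite E6 in N6; rewrite E0 in N0.
have A4 : 0 <= X ^+ 4 * t ^+ 2 by rewrite mulr_ge0 // ltW.
have B4 : 0 <= Y ^+ 4 * t ^+ 2 by rewrite mulr_ge0 // ltW.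
have F6 := ler_wpM2l A4 Xt; have F0 := ler_wpM2l B4 Yt.
rewrite -/X -/Y.
have -> : (10000 * 10000) * t ^+ 2 * (X ^+ 4 + Y ^+ 4) = (10000 * 10000) * (X ^+ 4 * t ^+ 2) + (10000 * 10000) * (Y ^+ 4 * t ^+ 2) by ring.
rewrite -[8 * th ^+ 4 * _]mulrA -[32 * th ^+ 6 * _]mulrA.
move: N4 N6 N0 F6 F0 A4 B4; set s4 := th ^+ 4 * _; set s6 := th ^+ 6 * _; set s0 := _ * S 0%N.
set A := X ^+ 4 * _; set B := Y ^+ 4 * _; set A' := A * _; set B' := B * _.
exact: moment_numerics.
Qed.

End Fixed.
End Major.

(** * The joint characteristic function of size and difference *)

Section CharFun.
Variables (R : realType) (N : nat) (a b : 'I_N).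
Hypothesis ab : a != b.

Section Fixed.
Variables (n : nat) (t : R).
Implicit Types (r th ph : R) (x : 'I_n * 'I_N).
Notation p x := (fermi (energy a b t (x : 'I_n * 'I_N))).
Notation psi th ph x := (phase a b th ph (x : 'I_n * 'I_N)).

(* Each part x occurs independently with probability [p x]; this is the joint characteristic
   function of the size and of the difference [pd]. *)
Definition charf th ph : R[i] :=
  \prod_(x : 'I_n * 'I_N) ((1 - p x)%:C + (p x)%:C * cis (psi th ph x))%C.

(** The integrand of the Fourier inversion formula at size n and difference r; its imaginary part
    integrates to zero. *)
Definition hchar r th ph : R := complex.Re (cis (- (n%:R * th + r * ph)) * charf th ph).

Lemma charf_bern th ph :
  charf th ph = cis (\sum_(x : 'I_n * 'I_N) p x * psi th ph x) *
    \prod_(x : 'I_n * 'I_N) bern_cf (p x) (psi th ph x).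
Proof.
rewrite cis_sum -big_split /=; apply: eq_bigr => x _.
by rewrite bern_cfE mulrA -cisD subrr cis0 mul1r.
Qed.

Definition mean1 : R := \sum_(x : 'I_n * 'I_N) (part x)%:R * p x.
Definition mean2 : R := \sum_(x : 'I_n * 'I_N) eps R a b x.2 * p x.

Lemma sum_p_phase th ph :
  \sum_(x : 'I_n * 'I_N) p x * psi th ph x = mean1 * th + mean2 * ph.
Proof.
rewrite /mean1 /mean2 !mulr_suml -big_split /=; apply: eq_bigr => x _.
by rewrite /phase; ring.
Qed.

Lemma prod_gauss_cf th ph :
  \prod_(x : 'I_n * 'I_N) gauss_cf (p x) (psi th ph x) =
  ((expR (- ((\sum_(x : 'I_n * 'I_N) fvar (energy a b t x) * psi th ph x ^+ 2) / 2)))%:C *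
  cis (- ((\sum_(x : 'I_n * 'I_N) fskew (energy a b t x) * psi th ph x ^+ 3) / 6)))%C.
Proof.
rewrite /gauss_cf big_split /= !mulr_suml -!sumrN cis_sum; congr (_ * _).
rewrite expR_sum.
by rewrite (rmorph_prod (real_complex R)).
Qed.

Lemma hchar_gauss r th ph :
  `|hchar r th ph - expR (- ((\sum_(x : 'I_n * 'I_N) fvar (energy a b t x) * psi th ph x ^+ 2) / 2)) *
     cos ((mean1 - n%:R) * th + (mean2 - r) * ph -
       (\sum_(x : 'I_n * 'I_N) fskew (energy a b t x) * psi th ph x ^+ 3) / 6)| <=
  normc (\prod_(x : 'I_n * 'I_N) bern_cf (p x) (psi th ph x) -
         \prod_(x : 'I_n * 'I_N) gauss_cf (p x) (psi th ph x)).
Proof.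
set V := _ / 2; set K := _ / 6; set u := (mean1 - _) * _ + _.
have -> : hchar r th ph = complex.Re (cis u * \prod_(x : 'I_n * 'I_N) bern_cf (p x) (psi th ph x)).
  rewrite /hchar charf_bern mulrA -cisD sum_p_phase; congr (complex.Re (cis _ * _)).
  by rewrite /u; ring.
have -> : expR (- V) * cos (u - K) = complex.Re (cis u * \prod_(x : 'I_n * 'I_N) gauss_cf (p x) (psi th ph x)).
  by rewrite prod_gauss_cf mulrCA -cisD /= mul0r subr0.
rewrite -raddfB /= -mulrBr; apply: le_trans (norm_Re_le _) _.
by rewrite normcM normc_cis mul1r.
Qed.

Lemma sum_fvar_phase th ph :
  \sum_(x : 'I_n * 'I_N) fvar (energy a b t x) * psi th ph x ^+ 2 =
  (\sum_(x : 'I_n * 'I_N) (part x)%:R ^+ 2 * fvar (energy a b t x)) * th ^+ 2 +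
  2 * (\sum_(x : 'I_n * 'I_N) eps R a b x.2 * ((part x)%:R ^+ 1 * fvar (energy a b t x))) * (th * ph) +
  (\sum_(x : 'I_n * 'I_N) eps R a b x.2 ^+ 2 * fvar (energy a b t x)) * ph ^+ 2.
Proof.
rewrite mulr_sumr !mulr_suml -!big_split /=; apply: eq_bigr => x _.
by rewrite /phase; ring.
Qed.

Lemma sum_fskew_phase th ph :
  \sum_(x : 'I_n * 'I_N) fskew (energy a b t x) * psi th ph x ^+ 3 =
  (\sum_(x : 'I_n * 'I_N) (part x)%:R ^+ 3 * fskew (energy a b t x)) * th ^+ 3 +
  3 * (\sum_(x : 'I_n * 'I_N) eps R a b x.2 * ((part x)%:R ^+ 2 * fskew (energy a b t x))) * (th ^+ 2 * ph) +
  3 * (\sum_(x : 'I_n * 'I_N) eps R a b x.2 ^+ 2 * ((part x)%:R * fskew (energy a b t x))) * (th * ph ^+ 2) +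
  (\sum_(x : 'I_n * 'I_N) eps R a b x.2 * ((part x)%:R ^+ 0 * fskew (energy a b t x))) * ph ^+ 3.
Proof.
rewrite !mulr_sumr !mulr_suml -!big_split /=; apply: eq_bigr => x _.
have e3 : eps R a b x.2 ^+ 3 = eps R a b x.2.
  by case: (eps_cases R ab x.2) => ->; ring.
by rewrite /phase expr0 mul1r -{4}e3; ring.
Qed.

End Fixed.
Section Moments.
Variable L : R -> R.
Hypothesis dL : forall x : R, -3 < x -> is_derive x (1 : R) L (- softlog x).
Hypothesis bL : forall x : R, -3 < x -> 0 <= L x <= expR (- x).
Hypothesis L0 : 1 / 3 <= L 0.
Variables (n : nat) (t : R).
Hypothesis t0 : 0 < t.
Hypothesis tN : (N%:R + 2) * t <= 1.
Hypothesis t216 : 216 * t <= 1.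
Hypothesis nt : n%:R * t ^+ 4 = L 0.

Let N1 : 1 <= N%:R :> R. Proof. by rewrite ler1n; case: N a => // -[]. Qed.

(** The last row has energy about N t^2 n = N L 0 / t^2, so the tail is smaller than any power of t.
    A bound by the cube of half this quantity is enough once 216 t <= 1; the number 216 is (2 * 3)^3
    from [pow_expR_le]. *)
Lemma model_tail : expR (- (N%:R * t ^+ 2 * n%:R) / 2) <= (N%:R * t ^+ 2) ^+ 2.
Proof.
have T0 := t0; have t2 : 0 < t ^+ 2 by rewrite exprn_gt0.
set y := (N%:R * t ^+ 2 * n%:R) / 2.
have yE : y * t ^+ 2 = N%:R * L 0 / 2 by rewrite /y -nt; field.
have y1 : 1 / 6 <= y * t ^+ 2 by rewrite yE; have := N1; have := L0; nra.
have y0 : 0 < y by rewrite -(pmulr_lgt0 _ t2); lra.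
rewrite mulNr -/y; have h := pow_expR_le 3 (ltW y0).
have h1 : y ^+ 3 * expR (- y) <= 216.
  apply: le_trans h _; rewrite -[leRHS]mulr1.
  have -> : (2 * 3) ^+ 3 = 216 :> R by ring.
  by apply: (ler_wpM2l (ler0n R 216)); rewrite mulNr expRN_le1 // divr_ge0 // ltW.
have h2 : (1 / 6) ^+ 3 <= y ^+ 3 * (t ^+ 2) ^+ 3 by rewrite -exprMn lerXn2r ?nnegrE //; lra.
have t46 : 216 * 216 * t ^+ 2 <= 1 by have := t216; nra.
have t4 : 0 < t ^+ 4 by rewrite exprn_gt0.
have N2 : 1 <= N%:R ^+ 2 :> R by rewrite exprn_ege1 // N1.
have -> : (N%:R * t ^+ 2) ^+ 2 = N%:R ^+ 2 * t ^+ 4 by ring.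
have e0 := expR_gt0 (- y).
have h3 : expR (- y) * (1 / 216) <= 216 * (t ^+ 2 * t ^+ 4).
  have -> : t ^+ 2 * t ^+ 4 = (t ^+ 2) ^+ 3 by ring.
  have -> : 1 / 216 = (1 / 6) ^+ 3 :> R by field.
  apply: (@le_trans _ _ (expR (- y) * (y ^+ 3 * (t ^+ 2) ^+ 3))).
    by rewrite ler_wpM2l ?(ltW e0).
  by rewrite mulrA [_ * y ^+ 3]mulrC ler_wpM2r // exprn_ge0 // ltW.
have h4 : t ^+ 4 <= N%:R ^+ 2 * t ^+ 4 by rewrite ler_peMl // ltW.
have h5 : 216 * 216 * t ^+ 2 * t ^+ 4 <= 1 * t ^+ 4 by rewrite ler_wpM2r // ltW.
lra.
Qed.

(** 3000 is the constant of [eps_sum_le], and 3456 = 16 * 6^3 is that of [moment_expR_le] for the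
    third moment. *)
Let C : R := 3000 * (N%:R + 2) ^+ 3 + 3456.

Let scale (S B B' : R) (k : nat) : `|S| <= B -> B * t ^+ k <= B' -> `|S * t ^+ k| <= B'.
Proof.
move=> h hB; apply: le_trans hB; rewrite normrM (ger0_norm (_ : 0 <= t ^+ k)) ?exprn_ge0 ?(ltW t0) //.
by rewrite ler_wpM2r // exprn_ge0 // ltW.
Qed.

Let N23 : (N%:R + 2) ^+ 2 <= (N%:R + 2) ^+ 3 :> R.
Proof. by apply: ler_weXn2l => //; have := N1; lra. Qed.
Let N30 : 0 <= (N%:R + 2) ^+ 3 :> R.
Proof. by rewrite exprn_ge0. Qed.

Let le_C (c : R) (j : nat) : c <= C -> c * t ^+ j <= C * t ^+ j.
Proof. by move=> h; rewrite ler_wpM2r // exprn_ge0 // ltW. Qed.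

Let C2 (c : R) : 0 <= c <= 3000 -> c * (N%:R + 2) ^+ 2 <= C.
Proof.
move=> /andP[c0 c1]; apply: (@le_trans _ _ (3000 * (N%:R + 2) ^+ 3)).
  by apply: ler_pM => //; rewrite exprn_ge0.
by rewrite /C lerDl ler0n.
Qed.
Let C3 (c : R) : 0 <= c <= 3000 -> c * (N%:R + 2) ^+ 3 <= C.
Proof.
move=> /andP[c0 c1]; apply: (@le_trans _ _ (3000 * (N%:R + 2) ^+ 3)).
  by apply: ler_pM.
by rewrite /C lerDl ler0n.
Qed.
Let C0 (c : R) : c <= 3456 -> c <= C.
Proof. by move=> c1; apply: (le_trans c1); rewrite /C lerDr; apply: mulr_ge0; [exact: ler0n|exact: N30]. Qed.

Let divXn (c : R) (j k : nat) : c / t ^+ j * t ^+ (j + k) = c * t ^+ k.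
Proof. by rewrite exprD mulrA divfK // gt_eqF // exprn_gt0. Qed.

(** The powers of t express everything in the scaled angles. Coefficients of monomials odd in the
    first angle are O(t); the others reach their limits up to O(t^2), for which the third cumulants
    use the cancellation in [eps_sum_le]. These are the assumptions of [symmetrised_gauss]. *)
Lemma model_moment_bounds :
  `|(\sum_(x : 'I_n * 'I_N) (part x)%:R ^+ 2 * fvar (energy a b t x)) * t ^+ 6 - 2 * L 0| <= C * t ^+ 2 /\
  `|(\sum_(x : 'I_n * 'I_N) eps R a b x.2 ^+ 2 * fvar (energy a b t x)) * t ^+ 2 - N%:R^-1| <= C * t ^+ 2 /\
  `|(\sum_(x : 'I_n * 'I_N) eps R a b x.2 * ((part x)%:R ^+ 1 * fvar (energy a b t x))) * t ^+ 4| <= C * t /\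
  `|(mean1 n t - n%:R) * t ^+ 3| <= C * t /\
  `|(mean2 n t - ((N%:R * t)^-1 + kappa0 R a b)) * t| <= C * t ^+ 2 /\
  `|(\sum_(x : 'I_n * 'I_N) (part x)%:R ^+ 3 * fskew (energy a b t x)) * t ^+ 9| <= C * t /\
  `|(\sum_(x : 'I_n * 'I_N) eps R a b x.2 * ((part x)%:R ^+ 2 * fskew (energy a b t x))) * t ^+ 7| <= C * t ^+ 2 /\
  `|(\sum_(x : 'I_n * 'I_N) eps R a b x.2 ^+ 2 * ((part x)%:R * fskew (energy a b t x))) * t ^+ 5| <= C * t /\
  `|(\sum_(x : 'I_n * 'I_N) eps R a b x.2 * ((part x)%:R ^+ 0 * fskew (energy a b t x))) * t ^+ 3| <= C * t ^+ 2.
Proof.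
have tl := model_tail.
have fb (x : R) : `|fvar x| <= expR (- x) by have /andP[h0 h1] := fvar_bound x; rewrite ger0_norm.
have fl (x y : R) : `|x - y| <= 1 -> `|fvar x - fvar y| <= 12 * `|x - y| * expR (- x).
  move=> /fermi_lip [_ [h _]]; apply: (le_trans h).
  by rewrite ler_wpM2r ?expR_ge0 // ler_wpM2r // ler_nat.
have sb (x : R) : `|fskew x| <= expR (- x) := fskew_bound x.
have sl (x y : R) : `|x - y| <= 1 -> `|fskew x - fskew y| <= 12 * `|x - y| * expR (- x).
  by move=> /fermi_lip [_ [_ h]].
have tX j : 0 < t ^+ j by rewrite exprn_gt0.
do 8?split.
- have h := fvar_energy2_sum ab t0 tN dL bL tl.
  have -> : 2 * L 0 = 2 * L 0 / t ^+ 6 * t ^+ 6 by rewrite divfK // gt_eqF.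
  rewrite -mulrBl; apply: (scale h); rewrite (divXn _ 4 2); apply: le_C; apply: C2; lra.
- have h := fvar_eps2_sum ab t0 tN tl.
  have -> : N%:R^-1 = (N%:R * t ^+ 2)^-1 * t ^+ 2.
    by rewrite invfM divfK // gt_eqF.
  rewrite -mulrBl; apply: (scale h); apply: le_C; apply: C2; lra.
- have h := @eps_sum_le R N a b ab t n t0 tN _ 1 isT fb fl; apply: (@scale _ _ _ _ h).
  by rewrite (divXn _ 3 1); apply: le_C; apply: C2; lra.
- have h := fermi_energy_sum ab t0 tN dL bL tl.
  have e : L 0 / t ^+ 4 = n%:R by rewrite -nt mulfK // gt_eqF.
  rewrite e in h.
  by apply: (scale h); rewrite (divXn _ 2 1); apply: le_C; apply: C2; lra.
- have h := eps_fermi_sum ab t0 tN tl.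
  apply: (@scale _ _ (C * t ^+ 2) 1 h).
  have -> : 200 * (N%:R + 2) ^+ 3 * t * t ^+ 1 = 200 * (N%:R + 2) ^+ 3 * t ^+ 2 by ring.
  by apply: le_C; apply: C3; lra.
- have h := moment_expR_le ab n t0 tN 3.
  apply: (@scale _ (16 * (2 * 3%:R) ^+ 3 / (t ^+ 2) ^+ 4)).
    apply: le_trans h; apply: le_trans (ler_norm_sum _ _ _) _; apply: ler_sum => x _.
    by rewrite normrM ger0_norm ?exprn_ge0 // ler_wpM2l ?exprn_ge0.
  rewrite -exprM (divXn _ 8 1); apply: le_C; apply: C0; lra.
- have h := @eps_sum_le R N a b ab t n t0 tN _ 2 isT sb sl; apply: (@scale _ _ _ _ h).
  by rewrite (divXn _ 5 2); apply: le_C; apply: C2; lra.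
- have h := moment_expR_le ab n t0 tN 1.
  apply: (@scale _ (16 * (2 * 1%:R) ^+ 1 / (t ^+ 2) ^+ 2)).
    apply: le_trans h; apply: le_trans (ler_norm_sum _ _ _) _; apply: ler_sum => x _.
    have e2 : `|eps R a b x.2 ^+ 2| <= 1 by rewrite normrX exprn_ile1 //; exact: norm_eps_le1.
    rewrite expr1 [ `|_ ^+ 2 * _|]normrM mulrC; apply: le_trans (ler_wpM2l (normr_ge0 _) e2) _.
    by rewrite mulr1 [ `|_%:R * _|]normrM normr_nat; apply: ler_wpM2l.
  rewrite -exprM (divXn _ 4 1); apply: le_C; apply: C0; lra.
- have h := @eps_sum_le R N a b ab t n t0 tN _ 0 isT sb sl; apply: (@scale _ _ _ _ h).
  by rewrite (divXn _ 1 2); apply: le_C; apply: C2; lra.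
Qed.

End Moments.
End CharFun.

Lemma add_sqr_le (R : realType) (u v : R) : 0 <= u -> 0 <= v -> u ^+ 2 + v ^+ 2 <= (1 + (u + v)) ^+ 2.
Proof. by nra. Qed.

(** * The Gaussian approximation near the origin *)

Section MajorArc.
Variables (R : realType) (N : nat) (a b : 'I_N).
Hypothesis ab : a != b.

Let N1 : 1 <= N%:R :> R. Proof. by rewrite ler1n; case: N a => // -[]. Qed.

Let small216 (t : R) : t <= 1 / 216 -> 216 * t <= 1. Proof. lra. Qed.

Let c2_gt0 : 0 < (300 * 300 * N%:R)^-1 :> R.
Proof. by rewrite invr_gt0; have := N1; lra. Qed.

Let small_t (t : R) : 0 < t -> (N%:R + 2) * t <= 1 -> 216 * t <= 1 ->
  3 * t ^+ 2 <= 1 /\ 2 * N%:R * t ^+ 2 <= 1.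
Proof.
move=> t0 tN t216; have N0 := N1; split; first by nra.
have Nt : N%:R * t <= 1 by nra.
have Nt0 : 0 <= N%:R * t by apply: mulr_ge0; lra.
have -> : 2 * N%:R * t ^+ 2 = (N%:R * t) * (2 * t) by ring.
by move: (N%:R * t) Nt Nt0 => u; nra.
Qed.

(** The integer part of 1 / (2 N t^2) serves: energies stay bounded up to row 2 m, while the number
    of rows is comparable with t^-2. *)
Lemma window_exists (t : R) (n : nat) : 0 < t -> 2 * N%:R * t ^+ 2 <= 1 -> 3 * t ^+ 2 <= 1 ->
  1 / 3 <= n%:R * t ^+ 4 ->
  exists m : nat, [/\ (0 < m)%N, (2 * m <= n)%N, 2 * m%:R * N%:R * t ^+ 2 <= 1 &
    1 <= 4 * m%:R * N%:R * t ^+ 2].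
Proof.
move=> t0 t1 t2 nt; have N0 := N1; have tt : 0 < t ^+ 2 by rewrite exprn_gt0.
pose y := 2 * N%:R * t ^+ 2; have y0 : 0 < y by rewrite mulr_gt0 // mulr_gt0 //; lra.
have x1 : 1 <= y^-1 by rewrite invf_ge1.
have yi0 : 0 <= y^-1 by rewrite invr_ge0 ltW.
have /andP[m1 m2] := truncn_itv yi0.
set m := Num.truncn _ in m1 m2; exists m.
have yy : y * y^-1 = 1 by rewrite divff // gt_eqF.
have h1 : y * m%:R <= 1 by rewrite -[leRHS]yy ler_wpM2l // ltW.
have h2 : 1 < y * m.+1%:R by rewrite -[ltLHS]yy ltr_pM2l.
have m0 : (0 < m)%N.
  rewrite lt0n; apply/eqP => m0; move: m2; rewrite m0; lra.
have m1' : 1 <= m%:R :> R by rewrite ler1n.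
have e : y * m%:R = 2 * m%:R * N%:R * t ^+ 2 by rewrite /y; ring.
split=> //.
- rewrite -(ler_nat R) natrM -(ler_pM2r (exprn_gt0 4 t0)); apply: le_trans nt.
  have h3 : 2 * m%:R * t ^+ 2 <= 1.
    apply: le_trans h1; rewrite e ler_pM2r // ler_peMr //.
  have -> : 2 * m%:R * t ^+ 4 = 2 * m%:R * t ^+ 2 * t ^+ 2 by ring.
  have := ler_wpM2r (ltW tt) h3; lra.
- by rewrite -e.
- move: h2; rewrite -natr1 mulrDr mulr1 e => h2.
  have : y <= y * m%:R by rewrite ler_peMr // ltW.
  rewrite e; lra.
Qed.

Lemma window_decay (t X Y : R) (m : nat) : 0 < t -> 1 <= 4 * m%:R * N%:R * t ^+ 2 ->
  (300 * 300 * N%:R)^-1 * (X ^+ 2 + Y ^+ 2) <=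
   m%:R * (3 / 2 * N%:R ^+ 2 * m%:R ^+ 2 * (X * t ^+ 3) ^+ 2 + (Y * t) ^+ 2) / 1156.
Proof.
move=> t0 h; pose q := m%:R * N%:R * t ^+ 2.
have q4 : 1 / 4 <= q by rewrite /q; lra.
have N0 : 0 < N%:R :> R by have := N1; lra.
have -> : m%:R * (3 / 2 * N%:R ^+ 2 * m%:R ^+ 2 * (X * t ^+ 3) ^+ 2 + (Y * t) ^+ 2) / 1156 =
   (3 / 2 * q ^+ 3 * X ^+ 2 + q * Y ^+ 2) / (1156 * N%:R).
  by rewrite /q; field; rewrite gt_eqF.
have q3 : (1 / 4) ^+ 3 <= q ^+ 3 by rewrite lerXn2r ?nnegrE //; lra.
rewrite ler_pdivlMr; last by apply: mulr_gt0; [exact: ltr0n|exact: N0].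
have -> : (300 * 300 * N%:R)^-1 * (X ^+ 2 + Y ^+ 2) * (1156 * N%:R) = (X ^+ 2 + Y ^+ 2) * 1156 / (300 * 300).
  by field; rewrite gt_eqF.
have x2 := sqr_ge0 X; have y2 := sqr_ge0 Y.
have := ler_wpM2r x2 q3; have := ler_wpM2r y2 q4; lra.
Qed.

Variable L : R -> R.
Hypothesis dL : forall x : R, -3 < x -> is_derive x (1 : R) L (- softlog x).
Hypothesis bL : forall x : R, -3 < x -> 0 <= L x <= expR (- x).
Hypothesis L0 : 1 / 3 <= L 0.

Lemma combine_decay (A D2 D1 c1 c2 t M : R) : 0 <= A -> 0 < D2 -> 0 < D1 -> 0 <= M ->
  (1 + M) ^+ 2 * expR (- (c2 * M)) <= D2 * expR (- (c2 / 2 * M)) ->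
  A * t ^+ 2 * ((1 + M) ^+ 2 * expR (- (c2 * M))) + D1 * t ^+ 2 * expR (- (c1 * M)) <=
   (A * D2 + D1) * t ^+ 2 * expR (- (Num.min c1 (c2 / 2) * M)).
Proof.
move=> A0 D20 D10 M0 H; set e := expR (- (Num.min _ _ * _)).
have e1 : expR (- (c1 * M)) <= e by rewrite ler_expR lerN2 ler_wpM2r // ge_min lexx.
have e2 : expR (- (c2 / 2 * M)) <= e by rewrite ler_expR lerN2 ler_wpM2r // ge_min lexx orbT.
have -> : (A * D2 + D1) * t ^+ 2 * e = A * t ^+ 2 * (D2 * e) + D1 * t ^+ 2 * e by ring.
have t2 := sqr_ge0 t.
apply: lerD; apply: ler_wpM2l => //.
- exact: mulr_ge0.
- by apply: le_trans H _; apply: ler_wpM2l e2; exact: ltW.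
- by apply: mulr_ge0 => //; exact: ltW.
Qed.

Lemma hchar_gauss_norm (t : R) (n m : nat) (r X Y : R) : 0 < t -> (N%:R + 2) * t <= 1 ->
  (0 < m)%N -> (2 * m <= n)%N -> 2 * m%:R * N%:R * t ^+ 2 <= 1 -> 1 <= 4 * m%:R * N%:R * t ^+ 2 ->
  `|X * t ^+ 3| <= t ^+ 2 / 8 -> `|Y * t| <= 1 / 8 ->
  `|hchar a b n t r (X * t ^+ 3) (Y * t) -
    expR (- ((\sum_(x : 'I_n * 'I_N) fvar (energy a b t x) * phase a b (X * t ^+ 3) (Y * t) x ^+ 2) / 2)) *
     cos ((mean1 a b n t - n%:R) * (X * t ^+ 3) + (mean2 a b n t - r) * (Y * t) -
       (\sum_(x : 'I_n * 'I_N) fskew (energy a b t x) * phase a b (X * t ^+ 3) (Y * t) x ^+ 3) / 6)| <=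
  24 * (10000 * 10000) * t ^+ 2 *
    ((1 + (X ^+ 2 + Y ^+ 2)) ^+ 2 * expR (- ((300 * 300 * N%:R)^-1 * (X ^+ 2 + Y ^+ 2)))).
Proof.
move=> t0 tN m0 mn mt mt2 hX hY; have T3 : 0 < t ^+ 3 by rewrite exprn_gt0.
apply: le_trans (hchar_gauss _ _ _ _ _ _ _) _.
apply: le_trans (char_prod_diff ab t0 tN m0 mn mt hX hY) _.
have Q := quartic_moment_sum ab n t0 tN hX hY.
rewrite (mulfK (lt0r_neq0 T3)) (mulfK (lt0r_neq0 t0)) in Q.
have W := window_decay X Y t0 mt2.
set E := _ / 1156 in W *; set S := \sum_x _ in Q *.
have M4 : X ^+ 4 + Y ^+ 4 <= (1 + (X ^+ 2 + Y ^+ 2)) ^+ 2.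
  rewrite -[4%N]/(2 * 2)%N !exprM; exact: add_sqr_le (sqr_ge0 X) (sqr_ge0 Y).
have E1 : expR (- E) <= expR (- ((300 * 300 * N%:R)^-1 * (X ^+ 2 + Y ^+ 2))) by rewrite ler_expR lerN2.
set E2 := expR (- (_^-1 * _)) in E1 *; set P := (1 + _) ^+ 2 in M4 *.
have t20 := sqr_ge0 t; have E0 := expR_ge0 (- E).
have Q2 : S <= 10000 * 10000 * t ^+ 2 * P.
  apply: le_trans Q _; apply: ler_wpM2l M4; apply: mulr_ge0 t20.
  by apply: mulr_ge0; exact: ler0n.
have S0 : 0 <= S.
  apply: sumr_ge0 => x _; apply: mulr_ge0; first exact: expR_ge0.
  by apply: addr_ge0; exact: exprn_even_ge0.
have -> : 24 * (10000 * 10000) * t ^+ 2 * (P * E2) = 24 * (E2 * (10000 * 10000 * t ^+ 2 * P)) :> R by ring.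
rewrite (_ : 24 * expR (- E) * S = 24 * (expR (- E) * S)); last by rewrite mulrA.
rewrite (ler_pM2l (ltr0Sn R 23)).
exact: ler_pM.
Qed.

(** Only the existence of the constants is passed on, which keeps the numerals out of the estimates
    that follow. *)
Let hchar_gauss_const : exists A c2 : R, [/\ 0 <= A, 0 < c2 & forall (t : R) (n m : nat) (r X Y : R), 0 < t -> (N%:R + 2) * t <= 1 ->
  (0 < m)%N -> (2 * m <= n)%N -> 2 * m%:R * N%:R * t ^+ 2 <= 1 -> 1 <= 4 * m%:R * N%:R * t ^+ 2 ->
  `|X * t ^+ 3| <= t ^+ 2 / 8 -> `|Y * t| <= 1 / 8 ->
  `|hchar a b n t r (X * t ^+ 3) (Y * t) -
    expR (- ((\sum_(x : 'I_n * 'I_N) fvar (energy a b t x) * phase a b (X * t ^+ 3) (Y * t) x ^+ 2) / 2)) *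
     cos ((mean1 a b n t - n%:R) * (X * t ^+ 3) + (mean2 a b n t - r) * (Y * t) -
       (\sum_(x : 'I_n * 'I_N) fskew (energy a b t x) * phase a b (X * t ^+ 3) (Y * t) x ^+ 3) / 6)| <=
  A * t ^+ 2 *
    ((1 + (X ^+ 2 + Y ^+ 2)) ^+ 2 * expR (- (c2 * (X ^+ 2 + Y ^+ 2))))].
Proof.
exists (24 * (10000 * 10000)), (300 * 300 * N%:R)^-1; split; [|exact: c2_gt0|exact: hchar_gauss_norm].
by do 2?apply: mulr_ge0; exact: ler0n.
Qed.

Let moment_const : exists2 C : R, 0 <= C & forall (n : nat) (t : R),
  0 < t -> (N%:R + 2) * t <= 1 -> 216 * t <= 1 -> n%:R * t ^+ 4 = L 0 ->
  `|(\sum_(x : 'I_n * 'I_N) (part x)%:R ^+ 2 * fvar (energy a b t x)) * t ^+ 6 - 2 * L 0| <= C * t ^+ 2 /\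
  `|(\sum_(x : 'I_n * 'I_N) eps R a b x.2 ^+ 2 * fvar (energy a b t x)) * t ^+ 2 - N%:R^-1| <= C * t ^+ 2 /\
  `|(\sum_(x : 'I_n * 'I_N) eps R a b x.2 * ((part x)%:R ^+ 1 * fvar (energy a b t x))) * t ^+ 4| <= C * t /\
  `|(mean1 a b n t - n%:R) * t ^+ 3| <= C * t /\
  `|(mean2 a b n t - ((N%:R * t)^-1 + kappa0 R a b)) * t| <= C * t ^+ 2 /\
  `|(\sum_(x : 'I_n * 'I_N) (part x)%:R ^+ 3 * fskew (energy a b t x)) * t ^+ 9| <= C * t /\
  `|(\sum_(x : 'I_n * 'I_N) eps R a b x.2 * ((part x)%:R ^+ 2 * fskew (energy a b t x))) * t ^+ 7| <= C * t ^+ 2 /\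
  `|(\sum_(x : 'I_n * 'I_N) eps R a b x.2 ^+ 2 * ((part x)%:R * fskew (energy a b t x))) * t ^+ 5| <= C * t /\
  `|(\sum_(x : 'I_n * 'I_N) eps R a b x.2 * ((part x)%:R ^+ 0 * fskew (energy a b t x))) * t ^+ 3| <= C * t ^+ 2.
Proof.
exists (3000 * (N%:R + 2) ^+ 3 + 3456); last by move=> n t; exact: model_moment_bounds.
apply: addr_ge0; last exact: ler0n.
by apply: mulr_ge0; [exact: ler0n|apply: exprn_ge0; exact: addr_ge0].
Qed.

Lemma norm_half_sum_sub (x y u v z A B : R) : `|x - u| <= A -> `|y - v| <= A ->
  `|(u + v) / 2 - z| <= B -> `|(x + y) / 2 - z| <= A + B.
Proof.
rewrite !ler_norml => /andP[? ?] /andP[? ?] /andP[? ?]; apply/andP; split; lra.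
Qed.

Lemma major_arc : exists D c t1 : R, [/\ 0 < D, 0 < c & 0 < t1] /\
  forall (t : R) (n : nat), 0 < t <= t1 -> n%:R * t ^+ 4 = L 0 ->
  forall r th ph : R, `|th| <= t ^+ 2 / 8 -> `|ph| <= 1 / 8 ->
  `|(hchar a b n t r th ph + hchar a b n t r (- th) ph) / 2 -
    expR (- ((2 * L 0 * (th / t ^+ 3) ^+ 2 + N%:R^-1 * (ph / t) ^+ 2) / 2)) *
      cos (((N%:R * t)^-1 + kappa0 R a b - r) * ph)| <=
   D * t ^+ 2 * expR (- (c * ((th / t ^+ 3) ^+ 2 + (ph / t) ^+ 2))).
Proof.
have N0 : 0 < N%:R :> R by have := N1; lra.
have [C C0 HM] := moment_const.
have [A [c2 [A0 c20 HG]]] := hchar_gauss_const.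
have al0 : 0 < 2 * L 0 by have := L0; lra.
have be0 : 0 < N%:R^-1 :> R by rewrite invr_gt0.
have [D1 [c1 [t1 [[D10 c10 t10] H1]]]] := symmetrised_gauss al0 be0 C0.
have [D2 D20 H2] := poly_expR_absorb 2 c20.
exists (A * D2 + D1), (Num.min c1 (c2 / 2)), (Num.min t1 (Num.min (1 / 216) (1 / (N%:R + 2)))).
split.
  split; first by apply: (ltr_wpDl _ D10); exact: mulr_ge0 A0 (ltW D20).
    by rewrite lt_min c10 divr_gt0.
  by rewrite !lt_min t10 (divr_gt0 ltr01 (ltr0Sn R 215)) divr_gt0 // addr_gt0.
move=> t n /andP[t0]; rewrite !le_min => /and3P[tt1 t216 tN'] nt.
have tN : (N%:R + 2) * t <= 1.
  by move: tN'; rewrite ler_pdivlMr ?addr_gt0 // mulrC.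
have {}t216 : 216 * t <= 1 := small216 t216.
have [tsm tsN] := small_t t0 tN t216.
have nt3 : 1 / 3 <= n%:R * t ^+ 4 by rewrite nt.
have [m [m0 mn mt mt2]] := window_exists t0 tsN tsm nt3.
move=> r th ph hth hph.
have T3 : 0 < t ^+ 3 by rewrite exprn_gt0.
have eth : th = (th / t ^+ 3) * t ^+ 3 by rewrite divfK // gt_eqF.
have eph : ph = (ph / t) * t by rewrite divfK // gt_eqF.
set X := th / t ^+ 3 in eth *; set Y := ph / t in eph *.
move: hth hph; rewrite eth eph -mulNr => hth hph {eth eph}.
have hth' : `|- X * t ^+ 3| <= t ^+ 2 / 8 by rewrite mulNr normrN.
have G1 := HG t n m r _ _ t0 tN m0 mn mt mt2 hth hph.
have G2 := HG t n m r _ _ t0 tN m0 mn mt mt2 hth' hph.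
rewrite sqrrN in G2.
have [B1 [B2 [B3 [B4 [B5 [B6 [B7 [B8 B9]]]]]]]] := HM n t t0 tN t216 nt.
have tt : 0 < t <= t1 by rewrite t0.
have G3 := H1 t tt _ _ _ _ _ _ _ _ _ B1 B2 B3 B4 B5 B6 B7 B8 B9 X Y
  (((N%:R * t)^-1 + kappa0 R a b - r) * (Y * t)).
have M0 : 0 <= X ^+ 2 + Y ^+ 2 by apply: addr_ge0; exact: sqr_ge0.
apply: le_trans (combine_decay c1 t A0 D20 D10 M0 (H2 _ M0)).
apply: norm_half_sum_sub G1 G2 _.
apply: le_trans G3; rewrite le_eqVlt; apply/orP; left; apply/eqP.
rewrite !sum_fvar_phase // !sum_fskew_phase //.
congr (`|(_ + _) / 2 - _|).
all: congr (expR _ * cos _).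
all: by field; rewrite ?(gt_eqF t0) ?(gt_eqF N0).
Qed.

End MajorArc.

(** * The minor arcs *)

Section TrigSums.
Variable R : realType.
Implicit Types x y : R.

Lemma cos_periodic_int x (z : int) : cos (x + 2 * pi * z%:~R) = cos x.
Proof.
have nat_case y (k : nat) : cos (y + 2 * pi * k%:R) = cos y.
  elim: k => [|k IH]; first by rewrite mulr0 addr0.
  have -> : y + 2 * pi * k.+1%:R = (y + 2 * pi * k%:R) + pi + pi by rewrite -natr1; ring.
  by rewrite !cosDpi opprK IH.
case: z => k; first exact: nat_case.
rewrite NegzE mulrNz mulrN -pmulrn -[LHS](nat_case _ k.+1); congr cos; ring.
Qed.

(** The Dirichlet kernel: multiplied by 2 sin (x / 2) the sum telescopes. *)
Lemma norm_sum_cos_le (base x : R) (J : nat) :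
  `|\sum_(i < J) cos (base + i%:R * x)| * `|sin (x / 2)| <= 1.
Proof.
have tel : 2 * (\sum_(i < J) cos (base + i%:R * x)) * sin (x / 2) =
   sin (base + J%:R * x - x / 2) - sin (base - x / 2).
  elim: J => [|J IH]; first by rewrite big_ord0 mul0r addr0 mulr0 mul0r subrr.
  rewrite big_ord_recr /= mulrDr mulrDl IH.
  have -> : base + J.+1%:R * x - x / 2 = (base + J%:R * x) + x / 2 by rewrite -natr1; field.
  set y := base + J%:R * x; rewrite (sinD y (x / 2)) (sinB y (x / 2)); ring.
have : `|2 * (\sum_(i < J) cos (base + i%:R * x)) * sin (x / 2)| <= 2.
  rewrite tel; apply: le_trans (ler_normB _ _) _.
  have := norm_sin_le1 (base + J%:R * x - x / 2); have := norm_sin_le1 (base - x / 2); lra.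
by rewrite -mulrA normrM normrM (ger0_norm (_ : 0 <= 2)) //; lra.
Qed.

(** 1 - cos x = 2 sin (x / 2)^2, the sine is at least 3 d / 16 by [ger0_sin_lower], and 18 / 256 = 2
    (3 / 16)^2. *)
Lemma cosB1_lower x (d : R) : 0 <= d -> d <= x / 2 -> x / 2 <= pi - d ->
  18 / 256 * d ^+ 2 <= 1 - cos x.
Proof.
move=> d0 dx xd; have P0 := pi_gt0 R; set y := x / 2 in dx xd *.
have -> : 1 - cos x = 2 * sin y ^+ 2.
  have -> : x = y + y by rewrite /y; field.
  by rewrite cosD; have := cos2Dsin2 y; lra.
have : 3 / 16 * d <= sin y.
  have [h|h] := leP y (pi / 2).
    by have := ger0_sin_lower (x := y); rewrite (le_trans d0 dx) h => /(_ isT); lra.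
  have := ger0_sin_lower (x := pi - y); rewrite sinB sinpi cospi mul0r mulN1r sub0r opprK.
  have -> : 0 <= pi - y <= pi / 2 by apply/andP; split; lra.
  by move=> /(_ isT); lra.
move=> h; have : (3 / 16 * d) ^+ 2 <= sin y ^+ 2.
  by rewrite lerXn2r ?nnegrE //; [|apply: le_trans h]; apply: mulr_ge0 => //; lra.
lra.
Qed.

Lemma fvar_expR_lower (x K : R) : `|x| <= K -> expR (- K) / 4 <= fvar x.
Proof.
move=> xK; have e0 := expR_gt0 x; have f0 := expR_gt0 (- x); have k0 := expR_gt0 (- K).
have ef : expR x * expR (- x) = 1 by rewrite -expRD subrr expR0.
have -> : fvar x = (2 + expR x + expR (- x))^-1.
  by rewrite /fvar /fermi expRN; field; rewrite !gt_eqF //; nra.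
have kk : expR K * expR (- K) = 1 by rewrite -expRD subrr expR0.
have h1 : expR x <= expR K by rewrite ler_expR; apply: le_trans xK; exact: ler_norm.
have h2 : expR (- x) <= expR K by rewrite ler_expR; apply: le_trans xK; rewrite -normrN; exact: ler_norm.
have h3 : 1 <= expR K by rewrite -expR0 ler_expR; apply: le_trans xK.
have -> : expR (- K) / 4 = (4 * expR K)^-1 by rewrite invfM expRN mulrC.
by rewrite lef_pV2 ?posrE; lra.
Qed.

Lemma multiple_between (y w : R) : 0 < y -> y <= w -> exists J : nat, w <= J%:R * y <= 2 * w.
Proof.
move=> y0 yw; have w0 : 0 < w by lra.
have wy0 : 0 <= w / y by rewrite divr_ge0 // ltW.
have /andP[m1 m2] := truncn_itv wy0.
move: m1 m2; rewrite ler_pdivlMr // ltr_pdivrMr // => m1 m2.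
exists (Num.truncn (w / y)).+1; rewrite (ltW m2) /= -natr1 mulrDl mul1r; lra.
Qed.

End TrigSums.

Section MinorArc.
Variables (R : realType) (N : nat) (a b : 'I_N).
Hypothesis ab : a != b.

(* At the point [(2 pi a' / N, 2 pi b' / N)] the phase of every part of the class j is
   [2 pi / N] times [character a' b' j] modulo [2 pi]; if the character is trivial, the
   characteristic function behaves there as at the origin. *)
Definition character (a' b' : nat) (j : 'I_N) : int := a'%:Z * j.+1%:Z + b'%:Z * sgn_ a b j.
Definition trivial_character (a' b' : nat) : bool := [forall j, (N%:Z %| character a' b' j)%Z].

Let N1 : 1 <= N%:R :> R. Proof. by rewrite ler1n; case: N a => // -[]. Qed.

Lemma partE n (i : 'I_n) (j : 'I_N) : (part (i, j))%:R = i%:R * N%:R + j.+1%:R :> R.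
Proof. by rewrite /part /= -addnS natrD natrM. Qed.

Lemma cos_phase n (a' b' : nat) (th ph : R) (i : 'I_n) (j : 'I_N) :
  cos (phase a b (2 * pi * a'%:R / N%:R + th) (2 * pi * b'%:R / N%:R + ph) (i, j)) =
  cos (2 * pi * (character a' b' j %% N)%Z%:~R / N%:R + (th * (part (i, j))%:R + ph * eps R a b j)).
Proof.
have N0 : N%:R != 0 :> R by rewrite gt_eqF //; have := N1; lra.
rewrite -[RHS](cos_periodic_int _ (a'%:Z * i%:Z + (character a' b' j %/ N)%Z)); congr cos.
have E : (character a' b' j)%:~R = (character a' b' j %/ N)%Z%:~R * N%:R + (character a' b' j %% N)%Z%:~R :> R.
  by rewrite [in LHS](divz_eq (character a' b' j) N) intrD intrM.
have E2 : (character a' b' j)%:~R = a'%:R * j.+1%:R + b'%:R * eps R a b j :> R.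
  by rewrite /character intrD !intrM.
have -> : (a'%:Z * i%:Z + (character a' b' j %/ N)%Z)%:~R = a'%:R * i%:R + (character a' b' j %/ N)%Z%:~R :> R by rewrite intrD intrM.
rewrite /phase /= partE.
have -> : (character a' b' j %% N)%Z%:~R = a'%:R * j.+1%:R + b'%:R * eps R a b j - (character a' b' j %/ N)%Z%:~R * N%:R :> R.
  by rewrite -E2 E addrAC subrr add0r.
by field.
Qed.

Section Window.
Variables (n : nat) (t : R).
Hypothesis t0 : 0 < t.
Hypothesis tN : (N%:R + 2) * t <= 1.

(** The first J parts of a single class suffice, all other factors having modulus at most 1. The
    parts kept have energies bounded by K + 1, so their variances are bounded below. *)
Lemma normc_charf_window (th ph K : R) (J : nat) (j : 'I_N) (f : nat -> R) : (J <= n)%N -> J%:R * (N%:R * t ^+ 2) <= K ->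
  (forall i : 'I_n, cos (phase a b th ph (i, j)) = f i) ->
  normc (charf a b n t th ph) <= expR (- (expR (- (K + 1)) / 4 * \sum_(i < J) (1 - f i))).
Proof.
move=> Jn JK fE; have T0 := t0; have N1' := N1.
rewrite /charf normc_prod.
pose F (x : 'I_n * 'I_N) : R := fvar (energy a b t x) * (1 - cos (phase a b th ph x)).
have F0 x : 0 <= F x.
  by apply: mulr_ge0; [have /andP[] := fvar_bound (energy a b t x)|rewrite subr_ge0 cos_le1].
apply: (@le_trans _ _ (\prod_x expR (- F x))).
  by apply: ler_prod => x _; rewrite normc_ge0; exact: normc_bern.
rewrite -expR_sum ler_expR sumrN lerN2 sum_model (bigD1 j) //=.
apply: (@le_trans _ _ (\sum_i F (i, j))); last first.
  by rewrite lerDl; apply: sumr_ge0 => j' _; apply: sumr_ge0 => i _; exact: F0.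
rewrite mulr_sumr.
have -> : \sum_(i < J) expR (- (K + 1)) / 4 * (1 - f i) =
   \sum_(i < n | (i < J)%N) expR (- (K + 1)) / 4 * (1 - f i).
  by rewrite (big_ord_widen n (fun i => expR (- (K + 1)) / 4 * (1 - f i)) Jn).
rewrite [leRHS](bigID (fun i : 'I_n => (i < J)%N)) /=.
apply: (@le_trans _ _ (\sum_(i < n | (i < J)%N) F (i, j))); last first.
  by rewrite lerDl; apply: sumr_ge0 => i _; exact: F0.
apply: ler_sum => i iJ; rewrite /F fE; apply: ler_wpM2r; first by rewrite -fE subr_ge0 cos_le1.
apply: fvar_expR_lower; rewrite /energy; apply: le_trans (ler_normB _ _) _; apply: lerD.
  rewrite ger0_norm; last by apply: mulr_ge0; [exact: sqr_ge0|exact: ler0n].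
  apply: le_trans JK.
  rewrite mulrA [leRHS]mulrC ler_wpM2l ?sqr_ge0 // -natrM ler_nat /part /=.
  apply: (@leq_trans (i.+1 * N)); last by rewrite leq_mul2r iJ orbT.
  by rewrite mulSn -addnS addnC leq_add2r.
have e1 := norm_eps_le1 R ab j.
have t1 : `|t| <= 1 by rewrite gtr0_norm //; have := tN; nra.
rewrite normrM /=; apply: (@le_trans _ _ (1 * 1)); last by rewrite mulr1.
by apply: ler_pM.
Qed.

Hypothesis t40 : 40 * t <= 1.
Hypothesis nt : 1 / 3 <= n%:R * t ^+ 4.

Lemma window_le (J : nat) (w : R) : w <= 172 -> J%:R * (N%:R * t ^+ 2) <= 2 * w -> (J <= n)%N.
Proof.
move=> w1 Jw; have T0 := t0; have tt : 0 < t ^+ 2 by rewrite exprn_gt0.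
rewrite -(ler_nat R) -(ler_pM2r (exprn_gt0 4 t0)); apply: le_trans nt.
have h1 : J%:R * t ^+ 2 <= 344.
  apply: (@le_trans _ _ (J%:R * (N%:R * t ^+ 2))); last by lra.
  by apply: ler_wpM2l => //; rewrite ler_peMl // ?ltW // N1.
have -> : J%:R * t ^+ 4 = J%:R * t ^+ 2 * t ^+ 2 by ring.
have h2 : 40 * 40 * t ^+ 2 <= 1 by have := t40; nra.
have := ler_wpM2r (ltW tt) h1; lra.
Qed.

(** Along one class the phase advances by N th from part to part. Over a window of length comparable
    with t^-2 the Dirichlet kernel then beats the trivial bound for the sum of cosines. *)
Lemma minor_arc_far (th ph : R) (a' b' : nat) : t ^+ 2 / 8 <= `|th| -> `|th| <= pi / N%:R ->
  normc (charf a b n t (2 * pi * a'%:R / N%:R + th) (2 * pi * b'%:R / N%:R + ph)) <=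
  expR (- (expR (- 345) / (4 * N%:R) / t ^+ 2)).
Proof.
move=> th0 thpi; have T0 := t0; have N0 : 0 < N%:R :> R by have := N1; lra.
have tt : 0 < t ^+ 2 by rewrite exprn_gt0.
have y0 : 0 < N%:R * t ^+ 2 by apply: mulr_gt0.
have yw : N%:R * t ^+ 2 <= 172.
  have : N%:R * t <= 1 by have := tN; nra.
  have := t40; rewrite expr2 mulrA; nra.
(* The cosine sum will be at most 256 / (3 N t^2), and the window has at least 172 / (N t^2) terms,
   so at least 1 / (N t^2) remains. The energies are bounded by 2 * 172 + 1 = 345. *)
have [J /andP[J1 J2]] := multiple_between y0 yw.
have Jn := window_le (lexx _) J2.
pose r : R := (character a' b' a %% N)%Z%:~R.
pose base := 2 * pi * r / N%:R + th * a.+1%:R + ph * eps R a b a.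
have fE (i : 'I_n) : cos (phase a b (2 * pi * a'%:R / N%:R + th) (2 * pi * b'%:R / N%:R + ph) (i, a)) =
   cos (base + i%:R * (N%:R * th)).
  by rewrite cos_phase partE /base -/r; congr cos; ring.
apply: le_trans (@normc_charf_window _ _ (2 * 172) J a (fun i => cos (base + i%:R * (N%:R * th))) Jn J2 fE) _.
rewrite ler_expR lerN2.
have -> : 2 * 172 + 1 = 345 :> R by ring.
set S := \sum_(i < J) _.
have E0 := expR_gt0 (- 345 : R).
suff S1 : (N%:R * t ^+ 2)^-1 <= S.
  have -> : expR (- 345) / (4 * N%:R) / t ^+ 2 = expR (- 345) / 4 * (N%:R * t ^+ 2)^-1.
    by field; rewrite !gt_eqF.
  by apply: ler_wpM2l; [apply: divr_ge0; [exact: ltW|exact: ler0n]|exact: S1].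
have SE : S = J%:R - \sum_(i < J) cos (base + i%:R * (N%:R * th)).
  by rewrite /S sumrB sumr_const card_ord.
have C := norm_sum_cos_le base (N%:R * th) J.
set T := \sum_(i < J) _ in SE C.
have s1 : 3 / 16 * (N%:R * (t ^+ 2 / 8) / 2) <= `|sin (N%:R * th / 2)|.
  apply: le_trans (norm_sin_lower _); last first.
    rewrite !normrM (gtr0_norm N0) (ger0_norm (_ : 0 <= 2^-1)) ?invr_ge0 //.
    by rewrite ler_wpM2r ?invr_ge0 // mulrC -ler_pdivlMr.
  rewrite !normrM (gtr0_norm N0) (ger0_norm (_ : 0 <= 2^-1)) ?invr_ge0 //.
  by rewrite ler_wpM2l // ler_wpM2r ?invr_ge0 // ler_wpM2l // ltW.
have yT : 3 / 256 * (N%:R * t ^+ 2) * `|T| <= 1.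
  apply: le_trans C; rewrite mulrC; apply: ler_wpM2l => //; apply: le_trans s1.
  by rewrite le_eqVlt; apply/orP; left; apply/eqP; field.
rewrite -(ler_pM2l y0) divff ?gt_eqF // SE.
have TT := ler_norm T.
set y := N%:R * t ^+ 2 in y0 yw J1 J2 yT *.
have : y * T <= y * `|T| by rewrite ler_wpM2l // ltW.
rewrite mulrBr; lra.
Qed.

Hypothesis tN2 : 2 * N%:R * t <= 1.
Let N2 : 2 <= N%:R :> R.
Proof.
rewrite ler_nat leqNgt; apply/negP => h; move/eqP: ab; apply; apply/val_inj => /=.
by move: (ltn_ord a) (ltn_ord b); rewrite !ltnS in h *; move: (val a) (val b) => x y; lia.
Qed.

(** Half of the total angle keeps the distance 1 / (32 N) from the multiples of pi: either r is a
    nonzero residue and the perturbation is too small to compensate it, or y alone is bounded away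
    from 0 and from a full turn. *)
Lemma cosB1_near (x y : R) (r : int) : 0 <= r < N%:Z -> `|x| <= (8 * N%:R)^-1 -> `|y| <= pi / N%:R ->
  (r != 0 \/ (r = 0 /\ 1 / 8 <= `|y|)) ->
  18 / 256 * (32 * N%:R)^-1 ^+ 2 <= 1 - cos (2 * pi * r%:~R / N%:R + (x + y)).
Proof.
move=> /andP[r0 rN] hx hy hr; have N2' := N2; have N0 : 0 < N%:R :> R by lra.
have P2 := pi_ge2 R; have P0 : 0 < pi :> R by lra.
have q0 : 0 < N%:R^-1 :> R by rewrite invr_gt0.
have q2 : N%:R^-1 <= 2^-1 :> R by rewrite lef_pV2 ?posrE.
have Nq : N%:R * N%:R^-1 = 1 :> R by rewrite divff // gt_eqF.
move: hx hy; rewrite !invfM; set q := N%:R^-1 in q0 q2 Nq * => hx hy.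
have pq : 2 * q <= pi * q by rewrite ler_wpM2r // ltW.
have d0 : 0 <= 32^-1 * q by apply: mulr_ge0; lra.
case: hr => [rn0|[-> hy8]].
  have r1 : 1 <= r%:~R :> R by rewrite ler1z -gtz0_ge1 lt_neqAle eq_sym rn0.
  have r2 : r%:~R <= N%:R - 1 :> R by rewrite lerBrDr (_ : r%:~R + 1 = (r + 1)%:~R :> R); [rewrite [leRHS]pmulrn ler_int lezD1|rewrite intrD].
  have e1 : pi * q <= pi * q * r%:~R by rewrite ler_peMr // mulr_ge0 // ltW.
  have e2 : pi * q * r%:~R <= pi - pi * q.
    have := ler_wpM2l (mulr_ge0 (ltW P0) (ltW q0)) r2.
    have -> : pi * q * (N%:R - 1) = pi * (N%:R * q) - pi * q by ring.
    by rewrite Nq mulr1.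
  have -> : 2 * pi * r%:~R * q = 2 * (pi * q * r%:~R) by ring.
  move: hx hy; rewrite !ler_norml => /andP[? ?] /andP[? ?].
  by apply: cosB1_lower => //; lra.
rewrite mulr0 mul0r add0r (_ : cos (x + y) = cos `|x + y|); last by case: (ger0P (x + y)) => //; rewrite cosN.
have h1 : 1 / 16 <= `|x + y|.
  have := lerB_dist y (- x); rewrite opprK normrN [y + x]addrC; lra.
have h2 : `|x + y| <= pi / 2 + 1 / 16.
  apply: le_trans (ler_normD _ _) _.
  have : pi * q <= pi * 2^-1 by rewrite ler_wpM2l // ltW.
  lra.
by apply: cosB1_lower => //; lra.
Qed.

Lemma minor_arc_near (th ph : R) (a' b' : nat) : `|th| <= t ^+ 2 / 8 -> `|ph| <= pi / N%:R ->
  ~~ trivial_character a' b' \/ (trivial_character a' b' /\ 1 / 8 <= `|ph|) ->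
  normc (charf a b n t (2 * pi * a'%:R / N%:R + th) (2 * pi * b'%:R / N%:R + ph)) <=
  expR (- (expR (- 2) / 4 * (18 / 256 * (32 * N%:R)^-1 ^+ 2) / (2 * N%:R ^+ 2) / t ^+ 2)).
Proof.
move=> hth hph hK; have T0 := t0; have N2' := N2; have N0 : 0 < N%:R :> R by lra.
have tt : 0 < t ^+ 2 by rewrite exprn_gt0.
have y0 : 0 < N%:R * t ^+ 2 by apply: mulr_gt0.
have yw : N%:R * t ^+ 2 <= (2 * N%:R)^-1.
  rewrite -(ler_pM2l (_ : 0 < 2 * N%:R)) ?divff ?gt_eqF //; try lra.
  have := tN2; have : 0 < N%:R * t by apply: mulr_gt0.
  have -> : 2 * N%:R * (N%:R * t ^+ 2) = 2 * ((N%:R * t) * (N%:R * t)) by ring.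
  by rewrite -mulrA; move: (N%:R * t) => u; nra.
(* The window is short: J N t^2 <= 1 / N keeps the phases due to th below 1 / (8 N). *)
have [J /andP[J1 J2]] := multiple_between y0 yw.
have w172 : (2 * N%:R)^-1 <= 172 :> R.
  apply: (@le_trans _ _ 1); last by rewrite ler1n.
  by rewrite invf_le1; lra.
have Jn := window_le w172 J2.
have Jq : J%:R * (N%:R * t ^+ 2) <= N%:R^-1.
  by apply: le_trans J2 _; rewrite invfM mulrA divff // mul1r.
have J1' : J%:R * (N%:R * t ^+ 2) <= 1 by apply: le_trans Jq _; rewrite invf_le1; lra.
pose w : R := 18 / 256 * (32 * N%:R)^-1 ^+ 2.
(* The class that produces the decay is one on which the character is nontrivial, or else the class
   of [a], where the sign 1 turns ph into a phase. *)
have [j hj] : exists j, (character a' b' j %% N)%Z != 0 \/ ((character a' b' j %% N)%Z = 0 /\ 1 / 8 <= `|ph * eps R a b j|).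
  case: hK => [/forallPn [j /negP hj]|[/forallP hK h8]].
    by exists j; left; apply/negP => /eqP h; apply: hj; apply/dvdz_mod0P.
  by exists a; right; split; [apply/dvdz_mod0P|rewrite eps_a // mulr1].
have key (i : 'I_n) : (i < J)%N -> w <= 1 - cos (phase a b (2 * pi * a'%:R / N%:R + th) (2 * pi * b'%:R / N%:R + ph) (i, j)).
  move=> iJ; rewrite cos_phase; apply: cosB1_near => //.
  - by rewrite modz_ge0 ?ltz_pmod // ?lt0r; case: N a => // -[].
  - rewrite normrM normr_nat; apply: (@le_trans _ _ (t ^+ 2 / 8 * (part (i, j))%:R)).
      by rewrite ler_wpM2r.
    have h : t ^+ 2 * (part (i, j))%:R <= J%:R * (N%:R * t ^+ 2) :> R.
      rewrite mulrA [leRHS]mulrC ler_wpM2l ?sqr_ge0 // -natrM ler_nat /part /=.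
      apply: (@leq_trans (i.+1 * N)); last by rewrite leq_mul2r iJ orbT.
      by rewrite mulSn -addnS addnC leq_add2r.
    have := le_trans h Jq; rewrite invfM; lra.
  - rewrite normrM; apply: le_trans hph; rewrite ler_piMr //; exact: norm_eps_le1.
(* The window lemma takes a function on all of nat; the default 0 is never met, as J <= n. *)
pose f k : R := if insub k is Some i then cos (phase a b (2 * pi * a'%:R / N%:R + th) (2 * pi * b'%:R / N%:R + ph) ((i : 'I_n), j)) else 0.
have fE (i : 'I_n) : cos (phase a b (2 * pi * a'%:R / N%:R + th) (2 * pi * b'%:R / N%:R + ph) (i, j)) = f i.
  by rewrite /f valK.
apply: le_trans (normc_charf_window Jn J1' fE) _.
rewrite ler_expR lerN2 -/w.
have e2 : expR (- (1 + 1)) = expR (- 2) :> R by congr (expR (- _)); lra.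
rewrite e2.
have -> : expR (- 2) / 4 * w / (2 * N%:R ^+ 2) / t ^+ 2 = expR (- 2) / 4 * (w / (2 * N%:R ^+ 2) / t ^+ 2).
  by field; rewrite !gt_eqF.
apply: ler_wpM2l; first by apply: divr_ge0 => //; exact: expR_ge0.
have w0 : 0 <= w by exact: mulr_ge0 (divr_ge0 (ler0n _ _) (ler0n _ _)) (sqr_ge0 _).
apply: (@le_trans _ _ (\sum_(i < J) w)).
  rewrite [leRHS](_ : _ = w * J%:R); last by rewrite sumr_const card_ord mulr_natr.
  rewrite -[leLHS]mulrA; apply: ler_wpM2l => //.
  rewrite -invfM -(ler_pM2r y0); apply: le_trans J1.
  by rewrite le_eqVlt; apply/orP; left; apply/eqP; field; rewrite !gt_eqF.
apply: ler_sum => i _; have iJ := ltn_ord i.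
have := key (widen_ord Jn i) iJ; by rewrite fE.
Qed.

End Window.

Lemma minor_arc (ell : R) : 1 / 3 <= ell -> exists c t1 : R, [/\ 0 < c, 0 < t1 &
  forall (t : R) (n : nat), 0 < t <= t1 -> n%:R * t ^+ 4 = ell ->
  forall (th ph : R) (a' b' : nat), `|th| <= pi / N%:R -> `|ph| <= pi / N%:R ->
  [\/ t ^+ 2 / 8 <= `|th|, ~~ trivial_character a' b' | 1 / 8 <= `|ph|] ->
  normc (charf a b n t (2 * pi * a'%:R / N%:R + th) (2 * pi * b'%:R / N%:R + ph)) <=
  expR (- (c / t ^+ 2))].
Proof.
move=> ell3; have N1' := N1; have N0 : 0 < N%:R :> R by lra.
have E1 := expR_gt0 (- 345 : R); have E2 := expR_gt0 (- 2 : R).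
have [C1 C10 H1] : exists2 C1, 0 < C1 & C1 = expR (- 345) / (4 * N%:R) :> R.
  by eexists; last reflexivity; apply: divr_gt0 => //; apply: mulr_gt0.
have [C2 C20 H2] : exists2 C2, 0 < C2 & C2 = expR (- 2) / 4 * (18 / 256 * (32 * N%:R)^-1 ^+ 2) / (2 * N%:R ^+ 2) :> R.
  eexists; last reflexivity; apply: divr_gt0; last by apply: mulr_gt0 => //; exact: exprn_gt0.
  apply: mulr_gt0; first exact: divr_gt0.
  by apply: mulr_gt0; [lra|apply: exprn_gt0; rewrite invr_gt0; exact: mulr_gt0].
exists (Num.min C1 C2), (Num.min (1 / 40) (Num.min (1 / (N%:R + 2)) (1 / (2 * N%:R)))); split.
- by rewrite lt_min C10.
- by rewrite !lt_min !divr_gt0 //; lra.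
move=> t n /andP[t0]; rewrite !le_min => /and3P[h40 hN hN2] nt th ph a' b' hth hph cases.
have t40 : 40 * t <= 1 by lra.
have tN : (N%:R + 2) * t <= 1 by move: hN; rewrite ler_pdivlMr; [rewrite mulrC|lra].
have tN2 : 2 * N%:R * t <= 1 by move: hN2; rewrite ler_pdivlMr; [rewrite mulrC|lra].
have nt3 : 1 / 3 <= n%:R * t ^+ 4 by rewrite nt.
have tt : 0 < (t ^+ 2)^-1 by rewrite invr_gt0 exprn_gt0.
have fin C : Num.min C1 C2 <= C -> expR (- (C / t ^+ 2)) <= expR (- (Num.min C1 C2 / t ^+ 2)).
  by move=> h; rewrite ler_expR lerN2 ler_wpM2r // ltW.
have [h|h] := leP (t ^+ 2 / 8) `|th|.
  apply: le_trans (@minor_arc_far n t t0 tN t40 nt3 th ph a' b' h hth) _.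
  by rewrite -H1; apply: fin; rewrite ge_min lexx.
apply: (@le_trans _ _ (expR (- (C2 / t ^+ 2)))); last by apply: fin; rewrite ge_min lexx orbT.
rewrite H2; apply: (@minor_arc_near n t t0 tN t40 nt3 tN2 th ph a' b' (ltW h) hph).
case: cases => [h'|h'|h']; [by move: h; rewrite ltNge h'|by left|].
by case: (boolP (trivial_character a' b')) => h2; [right|left].
Qed.

End MinorArc.

(** * Gaussian integrals *)

Section GaussTail.
Variable R : realType.
Implicit Types x y a : R.

Definition gauss_tail x : R := \int[lebesgue_measure]_(t in `[x, +oo[) expR (- (t ^+ 2)).

Let g x : R := expR (- (x ^+ 2)).

Let g_le x : g x <= 2 * expR (- x).
Proof.
apply: (@le_trans _ _ (expR (1 / 2) * expR (- x))).
  by rewrite -expRD ler_expR; have := sqr_ge0 (x - 1 / 2); lra.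
by rewrite ler_wpM2r ?expR_ge0 // expR_half_le2.
Qed.

Let cg : continuous g.
Proof. by move=> x; exact: continuous_gauss_fun. Qed.

Let primitive_incr (F : R -> R) a : (forall x, a < x -> is_derive x (1 : R) F (g x)) ->
  forall x y, a < x -> x <= y -> 0 <= F y - F x <= 2 * expR (- x).
Proof.
move=> dF x y ax xy; apply/andP; split.
  rewrite subr_ge0; apply: (ge0_derive_le xy (g := g)) => z /andP[xz _]; last exact: expR_ge0.
  by apply: dF; exact: lt_le_trans xz.
have : - 2 * expR (- x) - F x <= - 2 * expR (- y) - F y.
  apply: (ge0_derive_le xy (f := fun z => - 2 * expR (- z) - F z) (g := fun z => 2 * expR (- z) - g z)) => z /andP[xz _].
    have dFz := dF _ (lt_le_trans ax xz).
    by dv; ring.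
  by rewrite subr_ge0.
have := expR_ge0 (- y); lra.
Qed.

(** A primitive on (a, oo) together with its limit yields the derivative and the bound at once; as a
    is arbitrary, every point is reached. *)
Lemma gauss_tail_primitive a : exists (F : R -> R) (l : R),
  [/\ forall x, a < x -> is_derive x (1 : R) F (expR (- (x ^+ 2))),
      forall x, a < x -> gauss_tail x = l - F x &
      forall x, a < x -> 0 <= l - F x <= 2 * expR (- x)].
Proof.
have [F dF] := continuous_primitive a cg; have incr := primitive_incr dF.
(* The argument is clamped because [F] is known to be monotone only to the right of a, whereas the
   convergence theorem asks for a function monotone on the whole line. *)
pose G y := F (Num.max y (a + 1)).
have a1 y : a < Num.max y (a + 1) by rewrite lt_max ltrDl ltr01 orbT.
have ndG : nondecreasing_fun G.
  move=> y z yz; have m : Num.max y (a + 1) <= Num.max z (a + 1).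
    by rewrite ge_max !le_max yz lexx orbT.
  by have /andP[+ _] := incr _ _ (a1 y) m; rewrite subr_ge0.
have Gb y : G y <= F (a + 1) + 2 * expR (- (a + 1)).
  have /andP[_] := incr (a + 1) (Num.max y (a + 1)) ltac:(by rewrite ltrDl) ltac:(by rewrite le_max lexx orbT).
  by rewrite /G; lra.
have ubG : has_ubound (range G).
  by exists (F (a + 1) + 2 * expR (- (a + 1))) => _ [y _ <-].
have Gl := nondecreasing_cvgr ndG ubG; set l := sup _ in Gl.
have Fl : F y @[y --> +oo] --> l.
  apply: cvg_trans Gl; apply: near_eq_cvg; near=> y.
  by rewrite /G max_l //; near: y; apply: nbhs_pinfty_ge; rewrite num_real.
exists F, l; split=> // x ax.
- have cF z : a < z -> {for z, continuous F} by move=> az; exact: (is_derive_continuous (dF _ az)).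
  apply: Rintegral_ge0_continuous_FTC2y => //.
  + by apply: continuous_subspaceT; exact: cg.
  + by move=> z xz; have h := dF _ (lt_trans ax xz); exact: ex_derive.
  + by apply: cvg_at_right_filter; exact: cF.
  + move=> z; rewrite in_itv /= andbT => xz; have h := dF _ (lt_trans ax xz).
    by rewrite derive1E; exact: derive_val.
- have xm y : Num.max y (a + 1) <= x \/ x <= Num.max y (a + 1) by case: (leP (Num.max y (a + 1)) x) => h; [left|right; exact: ltW].
  apply/andP; split.
    rewrite subr_ge0; apply: (@le_trans _ _ (G x)); last by apply: ub_le_sup => //; exists x.
    by have /andP[+ _] := incr x (Num.max x (a + 1)) ax ltac:(by rewrite le_max lexx); rewrite subr_ge0.
  rewrite lerBlDl; apply: ge_sup; first by exists (G 0), 0.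
  move=> _ [y _ <-]; rewrite /G; case: (xm y) => h.
    by have /andP[+ _] := incr _ _ (a1 y) h; rewrite subr_ge0; have := expR_ge0 (- x); lra.
  by have /andP[_] := incr _ _ ax h; lra.
Unshelve. all: by end_near. Qed.

Lemma is_derive_gauss_tail x : is_derive x (1 : R) gauss_tail (- expR (- (x ^+ 2))).
Proof.
have [F [l [dF FE _]]] := gauss_tail_primitive (x - 1).
have x1 : x - 1 < x by lra.
have dG : is_derive x (1 : R) (fun z => l - F z) (- expR (- (x ^+ 2))).
  by have h := dF _ x1; dv; ring.
have E : \forall z \near x, l - F z = gauss_tail z.
  by near=> z; rewrite FE //; near: z; exact: lt_nbhsr.
exact: (near_eq_is_derive E dG).
Unshelve. all: by end_near. Qed.

Lemma gauss_tail_bound x : 0 <= gauss_tail x <= 2 * expR (- x).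
Proof.
have [F [l [_ FE Fb]]] := gauss_tail_primitive (x - 1).
by rewrite FE ?Fb //; lra.
Qed.

Lemma gauss_tail0 : gauss_tail 0 = Num.sqrt pi / 2.
Proof.
by rewrite /gauss_tail /Rintegral integral0y_gauss.
Qed.
End GaussTail.

(** * Integral estimates through increments of primitives *)

Section Integrals.
Variable R : realType.
Implicit Types (x y s eta : R) (F G : R -> R).

(** The integral of [f] is dominated by the integral of its majorant [e]; both appear only as
    increments of primitives. *)
Lemma norm_increment_le F (f E e : R -> R) x0 x1 : x0 <= x1 ->
  (forall x, x0 <= x <= x1 -> is_derive x (1 : R) F (f x)) ->
  (forall x, x0 <= x <= x1 -> is_derive x (1 : R) E (e x)) ->
  (forall x, x0 <= x <= x1 -> `|f x| <= e x) ->
  `|F x1 - F x0| <= E x1 - E x0.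
Proof.
move=> x01 dF dE fe; rewrite ler_norml; apply/andP; split.
  have : E x0 + F x0 <= E x1 + F x1.
    apply: (ge0_derive_le x01 (f := fun x => E x + F x) (g := fun x => e x + f x)) => x hx.
      by have h1 := dF x hx; have h2 := dE x hx; dv.
    by have := fe x hx; rewrite ler_norml => /andP[]; lra.
  lra.
have : E x0 - F x0 <= E x1 - F x1.
  apply: (ge0_derive_le x01 (f := fun x => E x - F x) (g := fun x => e x - f x)) => x hx.
    by have h1 := dF x hx; have h2 := dE x hx; dv.
  by have := fe x hx; rewrite ler_norml => /andP[]; lra.
lra.
Qed.

(** The increment over a rectangle is the integral of the mixed derivative. The majorant is a
    product, so its integral is a product of two increments. *)
Lemma rect_increment_le (F Fy Fxy : R -> R -> R) (E1 e1 E2 e2 : R -> R) x0 x1 y0 y1 :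
  x0 <= x1 -> y0 <= y1 ->
  (forall x y, x0 <= x <= x1 -> y0 <= y <= y1 -> is_derive y (1 : R) (F x) (Fy x y)) ->
  (forall x y, x0 <= x <= x1 -> y0 <= y <= y1 -> is_derive x (1 : R) (Fy ^~ y) (Fxy x y)) ->
  (forall x, x0 <= x <= x1 -> is_derive x (1 : R) E1 (e1 x)) ->
  (forall y, y0 <= y <= y1 -> is_derive y (1 : R) E2 (e2 y)) ->
  (forall y, y0 <= y <= y1 -> 0 <= e2 y) ->
  (forall x y, x0 <= x <= x1 -> y0 <= y <= y1 -> `|Fxy x y| <= e1 x * e2 y) ->
  `|(F x1 y1 - F x0 y1) - (F x1 y0 - F x0 y0)| <= (E1 x1 - E1 x0) * (E2 y1 - E2 y0).
Proof.
move=> x01 y01 dFy dFxy dE1 dE2 e20 bF; rewrite mulrBr.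
have xx0 : x0 <= x0 <= x1 by rewrite lexx.
have xx1 : x0 <= x1 <= x1 by rewrite lexx andbT.
apply: (norm_increment_le (F := fun y => F x1 y - F x0 y) (f := fun y => Fy x1 y - Fy x0 y)
  (E := fun y => (E1 x1 - E1 x0) * E2 y) (e := fun y => (E1 x1 - E1 x0) * e2 y) y01) => y hy.
- by have h1 := dFy x1 y xx1 hy; have h0 := dFy x0 y xx0 hy; dv.
- by have h := dE2 y hy; dv; ring.
- rewrite mulrBl.
  apply: (norm_increment_le (F := Fy ^~ y) (f := Fxy ^~ y) (E := fun x => E1 x * e2 y) (e := fun x => e1 x * e2 y) x01) => x hx.
  + exact: dFxy.
  + by have h := dE1 x hx; dv; ring.
  + exact: bF.
Qed.

(* [\int_0^x expR (- (a * y) ^+ 2) dy]. *)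
Definition gint (a x : R) : R := (Num.sqrt pi / 2 - gauss_tail (a * x)) / a.

Lemma is_derive_gint (a x : R) : 0 < a -> is_derive x (1 : R) (gint a) (expR (- ((a * x) ^+ 2))).
Proof.
move=> a0; have h := is_derive_gauss_tail (a * x).
have dax : is_derive x (1 : R) (fun z => a * z) a by dv; ring.
have h2 := dv_comp h dax.
rewrite /gint; apply: (@is_derive_ext _ (fun z => (Num.sqrt pi / 2 - gauss_tail (a * z)) * a^-1) _ x ((0 - - expR (- (a * x) ^+ 2) * a) * a^-1)) => //.
  by field; rewrite gt_eqF.
by dv; ring.
Qed.

Lemma gint0 (a : R) : gint a 0 = 0.
Proof. by rewrite /gint mulr0 gauss_tail0 subrr mul0r. Qed.

Lemma sqrt_pi_le2 : 0 < (Num.sqrt pi : R) <= 2.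
Proof.
rewrite sqrtr_gt0 pi_gt0 /= -(@ler_pXn2r _ 2) ?nnegrE ?sqrtr_ge0 // sqr_sqrtr ?pi_ge0 //.
by have := pi_lt4 R; lra.
Qed.

Lemma gint_bound (a x : R) : 0 < a -> 0 <= x -> gint a x <= a^-1.
Proof.
move=> a0 x0; rewrite /gint -[leRHS]mul1r ler_wpM2r ?invr_ge0 ?(ltW a0) //.
have /andP[h _] := gauss_tail_bound (a * x); have /andP[_ s] := sqrt_pi_le2; lra.
Qed.

Lemma gint_limit (a x : R) : 0 < a -> 0 <= x ->
  `|gint a x - Num.sqrt pi / (2 * a)| <= 2 / a * expR (- (a * x)).
Proof.
move=> a0 x0; have /andP[h0 h1] := gauss_tail_bound (a * x).
have -> : gint a x - Num.sqrt pi / (2 * a) = - (gauss_tail (a * x) / a).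
  by rewrite /gint; field; rewrite gt_eqF.
rewrite normrN ger0_norm; last by rewrite divr_ge0 // ltW.
by rewrite mulrAC ler_wpM2r // invr_ge0 ltW.
Qed.

(** Let f x be e^(s x^2 / 2) times the integral of e^(- y^2 / (2 s)) cos (x y) over [0, eta]. The
    x-derivative of the integrand is the y-derivative of [w], so f' x is the boundary value
    [w x eta], which carries the factor e^(- eta^2 / (2 s)). [quadratic_increments] takes the place
    of differentiation under the integral sign. *)
Lemma gauss_cos_integral (s eta X : R) F G : 0 < s -> 0 <= eta ->
  (forall y, 0 <= y <= eta -> is_derive y (1 : R) F (expR (- (y ^+ 2 / (2 * s))))) ->
  (forall y, 0 <= y <= eta -> is_derive y (1 : R) G (expR (- (y ^+ 2 / (2 * s))) * cos (X * y))) ->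
  `|(G eta - G 0) - expR (- (s * X ^+ 2 / 2)) * (F eta - F 0)| <= `|X| * s * expR (- (eta ^+ 2 / (2 * s))).
Proof.
move=> s0 eta0 dF; wlog X0 : X / 0 <= X.
  move=> H dG; have [X0|X0] := leP 0 X; first exact: H.
  have := H (- X); rewrite sqrrN normrN; apply; first lra.
  by move=> y hy; rewrite mulNr cosN; exact: dG.
move=> dG; rewrite (ger0_norm X0).
pose q x y := s * x ^+ 2 / 2 - y ^+ 2 / (2 * s).
pose u x y := expR (q x y) * cos (x * y).
pose u1 x y := expR (q x y) * (s * x * cos (x * y) - y * sin (x * y)).
pose u2 x y := expR (q x y) * (s * x * (s * x * cos (x * y) - y * sin (x * y)) +
   (s * cos (x * y) - s * x * y * sin (x * y) - y ^+ 2 * cos (x * y))).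
pose w x y := s * (expR (q x y) * sin (x * y)).
have s_neq0 : s != 0 by rewrite gt_eqF.
have du x y : is_derive x (1 : R) (u ^~ y) (u1 x y).
  by rewrite /u /u1 /q; dv; field; rewrite ?gt_eqF.
have du1 x y : is_derive x (1 : R) (u1 ^~ y) (u2 x y).
  by rewrite /u1 /u2 /q; dv; field; rewrite ?gt_eqF.
have dw x y : is_derive y (1 : R) (w x) (u1 x y).
  by rewrite /w /u1 /q; dv; field; rewrite ?gt_eqF.
have cu x : continuous (u x).
  move=> y; have h : is_derive y (1 : R) (u x) (expR (q x y) * (- y / s * cos (x * y) - x * sin (x * y))).
    by rewrite /u /q; dv; field; rewrite ?gt_eqF.
  exact: (is_derive_continuous h).
have [H dH] : exists H : R -> R -> R, forall x y, -1 < y -> is_derive y (1 : R) (H x) (u x y).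
  have [H dH] := (@choice R (R -> R) (fun x F => forall y, -1 < y -> is_derive y (1 : R) F (u x y)) (fun x => continuous_primitive (-1) (cu x))).
  by exists H.
pose f x := H x eta - H x 0.
pose M := expR (s * X ^+ 2 / 2) * ((s * X + eta) ^+ 2 + s).
have qb x y : 0 <= x <= X -> expR (q x y) <= expR (s * X ^+ 2 / 2).
  move=> /andP[x0 xX]; rewrite ler_expR /q.
  have : x ^+ 2 <= X ^+ 2 by rewrite lerXn2r ?nnegrE.
  have : 0 <= y ^+ 2 / (2 * s) by rewrite divr_ge0 ?sqr_ge0 // mulr_ge0 // ltW.
  nra.
have u2b x y : 0 <= x <= X -> 0 <= y <= eta -> `|u2 x y| <= M.
  move=> hx hy; rewrite /u2 normrM (ger0_norm (expR_ge0 _)); apply: ler_pM => //; [exact: qb|].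
  have c1 := norm_cos_le1 (x * y); have c2 := norm_sin_le1 (x * y).
  set C := cos _ in c1 *; set S := sin _ in c2 *.
  case/andP: hx => x0 xX; case/andP: hy => y0 ye.
  have sx0 : 0 <= s * x by rewrite mulr_ge0 // ltW.
  have -> : s * x * (s * x * C - y * S) + (s * C - s * x * y * S - y ^+ 2 * C) =
     ((s * x) ^+ 2 + s - y ^+ 2) * C - 2 * (s * x * y) * S by ring.
  have sxy0 : 0 <= s * x * y by rewrite mulr_ge0.
  have : ((s * x) ^+ 2 + s + y ^+ 2) + 2 * (s * x * y) <= (s * X + eta) ^+ 2 + s.
    have : (s * x + y) ^+ 2 <= (s * X + eta) ^+ 2.
      rewrite lerXn2r ?nnegrE ?addr_ge0 ?mulr_ge0 // ?(ltW s0) //.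
      by apply: lerD => //; rewrite ler_wpM2l // ltW.
    by rewrite sqrrD; lra.
  apply: le_trans; apply: le_trans (ler_normB _ _) _; apply: lerD.
    rewrite normrM -[leRHS]mulr1; apply: ler_pM => //.
    have h1 := sqr_ge0 (s * x); have h2 := sqr_ge0 y; rewrite ler_norml; apply/andP; split; lra.
  rewrite normrM -[leRHS]mulr1; apply: ler_pM => //.
  by rewrite ger0_norm // mulr_ge0.
pose e := s * (expR (s * X ^+ 2 / 2) * expR (- (eta ^+ 2 / (2 * s)))).
have wb x : 0 <= x <= X -> `|w x eta| <= e.
  move=> /andP[x0 xX]; rewrite /w /e normrM (gtr0_norm s0) ler_wpM2l ?(ltW s0) //.
  rewrite normrM (ger0_norm (expR_ge0 _)) -[leRHS]mulr1; apply: ler_pM => //; [|exact: norm_sin_le1].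
  rewrite -expRD ler_expR /q; have : x ^+ 2 <= X ^+ 2 by rewrite lerXn2r ?nnegrE.
  nra.
have w0 x : w x 0 = 0 by rewrite /w mulr0 sin0 !mulr0.
have inc : `|f X - f 0| <= e * (X - 0).
  apply: (@quadratic_increments _ f (M * eta) e 0 X X0) => x y x0 xy yX.
  have hx : 0 <= x <= X by rewrite x0 (le_trans xy yX).
  pose K z := H y z - H x z - (y - x) * w x z.
  have -> : f y - f x = (K eta - K 0) + (y - x) * w x eta.
    by rewrite /K /f w0; ring.
  apply: le_trans (ler_normD _ _) _; apply: lerD; last first.
    by rewrite normrM ger0_norm ?subr_ge0 // mulrC ler_wpM2r ?subr_ge0 // wb.
  have -> : M * eta * (y - x) ^+ 2 = M * (y - x) ^+ 2 * eta - M * (y - x) ^+ 2 * 0 by ring.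
  apply: (norm_increment_le (F := K) (f := fun z => u y z - u x z - (y - x) * u1 x z)
    (E := fun z => M * (y - x) ^+ 2 * z) (e := fun=> M * (y - x) ^+ 2) eta0) => z hz.
  - have z1 : -1 < z by case/andP: hz; lra.
    by rewrite /K; have h1 := dH y z z1; have h2 := dH x z z1; have h3 := dw x z; dv; ring.
  - by dv; ring.
  - apply: (@taylor1_bound _ (u ^~ z) (u1 ^~ z) (u2 ^~ z) M x y) => v hv.
    move: hv; rewrite (min_l xy) (max_r xy) => /andP[v1 v2]; apply: u2b => //.
    by rewrite (le_trans x0 v1) (le_trans v2 yX).
have eqd (F1 F2 g : R -> R) : (forall y, 0 <= y <= eta -> is_derive y (1 : R) F1 (g y)) ->
   (forall y, 0 <= y <= eta -> is_derive y (1 : R) F2 (g y)) -> F1 eta - F1 0 = F2 eta - F2 0.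
  move=> d1 d2; have := norm_increment_le (F := fun y => F1 y - F2 y) (f := fun=> 0) (E := fun=> 0) (e := fun=> 0) eta0.
  move=> /(_ _ _ _); rewrite subrr => h; apply/eqP; rewrite -subr_eq0.
  rewrite (_ : F1 eta - F1 0 - (F2 eta - F2 0) = F1 eta - F2 eta - (F1 0 - F2 0)); last by ring.
  rewrite -normr_le0; apply: h => [y hy|y _]; [by have h1 := d1 y hy; have h2 := d2 y hy; dv; ring|by rewrite normr0].
have f0 : f 0 = F eta - F 0.
  apply: eqd dF => y /andP[y0 _]; have y1 : -1 < y by lra.
  have := dH 0 y y1; rewrite /u /q mul0r cos0 mulr1 expr0n /= mulr0 mul0r sub0r //.
have fX : f X = expR (s * X ^+ 2 / 2) * (G eta - G 0).
  pose G2 y := expR (s * X ^+ 2 / 2) * G y.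
  have h : H X eta - H X 0 = G2 eta - G2 0.
    have d1 y : 0 <= y <= eta -> is_derive y (1 : R) (H X) (u X y) by move=> /andP[y0 _]; apply: dH; lra.
    have d2 y : 0 <= y <= eta -> is_derive y (1 : R) G2 (u X y).
      by move=> hy; have h := dG y hy; rewrite /G2; dv; rewrite /u /q expRD; ring.
    exact: eqd d1 d2.
  by rewrite /f h /G2; ring.
rewrite -(ler_pM2l (expR_gt0 (s * X ^+ 2 / 2))).
have ee : expR (s * X ^+ 2 / 2) * expR (- (s * X ^+ 2 / 2)) = 1 by rewrite -expRD subrr expR0.
move: inc; rewrite fX f0; set A := G eta - G 0; set B := F eta - F 0 => inc.
rewrite -[X in X * `|_|](ger0_norm (expR_ge0 _)) -normrM.
rewrite (_ : _ * (A - _) = expR (s * X ^+ 2 / 2) * A - B); last first.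
  by rewrite mulrBr (mulrA _ _ B) ee mul1r.
apply: le_trans inc _.
by rewrite /e subr0 le_eqVlt; apply/orP; left; apply/eqP; ring.
Qed.

End Integrals.

(** * Fourier inversion *)

Section RootSums.
Variable R : realType.
Implicit Types (x y be : R) (j : int).

Lemma dv_sum (I : Type) (s : seq I) (f : I -> R -> R) (g : I -> R) x :
  (forall i, is_derive x (1 : R) (f i) (g i)) ->
  is_derive x (1 : R) (fun y => \sum_(i <- s) f i y) (\sum_(i <- s) g i).
Proof.
move=> df; elim: s => [|i s IH].
  rewrite (_ : (fun y => _) = fun=> 0); last by apply/funext => y; rewrite big_nil.
  by rewrite big_nil; exact: dvC.
rewrite (_ : (fun y => _) = fun y => f i y + \sum_(k <- s) f k y); last by apply/funext => y; rewrite big_cons.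
by rewrite big_cons; exact: dvD.
Qed.

Lemma sum_cos_telescope be x (J : nat) :
  2 * (\sum_(i < J) cos (be + i%:R * x)) * sin (x / 2) = sin (be + J%:R * x - x / 2) - sin (be - x / 2).
Proof.
elim: J => [|J IH]; first by rewrite big_ord0 mul0r addr0 mulr0 mul0r subrr.
rewrite big_ord_recr /= mulrDr mulrDl IH.
have -> : be + J.+1%:R * x - x / 2 = (be + J%:R * x) + x / 2 by rewrite -natr1; field.
set y := be + J%:R * x; rewrite (sinD y (x / 2)) (sinB y (x / 2)); ring.
Qed.

Lemma sin_periodic_int x j : sin (x + 2 * pi * j%:~R) = sin x.
Proof.
have e (y : R) : sin y = - cos (y + pi / 2) by rewrite cosDpihalf opprK.
rewrite !e -[in RHS](cos_periodic_int _ j); congr (- cos _); ring.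
Qed.

Lemma sin_int_pi j : sin (j%:~R * pi) = 0 :> R.
Proof.
have h := cos_periodic_int (0 : R) j; rewrite add0r cos0 in h.
have e : 2 * pi * j%:~R = j%:~R * pi + j%:~R * pi :> R by ring.
rewrite e cosD in h; have h2 := cos2Dsin2 (j%:~R * pi : R).
by apply/eqP; rewrite -sqrf_eq0; apply/eqP; lra.
Qed.

Lemma sum_cos_roots (N : nat) j be : (0 < N)%N -> ~~ (N%:Z %| j)%Z ->
  \sum_(i < N) cos (be + i%:R * (2 * pi * j%:~R / N%:R)) = 0.
Proof.
move=> N0 nj; set x := 2 * pi * j%:~R / N%:R.
have NR : 0 < N%:R :> R by rewrite ltr0n.
have T := sum_cos_telescope be x N.
(* N x is a multiple of 2 pi, so the two ends of the telescoped sum coincide. *)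
have Nx : be + N%:R * x - x / 2 = (be - x / 2) + 2 * pi * j%:~R by rewrite /x; field; rewrite gt_eqF.
rewrite Nx sin_periodic_int subrr in T.
have sx : sin (x / 2) != 0.
  set r := (j %% N)%Z.
  have r0 : 0 < r.
    rewrite lt0r modz_ge0 ?andbT; last by rewrite eqz_nat -lt0n.
    by apply: contra nj => /eqP h; apply/dvdz_mod0P.
  have rN : r < N%:Z by rewrite ltz_pmod.
  have E : cos x = cos (2 * pi * r%:~R / N%:R).
    rewrite -[RHS](cos_periodic_int _ (j %/ N)%Z) /x; congr cos.
    have -> : j%:~R = (j %/ N)%Z%:~R * N%:R + r%:~R :> R by rewrite [in LHS](divz_eq j N) intrD intrM.
    by field; rewrite gt_eqF.
  have P0 := pi_gt0 R.
  have r1 : 1 <= r%:~R :> R by rewrite ler1z -gtz0_ge1.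
  have r2 : r%:~R + 1 <= N%:R :> R.
    by rewrite (_ : r%:~R + 1 = (r + 1)%:~R :> R); [rewrite [leRHS]pmulrn ler_int lezD1|rewrite intrD].
  have q0 : 0 < pi / N%:R :> R by rewrite divr_gt0.
  have Nq : pi / N%:R * N%:R = pi :> R by rewrite divfK // gt_eqF.
  have H := @cosB1_lower R (2 * pi * r%:~R / N%:R) (pi / N%:R) (ltW q0).
  have e : 2 * pi * r%:~R / N%:R / 2 = pi / N%:R * r%:~R :> R by field; rewrite gt_eqF.
  rewrite e -E in H; have h1 : pi / N%:R <= pi / N%:R * r%:~R :> R by rewrite ler_peMr // ltW.
  have h2 : pi / N%:R * r%:~R <= pi - pi / N%:R :> R.
    by have := ler_wpM2l (ltW q0) r2; rewrite mulrDr mulr1 Nq; lra.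
  have {}H := H h1 h2.
  have qq : 0 < (pi / N%:R) ^+ 2 :> R by rewrite exprn_gt0.
  apply/eqP => s0; have c1 : cos x = 1.
    have -> : x = x / 2 + x / 2 by field.
    rewrite cosD; have := cos2Dsin2 (x / 2); rewrite s0; lra.
  by rewrite c1 in H; lra.
move/eqP: T; rewrite mulf_eq0 (negbTE sx) orbF mulf_eq0 pnatr_eq0 /=.
by move/eqP.
Qed.

Definition cos_primitive j x : R := if j == 0 then x else sin (j%:~R * x) / j%:~R.

Lemma is_derive_cos_primitive j x : is_derive x (1 : R) (cos_primitive j) (cos (j%:~R * x)).
Proof.
have [->|j0] := eqVneq j 0.
  by rewrite mul0r cos0 /cos_primitive eqxx; exact: dv_id.
have jR : j%:~R != 0 :> R by rewrite intr_eq0.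
apply: (@is_derive_ext _ (fun y => sin (j%:~R * y) * j%:~R^-1) _ x (cos (j%:~R * x) * j%:~R * j%:~R^-1)).
- by move=> y; rewrite /cos_primitive (negbTE j0).
- by rewrite mulfK.
- by dv; ring.
Qed.

Lemma cos_primitive0 j : cos_primitive j 0 = 0.
Proof. by rewrite /cos_primitive; case: eqP => // _; rewrite mulr0 sin0 mul0r. Qed.

Lemma cos_primitive_dvd (N : nat) j : (0 < N)%N -> j != 0 -> (N%:Z %| j)%Z -> cos_primitive j (pi / N%:R) = 0.
Proof.
move=> N0 j0 /dvdzP [q jq]; rewrite /cos_primitive (negbTE j0) jq intrM.
have NR : N%:R != 0 :> R by rewrite pnatr_eq0 -lt0n.
rewrite (_ : q%:~R * N%:Z%:~R * (pi / N%:R) = q%:~R * pi); last by rewrite -pmulrn; field.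
by rewrite sin_int_pi mul0r.
Qed.

(** Orthogonality on the torus, each box being folded onto a quarter by symmetry; hence pi^2 in
    place of (2 pi)^2. If N does not divide one of the frequencies, the sum over the centres
    vanishes; if N divides a nonzero frequency, its primitive vanishes at pi / N. *)
Lemma sum_cos_box (N : nat) (j k : int) : (0 < N)%N ->
  (\sum_(u < N) \sum_(v < N) cos (2 * pi * (u%:R * j%:~R + v%:R * k%:~R) / N%:R)) *
    (cos_primitive j (pi / N%:R) * cos_primitive k (pi / N%:R)) =
  if (j == 0) && (k == 0) then pi ^+ 2 else 0.
Proof.
move=> N0; have NR : N%:R != 0 :> R by rewrite pnatr_eq0 -lt0n.
have [j0|j0] := eqVneq j 0; have [k0|k0] := eqVneq k 0 => /=.
- rewrite j0 k0 /cos_primitive eqxx.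
  rewrite (eq_bigr (fun=> N%:R)) => [|u _]; last first.
    rewrite (eq_bigr (fun=> 1)) => [|v _]; first by rewrite sumr_const card_ord.
    by rewrite !mulr0 addr0 mulr0 mul0r cos0.
  by rewrite sumr_const card_ord -mulr_natr; field.
- have [d|d] := boolP (N%:Z %| k)%Z; first by rewrite (cos_primitive_dvd N0 k0 d) !mulr0.
  rewrite big1 ?mul0r // => u _; rewrite -[RHS](@sum_cos_roots N k (2 * pi * (u%:R * j%:~R) / N%:R) N0 d).
  by apply: eq_bigr => v _; congr cos; field.
- have [d|d] := boolP (N%:Z %| j)%Z; first by rewrite (cos_primitive_dvd N0 j0 d) mul0r mulr0.
  rewrite exchange_big big1 ?mul0r //= => v _; rewrite -[RHS](@sum_cos_roots N j (2 * pi * (v%:R * k%:~R) / N%:R) N0 d).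
  by apply: eq_bigr => u _; congr cos; field.
- have [d|d] := boolP (N%:Z %| j)%Z; first by rewrite (cos_primitive_dvd N0 j0 d) mul0r mulr0.
  rewrite exchange_big big1 ?mul0r //= => v _; rewrite -[RHS](@sum_cos_roots N j (2 * pi * (v%:R * k%:~R) / N%:R) N0 d).
  by apply: eq_bigr => u _; congr cos; field.
Qed.

End RootSums.

Section Inversion.
Variables (R : realType) (N : nat) (a b : 'I_N).
Hypothesis ab : a != b.
Let N0 : (0 < N)%N. Proof. by case: N a => // -[]. Qed.

Section Fixed.
Variables (n : nat) (t : R).
Notation T := ('I_n * 'I_N)%type.
Implicit Types (A : {set T}) (r : int) (th ph : R).

Definition psize A : nat := \sum_(x in A) part x.
Definition pdiff A : int := \sum_(x in A) sgn_ a b x.2.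
Definition weight A : R := expR (- (t ^+ 2 * (psize A)%:R) + t * (pdiff A)%:~R).
Definition partition_function : R := \prod_(x : T) (1 + expR (- energy a b t x)).

Lemma partition_function_gt0 : 0 < partition_function.
Proof. by apply: prodr_gt0 => x _; rewrite addr_gt0 ?ltr01 ?expR_gt0. Qed.

Lemma weightE A : \prod_(x in A) expR (- energy a b t x) = weight A.
Proof.
rewrite -expR_sum /weight; congr expR.
have -> : (pdiff A)%:~R = \sum_(x in A) eps R a b x.2.
  exact: (big_morph (fun z : int => z%:~R : R) (@intrD R) (erefl _)).
rewrite /psize natr_sum !mulr_sumr -sumrN -big_split /=.
by apply: eq_bigr => x _; rewrite /energy opprB addrC.
Qed.

(** Expanding the product over the parts yields a sum over all sets of parts, with the normalised
    weights as probabilities. *)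
Lemma charfE th ph : charf a b n t th ph =
  ((partition_function^-1)%:C * \sum_A (weight A)%:C * cis (th * (psize A)%:R + ph * (pdiff A)%:~R))%C.
Proof.
have Z0 := lt0r_neq0 partition_function_gt0.
have -> : charf a b n t th ph = ((partition_function^-1)%:C *
   \prod_(x : T) (1 + (expR (- energy a b t x))%:C * cis (phase a b th ph x)))%C.
  rewrite /partition_function -prodfV (rmorph_prod (real_complex R)) -big_split /=; apply: eq_bigr => x _.
  have e0 := expR_gt0 (energy a b t x).
  have h1 : fermi (energy a b t x) = (1 + expR (- energy a b t x))^-1 * expR (- energy a b t x).
    by rewrite /fermi expRN; field; rewrite ?gt_eqF //; lra.
  have h2 : 1 - fermi (energy a b t x) = (1 + expR (- energy a b t x))^-1.
    by rewrite /fermi expRN; field; rewrite ?gt_eqF //; lra.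
  by rewrite h2 h1 (rmorphM (real_complex R)) /= -mulrA mulrDr mulr1.
congr (_ * _); under eq_bigr do rewrite addrC.
rewrite bigA_distr; apply: eq_big => [A|A _]; first by rewrite inE.
rewrite -big_mkcond big_split /= -weightE (rmorph_prod (real_complex R)); congr (_ * _).
rewrite -cis_sum; congr cis.
have -> : (pdiff A)%:~R = \sum_(x in A) eps R a b x.2.
  exact: (big_morph (fun z : int => z%:~R : R) (@intrD R) (erefl _)).
by rewrite /psize natr_sum !mulr_sumr -big_split.
Qed.

Lemma hcharE r th ph : hchar a b n t r%:~R th ph =
  partition_function^-1 * \sum_A weight A *
    cos (((psize A)%:Z - n%:Z)%:~R * th + (pdiff A - r)%:~R * ph).
Proof.
rewrite /hchar charfE mulrCA mulr_sumr mulr_sumr.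
rewrite mulr_sumr raddf_sum /=; apply: eq_bigr => A _.
have -> : ((psize A)%:Z - n%:Z)%:~R * th + (pdiff A - r)%:~R * ph =
  - (n%:R * th + r%:~R * ph) + (th * (psize A)%:R + ph * (pdiff A)%:~R).
  by rewrite !intrB -!pmulrn; ring.
by rewrite /= (cosD (- _)); ring.
Qed.

Definition residue_char (u v : nat) th ph r : R :=
  hchar a b n t r%:~R (2 * pi * u%:R / N%:R + th) (2 * pi * v%:R / N%:R + ph).

(* Averaging over the signs leaves a sum of products of one-variable cosines, whose integral
   over a box is the elementary [box_primitive]; double integrals are thereby avoided. *)
Definition even_char (u v : nat) r th ph : R :=
  (residue_char u v th ph r + residue_char u v (- th) ph r +
   residue_char u v th (- ph) r + residue_char u v (- th) (- ph) r) / 4.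

Definition set_angle (u v : nat) r A : R :=
  2 * pi * (u%:R * ((psize A)%:Z - n%:Z)%:~R + v%:R * (pdiff A - r)%:~R) / N%:R.

Lemma even_charE (u v : nat) r th ph : even_char u v r th ph =
  partition_function^-1 * \sum_A weight A * (cos (set_angle u v r A) *
    (cos (((psize A)%:Z - n%:Z)%:~R * th) * cos ((pdiff A - r)%:~R * ph))).
Proof.
rewrite /even_char /residue_char !hcharE -!mulrDr -mulrA; congr (_ * _).
rewrite -!big_split /= mulr_suml; apply: eq_bigr => A _.
set j := (_ - n%:Z)%:~R; set k := (_ - r)%:~R; set al := set_angle u v r A.
have NR : N%:R != 0 :> R by rewrite pnatr_eq0 -lt0n.
have e x y : j * (2 * pi * u%:R / N%:R + x) + k * (2 * pi * v%:R / N%:R + y) = al + j * x + k * y.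
  by rewrite /al /set_angle -/j -/k; field.
rewrite !e !mulrN.
set x := j * th; set y := k * ph.
rewrite (cosD (al + x) y) (cosD (al - x) y) (cosB (al + x) y) (cosB (al - x) y) (cosD al x) (cosB al x); by field.
Qed.

Definition box_primitive (u v : nat) r x y : R :=
  partition_function^-1 * \sum_A weight A * (cos (set_angle u v r A) *
    (cos_primitive ((psize A)%:Z - n%:Z) x * cos_primitive (pdiff A - r) y)).

Definition box_primitive1 (u v : nat) r x y : R :=
  partition_function^-1 * \sum_A weight A * (cos (set_angle u v r A) *
    (cos_primitive ((psize A)%:Z - n%:Z) x * cos ((pdiff A - r)%:~R * y))).

Lemma is_derive_box_primitive (u v : nat) r x y :
  is_derive y (1 : R) (box_primitive u v r x) (box_primitive1 u v r x y).
Proof.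
have h : is_derive y (1 : R) (fun y => \sum_A weight A * (cos (set_angle u v r A) *
    (cos_primitive ((psize A)%:Z - n%:Z) x * cos_primitive (pdiff A - r) y)))
  (\sum_A weight A * (cos (set_angle u v r A) *
    (cos_primitive ((psize A)%:Z - n%:Z) x * cos ((pdiff A - r)%:~R * y)))).
  apply: (@dv_sum R _ _ (fun A y => weight A * (cos (set_angle u v r A) *
    (cos_primitive ((psize A)%:Z - n%:Z) x * cos_primitive (pdiff A - r) y)))) => A.
  have h := is_derive_cos_primitive (pdiff A - r) y.
  by dv; ring.
by rewrite /box_primitive /box_primitive1; dv; ring.
Qed.

Lemma is_derive_box_primitive1 (u v : nat) r x y :
  is_derive x (1 : R) (box_primitive1 u v r ^~ y) (even_char u v r x y).
Proof.
rewrite even_charE.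
have h : is_derive x (1 : R) (fun x => \sum_A weight A * (cos (set_angle u v r A) *
    (cos_primitive ((psize A)%:Z - n%:Z) x * cos ((pdiff A - r)%:~R * y))))
  (\sum_A weight A * (cos (set_angle u v r A) *
    (cos (((psize A)%:Z - n%:Z)%:~R * x) * cos ((pdiff A - r)%:~R * y)))).
  apply: (@dv_sum R _ _ (fun A x => weight A * (cos (set_angle u v r A) *
    (cos_primitive ((psize A)%:Z - n%:Z) x * cos ((pdiff A - r)%:~R * y))))) => A.
  have h := is_derive_cos_primitive ((psize A)%:Z - n%:Z) x.
  by dv; ring.
by rewrite /box_primitive1; dv; ring.
Qed.

Lemma box_primitive0l u v r y : box_primitive u v r 0 y = 0.
Proof.
by rewrite /box_primitive big1 ?mulr0 // => A _; rewrite cos_primitive0 mul0r !mulr0.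
Qed.

Lemma box_primitive0r u v r x : box_primitive u v r x 0 = 0.
Proof.
by rewrite /box_primitive big1 ?mulr0 // => A _; rewrite cos_primitive0 !mulr0.
Qed.

Definition part_count r : nat := #|[set A | (psize A == n) && (pdiff A == r)]%SET|.

(** Summed over the centres, [sum_cos_box] keeps only the sets of size n and difference r, and these
    all have the same weight. *)
Lemma box_inversion r :
  \sum_(u < N) \sum_(v < N) box_primitive u v r (pi / N%:R) (pi / N%:R) =
  pi ^+ 2 * (part_count r)%:R * expR (- (t ^+ 2 * n%:R) + t * r%:~R) / partition_function.
Proof.
under eq_bigr do rewrite -mulr_sumr exchange_big /=.
rewrite -mulr_sumr exchange_big /= mulrC; congr (_ / _).
transitivity (\sum_A weight A * (if (psize A == n) && (pdiff A == r) then pi ^+ 2 else 0)).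
  apply: eq_bigr => A _; under eq_bigr do rewrite -mulr_sumr -mulr_suml.
  rewrite -mulr_sumr -mulr_suml sum_cos_box // !subr_eq0 eqz_nat //.
rewrite (bigID (fun A => (psize A == n) && (pdiff A == r))) /= [X in _ + X]big1 ?addr0; last first.
  by move=> A /negbTE ->; rewrite mulr0.
rewrite (eq_bigr (fun=> expR (- (t ^+ 2 * n%:R) + t * r%:~R) * pi ^+ 2)); last first.
  by move=> A /andP[/eqP h1 /eqP h2]; rewrite /weight h1 h2 eqxx eqxx.
rewrite (eq_bigl (fun A => A \in [set A | (psize A == n) && (pdiff A == r)]%SET)); last by move=> A; rewrite inE.
rewrite sumr_const -mulr_natr /part_count; ring.
Qed.

(** For a trivial character the angle of a set [A] at the centre is, modulo 2 pi, independent of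
    [A]. The box is then a copy of the one at the origin, up to a constant cosine. *)
Lemma trivial_even_char (u v : nat) r th ph : trivial_character a b u v ->
  even_char u v r th ph = cos (2 * pi * (u%:R * n%:R + v%:R * r%:~R) / N%:R) * even_char 0 0 r th ph.
Proof.
move=> /forallP K; rewrite !even_charE [RHS]mulrCA [in RHS]mulr_sumr; congr (_ * _); apply: eq_bigr => A _.
have a0 : cos (set_angle 0 0 r A) = 1 by rewrite /set_angle !mul0r addr0 mulr0 mul0r cos0.
rewrite [RHS]mulrCA; congr (_ * _); rewrite a0 mul1r; congr (_ * _).
have /dvdzP [q hq] : (N%:Z %| u%:Z * (psize A)%:Z + v%:Z * pdiff A)%Z.
  have -> : u%:Z * (psize A)%:Z + v%:Z * pdiff A =
     \sum_(x in A) (u%:Z * (x.1 * N)%:Z + character a b u v x.2).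
    have -> : (psize A)%:Z = \sum_(x in A) (part x)%:Z by exact: (big_morph Posz PoszD (erefl _)).
    rewrite /pdiff !mulr_sumr -big_split /=; apply: eq_bigr => x _.
    by rewrite /part /character -addnS PoszD; ring.
  apply: rpred_sum => x _; apply: rpredD; last exact: K.
  by rewrite PoszM mulrA dvdz_mull.
have NR : N%:R != 0 :> R by rewrite pnatr_eq0 -lt0n.
have e : u%:R * (psize A)%:R + v%:R * (pdiff A)%:~R = q%:~R * N%:R :> R.
  by have := congr1 (fun z : int => z%:~R : R) hq; rewrite intrD !intrM -!pmulrn.
rewrite -[RHS]cosN -[RHS](cos_periodic_int _ q) /set_angle; congr cos.
rewrite !intrB -!pmulrn.
have -> : q%:~R = (u%:R * (psize A)%:R + v%:R * (pdiff A)%:~R) / N%:R :> R by rewrite e mulfK.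
by field.
Qed.

End Fixed.
End Inversion.

(** * The local limit theorem *)

Lemma exp_small (R : realType) (c : R) (k : nat) : 0 < c ->
  exists2 C : R, 0 < C & forall t, 0 < t -> expR (- (c / t)) <= C * t ^+ k.
Proof.
move=> c0; exists ((2 * k%:R) ^+ k / c ^+ k + 1).
  by apply: ltr_wpDl => //; apply: divr_ge0; apply: exprn_ge0; [apply: mulr_ge0|exact: ltW].
move=> t t0; have tk : 0 < t ^+ k by rewrite exprn_gt0.
have y0 : 0 < c / t by rewrite divr_gt0.
have h := pow_expR_le k (ltW y0).
have h2 : (c / t) ^+ k * expR (- (c / t)) <= (2 * k%:R) ^+ k.
  apply: le_trans h _; rewrite -[leRHS]mulr1 ler_wpM2l ?exprn_ge0 ?mulr_ge0 //.
  by rewrite mulNr expRN_le1 // divr_ge0 // ltW.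
have ck : 0 < (c / t) ^+ k by rewrite exprn_gt0.
apply: (@le_trans _ _ ((2 * k%:R) ^+ k / c ^+ k * t ^+ k)); last by rewrite ler_wpM2r ?(ltW tk) // lerDl.
rewrite -(ler_pM2l ck); apply: le_trans h2 _.
rewrite le_eqVlt; apply/orP; left; apply/eqP.
by rewrite expr_div_n; field; rewrite !expf_neq0 // gt_eqF.
Qed.

Section BoxSum.
Variables (R : realType) (N : nat) (a b : 'I_N).
Hypothesis ab : a != b.
Variable L : R -> R.
Hypothesis dL : forall x : R, -3 < x -> is_derive x (1 : R) L (- softlog x).
Hypothesis bL : forall x : R, -3 < x -> 0 <= L x <= expR (- x).
Hypothesis L0 : 1 / 3 <= L 0.
Implicit Types (u v n : nat) (r : int) (t th ph : R).

Let N1 : 1 <= N%:R :> R. Proof. by rewrite ler1n; case: N a => // -[]. Qed.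

(** The arithmetic factor of the local limit theorem. By [ell_count] it is N^(2 - N) times a number
    of residue vectors. *)
Definition char_weight n r : R :=
  \sum_(u < N) \sum_(v < N) (if trivial_character a b u v then cos (2 * pi * (u%:R * n%:R + v%:R * r%:~R) / N%:R) else 0).

Lemma even_char_minor : exists c t1 : R, [/\ 0 < c, 0 < t1 &
  forall t n, 0 < t <= t1 -> n%:R * t ^+ 4 = L 0 ->
  forall u v r th ph, `|th| <= pi / N%:R -> `|ph| <= pi / N%:R ->
  [\/ t ^+ 2 / 8 <= `|th|, ~~ trivial_character a b u v | 1 / 8 <= `|ph|] ->
  `|even_char a b n t u v r th ph| <= expR (- (c / t ^+ 2))].
Proof.
have [c [t1 [c0 t10 H]]] := minor_arc ab L0; exists c, t1; split=> // t n tt nt u v r th ph hth hph hc.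
have bnd x y : `|x| = `|th| -> `|y| = `|ph| -> `|residue_char a b n t u v x y r| <= expR (- (c / t ^+ 2)).
  move=> hx hy; rewrite /residue_char /hchar.
  apply: le_trans (norm_Re_le _) _; rewrite normcM normc_cis mul1r.
  by apply: H => //; rewrite ?hx ?hy.
rewrite /even_char; move: (bnd th ph erefl erefl) (bnd (- th) ph (normrN _) erefl)
  (bnd th (- ph) erefl (normrN _)) (bnd (- th) (- ph) (normrN _) (normrN _)).
rewrite !ler_norml => /andP[? ?] /andP[? ?] /andP[? ?] /andP[? ?]; apply/andP; split; lra.
Qed.

Lemma even_char_major : exists D c t1 : R, [/\ 0 < D, 0 < c & 0 < t1] /\
  forall t n, 0 < t <= t1 -> n%:R * t ^+ 4 = L 0 ->
  forall r th ph, `|th| <= t ^+ 2 / 8 -> `|ph| <= 1 / 8 ->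
  `|even_char a b n t 0 0 r th ph -
    expR (- ((2 * L 0 * (th / t ^+ 3) ^+ 2 + N%:R^-1 * (ph / t) ^+ 2) / 2)) *
      cos (((N%:R * t)^-1 + kappa0 R a b - r%:~R) * ph)| <=
   D * t ^+ 2 * expR (- (c * ((th / t ^+ 3) ^+ 2 + (ph / t) ^+ 2))).
Proof.
have [D [c [t1 [H0 H]]]] := major_arc ab dL bL L0; exists D, c, t1; split=> // t n tt nt r th ph hth hph.
have h1 := H t n tt nt r%:~R th ph hth hph.
have hph' : `|- ph| <= 1 / 8 by rewrite normrN.
have h2 := H t n tt nt r%:~R th (- ph) hth hph'.
rewrite mulNr sqrrN mulrN cosN in h2.
rewrite /even_char /residue_char !mulr0 !mul0r !add0r.
move: h1 h2; set x1 := hchar _ _ _ _ _ _ _; set x2 := hchar _ _ _ _ _ _ _; set x3 := hchar _ _ _ _ _ _ _; set x4 := hchar _ _ _ _ _ _ _.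
rewrite !ler_norml => /andP[? ?] /andP[? ?]; apply/andP; split; lra.
Qed.

Section Rect.
Variables (t : R) (n u v : nat) (r : int).
Notation F := (box_primitive a b n t u v r).
Notation F1 := (box_primitive1 a b n t u v r).
Notation E := (even_char a b n t u v r).

Lemma box_rect_le (e x0 x1 y0 y1 : R) : x0 <= x1 -> y0 <= y1 -> 0 <= e ->
  (forall x y, x0 <= x <= x1 -> y0 <= y <= y1 -> `|E x y| <= e) ->
  `|(F x1 y1 - F x0 y1) - (F x1 y0 - F x0 y0)| <= e * ((x1 - x0) * (y1 - y0)).
Proof.
move=> x01 y01 e0 H.
have -> : e * ((x1 - x0) * (y1 - y0)) = (e * x1 - e * x0) * (y1 - y0) by ring.
apply: (@rect_increment_le R F F1 E (fun x => e * x) (fun=> e) id (fun=> 1) x0 x1 y0 y1 x01 y01).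
- by move=> x y _ _; exact: is_derive_box_primitive.
- by move=> x y _ _; exact: is_derive_box_primitive1.
- by move=> x _; dv; ring.
- by move=> y _; exact: ler01.
- by move=> x y hx hy; rewrite mulr1; exact: H.
Qed.

Hypothesis N2 : (0 < N)%N.
Let P : R := pi / N%:R.

(** The quarter box is cut into the major rectangle [0, x1] x [0, y1], the rectangle [0, x1] x
    [y1, P] beside it and the strip [x1, P] x [0, P]. *)
Lemma box_split (x1 y1 : R) :
  F P P = (F x1 y1 - 0) + ((F x1 P - F 0 P) - (F x1 y1 - F 0 y1)) + ((F P P - F x1 P) - (F P 0 - F x1 0)).
Proof. rewrite !box_primitive0l !box_primitive0r; ring. Qed.

(** The mixed derivative of the difference is dominated by a product of Gaussians of widths t^3 and
    t; their integrals supply t^4 beside the factor t^2 of the pointwise error. *)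
Lemma box_major_le (D c L0' X x1 y1 : R) (G : R -> R) : 0 < t -> 0 < D -> 0 < c -> 0 < L0' -> 0 <= x1 -> 0 <= y1 ->
  trivial_character a b u v ->
  (forall y, 0 <= y <= y1 -> is_derive y (1 : R) G (expR (- (y ^+ 2 / (2 * (N%:R * t ^+ 2)))) * cos (X * y))) ->
  G 0 = 0 ->
  (forall x y, 0 <= x <= x1 -> 0 <= y <= y1 -> `|even_char a b n t 0 0 r x y -
     expR (- ((2 * L0' * (x / t ^+ 3) ^+ 2 + N%:R^-1 * (y / t) ^+ 2) / 2)) * cos (X * y)| <=
      D * t ^+ 2 * expR (- (c * ((x / t ^+ 3) ^+ 2 + (y / t) ^+ 2)))) ->
  `|F x1 y1 - cos (2 * pi * (u%:R * n%:R + v%:R * r%:~R) / N%:R) * (gint (Num.sqrt L0' / t ^+ 3) x1 * G y1)| <=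
   D / c * t ^+ 6.
Proof.
move=> t0 D0 c0 l0 x10 y10 K dG G0 H.
have N0 : 0 < N%:R :> R by rewrite ltr0n.
have t3 : 0 < t ^+ 3 by rewrite exprn_gt0.
set kk := cos _; set a1 := Num.sqrt L0' / t ^+ 3.
have a10 : 0 < a1 by rewrite divr_gt0 // sqrtr_gt0.
pose b1 := Num.sqrt c / t ^+ 3; pose b2 := Num.sqrt c / t.
have sc0 : 0 < Num.sqrt c by rewrite sqrtr_gt0.
have b10 : 0 < b1 by rewrite divr_gt0.
have b20 : 0 < b2 by rewrite divr_gt0.
pose g y := expR (- (y ^+ 2 / (2 * (N%:R * t ^+ 2)))) * cos (X * y).
pose FF x y := F x y - kk * (gint a1 x * G y).
pose FF1 x y := F1 x y - kk * (gint a1 x * g y).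
pose EE x y := E x y - kk * (expR (- ((a1 * x) ^+ 2)) * g y).
pose E1 x := D * t ^+ 2 * gint b1 x; pose e1 x := D * t ^+ 2 * expR (- ((b1 * x) ^+ 2)).
pose e2 y := expR (- ((b2 * y) ^+ 2)).
have d1 x y : 0 <= x <= x1 -> 0 <= y <= y1 -> is_derive y (1 : R) (FF x) (FF1 x y).
  move=> hx hy; have h1 := is_derive_box_primitive a b n t u v r x y; have h2 := dG y hy.
  by rewrite /FF /FF1; dv; rewrite /g; ring.
have d2 x y : 0 <= x <= x1 -> 0 <= y <= y1 -> is_derive x (1 : R) (FF1 ^~ y) (EE x y).
  move=> hx hy; have h1 := is_derive_box_primitive1 a b n t u v r x y; have h2 := is_derive_gint x a10.
  by rewrite /FF1 /EE; dv; ring.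
have d3 x : 0 <= x <= x1 -> is_derive x (1 : R) E1 (e1 x).
  by move=> hx; have h1 := is_derive_gint x b10; rewrite /E1 /e1; dv; ring.
have d4 y : 0 <= y <= y1 -> is_derive y (1 : R) (gint b2) (e2 y).
  by move=> hy; exact: is_derive_gint.
have p2 y : 0 <= y <= y1 -> 0 <= e2 y by move=> _; exact: expR_ge0.
have p3 x y : 0 <= x <= x1 -> 0 <= y <= y1 -> `|EE x y| <= e1 x * e2 y.
  move=> hx hy; rewrite /EE trivial_even_char // -/kk -mulrBr normrM.
  apply: (@le_trans _ _ (1 * (D * t ^+ 2 * expR (- (c * ((x / t ^+ 3) ^+ 2 + (y / t) ^+ 2)))))).
    apply: ler_pM => //; first exact: norm_cos_le1.
    have h := H x y hx hy; apply: le_trans h; rewrite le_eqVlt; apply/orP; left; apply/eqP; congr (`|_ - _|).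
    rewrite /g mulrA -expRD; congr (expR _ * _).
    rewrite /a1 (_ : (Num.sqrt L0' / t ^+ 3 * x) ^+ 2 = Num.sqrt L0' ^+ 2 * (x / t ^+ 3) ^+ 2); last by ring.
    by rewrite sqr_sqrtr ?(ltW l0) //; field; rewrite !gt_eqF.
  rewrite mul1r /e1 /e2 -[leRHS]mulrA -expRD le_eqVlt; apply/orP; left; apply/eqP; congr (_ * expR _).
  rewrite /b1 /b2 (_ : (Num.sqrt c / t ^+ 3 * x) ^+ 2 = Num.sqrt c ^+ 2 * (x / t ^+ 3) ^+ 2); last by ring.
  rewrite (_ : (Num.sqrt c / t * y) ^+ 2 = Num.sqrt c ^+ 2 * (y / t) ^+ 2); last by ring.
  by rewrite sqr_sqrtr ?(ltW c0) //; ring.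
have R1 := rect_increment_le x10 y10 d1 d2 d3 d4 p2 p3; rewrite /FF /E1 in R1.
move: R1; rewrite !box_primitive0l !box_primitive0r !gint0 G0 !mulr0 !mul0r !mulr0 !subr0 => R1.
apply: le_trans R1 _.
have g1 := gint_bound b10 x10; have g2 := gint_bound b20 y10.
apply: (@le_trans _ _ (D * t ^+ 2 * b1^-1 * b2^-1)).
  have Dt : 0 <= D * t ^+ 2 by rewrite mulr_ge0 ?sqr_ge0 // ltW.
  have gg (d x : R) : 0 < d -> 0 <= x -> 0 <= gint d x.
    move=> d0 x0; rewrite -(gint0 d); apply: (ge0_derive_le x0 (g := fun z => expR (- ((d * z) ^+ 2)))) => z _; last exact: expR_ge0.
    exact: is_derive_gint.
  apply: ler_pM => //; [by apply: mulr_ge0 => //; exact: gg|exact: gg|].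
  by apply: ler_wpM2l.
have cc : Num.sqrt c * Num.sqrt c = c by rewrite -expr2 sqr_sqrtr // ltW.
rewrite le_eqVlt; apply/orP; left; apply/eqP.
have -> : D * t ^+ 2 / b1 / b2 = D / (Num.sqrt c * Num.sqrt c) * t ^+ 6.
  by rewrite /b1 /b2; field; rewrite !gt_eqF.
by rewrite cc.
Qed.

End Rect.

Lemma box_sum_approx : exists C t1 : R, [/\ 0 < C, 0 < t1 &
  forall t n, 0 < t <= t1 -> n%:R * t ^+ 4 = L 0 -> forall r (G : R -> R),
  let y1 := Num.min (1 / 8) (pi / N%:R) in
  (forall y, 0 <= y <= y1 -> is_derive y (1 : R) G (expR (- (y ^+ 2 / (2 * (N%:R * t ^+ 2)))) *
      cos (((N%:R * t)^-1 + kappa0 R a b - r%:~R) * y))) ->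
  G 0 = 0 ->
  `|\sum_(u < N) \sum_(v < N) box_primitive a b n t u v r (pi / N%:R) (pi / N%:R) -
     char_weight n r * (gint (Num.sqrt (L 0) / t ^+ 3) (t ^+ 2 / 8) * G y1)| <= C * t ^+ 6].
Proof.
have N0 : 0 < N%:R :> R by have := N1; lra.
have N0' : (0 < N)%N by rewrite -(ltr_nat R).
have [c1 [t1 [c10 t10 H1]]] := even_char_minor.
have [D [c2 [t2 [[D0 c20 t20] H2]]]] := even_char_major.
have [C3 C30 H3] := exp_small 6 c10.
have l0 : 0 < L 0 by have := L0; lra.
exists (N%:R ^+ 2 * (D / c2 + 32 * C3)), (Num.min (Num.min t1 t2) (Num.min 1 N%:R^-1)); split.
- apply: mulr_gt0; first exact: exprn_gt0.
  by apply: addr_gt0; [exact: divr_gt0|exact: mulr_gt0].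
- by rewrite !lt_min t10 t20 ltr01 invr_gt0.
move=> t n /andP[t0]; rewrite !le_min => /andP[/andP[tt1 tt2] /andP[t11 tN]] nt r G y1 dG G0.
have ht1 : 0 < t <= t1 by rewrite t0.
have ht2 : 0 < t <= t2 by rewrite t0.
pose P : R := pi / N%:R; pose x1 := t ^+ 2 / 8.
have P0 : 0 < P by rewrite divr_gt0 // pi_gt0.
have P4 : P <= 4.
  by rewrite /P ler_pdivrMr //; apply: le_trans (ltW (pi_lt4 R)) _; rewrite ler_peMr // N1.
have x10 : 0 <= x1 by rewrite /x1 divr_ge0 ?sqr_ge0.
have x1P : x1 <= P.
  have tt : t ^+ 2 <= t by rewrite expr2 ler_piMr // ltW.
  have NP : N%:R^-1 <= P.
    by rewrite /P ler_peMl ?invr_ge0 ?(ltW N0) //; apply: le_trans (pi_ge2 R); rewrite ler1n.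
  apply: le_trans (le_trans tt (le_trans tN NP)).
  by rewrite /x1 ler_pdivrMr // ler_peMr ?sqr_ge0 // ler1n.
have y10 : 0 <= y1 by rewrite /y1 le_min (ltW P0) divr_ge0.
have y1P : y1 <= P by rewrite /y1 ge_min lexx orbT.
have y18 : y1 <= 1 / 8 by rewrite /y1 ge_min lexx.
pose e := expR (- (c1 / t ^+ 2)).
have e0 : 0 <= e by exact: expR_ge0.
have eC : e <= C3 * t ^+ 6.
  apply: le_trans (H3 t t0); rewrite ler_expR lerN2 ler_wpM2l ?(ltW c10) // lef_pV2 ?posrE ?exprn_gt0 //.
  by rewrite expr2 ler_piMr // ltW.
have minor (u v : nat) x y : 0 <= x <= P -> 0 <= y <= P ->
   [\/ x1 <= x, ~~ trivial_character a b u v | 1 / 8 <= y] -> `|even_char a b n t u v r x y| <= e.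
  move=> /andP[hx0 hx] /andP[hy0 hy] hc; apply: (H1 t n ht1 nt); rewrite ?ger0_norm //.
have t6 : 0 <= t ^+ 6 by rewrite exprn_ge0 // ltW.
have each (u v : 'I_N) : `|box_primitive a b n t u v r P P -
    (if trivial_character a b u v then cos (2 * pi * (u%:R * n%:R + v%:R * r%:~R) / N%:R) else 0) *
      (gint (Num.sqrt (L 0) / t ^+ 3) x1 * G y1)| <= (D / c2 + 32 * C3) * t ^+ 6.
  have Dc : 0 <= D / c2 * t ^+ 6 by apply: mulr_ge0 => //; apply: divr_ge0; exact: ltW.
  have PP0 : 0 <= P * P by apply: mulr_ge0; exact: ltW.
  have PP : P * P <= 16 by rewrite (_ : 16 = 4 * 4); [exact: (ler_pM (ltW P0) (ltW P0) P4 P4)|ring].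
  have C16 : 0 <= C3 * t ^+ 6 * 16 by rewrite !mulr_ge0 // ltW.
  have c32 : C3 * t ^+ 6 * 16 + C3 * t ^+ 6 * 16 = 32 * C3 * t ^+ 6 by ring.
  case: ifP => K; last first.
    rewrite mul0r subr0.
    have B := @box_rect_le t n u v r e 0 P 0 P (ltW P0) (ltW P0) e0.
    rewrite !box_primitive0l !box_primitive0r !subr0 in B; apply: le_trans (B _) _.
      by move=> x y hx hy; apply: minor => //; rewrite K; apply: Or32.
    by rewrite mulrDl -c32 addrA; apply: le_trans (ler_pM e0 PP0 eC PP) _; rewrite lerDr addr_ge0.
  rewrite (box_split t n u v r x1 y1) subr0.
  have B1 := @box_rect_le t n u v r e 0 x1 y1 P x10 y1P e0.
  have B2 := @box_rect_le t n u v r e x1 P 0 P x1P (ltW P0) e0.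
  have {}B2 := B2 _.
  set q := _ * (_ * G y1).
  have M : `|box_primitive a b n t u v r x1 y1 - q| <= D / c2 * t ^+ 6.
    apply: (box_major_le N0' t0 D0 c20 l0 x10 y10 K dG G0) => x y /andP[hx0 hx] /andP[hy0 hy].
    by apply: (H2 t n ht2 nt); rewrite ger0_norm //; apply: le_trans hy _.
  have {}B2 : `|box_primitive a b n t u v r P P - box_primitive a b n t u v r x1 P -
      (box_primitive a b n t u v r P 0 - box_primitive a b n t u v r x1 0)| <= e * ((P - x1) * (P - 0)).
    apply: B2 => x y /andP[hx0 hx] hy; apply: minor => //; last exact: Or31.
    by rewrite (le_trans x10 hx0).
  have {}B1 : `|box_primitive a b n t u v r x1 P - box_primitive a b n t u v r 0 P -
      (box_primitive a b n t u v r x1 y1 - box_primitive a b n t u v r 0 y1)| <= e * ((x1 - 0) * (P - y1)).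
    (* For large N the box lies within the bound 1/8 on the second angle, and this rectangle is
       empty. *)
    have [h8|h8] := leP P (1 / 8).
      have -> : y1 = P by rewrite /y1 min_r.
      by rewrite !subrr !mulr0 normr0.
    have yE : y1 = 1 / 8 by rewrite /y1 min_l // ltW.
    apply: B1 => x y /andP[hx0 hx] /andP[hy0 hy]; apply: minor.
    - by rewrite hx0 (le_trans hx x1P).
    - by rewrite (le_trans y10 hy0).
    - by apply: Or33; rewrite -yE.
  have b1 : e * ((x1 - 0) * (P - y1)) <= C3 * t ^+ 6 * 16.
    apply: ler_pM => //; first by rewrite subr0 mulr_ge0 // subr_ge0.
    apply: le_trans PP; rewrite subr0; apply: ler_pM => //; [by rewrite subr_ge0|by rewrite lerBlDr lerDl].
  have b2 : e * ((P - x1) * (P - 0)) <= C3 * t ^+ 6 * 16.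
    apply: ler_pM => //; first by rewrite subr0 mulr_ge0 ?subr_ge0 // ltW.
    apply: le_trans PP; rewrite subr0; apply: ler_pM => //; [by rewrite subr_ge0|exact: ltW|by rewrite lerBlDr lerDl].
  move: M B1 B2; set z1 := box_primitive _ _ _ _ _ _ _ x1 y1; set z2 := (_ - _) - (_ - _); set z3 := (_ - _) - (_ - _).
  rewrite !ler_norml => /andP[? ?] /andP[? ?] /andP[? ?].
  clear nt ht1 ht2 tt1 tt2 t11 tN P0 P4 x10 x1P y10 y1P y18 e0 eC dG G0 PP PP0 minor.
  by apply/andP; split; lra.
rewrite /char_weight mulr_suml -sumrB; apply: le_trans (ler_norm_sum _ _ _) _.
apply: (@le_trans _ _ (\sum_(u < N) \sum_(v < N) (D / c2 + 32 * C3) * t ^+ 6)).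
  apply: ler_sum => u _; rewrite mulr_suml -sumrB; apply: le_trans (ler_norm_sum _ _ _) _.
  by apply: ler_sum => v _; exact: each.
rewrite -[leRHS]mulrA; set c := _ * t ^+ 6.
by rewrite !sumr_const !card_ord -[c *+ N]mulr_natl -[(_ * c) *+ N]mulr_natl mulrA -expr2.
Qed.

End BoxSum.

Section MainIntegral.
Variable R : realType.

(** A Gaussian integral in the first angle times a Gaussian Fourier integral in the second, both
    truncated with exponentially small loss. X may be as large as t^-4 because r runs up to the
    order of n. *)
Lemma main_integral (N B l0 : R) (y1 : R) : 0 < N -> 0 <= B -> 0 < l0 -> 0 < y1 ->
  exists2 C : R, 0 < C & forall (t X : R) (G : R -> R), 0 < t <= 1 -> `|X| <= B / t ^+ 4 ->
  (forall y, 0 <= y <= y1 -> is_derive y (1 : R) G (expR (- (y ^+ 2 / (2 * (N * t ^+ 2)))) * cos (X * y))) ->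
  G 0 = 0 ->
  `|gint (Num.sqrt l0 / t ^+ 3) (t ^+ 2 / 8) * G y1 -
    pi * Num.sqrt (2 * N) / (4 * Num.sqrt l0) * t ^+ 4 * expR (- (N * t ^+ 2 * X ^+ 2 / 2))| <= C * t ^+ 6.
Proof.
move=> N0 B0 l00 y10.
have sl0 : 0 < Num.sqrt l0 by rewrite sqrtr_gt0.
have sN0 : 0 < Num.sqrt (2 * N) by rewrite sqrtr_gt0 mulr_gt0.
have [C1 C10 H1] := exp_small 6 (divr_gt0 sl0 (ltr0n R 8)).
(* Exponent 8 and not 6: the error of [gauss_cos_integral] carries the factor |X| N t^2, which may
   be of order t^-2. *)
have [C2 C20 H2] := exp_small 8 (divr_gt0 (exprn_gt0 2 y10) (mulr_gt0 (ltr0n R 2) N0)).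
have [C3 C30 H3] := exp_small 6 (divr_gt0 y10 sN0).
pose K1 := (Num.sqrt l0)^-1; pose K2 := Num.sqrt (2 * N).
have K10 : 0 < K1 by rewrite invr_gt0.
have K20 : 0 < K2 by [].
exists (K1 * (B * N * C2 + 2 * K2 * C3) + 2 * K1 * C1 * K2).
  apply: ltr_wpDl; last by do 3?apply: mulr_gt0.
  by apply: mulr_ge0; [exact: ltW|apply: addr_ge0; do 2?apply: mulr_ge0 => //; exact: ltW].
move=> t X G /andP[t0 t1] hX dG G0.
have tj j : 0 < t ^+ j by rewrite exprn_gt0.
set a1 := Num.sqrt l0 / t ^+ 3; pose a2 := (K2 * t)^-1; set x1 := t ^+ 2 / 8.
have a10 : 0 < a1 by rewrite divr_gt0.
have a20 : 0 < a2 by rewrite invr_gt0 mulr_gt0.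
have x10 : 0 <= x1 by rewrite divr_ge0 // ltW.
pose s := N * t ^+ 2; have s0 : 0 < s by rewrite mulr_gt0.
have K22 : K2 ^+ 2 = 2 * N by rewrite /K2 sqr_sqrtr // mulr_ge0 // ltW.
have dF y : 0 <= y <= y1 -> is_derive y (1 : R) (gint a2) (expR (- (y ^+ 2 / (2 * s)))).
  move=> _; have h := is_derive_gint y a20.
  have -> : y ^+ 2 / (2 * s) = (a2 * y) ^+ 2.
    have -> : 2 * s = K2 ^+ 2 * t ^+ 2 by rewrite K22 /s mulrA.
    by rewrite /a2; field; rewrite !gt_eqF.
  exact: h.
have A := gauss_cos_integral s0 (ltW y10) dF dG.
rewrite G0 gint0 !subr0 in A.
have g1 := gint_limit a10 x10; have g1b := gint_bound a10 x10.
have g2 := gint_limit a20 (ltW y10).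
have ia1 : a1^-1 = K1 * t ^+ 3 by rewrite /a1 /K1 invfM invrK.
have ia2 : a2^-1 = K2 * t by rewrite /a2 invrK.
have t3 : t ^+ 3 <= 1 by rewrite exprn_ile1 // ltW.
have a1K : a1^-1 <= K1 by rewrite ia1 ler_piMr // ltW.
have a2K : a2^-1 <= K2 by rewrite ia2 ler_piMr // ltW.
have e1 : expR (- (a1 * x1)) <= C1 * t ^+ 6.
  rewrite (_ : a1 * x1 = Num.sqrt l0 / 8 / t); first exact: H1.
  by rewrite /a1 /x1; field; rewrite gt_eqF.
have e3 : expR (- (a2 * y1)) <= C3 * t ^+ 6.
  rewrite (_ : a2 * y1 = y1 / K2 / t); first exact: H3.
  by rewrite /a2; field; rewrite !gt_eqF.
have e2 : expR (- (y1 ^+ 2 / (2 * s))) <= C2 * t ^+ 8.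
  apply: le_trans (H2 t t0); rewrite ler_expR lerN2.
  rewrite (_ : y1 ^+ 2 / (2 * s) = y1 ^+ 2 / (2 * N) / t ^+ 2); last by rewrite /s; field; rewrite !gt_eqF.
  apply: ler_wpM2l; first by apply: divr_ge0; [exact: sqr_ge0|apply: mulr_ge0 => //; exact: ltW].
  by rewrite lef_pV2 ?posrE // expr2 ler_piMr // ltW.
have sp := @sqrt_pi_le2 R; case/andP: sp => sp0 sp2.
set Q1 := Num.sqrt pi / (2 * a1) in g1; set Q2 := Num.sqrt pi / (2 * a2) in g2.
set E := expR (- (s * X ^+ 2 / 2)) in A *.
have E0 : 0 <= E by exact: expR_ge0.
have E1 : E <= 1 by rewrite expRN_le1 // divr_ge0 // mulr_ge0 ?sqr_ge0 // ltW.
have Q1E : Q1 = Num.sqrt pi / 2 * a1^-1 by rewrite /Q1 invfM mulrA.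
have Q2E : Q2 = Num.sqrt pi / 2 * a2^-1 by rewrite /Q2 invfM mulrA.
have Q20 : 0 <= Q2 by rewrite /Q2 divr_ge0 ?(ltW sp0) // mulr_ge0 // ltW.
have Q2K : Q2 <= K2.
  apply: le_trans a2K; rewrite Q2E; have a2i : 0 <= a2^-1 by rewrite invr_ge0 ltW.
  by apply: ler_piMl => //; rewrite ler_pdivrMr ?mul1r.
have -> : pi * Num.sqrt (2 * N) / (4 * Num.sqrt l0) * t ^+ 4 * expR (- (N * t ^+ 2 * X ^+ 2 / 2)) = Q1 * (E * Q2).
  have spp : Num.sqrt pi * Num.sqrt pi = pi :> R by rewrite -expr2 sqr_sqrtr // pi_ge0.
  rewrite -[pi in LHS]spp Q1E Q2E ia1 ia2 /K1 /K2 -/s -/E.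
  by field; rewrite gt_eqF.
have D : `|G y1 - E * Q2| <= (B * N * C2 + 2 * K2 * C3) * t ^+ 6.
  have -> : G y1 - E * Q2 = (G y1 - E * gint a2 y1) + E * (gint a2 y1 - Q2) by ring.
  apply: le_trans (ler_normD _ _) _; rewrite mulrDl; apply: lerD.
    apply: le_trans A _.
    apply: (@le_trans _ _ (B / t ^+ 4 * s * (C2 * t ^+ 8))).
      apply: ler_pM => //; first by apply: mulr_ge0 => //; exact: ltW.
      by apply: ler_wpM2r => //; exact: ltW.
    by rewrite le_eqVlt; apply/orP; left; apply/eqP; rewrite /s; field; rewrite !gt_eqF.
  rewrite normrM (ger0_norm E0); apply: (@le_trans _ _ (1 * (2 * K2 * (C3 * t ^+ 6)))); last by rewrite mul1r mulrA.
  apply: ler_pM => //; apply: le_trans g2 _; apply: ler_pM => //.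
    by apply: divr_ge0 => //; exact: ltW.
  by apply: ler_wpM2l.
have -> : gint a1 x1 * G y1 - Q1 * (E * Q2) = gint a1 x1 * (G y1 - E * Q2) + (gint a1 x1 - Q1) * (E * Q2) by ring.
have gg : `|gint a1 x1| <= K1.
  rewrite ger0_norm; first exact: le_trans g1b a1K.
  rewrite -(gint0 a1); apply: (ge0_derive_le x10 (g := fun z => expR (- ((a1 * z) ^+ 2)))) => z _; last exact: expR_ge0.
  exact: is_derive_gint.
apply: le_trans (ler_normD _ _) _; rewrite [leRHS]mulrDl; apply: lerD.
  by rewrite normrM -[leRHS]mulrA; apply: ler_pM.
rewrite normrM; apply: (@le_trans _ _ (2 * K1 * (C1 * t ^+ 6) * (1 * K2))); last first.
  by rewrite le_eqVlt; apply/orP; left; apply/eqP; ring.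
apply: ler_pM => //.
  apply: le_trans g1 _; apply: ler_pM => //; first by apply: divr_ge0 => //; exact: ltW.
  by apply: ler_wpM2l.
rewrite ger0_norm; last exact: mulr_ge0.
exact: ler_pM.
Qed.

End MainIntegral.

Lemma count_identity (F : realFieldType) (e r l V d p c : F) :
  0 < e -> 0 < r -> 0 < l -> 0 < V -> 0 < d -> 0 < p ->
  c = e * e / r * (l^-1 * V / p ^+ 2 * (d * (p ^+ 2 * c * (e^-1 * r) / (d * (e / l * V))))).
Proof. by move=> *; field; rewrite !gt_eqF. Qed.

Section LLT.
Variables (R : realType) (N : nat) (a b : 'I_N).
Hypothesis ab : a != b.
Variable L : R -> R.
Hypothesis dL : forall x : R, -3 < x -> is_derive x (1 : R) L (- softlog x).
Hypothesis bL : forall x : R, -3 < x -> 0 <= L x <= expR (- x).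
Hypothesis L0 : 1 / 3 <= L 0.

Let N1 : 1 <= N%:R :> R. Proof. by rewrite ler1n; case: N a => // -[]. Qed.
Let N0 : 0 < N%:R :> R. Proof. exact: lt_le_trans N1. Qed.
Let l0 : 0 < L 0. Proof. have := L0; lra. Qed.

Lemma norm_kappa0_le1 : `|kappa0 R a b| <= 1.
Proof.
have aN : a%:R <= N%:R :> R by rewrite ler_nat ltnW.
have bN : b%:R <= N%:R :> R by rewrite ler_nat ltnW.
have a0 : 0 <= a%:R :> R by []. have b0 : 0 <= b%:R :> R by [].
have n0 := N0.
rewrite /kappa0 normrM normfV (ger0_norm (_ : 0 <= 2 * N%:R)); last by rewrite mulr_ge0.
rewrite ler_pdivrMr ?mulr_gt0 // mul1r ler_norml; apply/andP; split; lra.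
Qed.

Lemma norm_char_weight_le n r : `|char_weight R a b n r| <= N%:R ^+ 2.
Proof.
apply: le_trans (ler_norm_sum _ _ _) _.
apply: (@le_trans _ _ (\sum_(u < N) \sum_(v < N) 1)).
  apply: ler_sum => u _; apply: le_trans (ler_norm_sum _ _ _) _; apply: ler_sum => v _.
  by case: ifP => _; [exact: norm_cos_le1|rewrite normr0].
by rewrite !sumr_const !card_ord -[N%:R *+ N]mulr_natl expr2.
Qed.

Lemma partition_functionE n (t : R) :
  partition_function a b n t = expR (\sum_x softlog (energy a b t (x : 'I_n * 'I_N))).
Proof.
rewrite expR_sum; apply: eq_bigr => x _.
by rewrite /softlog lnK // posrE addr_gt0 // expR_gt0.
Qed.

Lemma norm_expRB1_le (x : R) : `|x| <= 1 -> `|expR x - 1| <= 4 * `|x|.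
Proof.
move=> x1; rewrite -[X in _ - X](@expR0 R) -[X in _ * `|X|]subr0.
apply: (@norm_derive_le R expR expR) => z /andP[_ zx].
 rewrite ger0_norm ?expR_ge0 //.
apply: le_trans (expR1_le4 R); rewrite ler_expR; apply: le_trans zx _.
rewrite ge_max ler01 /=; exact: le_trans (ler_norm _) x1.
Qed.

Let M : R := pi * Num.sqrt (2 * N%:R) / (4 * Num.sqrt (L 0)).

(** The factor exp (- t r) in the error is left when the tilted weight is divided out, and it makes
    the errors summable over r. The bound on r is there for [main_integral], which admits a mean
    displacement polynomial in 1 / t. *)
Lemma llt : exists C t1 : R, [/\ 0 < C, 0 < t1 &
  forall t n, 0 < t <= t1 -> n%:R * t ^+ 4 = L 0 -> forall r : int, `|r%:~R : R| <= 2 * N%:R * n%:R ->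
  `|(part_count a b n r)%:R - expR (2 * L 0 / t ^+ 2) *
     (char_weight R a b n r * (M * expR (- (ln 2 / 2)) / pi ^+ 2 * t ^+ 4 * expR (- (N%:R * t ^+ 2 * (r%:~R - kappa0 R a b) ^+ 2 / 2))))| <=
  C * expR (2 * L 0 / t ^+ 2) * t ^+ 6 * expR (- (t * r%:~R))].
Proof.
have n0 := N0; have l00 := l0; have n1 := N1.
have N20 : 0 < N%:R + 2 :> R by exact: addr_gt0.
have i2N : (2 * N%:R)^-1 <= 1 :> R by rewrite invf_le1; lra.
pose B : R := 2 * N%:R * L 0 + 2.
have B0 : 0 <= B by apply: addr_ge0 => //; do 2?apply: mulr_ge0 => //; exact: ltW.
pose y1 : R := Num.min (1 / 8) (pi / N%:R).
have y10 : 0 < y1 by rewrite lt_min !divr_gt0 // pi_gt0.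
have [C1 C10 H1] := main_integral n0 B0 l00 y10.
have [C2 [t1 [C20 t10 H2]]] := box_sum_approx ab dL bL L0.
have [C4 C40 C4E] : exists2 C4 : R, 0 < C4 & C4 = 100 * (N%:R + 2) ^+ 4.
  by eexists; last reflexivity; apply: mulr_gt0 => //; apply: exprn_gt0; lra.
pose U0 : R := expR (- (ln 2 / 2)) * expR 2 / pi ^+ 2.
have M0 : 0 < M by rewrite /M; do ?[apply: divr_gt0|apply: mulr_gt0|rewrite sqrtr_gt0|exact: pi_gt0|done].
have pi0 := pi_gt0 R.
have U00 : 0 < U0 by apply: divr_gt0; [apply: mulr_gt0; exact: expR_gt0|exact: exprn_gt0].
exists (U0 * (4 * (C2 + N%:R ^+ 2 * C1) + 4 * C4 * (N%:R ^+ 2 * M))).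
exists (Num.min (Num.min t1 1) (Num.min (Num.min (1 / 216) (1 / (N%:R + 2))) C4^-1)); split.
- apply: mulr_gt0 => //; apply: addr_gt0; apply: mulr_gt0; try exact: mulr_gt0.
    done. apply: addr_gt0 => //; apply: mulr_gt0 => //; exact: exprn_gt0.
  by apply: mulr_gt0 => //; exact: exprn_gt0.
- by rewrite !lt_min t10 ltr01 invr_gt0 C40 (divr_gt0 ltr01 (ltr0Sn R 215)) (divr_gt0 ltr01 N20).
move=> t n /andP[t0]; rewrite !le_min => /andP[/andP[tt1 t11] /andP[/andP[t216 tN] tC]] nt r hr.
have ht : 0 < t <= t1 by rewrite t0.
have ht1 : 0 < t <= 1 by rewrite t0.
have {}t216 : 216 * t <= 1 by lra.
have {}tN : (N%:R + 2) * t <= 1 by move: tN; rewrite ler_pdivlMr // mulrC.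
have tj j : 0 < t ^+ j by rewrite exprn_gt0.
pose X : R := (N%:R * t)^-1 + kappa0 R a b - r%:~R.
have hX : `|X| <= B / t ^+ 4.
  have t4 : t ^+ 4 <= t by rewrite exprS ler_piMr ?(ltW t0) // exprn_ile1 // ltW.
  have i4 : t^-1 <= (t ^+ 4)^-1 by rewrite lef_pV2 ?posrE.
  have i1 : 1 <= t^-1 by rewrite invf_ge1.
  have q1 : `|(N%:R * t)^-1| <= (t ^+ 4)^-1.
    rewrite ger0_norm; last by rewrite invr_ge0 mulr_ge0 // ltW.
    by apply: le_trans i4; rewrite invfM ler_piMl ?invr_ge0 ?(ltW t0) // invf_le1.
  have q2 : `|kappa0 R a b| <= (t ^+ 4)^-1 by apply: le_trans norm_kappa0_le1 _; exact: le_trans i4.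
  have q3 : `|r%:~R : R| <= 2 * N%:R * L 0 / t ^+ 4 by apply: le_trans hr _; rewrite -nt mulrA mulfK // gt_eqF.
  have -> : B / t ^+ 4 = (t ^+ 4)^-1 + (t ^+ 4)^-1 + 2 * N%:R * L 0 / t ^+ 4 by rewrite /B; field; rewrite gt_eqF.
  by apply: le_trans (ler_normB _ _) _; apply: lerD => //; apply: le_trans (ler_normD _ _) _; exact: lerD.
have [G0 dG0] : exists G : R -> R, forall y : R, -1 < y -> is_derive y (1 : R) G (expR (- (y ^+ 2 / (2 * (N%:R * t ^+ 2)))) * cos (X * y)).
  apply: continuous_primitive => y.
  have h : is_derive y (1 : R) (fun y => expR (- (y ^+ 2 / (2 * (N%:R * t ^+ 2)))) * cos (X * y))
     (expR (- (y ^+ 2 / (2 * (N%:R * t ^+ 2)))) * (- (y / (N%:R * t ^+ 2)) * cos (X * y) - X * sin (X * y))).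
    by dv; field; rewrite ?gt_eqF.
  exact: (is_derive_continuous h).
pose G y := G0 y - G0 0.
have dG y : 0 <= y <= y1 -> is_derive y (1 : R) G (expR (- (y ^+ 2 / (2 * (N%:R * t ^+ 2)))) * cos (X * y)).
  by move=> /andP[y0 _]; have h := dG0 y (lt_le_trans (ltrN10 R) y0); rewrite /G; dv; ring.
have GG : G 0 = 0 by rewrite /G subrr.
have A1 := H1 t X G ht1 hX dG GG.
have A2 := H2 t n ht nt r G dG GG.
rewrite box_inversion -/y1 in A2.
have tl := model_tail a L0 t0 t216 nt.
have SL := softlog_model_sum ab t0 tN dL bL tl.
rewrite -C4E in SL.
set S := \sum_x softlog _ in SL.
have ZE : partition_function a b n t = expR S by exact: partition_functionE.
rewrite ZE in A2.
set de := S - _ in SL.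
have de1 : `|de| <= 1.
  apply: le_trans SL _; rewrite -[leRHS](divff (lt0r_neq0 C40)) ler_wpM2l ?(ltW C40) //.
  by apply: le_trans tC; rewrite expr2 ler_piMr // ltW.
have e1 := norm_expRB1_le de1.
have e4 : expR de <= 4.
  apply: le_trans (expR1_le4 R); rewrite ler_expR; exact: le_trans (ler_norm _) de1.
set cnt := (part_count a b n r)%:R : R in A2 *.
set kw := char_weight R a b n r in A2 *.
have kwb : `|kw| <= N%:R ^+ 2 by exact: norm_char_weight_le.
set g1 := gint _ _ * G y1 in A1 A2.
set Y := expR (- (N%:R * t ^+ 2 * X ^+ 2 / 2)) in A1.
rewrite -/M in A1.
set Box := _ / expR S in A2.
pose U : R := expR (- (ln 2 / 2)) * expR ((2 * N%:R)^-1 + kappa0 R a b * t) / pi ^+ 2.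
have UU : 0 < U <= U0.
  apply/andP; split.
    by apply: divr_gt0; [apply: mulr_gt0; exact: expR_gt0|exact: exprn_gt0].
  rewrite /U /U0 ler_wpM2r ?invr_ge0 ?exprn_ge0 ?(ltW pi0) // ler_wpM2l ?expR_ge0 // ler_expR.
  have : `|kappa0 R a b * t| <= 1 * 1 by rewrite normrM; apply: ler_pM => //; [exact: norm_kappa0_le1|rewrite gtr0_norm].
  move=> kt; apply: (@le_trans _ _ (1 + 1 * 1)); last by rewrite mulr1.
  exact: lerD i2N (le_trans (ler_norm _) kt).
have tn : t ^+ 2 * n%:R = L 0 / t ^+ 2 by rewrite -nt; field; rewrite gt_eqF.
have cntE : cnt = expR (2 * L 0 / t ^+ 2) * expR (- (t * r%:~R)) * (U * (expR de * Box)).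
  rewrite /Box tn.
  have -> : expR (2 * L 0 / t ^+ 2) = expR (L 0 / t ^+ 2) * expR (L 0 / t ^+ 2).
    by rewrite -expRD; congr expR; field; rewrite gt_eqF.
  have eS : expR S = expR de * (expR (L 0 / t ^+ 2) * expR (- (ln 2 / 2)) * expR ((2 * N%:R)^-1 + kappa0 R a b * t)).
    by rewrite -!expRD; congr expR; rewrite /de; ring.
  rewrite eS /U (expRD (- (L 0 / t ^+ 2))); set V := expR ((2 * N%:R)^-1 + kappa0 R a b * t); rewrite !expRN.
  have p1 := expR_gt0 (L 0 / t ^+ 2); have p2 := expR_gt0 (t * r%:~R); have p3 := expR_gt0 de.
  have p4 := expR_gt0 (ln 2 / 2 : R); have p5 : 0 < V by exact: expR_gt0.
  exact: count_identity.
(* Completing the square: the tilt factor and the terms 1 / (2 N) + kappa0 t of the logarithm of the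
   partition function turn the Gaussian centred at 1 / (N t) + kappa0 into one centred at kappa0. *)
have mainE : expR (2 * L 0 / t ^+ 2) * (kw * (M * expR (- (ln 2 / 2)) / pi ^+ 2 * t ^+ 4 * expR (- (N%:R * t ^+ 2 * (r%:~R - kappa0 R a b) ^+ 2 / 2)))) =
   expR (2 * L 0 / t ^+ 2) * expR (- (t * r%:~R)) * (U * (kw * (M * t ^+ 4 * Y))).
  have -> : expR (- (N%:R * t ^+ 2 * (r%:~R - kappa0 R a b) ^+ 2 / 2)) = expR (- (t * r%:~R)) * expR ((2 * N%:R)^-1 + kappa0 R a b * t) * Y.
    by rewrite /Y -!expRD; congr expR; rewrite /X; field; rewrite !gt_eqF.
  by rewrite /U; ring.
rewrite cntE mainE -mulrBr -mulrBr normrM [ `|U * _|]normrM.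
rewrite (ger0_norm (_ : 0 <= expR (2 * L 0 / t ^+ 2) * expR (- (t * r%:~R)))); last by apply: mulr_ge0; exact: expR_ge0.
case/andP: UU => U1 U2.
have key : `|expR de * Box - kw * (M * t ^+ 4 * Y)| <= (4 * (C2 + N%:R ^+ 2 * C1) + 4 * C4 * (N%:R ^+ 2 * M)) * t ^+ 6.
  have -> : expR de * Box - kw * (M * t ^+ 4 * Y) =
    expR de * ((Box - kw * g1) + kw * (g1 - M * t ^+ 4 * Y)) + (expR de - 1) * (kw * (M * t ^+ 4 * Y)) by ring.
  apply: le_trans (ler_normD _ _) _; rewrite [leRHS]mulrDl; apply: lerD.
    rewrite normrM (ger0_norm (expR_ge0 _)) -[leRHS]mulrA; apply: ler_pM => //.
    apply: le_trans (ler_normD _ _) _; rewrite [leRHS]mulrDl; apply: lerD => //.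
    by rewrite normrM -[leRHS]mulrA; apply: ler_pM.
  rewrite normrM; apply: (@le_trans _ _ (4 * (C4 * t ^+ 2) * (N%:R ^+ 2 * (M * t ^+ 4 * 1)))); last first.
    by rewrite le_eqVlt; apply/orP; left; apply/eqP; ring.
  apply: ler_pM => //; first by apply: le_trans e1 _; rewrite ler_wpM2l.
  rewrite normrM; apply: ler_pM => //.
  rewrite ger0_norm; last by apply: mulr_ge0; [apply: mulr_ge0; exact: ltW|exact: expR_ge0].
  apply: ler_wpM2l; first by apply: mulr_ge0; exact: ltW.
  by rewrite expRN_le1 // divr_ge0 // mulr_ge0 ?sqr_ge0 // mulr_ge0 ?sqr_ge0 // ltW.
set e2 := expR (2 * _ / _); set er := expR (- (t * _)).
have -> : U0 * (4 * (C2 + N%:R ^+ 2 * C1) + 4 * C4 * (N%:R ^+ 2 * M)) * e2 * t ^+ 6 * er =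
  e2 * er * (U0 * ((4 * (C2 + N%:R ^+ 2 * C1) + 4 * C4 * (N%:R ^+ 2 * M)) * t ^+ 6)) by ring.
apply: ler_wpM2l; first by apply: mulr_ge0; exact: expR_ge0.
by rewrite (gtr0_norm U1); apply: ler_pM => //; exact: ltW.
Qed.

End LLT.

(** * Summation over the difference *)

Section GaussSums.
Variable R : realType.
Implicit Types (x y X e t w : R).

Let g x : R := expR (- (x ^+ 2)).
Let g1 x : R := - (2 * x * expR (- (x ^+ 2))).
Let g2 x : R := (4 * x ^+ 2 - 2) * expR (- (x ^+ 2)).

Let dg x : is_derive x (1 : R) g (g1 x).
Proof. by rewrite /g /g1; dv; ring. Qed.
Let dg1 x : is_derive x (1 : R) g1 (g2 x).
Proof. by rewrite /g1 /g2; dv; ring. Qed.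

Let g1_le x : `|g1 x| <= 2.
Proof.
have h : `|x| * expR (- (x ^+ 2)) <= 1.
  have e0 := expR_gt0 (x ^+ 2); have e1 := expR_ge1Dx (x ^+ 2).
  rewrite expRN ler_pdivrMr // mul1r; apply: le_trans e1.
  by rewrite -(real_normK (num_real x)); have := sqr_ge0 (`|x| - 1); have := normr_ge0 `|x|; nra.
rewrite /g1 normrN !normrM (ger0_norm (expR_ge0 _)) (ger0_norm (_ : 0 <= 2)) //; lra.
Qed.

Let g2_le x : `|g2 x| <= 20 * expR (- x / 2).
Proof.
have h1 : expR (- (x ^+ 2 / 2)) <= 2 * expR (- x / 2).
  apply: (@le_trans _ _ (expR (1 / 2) * expR (- x / 2))).
    by rewrite -expRD ler_expR; have := sqr_ge0 (x - 1 / 2); lra.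
  by rewrite ler_wpM2r ?expR_ge0 // expR_half_le2.
apply: (@le_trans _ _ (10 * expR (- (x ^+ 2 / 2)))); last by lra.
have E : expR (- (x ^+ 2)) = expR (- (x ^+ 2 / 2)) * expR (- (x ^+ 2 / 2)) by rewrite -expRD; congr expR; field.
have e1 := expR_ge1Dx (x ^+ 2 / 2); have e0 := expR_gt0 (x ^+ 2 / 2); have e2 := expR_gt0 (- (x ^+ 2 / 2)).
rewrite /g2 E normrM mulrC normrM (ger0_norm (ltW e2)) -[leLHS]mulrA [leRHS]mulrC ler_wpM2l ?(ltW e2) //.
have x2 := sqr_ge0 x.
apply: (@le_trans _ _ (expR (- (x ^+ 2 / 2)) * (10 * expR (x ^+ 2 / 2)))); last first.
  by rewrite mulrCA -expRD addNr expR0 mulr1.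
rewrite ler_wpM2l ?(ltW e2) // ler_norml; apply/andP; split; lra.
Qed.

Lemma neg_sqr_le (z : R) : - (z ^+ 2) <= 1 / 2 - z.
Proof. by have := sqr_ge0 (z - 1 / 2); lra. Qed.

(** The trapezoidal rule for one residue class: its boundary term gives 1/2, and moving the first
    node X + e t w back to X gives - e / N by the expansion of [gauss_tail]. *)
Lemma gauss_class_sum (B w N l0 : R) : 0 <= B -> 0 < w -> 1 <= N -> 0 < l0 ->
  exists C t1 : R, [/\ 0 < C, 0 < t1 &
  forall t X e (n : nat), 0 < t <= t1 -> n%:R * t ^+ 4 = l0 -> `|X| <= B -> `|e| <= N + 2 ->
  `|\sum_(i < n) expR (- ((X + e * (t * w) + N * (t * w) * i%:R) ^+ 2)) -
    (gauss_tail X / (N * (t * w)) + expR (- (X ^+ 2)) * (1 / 2 - e / N))| <= C * t].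
Proof.
move=> B0 w0 N1 l00; have N0 : 0 < N by lra.
have c0 : 0 < N * w * l0 by do 2?apply: mulr_gt0.
have [C1 C10 H1] := exp_small 2 c0.
pose K : R := expR (B + 1).
have K0 : 0 < K by exact: expR_gt0.
pose C : R := (80 * K * N ^+ 2 * w ^+ 2 + 4 * K * C1 + 2 * ((N + 2) * w) ^+ 2 + N * w * (N + 2) * w) / (N * w).
have Nw : 0 < N * w by exact: mulr_gt0.
exists C, (Num.min 1 (Num.min (((N + 2) * w)^-1) ((N * w)^-1))); split.
- apply: divr_gt0 => //; apply: ltr_wpDl; last by do 2?apply: mulr_gt0 => //; lra.
  apply: addr_ge0; last by apply: mulr_ge0 => //; exact: sqr_ge0.
  by apply: addr_ge0; do 3?apply: mulr_ge0 => //; rewrite ?exprn_ge0 ?(ltW w0) ?(ltW K0) ?(ltW N0) ?(ltW C10).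
- by rewrite !lt_min ltr01 !invr_gt0 Nw mulr_gt0 //; lra.
move=> t X e n /andP[t0]; rewrite !le_min => /and3P[t1 tw1 tw2] nt hX he.
have tw : 0 < t * w by exact: mulr_gt0.
have h01 : 0 < N * (t * w) <= 1.
  rewrite mulr_gt0 //=; have := tw2; rewrite -(ler_pM2l Nw) divff ?gt_eqF // => h; apply: le_trans h.
  by rewrite le_eqVlt; apply/orP; left; apply/eqP; ring.
have ew : `|e * (t * w)| <= (N + 2) * w * t.
  rewrite normrM (gtr0_norm tw) (_ : (N + 2) * w * t = (N + 2) * (t * w)); last by ring.
  by rewrite ler_wpM2r // ltW.
have ew1 : `|e * (t * w)| <= 1.
  apply: le_trans ew _; have p : 0 < (N + 2) * w by apply: mulr_gt0 => //; lra.
  by rewrite -[leRHS](divff (lt0r_neq0 p)) ler_pM2l.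
set h := N * (t * w) in h01 *; set d := e * (t * w) in ew ew1 *; pose x := X + d.
have xb : - (B + 1) <= x.
  by move: hX ew1; rewrite !ler_norml /x => /andP[? ?] /andP[? ?]; lra.
have T := @trapezoid_sum R (@gauss_tail R) g g1 g2 20 (B + 1) ltac:(lra) (fun x _ => is_derive_gauss_tail x) (fun x _ => dg x) (fun x _ => dg1 x) (fun x _ => g2_le x) x h n xb h01.
set S := \sum_(i < n) _; have SE : \sum_(i < n) g (x + h * i%:R) = S by [].
rewrite SE in T.
have xb' : - x <= B + 1 by rewrite lerNl.
have xK : expR (- x / 2) <= K.
  by rewrite ler_expR ler_pdivrMr //; apply: le_trans xb' _; rewrite ler_peMr ?ler1n // addr_ge0.
set z := x + h * n%:R in T.
have zK : expR (- z) <= K * (C1 * t ^+ 2).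
  have hn : h * n%:R = N * w * l0 / t ^+ 3.
    by rewrite /h -nt; field; rewrite gt_eqF.
  rewrite /z hn opprD expRD; apply: ler_pM; rewrite ?expR_ge0 //.
    by rewrite ler_expR.
  apply: le_trans (H1 t t0); rewrite ler_expR lerN2 ler_wpM2l ?(ltW c0) // lef_pV2 ?posrE ?exprn_gt0 //.
  by rewrite exprS ler_piMr ?(ltW t0) // exprn_ile1 // ltW.
have /andP[z1 z2] := gauss_tail_bound z.
have z3 : 0 <= g z <= 2 * expR (- z).
  rewrite expR_ge0 /=; apply: (@le_trans _ _ (expR (1 / 2) * expR (- z))).
    by rewrite -expRD ler_expR; exact: neg_sqr_le.
  by rewrite ler_wpM2r ?expR_ge0 // expR_half_le2.
have TT : `|gauss_tail x - gauss_tail X - (x - X) * - g X| <= 2 * (x - X) ^+ 2.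
  apply: (@taylor1_bound R (@gauss_tail R) (fun y => - g y) (fun y => - g1 y) 2 X x) => y _.
  - exact: is_derive_gauss_tail.
  - by have h0 := dg y; dv.
  - by rewrite normrN.
have gx : `|g x - g X| <= 2 * `|x - X|.
  by apply: (@norm_derive_le R g g1 2 X x).
have xX : x - X = d by rewrite /x addrAC subrr add0r.
rewrite xX in TT gx.
have d2 : d ^+ 2 <= ((N + 2) * w * t) ^+ 2.
  by rewrite -(real_normK (num_real d)) lerXn2r ?nnegrE ?normr_ge0 //; apply: le_trans ew.
have h0 : 0 < h by case/andP: h01.
have hE : h = N * w * t by rewrite /h; ring.
have dE : d = e / N * h by rewrite /d /h; field; rewrite gt_eqF.
have main : `|h * S - (gauss_tail X + expR (- (X ^+ 2)) * (h / 2 - d))| <=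
   (80 * K * N ^+ 2 * w ^+ 2 + 4 * K * C1 + 2 * ((N + 2) * w) ^+ 2 + N * w * (N + 2) * w) * t ^+ 2.
  have b1 : 4 * 20 * expR (- x / 2) * h ^+ 2 <= 80 * K * N ^+ 2 * w ^+ 2 * t ^+ 2.
    have -> : 80 * K * N ^+ 2 * w ^+ 2 * t ^+ 2 = 80 * K * h ^+ 2 by rewrite hE; ring.
    rewrite ler_wpM2r ?sqr_ge0 // (_ : 4 * 20 = 80); last by ring.
    by rewrite ler_wpM2l.
  have h1 : h <= 1 by case/andP: h01.
  have h2 : 0 <= h / 2 by rewrite divr_ge0 // ltW.
  have b2 : h / 2 * g z <= expR (- z).
    case/andP: z3 => _ z3; apply: (@le_trans _ _ (h / 2 * (2 * expR (- z)))); first by rewrite ler_wpM2l.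
    by rewrite mulrA divfK ?pnatr_eq0 // ler_piMl ?expR_ge0.
  have b2' : 0 <= h / 2 * g z by case/andP: z3 => ? ?; exact: mulr_ge0.
  have b3 : h / 2 * `|g x - g X| <= N * w * (N + 2) * w * t ^+ 2.
    apply: (@le_trans _ _ (h / 2 * (2 * ((N + 2) * w * t)))).
      by apply: ler_wpM2l => //; apply: le_trans gx _; rewrite ler_wpM2l.
    by rewrite hE le_eqVlt; apply/orP; left; apply/eqP; field.
  have b4 : 2 * d ^+ 2 <= 2 * ((N + 2) * w) ^+ 2 * t ^+ 2.
    by rewrite -mulrA -exprMn ler_wpM2l.
  have b3' : `|h / 2 * (g x - g X)| <= N * w * (N + 2) * w * t ^+ 2.
    by rewrite normrM (ger0_norm h2).
  have zK' : 4 * expR (- z) <= 4 * K * C1 * t ^+ 2 by rewrite -!mulrA ler_wpM2l.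
  have b5 : `|gauss_tail z + h / 2 * g z| <= 4 * K * C1 * t ^+ 2.
    rewrite (ger0_norm (addr_ge0 z1 b2')); apply: le_trans zK'; apply: le_trans (lerD z2 b2) _.
    rewrite (_ : 4 * expR (- z) = 2 * expR (- z) + 2 * expR (- z)); last by ring.
    by rewrite lerD2l ler_peMl ?expR_ge0 // ler1n.
  have -> : h * S - (gauss_tail X + expR (- (X ^+ 2)) * (h / 2 - d)) =
     (h * S - (gauss_tail x - gauss_tail z) - h / 2 * (g x - g z)) +
     (gauss_tail x - gauss_tail X - d * - g X) + h / 2 * (g x - g X) - (gauss_tail z + h / 2 * g z).
    by rewrite -/(g X); ring.
  rewrite [leRHS](_ : _ = 80 * K * N ^+ 2 * w ^+ 2 * t ^+ 2 + 2 * ((N + 2) * w) ^+ 2 * t ^+ 2 +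
     N * w * (N + 2) * w * t ^+ 2 + 4 * K * C1 * t ^+ 2); last by ring.
  apply: le_trans (ler_normB _ _) (lerD _ b5); apply: le_trans (ler_normD _ _) (lerD _ b3').
  exact: le_trans (ler_normD _ _) (lerD (le_trans T b1) (le_trans TT b4)).
have -> : S - (gauss_tail X / h + expR (- (X ^+ 2)) * (1 / 2 - e / N)) =
   (h * S - (gauss_tail X + expR (- (X ^+ 2)) * (h / 2 - d))) / h.
  by rewrite dE; field; rewrite gt_eqF // gt_eqF.
rewrite normrM normfV (gtr0_norm h0) ler_pdivrMr //; apply: le_trans main _.
rewrite /C hE le_eqVlt; apply/orP; left; apply/eqP.
by field; rewrite !gt_eqF.
Qed.

End GaussSums.

Lemma norm_shift_le (R : realType) (c j i m M n : R) :
  0 <= j -> j + 1 <= m -> 0 <= i -> i + m <= M -> `|c| + m + 1 <= n -> n <= M -> `|c + j + i| <= 2 * M.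
Proof. by move=> *; have := ler_norm c; have := lerNnormlW (lexx `|c|); rewrite ler_norml; lra. Qed.

Lemma norm_offset_le (R : realType) (d j k m : R) :
  0 <= d <= 1 -> 0 <= j -> j + 1 <= m -> `|k| <= 1 -> `|d + j - k| <= m + 2.
Proof. by rewrite !ler_norml => *; lra. Qed.

Section SumAsymptotics.
Variables (R : realType) (N : nat) (a b : 'I_N).
Hypothesis ab : a != b.
Variable L : R -> R.
Hypothesis dL : forall x : R, -3 < x -> is_derive x (1 : R) L (- softlog x).
Hypothesis bL : forall x : R, -3 < x -> 0 <= L x <= expR (- x).
Hypothesis L0 : 1 / 3 <= L 0.

Let N1 : 1 <= N%:R :> R. Proof. by rewrite ler1n; case: N a => // -[]. Qed.
Let N0 : 0 < N%:R :> R. Proof. exact: lt_le_trans N1. Qed.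
Let l0 : 0 < L 0. Proof. have := L0; lra. Qed.

Lemma char_weight_periodic (n : nat) (r : int) (i : nat) :
  char_weight R a b n (r + (N * i)%:Z) = char_weight R a b n r.
Proof.
apply: eq_bigr => u _; apply: eq_bigr => v _; case: ifP => // _.
rewrite -[RHS](cos_periodic_int _ (v%:Z * i%:Z)); congr cos.
rewrite intrD intrM -!pmulrn natrM; field.
by rewrite gt_eqF // N0.
Qed.

Definition scale_const : R :=
  pi * Num.sqrt (2 * N%:R) / (4 * Num.sqrt (L 0)) * expR (- (ln 2 / 2)) / pi ^+ 2.

Lemma scale_const_ge0 : 0 <= scale_const.
Proof.
rewrite /scale_const; apply: divr_ge0; last exact: sqr_ge0.
apply: mulr_ge0; last exact: expR_ge0.
by rewrite divr_ge0 ?mulr_ge0 ?pi_ge0 ?sqrtr_ge0.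
Qed.

(** With w^2 = N / 2 the exponent in [llt] becomes the square of (r - kappa0) t w. [X] is the real
    threshold in this scale, and [de] is what rounding up to the integer c adds. The errors t^6 exp
    (- t r) form a geometric series of sum O(t^5). *)
Lemma sum_asymp (B w : R) : 0 <= B -> 0 < w -> w ^+ 2 = N%:R / 2 ->
  exists C t1 : R, [/\ 0 < C, 0 < t1 &
  forall (t X de : R) (n : nat) (c : int), 0 < t <= t1 -> n%:R * t ^+ 4 = L 0 -> `|X| <= B ->
  0 <= de <= 1 -> c%:~R * (t * w) = X + de * (t * w) ->
  (c + (N * n)%:Z > n%:Z)%R /\
  `|\sum_(j < N) \sum_(i < n) (part_count a b n (c + j%:Z + (N * i)%:Z))%:R -
    expR (2 * L 0 / t ^+ 2) * (scale_const * t ^+ 4 *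
      \sum_(j < N) char_weight R a b n (c + j%:Z) *
        (gauss_tail X / (N%:R * (t * w)) + expR (- (X ^+ 2)) * (1 / 2 - (de + j%:R - kappa0 R a b) / N%:R)))| <=
  C * expR (2 * L 0 / t ^+ 2) * t ^+ 5].
Proof.
move=> B0 w0 w2; have n0 := N0; have n1 := N1; have l00 := l0; have M0 := scale_const_ge0.
have N2 : 2 <= N%:R :> R.
  rewrite ler_nat leqNgt; apply/negP => h; move/eqP: ab; apply; apply/val_inj => /=.
  by move: (ltn_ord a) (ltn_ord b); rewrite !ltnS in h *; move: (val a) (val b) => x y; lia.
have [C1 [t1 [C10 t10 H1]]] := llt ab dL bL L0.
have [C2 [t2 [C20 t20 H2]]] := gauss_class_sum B0 w0 n1 l00.
(* For a negative threshold exp (- t c) exceeds 1; as t c = X / w + de t, it stays below [K]. *)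
pose K : R := expR (B / w).
have K0 : 0 < K by exact: expR_gt0.
pose q : R := B / w + 1 + N%:R.
have Bw0 : 0 <= B / w by exact: divr_ge0 B0 (ltW w0).
have q0 : 0 < q by rewrite /q; lra.
have q1 : 0 < q + 1 by exact: addr_gt0.
exists (C1 * K * 2 + scale_const * (N%:R * (N%:R ^+ 2 * C2))).
exists (Num.min (Num.min t1 t2) (Num.min (Num.min 1 (L 0 / (q + 1))) (2 * N%:R)^-1)); split.
- apply: ltr_wpDr; last by do 2?apply: mulr_gt0.
  by do 3?apply: mulr_ge0 => //; rewrite ?sqr_ge0 // ltW.
- by rewrite !lt_min t10 t20 ltr01 divr_gt0 ?invr_gt0 ?mulr_gt0.
move=> t X de n c /andP[t0]; rewrite !le_min => /andP[/andP[tt1 tt2] /andP[/andP[t11 tq] tN]] nt hX hde hc.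
have ht1 : 0 < t <= t1 by rewrite t0.
have ht2 : 0 < t <= t2 by rewrite t0.
have tw : 0 < t * w by exact: mulr_gt0.
case/andP: (hde) => d0 d1.
have tX j : 0 < t ^+ j by rewrite exprn_gt0.
have cE : t * c%:~R = X / w + de * t.
  have -> : t * c%:~R = (c%:~R * (t * w)) / w by field; rewrite gt_eqF.
  by rewrite hc; field; rewrite gt_eqF.
have Xw : `|X / w| <= B / w by rewrite normrM normfV (gtr0_norm w0) ler_wpM2r // invr_ge0 ltW.
have cb : `|c%:~R : R| * t <= B / w + t.
  rewrite -[X in _ * X](gtr0_norm t0) -normrM mulrC cE; apply: le_trans (ler_normD _ _) _; apply: lerD => //.
  by rewrite normrM (ger0_norm d0) (gtr0_norm t0) ler_piMl // ltW.
have nbig : `|c%:~R : R| + N%:R + 1 <= n%:R.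
  rewrite -(ler_pM2r (tX 4%N)) nt.
  apply: (@le_trans _ _ ((q + 1) * t)); last first.
    by move: tq; rewrite ler_pdivlMr // mulrC.
  have t41 : t ^+ 4 <= t by rewrite exprS ler_piMr ?(ltW t0) // exprn_ile1 // ltW.
  have t31 : t ^+ 3 <= 1 by rewrite exprn_ile1 // ltW.
  have e1 : `|c%:~R : R| * t ^+ 4 <= (B / w + 1) * t.
    have -> : `|c%:~R : R| * t ^+ 4 = `|c%:~R : R| * t * t ^+ 3 by ring.
    have t3t : t ^+ 3 <= t by rewrite exprS ler_piMr ?(ltW t0) // exprn_ile1 // ltW.
    apply: ler_pM => //; [by apply: mulr_ge0 => //; exact: ltW|exact: ltW|].
    by apply: le_trans cb _; rewrite lerD2l.
  have e2 : (N%:R + 1) * t ^+ 4 <= (N%:R + 1) * t by rewrite ler_wpM2l // addr_ge0 // ltW.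
  rewrite /q; clear cE Xw cb nt tq tN t41 t31 hc hX hde; have := ltW t0; lra.
(* The difference of a partition of n never exceeds n, so n values in each class exhaust all r >= c
   that can occur. *)
have crN : n%:R < c%:~R + N%:R * n%:R :> R.
  have := lerNnormlW (lexx `|c%:~R : R|).
  have : 2 * n%:R <= N%:R * n%:R :> R by rewrite ler_wpM2r.
  by clear cE Xw cb nt tq tN hc hX hde tw; lra.
split.
  rewrite -(ltr_int R) intrD -!pmulrn natrM; exact: crN.
set E2 := expR (2 * L 0 / t ^+ 2) in H1 *.
have E20 : 0 < E2 by exact: expR_gt0.
rewrite mulr_sumr mulr_sumr -sumrB.
apply: le_trans (ler_norm_sum _ _ _) _.
pose bnd : R := C1 * E2 * t ^+ 6 * (K * (2 / (t * N%:R))) + E2 * (scale_const * t ^+ 4 * (N%:R ^+ 2 * (C2 * t))).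
apply: (@le_trans _ _ (\sum_(j < N) bnd)); last first.
  rewrite sumr_const card_ord -[_ *+ N]mulr_natl /bnd le_eqVlt; apply/orP; left; apply/eqP; field.
  by rewrite !gt_eqF.
apply: ler_sum => j _.
set kw := char_weight R a b n (c + j%:Z).
have kwb : `|kw| <= N%:R ^+ 2 by exact: norm_char_weight_le.
pose e : R := de + j%:R - kappa0 R a b.
have jN : j%:R + 1 <= N%:R :> R by rewrite natr1 ler_nat.
have eb : `|e| <= N%:R + 2.
  have hk := @norm_kappa0_le1 R N a b; have j0 : 0 <= j%:R :> R by [].
  exact: norm_offset_le.
have G := H2 t X e n ht2 nt hX eb.
set Sg := \sum_(i < n) _ in G; set Ap := _ + _ * (_ - _) in G.
have L1 (i : 'I_n) : `|(part_count a b n (c + j%:Z + (N * i)%:Z))%:R - E2 * (kw * (scale_const * t ^+ 4 *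
     expR (- ((X + e * (t * w) + N%:R * (t * w) * i%:R) ^+ 2))))| <= C1 * E2 * t ^+ 6 * (K * expR (- (0 + 2 * t * N%:R * i%:R) / 2)).
  have rE : (c + j%:Z + (N * i)%:Z)%:~R = c%:~R + j%:R + N%:R * i%:R :> R by rewrite !intrD -!pmulrn natrM.
  have hr : `|(c + j%:Z + (N * i)%:Z)%:~R : R| <= 2 * N%:R * n%:R.
    rewrite rE; have i1 : N%:R * i%:R + N%:R <= N%:R * n%:R :> R.
      by rewrite -[X in _ + X]mulr1 -mulrDr ler_wpM2l // natr1 ler_nat.
    have i0 : 0 <= N%:R * i%:R :> R by apply: mulr_ge0.
    have j0 : 0 <= j%:R :> R by [].
    have nN : n%:R <= N%:R * n%:R :> R by rewrite ler_peMl.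
    by rewrite -mulrA; apply: norm_shift_le nbig nN.
  have := H1 t n ht1 nt _ hr; rewrite char_weight_periodic -/kw.
  have -> : expR (- (N%:R * t ^+ 2 * ((c + j%:Z + (N * i)%:Z)%:~R - kappa0 R a b) ^+ 2 / 2)) =
     expR (- ((X + e * (t * w) + N%:R * (t * w) * i%:R) ^+ 2)).
    congr (expR (- _)).
    have -> : X + e * (t * w) + N%:R * (t * w) * i%:R = (c%:~R + j%:R + N%:R * i%:R - kappa0 R a b) * (t * w).
      rewrite (_ : (c%:~R + j%:R + N%:R * i%:R - kappa0 R a b) * (t * w) = c%:~R * (t * w) + (j%:R + N%:R * i%:R - kappa0 R a b) * (t * w)); last by ring.
      by rewrite hc /e; ring.
    by rewrite rE !exprMn w2; field.
  have -> : pi * Num.sqrt (2 * N%:R) / (4 * Num.sqrt (L 0)) * expR (- (ln 2 / 2)) / pi ^+ 2 = scale_const by [].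
  move/le_trans; apply; rewrite ler_wpM2l //; first by apply: mulr_ge0 (ltW (tX 6%N)); apply: mulr_ge0; exact: ltW.
  rewrite /K -expRD ler_expR rE mulrDr mulrDr cE.
  have : - (B / w) <= X / w by move: Xw; rewrite ler_norml => /andP[].
  have : 0 <= de * t by apply: mulr_ge0 => //; exact: ltW.
  have : 0 <= t * j%:R by apply: mulr_ge0 => //; exact: ltW.
  clear cE Xw cb nt tq tN hc hX hde hr rE eb kwb crN nbig; lra.
have geo : \sum_(i < n) expR (- (0 + 2 * t * N%:R * i%:R) / 2) <= 2 / (t * N%:R).
  apply: le_trans (@geometric_expR_le R 0 (2 * t * N%:R) n _) _.
    rewrite !mulr_gt0 //=; move: tN; rewrite -(ler_pM2l (_ : 0 < 2 * N%:R)) ?mulr_gt0 // divff ?gt_eqF ?mulr_gt0 // => h.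
    by apply: le_trans h; rewrite le_eqVlt; apply/orP; left; apply/eqP; ring.
  by rewrite oppr0 mul0r expR0 mul1r le_eqVlt; apply/orP; left; apply/eqP; field; rewrite !gt_eqF.
have -> : \sum_(i < n) (part_count a b n (c + j%:Z + (N * i)%:Z))%:R - E2 * (scale_const * t ^+ 4 * (kw * Ap)) =
   (\sum_(i < n) ((part_count a b n (c + j%:Z + (N * i)%:Z))%:R - E2 * (kw * (scale_const * t ^+ 4 *
     expR (- ((X + e * (t * w) + N%:R * (t * w) * i%:R) ^+ 2)))))) + E2 * (scale_const * t ^+ 4 * (kw * (Sg - Ap))).
  rewrite sumrB -!mulr_sumr -/Sg; ring.
apply: le_trans (ler_normD _ _) _; apply: lerD.
  apply: le_trans (ler_norm_sum _ _ _) _; apply: le_trans (ler_sum _ (fun i _ => L1 i)) _.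
  rewrite -!mulr_sumr ler_wpM2l //; first by apply: mulr_ge0 (ltW (tX 6%N)); apply: mulr_ge0; exact: ltW.
  by rewrite ler_wpM2l // ltW.
rewrite normrM (gtr0_norm E20) ler_wpM2l ?(ltW E20) // normrM ger0_norm; last by apply: mulr_ge0 => //; exact: ltW.
rewrite ler_wpM2l //; first by apply: mulr_ge0 => //; exact: ltW.
by rewrite normrM; apply: ler_pM.
Qed.

End SumAsymptotics.

(** * Partitions into distinct parts *)

Section Partitions.
Variables (N : nat) (a b : 'I_N).
Hypothesis ab : a != b.
Let N0 : (0 < N)%N. Proof. by case: N a => // -[]. Qed.

Section Fixed.
Variable n : nat.
Notation T := ('I_n * 'I_N)%type.
Implicit Types (A : {set T}) (lambda : seq nat) (x : T).

Lemma part_inj : injective (@part N n).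
Proof.
move=> [i j] [i' j'] /= [] h.
have h1 : i = i' :> nat by have := congr1 (divn^~ N) h; rewrite !divnMDl // !divn_small // !addn0.
have h2 : j = j' :> nat by have := congr1 (modn^~ N) h; rewrite !modnMDl !modn_small.
by congr pair; exact: val_inj.
Qed.

Lemma part_surj (y : nat) : (0 < y <= n)%N -> exists x : T, part x = y.
Proof.
move=> /andP[y0 yn].
have h1 : (y.-1 %/ N < n)%N by apply: leq_ltn_trans (leq_div _ _) _; rewrite prednK.
have h2 : (y.-1 %% N < N)%N by rewrite ltn_mod.
by exists (Ordinal h1, Ordinal h2); rewrite /part /= -divn_eq prednK.
Qed.

Lemma part_mod x (c : 'I_N) : (part x == c.+1 %[mod N])%N = (x.2 == c).
Proof.
rewrite /part -!(addn1 (_ + _)) -(addn1 c) eqn_modDr modnMDl !modn_small //.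
Qed.

Definition parts_of A : seq nat := sort geq [seq part x | x <- enum A].

Lemma mem_parts_of A (y : nat) : (y \in parts_of A) = [exists x in A, part x == y].
Proof.
rewrite /parts_of mem_sort; apply/mapP/exists_inP => [[x xA ->]|[x xA /eqP <-]].
  by exists x => //; rewrite -mem_enum.
by exists x => //; rewrite mem_enum.
Qed.

Lemma uniq_parts_of A : uniq (parts_of A).
Proof. by rewrite sort_uniq (map_inj_uniq part_inj) enum_uniq. Qed.

Let geq_total : total geq. Proof. by move=> x y; exact: leq_total. Qed.
Let geq_trans : transitive geq. Proof. by move=> y x z /= h1 h2; exact: leq_trans h2 h1. Qed.
Let geq_anti : antisymmetric geq. Proof. by move=> x y; rewrite /= andbC => /anti_leq. Qed.

Lemma parts_of_inj : injective parts_of.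
Proof.
move=> A B AB; apply/setP => x.
have h (C : {set T}) : (x \in C) = (part x \in parts_of C).
  rewrite mem_parts_of; apply/idP/exists_inP => [xC|[y yC /eqP /part_inj <-] //].
  by exists x.
by rewrite !h AB.
Qed.

Lemma sumn_parts_of A : sumn (parts_of A) = psize A.
Proof.
rewrite (perm_sumn (permEl (perm_sort _ _))) sumnE big_map /psize -big_enum.
by [].
Qed.

Lemma pd_parts_of A : pd a.+1 b.+1 N (parts_of A) = pdiff a b A.
Proof.
have cnt (c : 'I_N) : (count (fun p => p == c.+1 %[mod N])%N (parts_of A))%:Z = \sum_(x in A) (x.2 == c)%:Z.
  rewrite /parts_of (permP (permEl (perm_sort _ _))) count_map -sum1_count big_mkcond -big_enum /=.
  rewrite (big_morph Posz PoszD (erefl _)); apply: eq_bigr => x _.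
  by rewrite part_mod; case: (_ == _).
by rewrite /pd !cnt -sumrB.
Qed.

Lemma parts_of_distinct A : psize A = n -> distinct_partitions n (parts_of A).
Proof.
move=> sA; split; last by rewrite sumn_parts_of.
  by rewrite gtn_sorted_uniq_geq uniq_parts_of /parts_of sort_sorted.
by apply/allP => y; rewrite mem_parts_of => /exists_inP [x _ /eqP <-].
Qed.

Lemma parts_of_surj lambda : distinct_partitions n lambda -> exists A, parts_of A = lambda.
Proof.
move=> [sl pl sn].
move: (sl); rewrite gtn_sorted_uniq_geq => /andP[ul gl].
exists [set x : T | part x \in lambda]%SET.
apply: (sorted_eq geq_trans geq_anti) => //; first exact: sort_sorted geq_total _.
apply: uniq_perm => //; first exact: uniq_parts_of.
move=> y; rewrite mem_parts_of; apply/exists_inP/idP => [[x] | yl].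
  by rewrite inE => xl /eqP <-.
have y0 : (0 < y)%N by exact: (allP pl).
have yn : (y <= n)%N by rewrite -sn (perm_sumn (perm_to_rem yl)) /= leq_addr.
have [x xy] := @part_surj y ltac:(by rewrite y0).
by exists x; rewrite ?inE ?xy.
Qed.

(** Every number from 1 to n is [part x] for exactly one x, so distinct partitions of n correspond
    to sets of size n. As [pd] is an integer, the real threshold may be replaced by its ceiling. *)
Lemma d_card (R : realType) (c : R) :
  d a.+1 b.+1 N c n = #|[set A : {set T} | (psize A == n) && (Num.ceil c <= pdiff a b A)]%SET|.
Proof.
rewrite /d; set S := [set lambda | _].
have fS : finite_set S by apply: sub_finite_set (finite_distinct_partitions n) => x [].
set P := [set A : {set T} | _]%SET.
rewrite cardE -(size_map parts_of); apply: perm_size.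
apply: uniq_perm; [exact: fset_uniq|by rewrite map_inj_uniq ?enum_uniq //; exact: parts_of_inj|].
move=> lambda; rewrite in_fset_set //; apply/idP/mapP.
  rewrite inE => -[dl cl]; have [A AE] := parts_of_surj dl.
  exists A => //; rewrite mem_enum inE -sumn_parts_of AE.
  have [_ _ ->] := dl; rewrite eqxx /=.
  by rewrite -pd_parts_of AE ceil_le_int.
move=> [A AP ->]; have /andP[/eqP sA cA] : (psize A == n) && (Num.ceil c <= pdiff a b A) by move: AP; rewrite mem_enum finset.in_set.
rewrite inE; split; first exact: parts_of_distinct.
by rewrite pd_parts_of -ceil_le_int.
Qed.

Lemma pdiff_le A : pdiff a b A <= (psize A)%:Z.
Proof.
have -> : (psize A)%:Z = \sum_(x in A) (part x)%:Z by exact: (big_morph Posz PoszD (erefl _)).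
apply: ler_sum => x _; rewrite /sgn_ /part.
by case: (_ == a); case: (_ == b); rewrite //= ?subrr ?subr0 ?sub0r.
Qed.

(** Euclidean division by N of the excess of the difference over the ceiling gives the class j and
    the index i; by [pdiff_le] and the hypothesis the quotient is below n. *)
Lemma d_part_count (R : realType) (c : R) : n%:Z < Num.ceil c + (N * n)%:Z ->
  (d a.+1 b.+1 N c n)%:R = \sum_(j < N) \sum_(i < n) (part_count a b n (Num.ceil c + j%:Z + (N * i)%:Z))%:R :> R.
Proof.
move=> hn; rewrite d_card; set C := Num.ceil c in hn *.
have pcE (r : int) : (part_count a b n r)%:R = \sum_(A : {set T}) ((psize A == n) && (pdiff a b A == r))%:R :> R.
  rewrite /part_count -sum1_card natr_sum big_mkcond /=; apply: eq_bigr => A _.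
  by rewrite inE; case: (_ && _).
under eq_bigr do under eq_bigr do rewrite pcE.
under eq_bigr do rewrite exchange_big /=.
rewrite exchange_big /= -sum1_card natr_sum big_mkcond /=; apply: eq_bigr => A _.
rewrite inE; case: eqP => /= [sA|_]; last first.
  by rewrite big1 // => j _; rewrite big1.
case: (leP C (pdiff a b A)) => hC; last first.
  rewrite big1 // => j _; rewrite big1 // => i _; case: eqP => // h.
  by move: hC; rewrite h ltNge; lia.
have hk : pdiff a b A < C + (N * n)%:Z by apply: le_lt_trans hn; rewrite -[in leRHS]sA; exact: pdiff_le.
have [k kE] : exists k : nat, pdiff a b A = C + k%:Z by exists `|pdiff a b A - C|%N; lia.
have kn : (k < N * n)%N by move: hk; rewrite kE; lia.
have h1 : (k %/ N < n)%N by rewrite ltn_divLR // mulnC.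
have h2 : (k %% N < N)%N by rewrite ltn_mod.
have E (j : 'I_N) (i : 'I_n) : (pdiff a b A == C + j%:Z + (N * i)%:Z) = (j == Ordinal h2) && (i == Ordinal h1).
  have -> : (pdiff a b A == C + j%:Z + (N * i)%:Z) = (k == i * N + j)%N.
    by rewrite kE; apply/eqP/eqP => h; lia.
  apply/eqP/andP => [h|[/eqP -> /eqP ->]]; last by rewrite /= -divn_eq.
  by split; apply/eqP/val_inj; rewrite /= h ?modnMDl ?modn_small // divnMDl // divn_small // addn0.
under eq_bigr do under eq_bigr do rewrite E.
rewrite (bigD1 (Ordinal h2)) //= (bigD1 (Ordinal h1)) //= !eqxx /= big1 ?addr0; last first.
  by move=> i /negbTE ->.
by rewrite big1 ?addr0 // => j /negbTE jn; rewrite big1 // => i _; rewrite jn.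
Qed.

End Fixed.
End Partitions.

(** * Residue vectors *)

Section Vectors.
Variables (R : realType) (N : nat) (p q : 'I_N).
Hypothesis N0 : (0 < N)%N.
Implicit Types (ell : N.-tuple 'I_N) (n u v : nat) (r : int).

Let NR : N%:R != 0 :> R. Proof. by rewrite pnatr_eq0 -lt0n. Qed.

Lemma ell_tnth ell (j : 'I_N) : ell_ ell j.+1 = tnth ell j.
Proof.
rewrite /ell_ (nth_map j) ?size_tuple //=.
by rewrite (tnth_nth j).
Qed.

Definition moment1 ell : nat := \sum_(j < N) j.+1 * tnth ell j.

Lemma half_sqr_bin (m : nat) : 1 / 2 * (m%:R * m%:R) - m%:R / 2 = ('C(m, 2))%:R :> R.
Proof.
elim: m => [|m IH]; first by rewrite bin0n /= mul0r mulr0 mul0r subrr.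
by rewrite binS bin1 natrD -IH -natr1; field.
Qed.

(** The quadratic part and the half-integers in the vector b combine to N times binomial
    coefficients, so modulo N only the linear form [moment1] remains. *)
Lemma scaled_H ell : N%:R * H (vec R ell) = (moment1 ell)%:R + N%:R * (\sum_(j < N) 'C(tnth ell j, 2))%:R.
Proof.
rewrite /H /moment1 !mxE !natr_sum mulrDr !mulr_sumr -!big_split /=; apply: eq_bigr => j _.
by rewrite !mxE -half_sqr_bin natrM; field.
Qed.

Lemma int_div_dvd (z : int) : (z%:~R / N%:R : R) \is a Num.int = (N%:Z %| z)%Z.
Proof.
apply/idP/idP => [/intrP [k hk]|/dvdzP [k ->]]; last by rewrite intrM -pmulrn mulfK ?rpred_int.
apply/dvdzP; exists k; apply/eqP; rewrite -(eqr_int R) intrM -pmulrn -hk divfK //.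
Qed.

Lemma eq_modE ell n : eq_mod N (N%:R * H (vec R ell)) (n%:R : R) = (N%:Z %| (moment1 ell)%:Z - n%:Z)%Z.
Proof.
rewrite /eq_mod scaled_H -int_div_dvd intrB -!pmulrn.
set S := (\sum_(j < N) _)%N.
have -> : ((moment1 ell)%:R + N%:R * S%:R - n%:R) / N%:R = ((moment1 ell)%:R - n%:R) / N%:R + S%:R :> R by field.
by rewrite rpredDr // rpred_nat.
Qed.

Definition ell_diff ell : int := (tnth ell p)%:Z - (tnth ell q)%:Z.

Definition ell_char u v ell : int := \sum_(j < N) (tnth ell j)%:Z * character p q u v j.

Lemma ell_charE u v ell : ell_char u v ell = u%:Z * (moment1 ell)%:Z + v%:Z * ell_diff ell.
Proof.
have -> : ell_diff ell = \sum_(j < N) sgn_ p q j * (tnth ell j)%:Z.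
  rewrite /sgn_; under eq_bigr do rewrite mulrBl.
  rewrite sumrB /ell_diff; congr (_ - _).
    by rewrite (bigD1 p) //= eqxx mul1r big1 ?addr0 // => i /negbTE ->; rewrite mul0r.
  by rewrite (bigD1 q) //= eqxx mul1r big1 ?addr0 // => i /negbTE ->; rewrite mul0r.
rewrite /moment1 (big_morph Posz PoszD (erefl _)) !mulr_sumr -big_split /=; apply: eq_bigr => j _.
by rewrite /character PoszM; ring.
Qed.

Lemma sum_cos_pair (x y : int) :
  \sum_(u < N) \sum_(v < N) cos (2 * pi * (u%:R * x%:~R + v%:R * y%:~R) / N%:R) =
  (if (N%:Z %| x)%Z && (N%:Z %| y)%Z then N%:R ^+ 2 else 0 : R).
Proof.
have [dx|dx] := boolP (N%:Z %| x)%Z; have [dy|dy] := boolP (N%:Z %| y)%Z => /=.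
- have [x' ->] := dvdzP dx; have [y' ->] := dvdzP dy.
  rewrite (eq_bigr (fun=> N%:R)) => [|u _]; last first.
    rewrite (eq_bigr (fun=> 1)) => [|v _]; first by rewrite sumr_const card_ord.
    rewrite -[RHS](@cos0 R) -[RHS](cos_periodic_int _ (u%:Z * x' + v%:Z * y')); congr cos.
    by rewrite intrD !intrM -!pmulrn; field.
  by rewrite sumr_const card_ord -[_ *+ N]mulr_natl expr2.
- rewrite big1 // => u _; rewrite -[RHS](@sum_cos_roots R N y (2 * pi * (u%:R * x%:~R) / N%:R) N0 dy).
  by apply: eq_bigr => v _; congr cos; field.
- rewrite exchange_big big1 //= => v _; rewrite -[RHS](@sum_cos_roots R N x (2 * pi * (v%:R * y%:~R) / N%:R) N0 dx).
  by apply: eq_bigr => u _; congr cos; field.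
- rewrite exchange_big big1 //= => v _; rewrite -[RHS](@sum_cos_roots R N x (2 * pi * (v%:R * y%:~R) / N%:R) N0 dx).
  by apply: eq_bigr => u _; congr cos; field.
Qed.

Lemma addm_lt (x y : nat) : ((x + y) %% N < N)%N. Proof. by rewrite ltn_mod. Qed.

Definition rotate (k : 'I_N) (i : nat) ell : N.-tuple 'I_N :=
  [tuple (if j == k then Ordinal (addm_lt (tnth ell j) i) else tnth ell j) | j < N].

Lemma rotate_inj k i : injective (rotate k i).
Proof.
move=> e1 e2 h; apply: eq_from_tnth => j; have := congr1 (fun e => tnth e j) h.
rewrite !tnth_mktuple; case: eqP => // _ /(congr1 val) /= h2; apply: val_inj => /=.
have : (tnth e1 j + i == tnth e2 j + i %[mod N])%N by rewrite h2.
by rewrite eqn_modDr !modn_small // => /eqP.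
Qed.

Lemma ell_char_rotate u v (k : 'I_N) (i : nat) ell :
  exists z : int, ell_char u v (rotate k i ell) = ell_char u v ell + i%:Z * character p q u v k + z * N%:Z.
Proof.
exists (- ((tnth ell k + i) %/ N)%:Z * character p q u v k).
rewrite /ell_char (bigD1 k) //= [in RHS](bigD1 k) //= tnth_mktuple eqxx /=.
under eq_bigr => j /negbTE jk do rewrite tnth_mktuple jk.
have e : ((tnth ell k + i) %% N)%N%:Z = (tnth ell k)%:Z + i%:Z - ((tnth ell k + i) %/ N)%N%:Z * N%:Z.
  have := congr1 Posz (divn_eq (tnth ell k + i) N); rewrite !PoszD PoszM => ->; ring.
by rewrite e; ring.
Qed.

(** Rotating a coordinate on which the character is nontrivial permutes the vectors and shifts every
    angle by the same amount modulo 2 pi. The average over all N rotations is a vanishing sum of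
    roots of unity. *)
Lemma sum_cos_ell u v (be : R) : ~~ trivial_character p q u v ->
  \sum_ell cos (2 * pi * (ell_char u v ell)%:~R / N%:R + be) = 0.
Proof.
move=> /forallPn [k hk]; set S := \sum_ell _.
have SE (i : 'I_N) : S = \sum_ell cos ((2 * pi * (ell_char u v ell)%:~R / N%:R + be) +
    i%:R * (2 * pi * (character p q u v k)%:~R / N%:R)).
  rewrite /S (reindex_inj (@rotate_inj k i)) /=; apply: eq_bigr => ell _.
  have [z ->] := ell_char_rotate u v k i ell.
  have H (x y : int) : (x + i%:Z * y + z * N%:Z)%:~R = x%:~R + i%:R * y%:~R + z%:~R * N%:R :> R.
    by rewrite !intrD !intrM -!pmulrn.
  by rewrite -[RHS](cos_periodic_int _ z); congr cos; rewrite H; field.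
have : \sum_(i < N) S = 0.
  rewrite (eq_bigr _ (fun i _ => SE i)) exchange_big /= big1 // => ell _.
  exact: sum_cos_roots.
rewrite sumr_const card_ord -mulr_natr => /eqP; rewrite mulf_eq0 (negbTE NR) orbF => /eqP //.
Qed.

(** Both congruences are detected by sums over u and v. After the sums are exchanged a nontrivial
    character contributes nothing and a trivial one N^N equal cosines. *)
Lemma ell_count n r :
  (#|[set ell | (N%:Z %| (moment1 ell)%:Z - n%:Z)%Z && (N%:Z %| ell_diff ell - r)%Z]%SET|)%:R * N%:R ^+ 2 =
  N%:R ^+ N * char_weight R p q n r.
Proof.
have -> : (#|[set ell | (N%:Z %| (moment1 ell)%:Z - n%:Z)%Z && (N%:Z %| ell_diff ell - r)%Z]%SET|)%:R * N%:R ^+ 2 =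
   \sum_ell \sum_(u < N) \sum_(v < N)
     cos (2 * pi * (u%:R * ((moment1 ell)%:Z - n%:Z)%:~R + v%:R * (ell_diff ell - r)%:~R) / N%:R) :> R.
  rewrite -sum1_card natr_sum big_mkcond mulr_suml; apply: eq_bigr => ell _.
  by rewrite sum_cos_pair finset.in_set; case: ifP => _; rewrite ?mul1r ?mul0r.
rewrite exchange_big /= /char_weight mulr_sumr; apply: eq_bigr => u _.
rewrite exchange_big /= mulr_sumr; apply: eq_bigr => v _.
set al := (u%:R * n%:R + v%:R * r%:~R).
have -> : \sum_ell cos (2 * pi * (u%:R * ((moment1 ell)%:Z - n%:Z)%:~R + v%:R * (ell_diff ell - r)%:~R) / N%:R) =
   \sum_ell cos (2 * pi * (ell_char u v ell)%:~R / N%:R + - (2 * pi * al / N%:R)).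
  by apply: eq_bigr => ell _; congr cos; rewrite ell_charE /al; move: (moment1 ell) (ell_diff ell) => m d; rewrite !intrD !intrM !intrN -!pmulrn; field.
case: ifP => K; last by rewrite mulr0 sum_cos_ell // K.
rewrite (eq_bigr (fun=> cos (2 * pi * al / N%:R))) => [|ell _].
  by rewrite sumr_const card_tuple card_ord -[_ *+ (N ^ N)]mulr_natl natrX.
have /dvdzP [z zE] : (N%:Z %| ell_char u v ell)%Z.
  apply: rpred_sum => j _; rewrite dvdz_mull //; exact: (forallP K).
rewrite zE -[RHS]cosN -[RHS](cos_periodic_int _ z); congr cos.
by rewrite intrM -pmulrn; field.
Qed.

(** Each admissible vector belongs to exactly one j, the residue of its coordinate difference minus
    C; with C the ceiling of the threshold this is how the partial sums over classes turn into the
    sum over vectors. *)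
Lemma sum_ell_residue n (C : int) (F : R -> R) :
  \sum_(ell : N.-tuple 'I_N | eq_mod N (N%:R * H (vec R ell)) (n%:R : R))
    F ((residue ((ell_ ell p.+1)%:Z - (ell_ ell q.+1)%:Z - C) N)%:~R) =
  \sum_(j < N) N%:R ^+ N / N%:R ^+ 2 * char_weight R p q n (C + j%:Z) * F j%:R.
Proof.
have -> : \sum_(j < N) N%:R ^+ N / N%:R ^+ 2 * char_weight R p q n (C + j%:Z) * F j%:R =
   \sum_(j < N) \sum_(ell : N.-tuple 'I_N) (if (N%:Z %| (moment1 ell)%:Z - n%:Z)%Z && (N%:Z %| ell_diff ell - (C + j%:Z))%Z then F j%:R else 0).
  apply: eq_bigr => j _; rewrite -big_mkcond /=.
  have -> : N%:R ^+ N / N%:R ^+ 2 * char_weight R p q n (C + j%:Z) = (N%:R ^+ N * char_weight R p q n (C + j%:Z)) / N%:R ^+ 2 by field.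
  rewrite -ell_count mulfK ?expf_neq0 //.
  rewrite (eq_bigl (fun ell => ell \in [set ell | (N%:Z %| (moment1 ell)%:Z - n%:Z)%Z && (N%:Z %| ell_diff ell - (C + j%:Z))%Z]%SET)).
    by rewrite sumr_const mulr_natl.
  by move=> ell; rewrite finset.in_set.
rewrite exchange_big /= big_mkcond /=; apply: eq_bigr => ell _.
rewrite eq_modE; case: ifP => _; last by rewrite big1.
rewrite !ell_tnth -/(ell_diff ell) /residue.
set z := ell_diff ell - C.
have zN : (z %% N)%Z < N%:Z by rewrite ltz_pmod.
have z0 : 0 <= (z %% N)%Z by rewrite modz_ge0 // eqz_nat -lt0n.
have [k kE] : exists k : nat, (z %% N)%Z = k%:Z by exists `|(z %% N)%Z|%N; rewrite gez0_abs.
have kN : (k < N)%N by move: zN; rewrite kE.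
rewrite kE (bigD1 (Ordinal kN)) //= big1 ?addr0 => [|j jk]; last first.
  case: ifP => // /dvdzP [w wE]; case/eqP: jk; apply/val_inj => /=.
  have zE : z = w * N%:Z + j%:Z by rewrite /z; lia.
  have : (z %% N)%Z = j%:Z by rewrite zE modzMDl modz_small // ltz_nat ltn_ord.
  by rewrite kE => -[].
rewrite ifT // opprD addrA -/z; apply/dvdzP; exists (z %/ N)%Z.
by rewrite -kE {1}(divz_eq z N) addrK.
Qed.

End Vectors.

(** * The asymptotic formula *)

Section Constants.
Variable R : realType.

Lemma eq_pos_sqr (x y : R) : 0 <= x -> 0 <= y -> x ^+ 2 = y ^+ 2 -> x = y.
Proof. by move=> x0 y0 /eqP; rewrite eqrXn2 // => /eqP. Qed.

Lemma powR_quarter_pow4 (x : R) : 0 <= x -> (x `^ (1 / 4)) ^+ 4 = x.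
Proof.
move=> x0; rewrite -powR_mulrn ?powR_ge0 // -powRrM (_ : 1 / 4 * 4 = 1); [by rewrite powRr1|by field].
Qed.

Lemma powR_three_quarters (x : R) : 0 <= x -> x `^ (- (3 / 4)) = (x `^ (1 / 4)) ^- 3.
Proof.
by move=> x0; rewrite powRN -powR_mulrn ?powR_ge0 // -powRrM; congr (_ `^ _)^-1; field.
Qed.

Lemma powR_half (x : R) : 0 <= x -> x `^ (- (1 / 2)) = (x `^ (1 / 4)) ^- 2.
Proof.
by move=> x0; rewrite powRN -powR_mulrn ?powR_ge0 // -powRrM; congr (_ `^ _)^-1; field.
Qed.

Lemma quarter_sqr (x : R) : 0 <= x -> (x `^ (1 / 4)) ^+ 2 = Num.sqrt x.
Proof.
move=> x0; apply: eq_pos_sqr; rewrite ?sqr_ge0 ?sqrtr_ge0 // -exprM powR_quarter_pow4 // sqr_sqrtr //.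
Qed.

(* [f = 3^(1/4)], [ta] is the quotient of [n^(-1/4)] by the tilt, [w = sqrt (N/2)] and
   [h = 1 / sqrt 2]. *)
Lemma constants_erfc (f s ta h sp p : R) : 0 < f -> 0 < s -> 0 < ta -> 0 < h -> 0 < sp -> 0 < p ->
  f ^+ 2 = s -> s ^+ 2 = 3 -> ta ^+ 2 = p / (2 * s) -> h ^+ 2 = 1 / 2 -> sp ^+ 2 = p ->
  h * s * ta ^+ 3 / p ^+ 2 = (4 * f * sp)^-1.
Proof.
move=> f0 s0 ta0 h0 sp0 p0 f2 s2 ta2 h2 sp2.
have p20 : 0 < p ^+ 2 by rewrite exprn_gt0.
apply: (@mulIf _ (p ^+ 2 * (4 * f * sp))); first by rewrite gt_eqF // !mulr_gt0.
have -> : h * s * ta ^+ 3 / p ^+ 2 * (p ^+ 2 * (4 * f * sp)) = h * s * ta ^+ 3 * (4 * f * sp) by field; rewrite !gt_eqF.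
have -> : (4 * f * sp)^-1 * (p ^+ 2 * (4 * f * sp)) = p ^+ 2 by field; rewrite !gt_eqF.
apply: eq_pos_sqr; [by rewrite !mulr_ge0 ?exprn_ge0 // ltW|exact: ltW|].
rewrite (_ : (h * s * ta ^+ 3 * (4 * f * sp)) ^+ 2 = 16 * h ^+ 2 * s ^+ 2 * (ta ^+ 2) ^+ 3 * f ^+ 2 * sp ^+ 2); last by ring.
rewrite h2 ta2 f2 sp2 (_ : (p / (2 * s)) ^+ 3 = p ^+ 3 / (8 * s ^+ 2 * s)); last by field; rewrite gt_eqF.
by rewrite s2; field; rewrite gt_eqF.
Qed.

Lemma scale_const_identity (p w h s : R) : 0 < p -> 0 < s ->
  p * (2 * w) / (4 * (p / (2 * s))) * h / p ^+ 2 = w * h * s / p ^+ 2.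
Proof. by move=> *; field; rewrite !gt_eqF. Qed.

Lemma main_term_split (p w h s ta q g n e : R) : 0 < p -> 0 < w -> 0 < ta -> 0 < q -> 0 < n ->
  w * h * s / p ^+ 2 * (ta / q) ^+ 4 * (g / (n * (ta / q * w)) + e) =
  q ^- 3 * ((h * s * ta ^+ 3 / p ^+ 2) * g / n) + q ^- 4 * (w * h) * s / p ^+ 2 * ta ^+ 4 * e.
Proof. by move=> *; field; rewrite !gt_eqF. Qed.

Lemma main_term_pi (p s m q : R) : 0 < p -> 0 < s -> 0 < q ->
  q ^- 4 * (m / 2) * s / p ^+ 2 * (p ^+ 2 / 12) = q ^- 4 * (m * s ^+ 2 / (24 * s)).
Proof. by move=> *; field; rewrite !gt_eqF. Qed.

End Constants.

Section Final.
Variables (R : realType) (N : nat) (a c : 'I_N).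
Hypothesis ac : a != c.
Variable c0 : R.
Variable L : R -> R.
Hypothesis dL : forall x : R, -3 < x -> is_derive x (1 : R) L (- softlog x).
Hypothesis bL : forall x : R, -3 < x -> 0 <= L x <= expR (- x).
Hypothesis L0E : L 0 = pi ^+ 2 / 12.

Let N0' : (0 < N)%N. Proof. by case: N a => // -[]. Qed.
Let NR : 0 < N%:R :> R. Proof. by rewrite ltr0n. Qed.
Let L0 : 1 / 3 <= L 0.
Proof. by rewrite L0E; have := pi_ge2 R; nra. Qed.

Let s3 : R := Num.sqrt 3.
(** The fourth power of [ta] is pi^2 / 12, so t = ta / n^(1/4) satisfies n t^4 = L 0. *)
Let ta : R := Num.sqrt (pi / (2 * s3)).
Let w : R := Num.sqrt (N%:R / 2).
Let X : R := c0 * (ta * w).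

Let s30 : 0 < s3. Proof. by rewrite sqrtr_gt0. Qed.
Let s32 : s3 ^+ 2 = 3. Proof. by rewrite sqr_sqrtr. Qed.
Let ta2 : ta ^+ 2 = pi / (2 * s3).
Proof. by rewrite sqr_sqrtr // divr_ge0 ?pi_ge0 // mulr_ge0 // ltW. Qed.
Let ta0 : 0 < ta. Proof. by rewrite sqrtr_gt0 divr_gt0 ?pi_gt0 // mulr_gt0. Qed.
Let ta4 : ta ^+ 4 = L 0.
Proof.
rewrite (_ : ta ^+ 4 = (ta ^+ 2) ^+ 2); last by ring.
rewrite ta2 L0E.
rewrite (_ : (pi / (2 * s3)) ^+ 2 = pi ^+ 2 / (4 * s3 ^+ 2)); last by field; rewrite gt_eqF.
by rewrite s32; field.
Qed.
Let w0 : 0 < w. Proof. by rewrite sqrtr_gt0 divr_gt0. Qed.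
Let w2 : w ^+ 2 = N%:R / 2. Proof. by rewrite sqr_sqrtr // divr_ge0. Qed.
Let h : R := expR (- (ln 2 / 2)).
Let h0 : 0 < h. Proof. exact: expR_gt0. Qed.
Let h2 : h ^+ 2 = 1 / 2.
Proof.
by rewrite /h expr2 -expRD (_ : - (ln 2 / 2) + - (ln 2 / 2) = - ln 2) ?expRN ?lnK ?posrE ?div1r //; field.
Qed.

Let scale_constE : scale_const N L = w * h * s3 / pi ^+ 2.
Proof.
have P0 := pi_gt0 R.
have e1 : Num.sqrt (2 * N%:R) = 2 * w.
  by apply: eq_pos_sqr; rewrite ?sqrtr_ge0 ?mulr_ge0 ?(ltW w0) // sqr_sqrtr ?mulr_ge0 // exprMn w2; field.
have e2 : Num.sqrt (L 0) = ta ^+ 2.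
  by apply: eq_pos_sqr; rewrite ?sqrtr_ge0 ?sqr_ge0 // sqr_sqrtr -?ta4 -?exprM // exprn_ge0 // ltW.
by rewrite /scale_const e1 e2 ta2 -/h; exact: scale_const_identity.
Qed.

Let f3 : R := 3 `^ (1 / 4).
Let f30 : 0 < f3. Proof. exact: powR_gt0. Qed.
Let f32 : f3 ^+ 2 = s3. Proof. exact: quarter_sqr. Qed.

Let XE : c0 * Num.sqrt (pi * N%:R) / (2 * f3) = X.
Proof.
rewrite /X -mulrA; congr (_ * _); apply: eq_pos_sqr.
- by rewrite divr_ge0 ?sqrtr_ge0 // mulr_ge0 // ltW.
- by rewrite mulr_ge0 // ltW.
rewrite expr_div_n sqr_sqrtr ?mulr_ge0 ?pi_ge0 // !exprMn ta2 w2 f32.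
by field; rewrite gt_eqF.
Qed.

Let X2E : c0 ^+ 2 * pi * N%:R / (4 * s3) = X ^+ 2.
Proof. by rewrite /X !exprMn ta2 w2; field; rewrite gt_eqF. Qed.

Definition main_term (q x : R) : R :=
  1 / (8 * f3 * N%:R ^+ (N - 1)) * erfc X +
  expR (- (X ^+ 2)) * (N%:R ^+ 2 - 2 * x * N%:R + (c.+1%:R - a.+1%:R)) / (16 * s3 * N%:R `^ (N%:R - 1 / 2) * q).

Lemma main_termE (q x : R) : main_term q x =
  1 / (8 * 3 `^ (1 / 4) * N%:R ^+ (N - 1)) * erfc (c0 * Num.sqrt (pi * N%:R) / (2 * 3 `^ (1 / 4)))
  + expR (- (c0 ^+ 2 * pi * N%:R / (4 * Num.sqrt 3))) * (N%:R ^+ 2 - 2 * x * N%:R + (c.+1%:R - a.+1%:R)) /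
      (16 * Num.sqrt 3 * N%:R `^ (N%:R - 1 / 2) * q).
Proof. by rewrite XE X2E. Qed.

(** The boundary and kappa terms combine to (N^2 - 2 x N + beta - alpha) / (2 N^2). The factor N^N /
    N^2 is the conversion from [char_weight] to the number of vectors in [ell_count]. *)
Lemma main_term_match (q x : R) : 0 < q ->
  scale_const N L * (ta / q) ^+ 4 * (gauss_tail X / (N%:R * (ta / q * w)) +
     expR (- (X ^+ 2)) * (1 / 2 - (x - kappa0 R a c) / N%:R)) =
  q ^- 3 * (N%:R ^+ N / N%:R ^+ 2 * main_term q x).
Proof.
move=> q0; have P0 := pi_gt0 R; have n0 := NR.
pose sp : R := Num.sqrt pi; have sp0 : 0 < sp by rewrite sqrtr_gt0.
have sp2 : sp ^+ 2 = pi by rewrite sqr_sqrtr // pi_ge0.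
pose sN : R := Num.sqrt N%:R; have sN0 : 0 < sN by rewrite sqrtr_gt0.
have sN2 : sN ^+ 2 = N%:R by rewrite sqr_sqrtr.
have wh : 2 * (w * h) = sN.
  by apply: eq_pos_sqr; rewrite ?mulr_ge0 ?(ltW w0) ?(ltW h0) ?(ltW sN0) // !exprMn w2 h2 sN2; field.
have pw : N%:R `^ (N%:R - 1 / 2) = N%:R ^+ N / sN.
  rewrite powRB; last by apply/implyP => _; rewrite gt_eqF.
  by rewrite powR_mulrn // div1r powR12_sqrt.
have NN : N%:R ^+ N = N%:R * N%:R ^+ (N - 1) :> R by rewrite -exprS subn1 prednK.
have P10 : 0 < N%:R ^+ (N - 1) :> R by rewrite exprn_gt0.
have E1 := constants_erfc f30 s30 ta0 h0 sp0 P0 f32 s32 ta2 h2 sp2.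
rewrite /main_term /erfc -/sp -/(gauss_tail X) scale_constE pw NN.
set g := gauss_tail X; set e := expR _; set P := N%:R ^+ (N - 1) in P10 *.
rewrite (main_term_split h s3 g _ P0 w0 ta0 q0 n0).
rewrite E1 ta4 L0E (_ : w * h = sN / 2); last by rewrite -wh; field.
rewrite /kappa0 (_ : c.+1%:R - a.+1%:R = c%:R - a%:R :> R); last by rewrite -!natr1; ring.
have -> : q ^- 3 * (N%:R * P / N%:R ^+ 2 * (1 / (8 * f3 * P) * (2 / sp * g) +
    e * (N%:R ^+ 2 - 2 * x * N%:R + (c%:R - a%:R)) / (16 * s3 * (N%:R * P / sN) * q))) =
   q ^- 3 * ((4 * f3 * sp)^-1 * g / N%:R) + q ^- 4 * (e * sN * (N%:R ^+ 2 - 2 * x * N%:R + (c%:R - a%:R)) / (16 * s3 * N%:R ^+ 2)).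
  by field; rewrite !gt_eqF.
congr (_ + _).
rewrite (main_term_pi sN P0 s30 q0).
by rewrite s32; field; rewrite !gt_eqF.
Qed.

Lemma d_asymptotics : exists C : R, exists n0 : nat, forall n : nat, (n0 <= n)%N -> (0 < n)%N ->
  let q := n%:R `^ (1 / 4) : R in
  `|(d a.+1 c.+1 N (c0 * q) n)%:R -
    expR (pi * Num.sqrt (n%:R / 3)) * (q ^- 3 *
     \sum_(ell : N.-tuple 'I_N | eq_mod N (N%:R * H (vec R ell)) (n%:R : R)) main_term q (partial_star a.+1 c.+1 c0 n ell))| <=
  C * expR (pi * Num.sqrt (n%:R / 3)) * q ^- 5.
Proof.
have [C [t1 [C_0 t10 H1]]] := @sum_asymp R N a c ac L dL bL L0 `|X| w (normr_ge0 X) w0 w2.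
have qt0 : 0 < ta / t1 by rewrite divr_gt0.
(* From this n on, t = ta / n^(1/4) is at most [t1]; the factor ta^5 converts t^5 into n^(-5/4). *)
exists (C * ta ^+ 5), (Num.truncn ((ta / t1) ^+ 4)).+1 => n n0n n0 /=.
set q := n%:R `^ (1 / 4).
have nR : 0 < n%:R :> R by rewrite ltr0n.
have q0 : 0 < q by exact: powR_gt0.
have q4 : q ^+ 4 = n%:R by apply: powR_quarter_pow4; exact: ltW.
have q2 : q ^+ 2 = Num.sqrt n%:R by apply: quarter_sqr; exact: ltW.
have tt1 : 0 < ta / q <= t1.
  rewrite divr_gt0 //= ler_pdivrMr // mulrC -ler_pdivrMr //.
  rewrite -(@ler_pXn2r _ 4) ?nnegrE ?(ltW qt0) ?(ltW q0) // q4.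
  have /andP[_ /ltW hh] := truncn_itv (exprn_ge0 4 (ltW qt0)).
  by apply: le_trans hh _; rewrite ler_nat.
have nt : n%:R * (ta / q) ^+ 4 = L 0 by rewrite -q4 -ta4; field; rewrite gt_eqF.
pose cc := Num.ceil (c0 * q).
pose de : R := cc%:~R - c0 * q.
have de01 : 0 <= de <= 1.
  have := @ceil_itv R (c0 * q); rewrite -/cc /de intrB => /andP[h1 h2'].
  by rewrite subr_ge0 h2' /=; lra.
have ccE : cc%:~R * (ta / q * w) = X + de * (ta / q * w).
  by rewrite /de /X; field; rewrite gt_eqF.
have [hn H2] := H1 (ta / q) X de n cc tt1 nt (lexx _) de01 ccE.
rewrite (@d_part_count N a c ac n R (c0 * q) hn) -/cc.
have E2 : expR (2 * L 0 / (ta / q) ^+ 2) = expR (pi * Num.sqrt (n%:R / 3)).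
  congr expR; rewrite sqrtrM ?(ltW nR) // sqrtrV // -/s3 -q2 -ta4.
  have -> : 2 * ta ^+ 4 / (ta / q) ^+ 2 = 2 * ta ^+ 2 * q ^+ 2 by field; rewrite !gt_eqF.
  by rewrite ta2; field; rewrite gt_eqF.
rewrite E2 in H2.
have S : scale_const N L * (ta / q) ^+ 4 * (\sum_(j < N) char_weight R a c n (cc + j%:Z) *
        (gauss_tail X / (N%:R * (ta / q * w)) + expR (- (X ^+ 2)) * (1 / 2 - (de + j%:R - kappa0 R a c) / N%:R))) =
  q ^- 3 * \sum_(ell : N.-tuple 'I_N | eq_mod N (N%:R * H (vec R ell)) (n%:R : R)) main_term q (partial_star a.+1 c.+1 c0 n ell).
  rewrite /partial_star /partial -/q -/cc -/de.
  rewrite (@sum_ell_residue R N a c N0' n cc (fun y => main_term q (de + y))).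
  rewrite !mulr_sumr; apply: eq_bigr => j _.
  rewrite mulrCA main_term_match // mulrCA; congr (_ * _); ring.
rewrite S in H2; apply: le_trans H2 _.
rewrite le_eqVlt; apply/orP; left; apply/eqP; set E := expR _.
by field; rewrite gt_eqF.
Qed.

End Final.

(** Coordinate number 1 enters [moment1] with coefficient 1, so it alone realises every residue.
    This supplies the nonempty index set for [distribute_error]. *)
Lemma eq_mod_solvable (R : realType) (N : nat) : (0 < N)%N -> forall n : nat,
  exists ell : N.-tuple 'I_N, eq_mod N (N%:R * H (vec R ell)) (n%:R : R).
Proof.
case: N => // N _ n.
exists [tuple if j == ord0 then inord (n %% N.+1) else ord0 | j < N.+1].
rewrite eq_modE // /moment1.
rewrite big_ord_recl big1 => [|j _]; last by rewrite tnth_mktuple muln0.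
rewrite tnth_mktuple eqxx mul1n addn0 inordK ?ltn_mod //.
rewrite {2}(divn_eq n N.+1) PoszD opprD addrA addrAC subrr add0r PoszM.
by rewrite -mulNr dvdz_mull.
Qed.

(* The error of the total is spread evenly over the summands, so there must be at least one. *)
Lemma distribute_error (R : realType) (I : finType) (P : pred I) (D A S B : R) (F : I -> R) :
  (exists i, P i) -> 0 < A -> \sum_(i | P i) F i = S -> `|D - A * S| <= A * B ->
  let e := (D / A - S) / (#|[pred i | P i]|)%:R in
  D = A * \sum_(i | P i) (F i + e) /\ `|e| <= B.
Proof.
move=> [i Pi] A0 FS DB e.
have m1 : (0 < #|[pred i | P i]|)%N by apply/card_gt0P; exists i.
have m0 : 1 <= (#|[pred i | P i]|)%:R :> R by rewrite ler1n.
have m00 : 0 < (#|[pred i | P i]|)%:R :> R by rewrite ltr0n.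
split.
  rewrite big_split /= FS sumr_const -mulr_natr /e divfK ?gt_eqF //.
  by field; rewrite gt_eqF.
have B0 : 0 <= B by rewrite -(pmulr_rge0 _ A0); exact: le_trans (normr_ge0 _) DB.
rewrite /e normrM normfV (gtr0_norm m00) ler_pdivrMr //.
have -> : D / A - S = (D - A * S) / A by field; rewrite gt_eqF.
rewrite normrM normfV (gtr0_norm A0) ler_pdivrMr // [leRHS]mulrC; apply: (le_trans DB).
by rewrite ler_wpM2l ?(ltW A0) // ler_peMr.
Qed.

Theorem theorem1p1 (R : realType) (N alpha beta : nat) (c0 : R)
    (hN : (2 <= N)%N) (halpha : (1 <= alpha <= N)%N)
    (hbeta : (1 <= beta <= N)%N) (hneq : alpha <> beta) :
  exists E : N.-tuple 'I_N -> nat -> R,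
    (forall ell, E ell =O_\oo (fun n : nat => n%:R `^ (- (1 / 2)) : R)) /\
    \forall n \near \oo,
      (d alpha beta N (c0 * n%:R `^ (1 / 4)) n)%:R =
      expR (pi * Num.sqrt (n%:R / 3)) * n%:R `^ (- (3 / 4)) *
      \sum_(ell : N.-tuple 'I_N | eq_mod N (N%:R * H (vec R ell)) n%:R)
        (1 / (8 * 3 `^ (1 / 4) * N%:R ^+ (N - 1)) *
           erfc (c0 * Num.sqrt (pi * N%:R) / (2 * 3 `^ (1 / 4)))
         + expR (- (c0 ^+ 2 * pi * N%:R / (4 * Num.sqrt 3))) *
             (N%:R ^+ 2 - 2 * partial_star alpha beta c0 n ell * N%:R
              + (beta%:R - alpha%:R)) /
             (16 * Num.sqrt 3 * N%:R `^ (N%:R - 1 / 2) * n%:R `^ (1 / 4))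
         + E ell n).
Proof.
have [L [dL bL L0E]] := dilog_exists R.
have a_lt : (alpha.-1 < N)%N by move: halpha; lia.
have b_lt : (beta.-1 < N)%N by move: hbeta; lia.
pose a := Ordinal a_lt; pose b := Ordinal b_lt.
have aE : alpha = a.+1 by rewrite /=; lia.
have bE : beta = b.+1 by rewrite /=; lia.
have ab : a != b by apply/eqP => /(congr1 val) /=; lia.
have [C [n0 HC]] := d_asymptotics ab c0 dL bL L0E.
pose P n (ell : N.-tuple 'I_N) := eq_mod N (N%:R * H (vec R ell)) (n%:R : R).
pose q n := n%:R `^ (1 / 4) : R.
pose A n := expR (pi * Num.sqrt (n%:R / 3)) * n%:R `^ (- (3 / 4)) : R.
pose S n := \sum_(ell | P n ell) main_term a b c0 (q n) (partial_star alpha beta c0 n ell).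
(* One error serves for all vectors: the asymptotic formula controls only the total. *)
pose E n : R := ((d alpha beta N (c0 * q n) n)%:R / A n - S n) / (#|[pred ell | P n ell]|)%:R.
have key n : (n0 <= n)%N -> (0 < n)%N ->
    (d alpha beta N (c0 * q n) n)%:R =
      A n * \sum_(ell | P n ell) (main_term a b c0 (q n) (partial_star alpha beta c0 n ell) + E n) /\
    `|E n| <= C * n%:R `^ (- (1 / 2)).
  move=> n0n n_gt0; have nR : 0 < n%:R :> R by rewrite ltr0n.
  have q0 : 0 < q n by exact: powR_gt0.
  have A0 : 0 < A n by rewrite mulr_gt0 ?expR_gt0 ?powR_gt0.
  apply: distribute_error => //; first exact: eq_mod_solvable (ltnW hN) n.
  have AE : A n = expR (pi * Num.sqrt (n%:R / 3)) * (q n) ^- 3 by rewrite /A powR_three_quarters.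
  rewrite AE powR_half // -/(q n) -[X in _ <= X]mulrA.
  have -> : (q n) ^- 3 * (C * (q n) ^- 2) = C * (q n) ^- 5 by field; rewrite gt_eqF.
  rewrite mulrCA mulrA -[_ * _ * S n]mulrA /S aE bE.
  exact: HC.
exists (fun _ => E); split.
  move=> ell; apply/eqO_exP; exists (`|C| + 1); first by rewrite ltr_wpDl.
  exists (maxn n0 1) => // n /=; rewrite geq_max => /andP[n0n n1].
  have [_ /le_trans] := key n n0n n1; apply.
  have e0 : 0 <= n%:R `^ (- (1 / 2)) :> R by exact: powR_ge0.
  by rewrite (ger0_norm e0) ler_wpM2r //; have := ler_norm C; lra.
exists (maxn n0 1) => // n /=; rewrite geq_max => /andP[n0n n1].
have [-> _] := key n n0n n1.
congr (_ * _); apply: eq_bigr => ell _.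
rewrite main_termE.
by rewrite aE bE.
Qed.
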